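(* For every $n\ge 2$ there exist a lattice $\Gamma<\mathrm{SO}(n,1)$ and some $\alpha<\delta(\Gamma)$ such that the following holds: for every $\varepsilon>0$ one can find a homomorphism $\varphi:\Gamma\to\Gamma$ with $\delta(\mathrm{Ker}\,\varphi)<\alpha$ and $\delta(\varphi(\Gamma))<\varepsilon$.
   Context: $\mathrm{SO}(n,1)$ denotes the identity component of the subgroup of $\mathrm{SL}_{n+1}(\mathbb{R})$ preserving the form $x_1^2+\dots+x_n^2-x_{n+1}^2$. With $K$ a maximal compact subgroup, $\mathrm{SO}(n,1)/K$ is real hyperbolic $n$-space, with its invariant distance $d$ of constant curvature $-1$ and base point $o=eK$. The critical exponent of a discrete subgroup $\Lambda$ is $\delta(\Lambda)=\inf\{s\ge 0\mid\sum_{\lambda\in\Lambda}e^{-s\,d(\lambda o,o)}<\infty\}$; for a lattice it equals $n-1$. *)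

(* Defs.v *)
From mathcomp Require Import all_boot all_order all_algebra.
From mathcomp Require Import all_classical all_reals all_analysis.

Set Implicit Arguments.
Unset Strict Implicit.
Unset Printing Implicit Defensive.

Import Order.TTheory GRing.Theory Num.Theory.
Import numFieldNormedType.Exports.

Local Open Scope classical_set_scope.
Local Open Scope ring_scope.

Section LorentzGroup.
Context {R : realType} {n : nat}.
Implicit Types (x y : 'cV[R]_n.+1) (g h : 'M[R]_n.+1).
Implicit Types (L Gam F A : set 'M[R]_n.+1).

(* The polar form of x_1^2 + ... + x_n^2 - x_{n+1}^2; [lift ord_max] embeds
   'I_n into 'I_n.+1 as the first n indices. *)
Definition lorentz x y : R :=
  (\sum_(i < n) x (lift ord_max i) 0 * y (lift ord_max i) 0)
  - x ord_max 0 * y ord_max 0.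

Definition lorentz_isometries : set 'M[R]_n.+1 :=
  [set g | \det g = 1 /\
           forall x, lorentz (g *m x) (g *m x) = lorentz x x].

(* SO(n,1) is the identity component only. *)
Definition SO_n1 : set 'M[R]_n.+1 :=
  connected_component lorentz_isometries 1%:M.

(* SO(n,1)/K is realised, through g K |-> g *m base_point, as the sheet of the
   hyperboloid lorentz x x = -1 that contains base_point = e_{n+1}, whose
   stabiliser K in SO(n,1) is a maximal compact subgroup.  The invariant
   distance of curvature -1 is determined by
   cosh (hdist x y) = - lorentz x y, and arcosh t = ln (t + sqrt (t^2 - 1)). *)
Definition base_point : 'cV[R]_n.+1 := delta_mx ord_max 0.

Definition arcosh (t : R) : R := ln (t + Num.sqrt (t ^+ 2 - 1)).

Definition hdist x y : R := arcosh (- lorentz x y).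

Definition is_subgroup L : Prop :=
  [/\ L `<=` SO_n1, L 1%:M,
      forall g h, L g -> L h -> L (g *m h) &
      forall g, L g -> L (invmx g)].

(* Discreteness means that the subspace topology of L is discrete. *)
Definition is_discrete_subgroup L : Prop :=
  is_subgroup L /\ L `<=` isolated L.

(* The infimum is taken in \bar R, so that it would be +oo, and not a junk
   value, if the series never converged. *)
Definition critical_exponent L : \bar R :=
  ereal_inf [set s%:E | s in [set s : R | 0 <= s /\
    (\esum_(g in L)
       (expR (- s * hdist (g *m base_point) base_point))%:E < +oo)%E]].

Definition borel_matrix := g_sigma_algebraType (@open 'M[R]_n.+1).

(* A left Haar measure on SO(n,1), seen as a Borel measure on the space of all
   matrices that is concentrated on the closed subset SO(n,1). *)
Definition is_haar (mu : {measure set borel_matrix -> \bar R}) : Prop :=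
  [/\ mu (~` SO_n1) = 0%E,
      (0 < mu SO_n1)%E,
      forall A, compact A -> (mu A < +oo)%E &
      forall g A, SO_n1 g -> measurable (A : set borel_matrix) ->
        mu [set g *m h | h in A] = mu A].

(* F contains exactly one point of each coset Gam g, g in SO(n,1). *)
Definition is_fundamental_domain Gam F : Prop :=
  F `<=` SO_n1 /\
  forall g, SO_n1 g -> exists! c, Gam c /\ F (c *m g).

(* The covolume of a discrete subgroup Gam is the Haar measure of a Borel
   fundamental domain for Gam. *)
Definition is_lattice Gam : Prop :=
  is_discrete_subgroup Gam /\
  exists mu : {measure set borel_matrix -> \bar R}, is_haar mu /\
  exists F, [/\ measurable (F : set borel_matrix),
                is_fundamental_domain Gam F &
                (mu F < +oo)%E].

(* Only the restriction of phi to Gam matters. *)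
Definition is_endomorphism Gam (phi : 'M[R]_n.+1 -> 'M[R]_n.+1) : Prop :=
  (forall g, Gam g -> Gam (phi g)) /\
  (forall g h, Gam g -> Gam h -> phi (g *m h) = phi g *m phi h).

Definition Ker Gam (phi : 'M[R]_n.+1 -> 'M[R]_n.+1) : set 'M[R]_n.+1 :=
  [set g | Gam g /\ phi g = 1%:M].

End LorentzGroup.

(* Main.v *)
From HB Require Import structures.
Require Import Defs.
From mathcomp Require Import all_boot all_order all_algebra.
From mathcomp Require Import all_classical all_reals all_analysis.
From mathcomp Require Import measurable_realfun ring lra zify.
Set Implicit Arguments.
Unset Strict Implicit.
Unset Printing Implicit Defensive.
Import Order.TTheory GRing.Theory Num.Theory.
Import numFieldNormedType.Exports.
Local Open Scope classical_set_scope.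
Local Open Scope ring_scope.

(** The form x_1^2 + ... + x_n^2 - sqrt 2 x_{n+1}^2 over Z[sqrt 2] is Lorentzian while its Galois
    conjugate is definite, so its integral isometries [arith 1] act discretely and cocompactly on
    hyperbolic space ([finite_arith_ball], [arith1_cocompact]). Consider the integral vectors of
    norm 1 that are congruent mod q to plus or minus a fixed one. A nonzero element of Z[sqrt 2] has
    norm at least 1 in absolute value, which forces the mirrors of two such vectors to coincide or
    to be far apart ([iroot_separation]). Hence the reflections in the walls around the chamber of
    the base point generate a free product W of groups of order 2 ([word_unique]), normalised by the
    stabiliser S of the chamber in the congruence subgroup mod M+1, where q divides M+1. The lattice
    [Gam] consists of the products a s with a an even word in W and s in S ([Gam_lattice]).

    Label a boundary wall by the residue of its root mod M+1. S preserves labels, so for any choice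
    of distinct boundary walls X_j, one for each label j, killing S and replacing the reflection in
    u by the one in X_(lab u) defines an endomorphism ([phi_endo]). Its image is as thin as desired
    once the X_j are spread out: a reduced word of length k then has height at least L^k with L
    arbitrary ([image_exponent]). The kernel does not depend on the X_j: it consists of the a s
    whose labels cancel in the free product on the labels ([Ker_phi]). It remains to bound its
    exponent strictly below [delta], the exponent of [arith 1], which is at most that of [Gam]
    ([Gam_exponent]).

    For S alone, the translates of one suitable half-space carry disjoint parts of the orbit, so the
    Poincare series of S converges at [delta] ([stab_sum_delta]); for a group cocompact on a convex
    set, convergence at a positive exponent persists slightly below it ([orbit_gap]), whence
    [stab_gap]. Next, the reduced words form a tree of nested half-spaces with disjoint siblings.
    The mass of a half-space is the part of the Poincare series of [arith 1], at an exponent s >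
    [delta], carried by the orbit points inside; it is comparable to cosh^-s of the distance to the
    wall ([mass_upper], [mass_lower]). Weigh a node by mass^t 2^-l, where l is the length of its
    reduced word of labels. A child whose label cancels doubles the second factor, any other child
    halves it. For t near 1 the t-th powers of the ratios child/parent sum to at most 3/2; since
    walls of equal label are very far apart, those with the cancelling label sum to at most 1/10. As
    3/4 + 1/5 < 1, the weights decay geometrically with depth ([weight_step]). Nodes of the kernel
    have l = 0, so its series converges at t s ([kernel_sum]), and the constants can be arranged so
    that t s < [delta] ([kernel_gap]). *)

(** * Geometry of the hyperboloid: distances, walls, half-spaces *)

Section Lorentz.
Context {R : realType} {n : nat}.
Implicit Types (x y z w a u v : 'cV[R]_n.+1) (g h : 'M[R]_n.+1).

Lemma sum_CauchySchwarz k (a b : 'I_k -> R) :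
  (\sum_i a i * b i) ^+ 2 <= (\sum_i a i ^+ 2) * (\sum_i b i ^+ 2).
Proof.
set A := \sum_i a i ^+ 2; set B := \sum_i b i ^+ 2; set P := \sum_i _.
have B0 : 0 <= B by apply: sumr_ge0 => i _; exact: sqr_ge0.
have : 0 <= \sum_i (B * a i - P * b i) ^+ 2.
  by apply: sumr_ge0 => i _; exact: sqr_ge0.
have -> : \sum_i (B * a i - P * b i) ^+ 2 = B * (A * B - P ^+ 2).
  transitivity (\sum_i (B ^+ 2 * (a i ^+ 2) - (2 * B * P) * (a i * b i)
                        + P ^+ 2 * (b i ^+ 2))).
    by apply: eq_bigr => i _; ring.
  by rewrite big_split sumrB /= -!mulr_sumr -/A -/B -/P; ring.
have [B1|] := ltP 0 B; first by rewrite pmulr_rge0 // subr_ge0.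
move=> Ble; have B00 : B = 0 by apply/eqP; rewrite eq_le Ble.
have b0 i : b i = 0.
  apply/eqP; rewrite -sqrf_eq0; apply/eqP.
  have /eqP := B00; rewrite psumr_eq0; last by move=> j _; exact: sqr_ge0.
  by move=> /allP /(_ i); rewrite mem_index_enum /= => /(_ isT) /eqP.
rewrite B00 mulr0 /P big1 ?expr0n // => i _; by rewrite b0 mulr0.
Qed.

Definition dot x y : R := \sum_i x i 0 * y i 0.

Lemma dotE x y : dot x y = lorentz x y + 2 * x ord_max 0 * y ord_max 0.
Proof. by rewrite /dot /lorentz (bigD1_ord ord_max) //=; ring. Qed.

Lemma dotC x y : dot x y = dot y x.
Proof. by apply: eq_bigr => i _; rewrite mulrC. Qed.

Lemma dot_ge0 x : 0 <= dot x x.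
Proof. by apply: sumr_ge0 => i _; rewrite -expr2 sqr_ge0. Qed.

Lemma dot_eq0 x : dot x x = 0 -> x = 0.
Proof.
move=> /eqP; rewrite psumr_eq0; last by move=> i _; rewrite -expr2 sqr_ge0.
move=> /allP x0; apply/colP => i; rewrite mxE.
by have := x0 i; rewrite mem_index_enum -expr2 sqrf_eq0 => /(_ isT) /eqP.
Qed.

Lemma dot_CauchySchwarz x y : dot x y ^+ 2 <= dot x x * dot y y.
Proof.
have := sum_CauchySchwarz (fun i => x i 0) (fun i => y i 0).
by under [in X in _ <= X * _]eq_bigr do rewrite expr2;
   under [in X in _ <= _ * X]eq_bigr do rewrite expr2.
Qed.

Lemma lorentz_sqr x :
  lorentz x x = \sum_(i < n) x (lift ord_max i) 0 ^+ 2 - x ord_max 0 ^+ 2.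
Proof. by rewrite /lorentz expr2; under eq_bigr do rewrite -expr2. Qed.

Lemma lorentzC x y : lorentz x y = lorentz y x.
Proof.
by rewrite /lorentz mulrC; congr (_ - _); apply: eq_bigr => i _; rewrite mulrC.
Qed.

Lemma lorentzDl x y z : lorentz (x + y) z = lorentz x z + lorentz y z.
Proof.
rewrite /lorentz mxE mulrDl.
under eq_bigr do rewrite mxE mulrDl.
by rewrite big_split /=; ring.
Qed.

Lemma lorentzZl (c : R) x z : lorentz (c *: x) z = c * lorentz x z.
Proof.
rewrite /lorentz mxE -mulrA mulrBr mulr_sumr; congr (_ - _).
by apply: eq_bigr => i _; rewrite mxE mulrA.
Qed.

Lemma lorentzDr x y z : lorentz z (x + y) = lorentz z x + lorentz z y.
Proof. by rewrite lorentzC lorentzDl !(lorentzC z). Qed.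

Lemma lorentzZr (c : R) x z : lorentz z (c *: x) = c * lorentz z x.
Proof. by rewrite lorentzC lorentzZl lorentzC. Qed.

Lemma lorentzNl x z : lorentz (- x) z = - lorentz x z.
Proof. by rewrite -scaleN1r lorentzZl mulN1r. Qed.

Lemma lorentzNr x z : lorentz z (- x) = - lorentz z x.
Proof. by rewrite lorentzC lorentzNl lorentzC. Qed.

Lemma lorentz0l x : lorentz 0 x = 0.
Proof. by rewrite -(scale0r 0) lorentzZl mul0r. Qed.

Definition lorentzE := (lorentzDl, lorentzDr, lorentzZl, lorentzZr, lorentzNl, lorentzNr).

Lemma lorentz_suml I (r : seq I) (P : pred I) (F : I -> 'cV[R]_n.+1) y :
  lorentz (\sum_(i <- r | P i) F i) y = \sum_(i <- r | P i) lorentz (F i) y.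
Proof.
by elim/big_rec2 : _ => [|i a b _ <-]; rewrite ?lorentz0l ?lorentzDl.
Qed.

Definition hyp : set 'cV[R]_n.+1 :=
  [set x | lorentz x x = -1 /\ 0 < x ord_max 0].

(** The hyperbolic cosine of the distance. All estimates use it in place of the distance, so that
    the triangle inequality becomes multiplicative. *)
Definition tau x y := - lorentz x y.

Lemma tauC x y : tau x y = tau y x. Proof. by rewrite /tau lorentzC. Qed.

Lemma hyp_tau x : hyp x -> tau x x = 1.
Proof. by move=> [xx _]; rewrite /tau xx opprK. Qed.

(** By Cauchy-Schwarz the first [n] coordinates cannot outweigh the last ones: a timelike vector
    pairs negatively with the sheet on its own side of the cone. *)
Lemma timelike_hyp a x : lorentz a a < 0 -> hyp x -> lorentz a x * a ord_max 0 < 0.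
Proof.
move=> aa [xx x0].
have := sum_CauchySchwarz (fun i : 'I_n => a (lift ord_max i) 0)
                          (fun i : 'I_n => x (lift ord_max i) 0).
move: aa xx; rewrite !lorentz_sqr /lorentz.
set S := \sum_i _ ^+ 2; set T := \sum_i _ ^+ 2; set P := \sum_i _.
have S0 : 0 <= S by apply: sumr_ge0 => i _; exact: sqr_ge0.
have T0 : 0 <= T by apply: sumr_ge0 => i _; exact: sqr_ge0.
move: (a ord_max 0) (x ord_max 0) x0 => p q q0 Sp Tq PST.
rewrite ltNge; apply/negP => H.
have p2 : 0 < p ^+ 2 by lra.
have pq : 0 < p ^+ 2 * q by rewrite mulr_gt0.
have H1 : p ^+ 2 * q <= P * p by nra.
have H2 : (p ^+ 2 * q) ^+ 2 <= (P * p) ^+ 2.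
  by rewrite ler_sqr ?nnegrE ?(ltW pq) // (le_trans (ltW pq)).
have H3 : p ^+ 2 * q ^+ 2 <= P ^+ 2.
  by rewrite -(ler_pM2l p2); rewrite !exprMn in H2; nra.
have : S * T < p ^+ 2 * q ^+ 2 by nra.
lra.
Qed.

(** The orthogonal hyperplane of a timelike vector misses hyperbolic space, so the pairing never
    changes sign there. Sums and differences of wall normals are fed to it below. *)
Lemma timelike_sign a x y : lorentz a a < 0 -> hyp x -> hyp y ->
  0 < lorentz a x * lorentz a y.
Proof.
move=> aa hx hy; have := timelike_hyp aa hx; have := timelike_hyp aa hy.
nra.
Qed.

Lemma perp_hyp_ge0 x y : hyp x -> lorentz x y = 0 -> 0 <= lorentz y y.
Proof.
move=> hx xy; rewrite leNgt; apply/negP => yy.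
by have := timelike_sign yy hx hx; rewrite lorentzC xy mul0r ltxx.
Qed.

(** The left-over quantity is the square norm of the component of [y] tangent at [x], where the form
    is positive. *)
Lemma lorentz_add_sqr_ge0 x y : hyp x -> 0 <= lorentz y y + lorentz y x ^+ 2.
Proof.
move=> hx; have [xx _] := hx.
have : lorentz x (y + lorentz y x *: x) = 0.
  by rewrite !lorentzE xx (lorentzC x); ring.
move/(perp_hyp_ge0 hx); rewrite !lorentzE xx (lorentzC x y).
by congr (_ <= _); ring.
Qed.

Lemma perp_hyp_eq0 x y : hyp x -> lorentz x y = 0 -> lorentz y y = 0 -> y = 0.
Proof.
move=> [xx x0] xy yy.
have := sum_CauchySchwarz (fun i : 'I_n => x (lift ord_max i) 0)
                          (fun i : 'I_n => y (lift ord_max i) 0).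
move: (xx) (xy) (yy); rewrite !lorentz_sqr /lorentz.
set S := \sum_i _ ^+ 2; set P := \sum_i _; set T := \sum_i _ ^+ 2.
have T0 : 0 <= T by apply: sumr_ge0 => i _; exact: sqr_ge0.
move=> E1 E2 E3 E4; apply: dot_eq0; rewrite dotE yy.
suff -> : y ord_max 0 = 0 by ring.
apply/eqP; rewrite -sqrf_eq0 eq_le sqr_ge0 andbT.
move: E1 E2 E3 E4; move: (x ord_max 0) x0 (y ord_max 0) => p p0 q E1 E2 E3.
have -> : S = p ^+ 2 - 1 by lra.
have -> : T = q ^+ 2 by lra.
have -> : P = p * q by lra.
nra.
Qed.

Lemma perp_CauchySchwarz x y z : hyp x -> lorentz x y = 0 -> lorentz x z = 0 ->
  lorentz y z ^+ 2 <= lorentz y y * lorentz z z.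
Proof.
move=> hx xy xz; have := perp_hyp_ge0 hx xz; rewrite le_eqVlt => /orP[/eqP zz|zz].
  by rewrite (perp_hyp_eq0 hx xz (esym zz)) lorentzC !lorentz0l expr0n mulr0.
have : lorentz x (lorentz z z *: y - lorentz y z *: z) = 0.
  by rewrite !lorentzE xy xz; ring.
move/(perp_hyp_ge0 hx); rewrite !lorentzE (lorentzC z y) => H.
rewrite -subr_ge0 -(pmulr_rge0 _ zz).
by congr (_ <= _) : H; ring.
Qed.

Lemma tau_ge1 x y : hyp x -> hyp y -> 1 <= tau x y.
Proof.
move=> hx hy; have := lorentz_add_sqr_ge0 y hx; have [yy _] := hy.
have [xx x0] := hx.
have : lorentz x y * x ord_max 0 < 0 by apply: timelike_hyp => //; rewrite xx; lra.
rewrite pmulr_llt0 // yy (lorentzC y x) /tau => H1 H2; nra.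
Qed.

Lemma tau_gt0 x y : hyp x -> hyp y -> 0 < tau x y.
Proof. by move=> hx hy; apply: lt_le_trans (tau_ge1 hx hy). Qed.

(** Hyperbolic law of cosines: [c] is the inner product of the components of [y] and [z] tangent at
    [x]. *)
Lemma lorentz_split x y z : hyp x ->
  exists c : R, lorentz y z = - (lorentz y x * lorentz z x) + c /\
   c ^+ 2 <= (lorentz y y + lorentz y x ^+ 2) * (lorentz z z + lorentz z x ^+ 2).
Proof.
move=> hx; have [xx _] := hx.
exists (lorentz (y + lorentz y x *: x) (z + lorentz z x *: x)); split.
  by rewrite !lorentzE xx (lorentzC x z); ring.
have := @perp_CauchySchwarz x (y + lorentz y x *: x) (z + lorentz z x *: x) hx.
rewrite !lorentzE xx !(lorentzC x) => H.
have {}H := H ltac:(ring) ltac:(ring).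
by congr (_ <= _ * _) : H; ring.
Qed.

(** This is cosh (a + b) <= 2 cosh a cosh b. *)
Lemma tau_tri x y z : hyp x -> hyp y -> hyp z -> tau x z <= 2 * tau x y * tau y z.
Proof.
move=> hx hy hz; have [c [E H]] := lorentz_split x z hy.
have [xx _] := hx; have [zz _] := hz; move: H; rewrite xx zz => H.
have := tau_ge1 hx hy; have := tau_ge1 hy hz.
rewrite /tau E (lorentzC y z); move: (lorentz x y) (lorentz z y) H => a b.
move=> H b1 a1; suff : - c <= a * b by nra.
have ab0 : 0 <= a * b by nra.
have Hc : c ^+ 2 <= (a * b) ^+ 2 by nra.
nra.
Qed.

Lemma hyp_scale a x : lorentz a a < 0 -> lorentz a x < 0 -> hyp x ->
  hyp ((Num.sqrt (- lorentz a a))^-1 *: a).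
Proof.
move=> aa ax hx; have s0 : 0 < Num.sqrt (- lorentz a a) by rewrite sqrtr_gt0; lra.
split.
  rewrite !lorentzE mulrA -expr2 exprVn sqr_sqrtr; last by lra.
  by rewrite -{2}[lorentz a a]opprK mulrN mulVf // lt0r_neq0 //; lra.
rewrite mxE mulr_gt0 ?invr_gt0 //.
by have := timelike_hyp aa hx; rewrite nmulr_rlt0.
Qed.

(** For a unit normal [u], the pairing is the sinh of the signed distance to the wall, and this is
    the cosh of that distance. *)
Definition cosh_wall u x := Num.sqrt (1 + lorentz u x ^+ 2).

Lemma cosh_wall_sqr u x : cosh_wall u x ^+ 2 = 1 + lorentz u x ^+ 2.
Proof. by rewrite sqr_sqrtr //; have := sqr_ge0 (lorentz u x); lra. Qed.

Lemma cosh_wall_ge1 u x : 1 <= cosh_wall u x.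
Proof.
rewrite -(ler_sqr (ler01 : 1 \is Num.nneg) (sqrtr_ge0 _ : _ \is Num.nneg)).
by rewrite cosh_wall_sqr expr1n; have := sqr_ge0 (lorentz u x); lra.
Qed.

Lemma cosh_wall_gt0 u x : 0 < cosh_wall u x.
Proof. exact: lt_le_trans (cosh_wall_ge1 u x). Qed.

Lemma abs_le_cosh_wall u x : `|lorentz u x| <= cosh_wall u x.
Proof.
rewrite -ler_sqr ?nnegrE ?sqrtr_ge0 // cosh_wall_sqr.
by rewrite real_normK ?num_real //; lra.
Qed.

Definition wall_proj u x := (cosh_wall u x)^-1 *: (x - lorentz u x *: u).

Lemma wall_projE u x : x = cosh_wall u x *: wall_proj u x + lorentz u x *: u.
Proof.
by rewrite scalerA mulfV ?scale1r ?subrK // lt0r_neq0 // cosh_wall_gt0.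
Qed.

Lemma wall_proj_hyp u x : lorentz u u = 1 -> hyp x -> hyp (wall_proj u x).
Proof.
move=> uu hx; have [xx _] := hx.
have E : lorentz (x - lorentz u x *: u) (x - lorentz u x *: u) = -(1 + lorentz u x ^+ 2).
  by rewrite !lorentzE uu xx (lorentzC x u); ring.
rewrite /wall_proj /cosh_wall -[X in Num.sqrt X]opprK -E; apply: (hyp_scale _ _ hx).
  by rewrite E; have := sqr_ge0 (lorentz u x); lra.
by rewrite !lorentzE xx; have := sqr_ge0 (lorentz u x); lra.
Qed.

Lemma wall_proj_wall u x : lorentz u u = 1 -> lorentz u (wall_proj u x) = 0.
Proof. by move=> uu; rewrite !lorentzE uu mulr1 subrr mulr0. Qed.

Lemma wall_proj_tau u x : lorentz u u = 1 -> hyp x ->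
  tau x (wall_proj u x) = cosh_wall u x.
Proof.
move=> uu hx; have [yy _] := wall_proj_hyp uu hx.
have up := wall_proj_wall x uu; have E := wall_projE u x.
move: (wall_proj u x) yy up E => p yy up E.
transitivity (- lorentz (cosh_wall u x *: p + lorentz u x *: u) p); first by rewrite -E.
by rewrite lorentzDl !lorentzZl yy up; ring.
Qed.

(** Decompose [x] along its foot on the wall and [u]; the extra term - <u,x> <u,y> is nonnegative
    because the points lie on opposite sides. All multiplicative estimates along the tree come from
    this. *)
Lemma halfspace_tau u x y : lorentz u u = 1 -> lorentz u x <= 0 ->
  0 <= lorentz u y -> cosh_wall u x * tau (wall_proj u x) y <= tau x y.
Proof.
move=> uu ux uy; move: (wall_projE u x); move: (wall_proj u x) => p E.
suff -> : tau x y = tau (cosh_wall u x *: p + lorentz u x *: u) y.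
  by rewrite /tau lorentzDl !lorentzZl; nra.
by rewrite -E.
Qed.

(** On the wall of [u], [w] pairs like its component orthogonal to [u], whose square norm is 1 -
    <u,w>^2. *)
Lemma wall_point_far u w p : lorentz u u = 1 -> lorentz w w = 1 -> hyp p ->
  lorentz u p = 0 -> lorentz u w ^+ 2 - 1 <= lorentz w p ^+ 2.
Proof.
move=> uu ww hp up; have := lorentz_add_sqr_ge0 (w - lorentz u w *: u) hp.
by rewrite !lorentzE uu ww up (lorentzC w u); nra.
Qed.

(** [u + w] is timelike, hence keeps at [y] the negative sign it has at [x]. *)
Lemma opposite_halfspaces u w x y : lorentz u u = 1 -> lorentz w w = 1 ->
  lorentz u w < -1 -> hyp x -> hyp y -> lorentz u x < 0 -> lorentz w x < 0 ->
  0 <= lorentz u y -> lorentz w y < 0.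
Proof.
move=> uu ww uw hx hy ux wx uy; have := @timelike_sign (u + w) x y.
by rewrite !lorentzE uu ww (lorentzC w u) => H; have := H ltac:(lra) hx hy; nra.
Qed.

(** [u - w] is timelike, so its sign is the same at [x] and [y]. *)
Lemma nested_halfspaces u w x y : lorentz u u = 1 -> lorentz w w = 1 ->
  1 < lorentz u w -> hyp x -> hyp y -> lorentz u x < lorentz w x ->
  lorentz u y < lorentz w y.
Proof.
move=> uu ww uw hx hy uwx; have := @timelike_sign (u - w) x y.
by rewrite !lorentzE uu ww (lorentzC w u) => H; have := H ltac:(lra) hx hy; nra.
Qed.

(** No point is close to both of two distant walls; apply [lorentz_add_sqr_ge0] to [u + w]. *)
Lemma far_walls_sum u w p : lorentz u u = 1 -> lorentz w w = 1 -> hyp p ->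
  - lorentz u w - 1 <= lorentz u p ^+ 2 + lorentz w p ^+ 2.
Proof.
move=> uu ww hp; have := lorentz_add_sqr_ge0 (u + w) hp.
rewrite !lorentzE uu ww (lorentzC w u).
have := sqr_ge0 (lorentz u p - lorentz w p); nra.
Qed.

(** The point of the geodesic segment at distance A from [x], where a = cosh A. With t = cosh T for
    the whole segment, the coefficients are sinh (T - A) / sinh T and sinh A / sinh T, and the
    remaining part satisfies cosh (T - A) <= 2 cosh T / cosh A. Coincident end points are treated
    apart. *)
Lemma hyp_segment x y (a : R) : hyp x -> hyp y -> 1 <= a -> a <= tau x y ->
  exists al be z, [/\ 0 <= al, 0 <= be, z = al *: x + be *: y, hyp z &
     tau x z = a /\ tau z y <= 2 * tau x y / a].
Proof.
move=> hx hy a1 at_; have [xx x0] := hx; have [yy _] := hy; set t := tau x y in at_ *.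
have [t1|t1] := leP t 1.
  have a_ : a = 1 by apply/eqP; rewrite eq_le a1 andbT; lra.
  exists 1, 0, x; split; rewrite ?scale1r ?scale0r ?addr0 // hyp_tau // a_.
  by split => //; rewrite divr1 -/t; lra.
have [s0 s2] : 0 < Num.sqrt (t ^+ 2 - 1) /\ Num.sqrt (t ^+ 2 - 1) ^+ 2 = t ^+ 2 - 1.
  by rewrite sqrtr_gt0 sqr_sqrtr; [split => //; nra | nra].
have [r0 r2] : 0 <= Num.sqrt (a ^+ 2 - 1) /\ Num.sqrt (a ^+ 2 - 1) ^+ 2 = a ^+ 2 - 1.
  by rewrite sqrtr_ge0 sqr_sqrtr; [split | nra].
move: (Num.sqrt (t ^+ 2 - 1)) (Num.sqrt (a ^+ 2 - 1)) s0 s2 r0 r2 => s r s0 s2 r0 r2.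
have xyt : lorentz x y = - t by rewrite /t /tau opprK.
have be0 : 0 <= r / s by rewrite divr_ge0 // ltW.
have al0 : 0 <= a - t * (r / s).
  rewrite subr_ge0 mulrA ler_pdivrMr //.
  have [h1 h2] : 0 <= t * r /\ 0 <= a * s by split; apply: mulr_ge0; lra.
  rewrite -ler_sqr ?nnegrE // !exprMn r2 s2; have : a ^+ 2 <= t ^+ 2 by nra.
  move: (a ^+ 2) (t ^+ 2) => A T AT; nra.
have bs : (r / s) * s = r by rewrite divfK // lt0r_neq0.
move: (r / s) be0 al0 bs => b b0 al0 bs.
have xz : tau x ((a - t * b) *: x + b *: y) = a.
  by rewrite /tau !lorentzE xx xyt; ring.
have zz : lorentz ((a - t * b) *: x + b *: y) ((a - t * b) *: x + b *: y) = -1.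
  rewrite !lorentzE xx yy (lorentzC y x) xyt.
  have : (b * s) ^+ 2 = r ^+ 2 by rewrite bs.
  by rewrite exprMn s2 r2; nra.
exists (a - t * b), b, ((a - t * b) *: x + b *: y); split => //.
  split => //; have := @timelike_hyp ((a - t * b) *: x + b *: y) x.
  rewrite zz => /(_ ltac:(lra) hx); rewrite lorentzC.
  have -> : lorentz x ((a - t * b) *: x + b *: y) = - a by move: xz; rewrite /tau; lra.
  by rewrite nmulr_rlt0 //; lra.
split => //.
have -> : tau ((a - t * b) *: x + b *: y) y = a * t - r * s.
  rewrite /tau !lorentzE yy xyt -bs; have -> : b * s * s = b * (t ^+ 2 - 1) by rewrite -s2; ring.
  ring.
have a0 : 0 < a by lra.
rewrite ler_pdivlMr //.
have [a2|a2] := leP (a ^+ 2) 2.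
  have : 0 <= a * (r * s) by rewrite !mulr_ge0 // ltW.
  nra.
suff : t * (a ^+ 2 - 2) <= a * r * s by nra.
have H0 : 0 <= t * (a ^+ 2 - 2) by nra.
have H1 : 0 <= a * r * s by rewrite !mulr_ge0 // ltW.
rewrite -ler_sqr ?nnegrE // !exprMn r2 s2.
have ta : a ^+ 2 <= t ^+ 2 by nra.
nra.
Qed.
End Lorentz.

(** * Isometries of the form and reflections *)

Section Isometries.
Context {R : realType} {n : nat}.
Implicit Types (x y z w a u v : 'cV[R]_n.+1) (g h : 'M[R]_n.+1).

Definition lorJ : 'M[R]_n.+1 := diag_mx (\row_i if i == ord_max then -1 else 1).

Lemma lorJ_mulE x i : (lorJ *m x) i 0 = (if i == ord_max then -1 else 1) * x i 0.
Proof. by rewrite mul_diag_mx !mxE. Qed.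

Lemma lorJK : lorJ *m lorJ = 1%:M.
Proof.
apply/matrixP => i j; rewrite mul_diag_mx !mxE.
by case: (i == j); case: ifP => _; rewrite ?(mulr0n, mulr1n, mulr0, mulr1, mulrNN).
Qed.

Lemma mx_col_eq m p (A B : 'M[R]_(m, p)) :
  (forall x : 'cV_p, A *m x = B *m x) -> A = B.
Proof.
by move=> H; apply/matrixP => i j; have /colP/(_ i) := H (delta_mx j 0); rewrite -!colE !mxE.
Qed.

Lemma lorJT : lorJ^T = lorJ. Proof. exact: tr_diag_mx. Qed.

Lemma lorentz_mx x y : lorentz x y = ((lorJ *m x)^T *m y) 0 0.
Proof.
rewrite mxE (bigD1_ord ord_max) //= mxE lorJ_mulE eqxx /lorentz addrC mulN1r mulNr.
congr (_ + _); apply: eq_bigr => i _; rewrite [in RHS]mxE lorJ_mulE.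
by rewrite eq_sym (negbTE (neq_lift _ _)) mul1r.
Qed.

Lemma lorentz_basel (i : 'I_n.+1) x :
  lorentz (delta_mx i 0) x = (if i == ord_max then -1 else 1) * x i 0.
Proof.
rewrite lorentz_mx (_ : lorJ *m _ = (if i == ord_max then -1 else 1) *: delta_mx i 0).
  rewrite linearZ /= -scalemxAl mxE trmx_delta -rowE mxE; congr (_ * _).
apply/colP => j; rewrite lorJ_mulE !mxE.
by case: (eqVneq j i) => [->//|]; rewrite !mulr0.
Qed.

Lemma lorentz_inj x y : (forall z, lorentz z x = lorentz z y) -> x = y.
Proof.
move=> H; apply/colP => i; have := H (delta_mx i 0); rewrite !lorentz_basel.
by case: ifP => _; rewrite ?mul1r ?mulN1r // => /oppr_inj.
Qed.

Definition isom : set 'M[R]_n.+1 :=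
  [set g | forall x, lorentz (g *m x) (g *m x) = lorentz x x].

Lemma isom_lorentz g x y : isom g -> lorentz (g *m x) (g *m y) = lorentz x y.
Proof.
move=> gi; have := gi (x + y); rewrite mulmxDr !lorentzE !gi.
by rewrite (lorentzC (g *m y)) (lorentzC y); lra.
Qed.

Lemma isom1 : isom 1%:M. Proof. by move=> x; rewrite mul1mx. Qed.

Lemma isomM g h : isom g -> isom h -> isom (g *m h).
Proof. by move=> gi hi x; rewrite -!mulmxA gi hi. Qed.

Lemma isom_mx g : isom g -> lorJ *m g^T *m lorJ *m g = 1%:M.
Proof.
move=> gi; apply: mx_col_eq => x; rewrite mul1mx; apply: lorentz_inj => z.
rewrite -[RHS](isom_lorentz _ _ gi) !lorentz_mx !trmx_mul lorJT !mulmxA.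
by rewrite -[z^T *m lorJ *m lorJ]mulmxA lorJK mulmx1.
Qed.

Lemma isom_unit g : isom g -> g \in unitmx.
Proof. by move=> /isom_mx /mulmx1_unit []. Qed.

Lemma isom_inv g : isom g -> isom (invmx g).
Proof. by move=> gi x; rewrite -gi !mulmxA mulmxV ?isom_unit // mul1mx. Qed.

Lemma isom_invE g : isom g -> invmx g = lorJ *m g^T *m lorJ.
Proof.
by move=> gi; rewrite -[RHS](mulmxK (isom_unit gi)) isom_mx // mul1mx.
Qed.

Lemma isom_adj g x y : isom g -> lorentz (g *m x) y = lorentz x (invmx g *m y).
Proof.
by move=> gi; rewrite -(isom_lorentz _ _ (isom_inv gi)) mulmxA mulVmx ?isom_unit // mul1mx.
Qed.

Lemma isom_invK g x : isom g -> invmx g *m (g *m x) = x.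
Proof. by move=> gi; rewrite mulmxA mulVmx ?isom_unit // mul1mx. Qed.

Lemma isom_mulK g x : isom g -> g *m (invmx g *m x) = x.
Proof. by move=> gi; rewrite mulmxA mulmxV ?isom_unit // mul1mx. Qed.

Lemma base_hyp : hyp (base_point : 'cV[R]_n.+1).
Proof. by split; rewrite ?lorentz_basel !mxE !eqxx ?mulr1. Qed.

Lemma lorentz_base x : lorentz base_point x = - x ord_max 0.
Proof. by rewrite lorentz_basel eqxx mulN1r. Qed.

Lemma mul_base g : (g *m base_point) ord_max 0 = g ord_max ord_max.
Proof. by rewrite -colE mxE. Qed.

(** Isometries preserving the sheet, of either determinant: the reflections in spacelike vectors lie
    here, but not in [SO_n1]. *)
Definition oplus : set 'M[R]_n.+1 := [set g | isom g /\ 0 < g ord_max ord_max].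

Lemma oplus_isom g : oplus g -> isom g. Proof. by case. Qed.

Lemma oplus_hyp g x : oplus g -> hyp x -> hyp (g *m x).
Proof.
move=> [gi g0] hx; have hgo : hyp (g *m base_point).
  by split; rewrite ?mul_base ?gi //; case: base_hyp.
have [xx _] := hx; split; first by rewrite gi.
have := @timelike_hyp _ _ (g *m x) _ _ hgo.
rewrite !isom_lorentz // xx => /(_ ltac:(lra)).
by have := tau_ge1 hx base_hyp; rewrite /tau => ?; rewrite nmulr_rlt0 //; lra.
Qed.

Lemma isom_oplus g x : isom g -> hyp x -> hyp (g *m x) -> oplus g.
Proof.
move=> gi hx hgx; split => //; rewrite -mul_base.
have := @timelike_hyp _ _ (g *m base_point) _ _ hgx.
rewrite !isom_lorentz //; have [-> _] := base_hyp => /(_ ltac:(lra)).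
by have := tau_ge1 base_hyp hx; rewrite /tau => ?; rewrite nmulr_rlt0 //; lra.
Qed.

Lemma oplus1 : oplus 1%:M.
Proof. by split; [exact: isom1 | rewrite mxE eqxx]. Qed.

Lemma oplusM g h : oplus g -> oplus h -> oplus (g *m h).
Proof.
move=> go ho; apply: (@isom_oplus _ base_point); [|exact: base_hyp|].
  by apply: isomM; exact: oplus_isom.
by rewrite -mulmxA; apply/oplus_hyp/oplus_hyp/base_hyp.
Qed.

Lemma oplusV g : oplus g -> oplus (invmx g).
Proof.
move=> go; have gi := oplus_isom go.
apply: (@isom_oplus _ (g *m base_point)); first exact: isom_inv.
  exact/oplus_hyp/base_hyp.
by rewrite isom_invK //; exact: base_hyp.
Qed.

Lemma tau_base g : tau (g *m base_point) base_point = g ord_max ord_max.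
Proof. by rewrite /tau lorentzC lorentz_base opprK mul_base. Qed.

Lemma oplus_tau g x y : oplus g -> tau (g *m x) (g *m y) = tau x y.
Proof. by move=> [gi _]; rewrite /tau isom_lorentz. Qed.

Definition refl u : 'M[R]_n.+1 :=
  1%:M - (2 / lorentz u u) *: (u *m (lorJ *m u)^T).

Lemma reflE u x : refl u *m x = x - (2 * lorentz u x / lorentz u u) *: u.
Proof.
rewrite mulmxBl mul1mx -scalemxAl -mulmxA [_^T *m x]mx11_scalar -lorentz_mx.
by rewrite mul_mx_scalar scalerA mulrAC.
Qed.

Lemma refl_unitE u x : lorentz u u = 1 -> refl u *m x = x - (2 * lorentz u x) *: u.
Proof. by move=> uu; rewrite reflE uu divr1. Qed.

Lemma refl_isom u : lorentz u u != 0 -> isom (refl u).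
Proof.
move=> u0 x; rewrite reflE !lorentzE (lorentzC x u).
by field.
Qed.

Lemma refl_oplus u : 0 < lorentz u u -> oplus (refl u).
Proof.
move=> u0; have ui : isom (refl u) by apply: refl_isom; rewrite gt_eqF.
apply: (isom_oplus ui base_hyp); split; first by rewrite ui; case: base_hyp.
have := @timelike_hyp _ _ (refl u *m base_point) _ _ base_hyp.
rewrite ui; have [oo _] := base_hyp; rewrite oo => /(_ ltac:(lra)).
move=> H; suff E : lorentz (refl u *m base_point) base_point < 0 by rewrite nmulr_rlt0 in H.
rewrite reflE !lorentzE oo; move: (lorentz u base_point) => b.
have : 0 <= b ^+ 2 / lorentz u u by rewrite divr_ge0 ?sqr_ge0 // ltW.
have -> : 2 * b / lorentz u u * b = 2 * (b ^+ 2 / lorentz u u) by ring.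
lra.
Qed.

Lemma refl_unit_oplus u : lorentz u u = 1 -> oplus (refl u).
Proof. by move=> uu; apply: refl_oplus; rewrite uu. Qed.

Lemma reflK u : lorentz u u != 0 -> refl u *m refl u = 1%:M.
Proof.
move=> u0; apply: mx_col_eq => x; rewrite mul1mx -mulmxA !reflE !lorentzE.
rewrite -addrA -opprD -scalerDl; set c := (X in X *: _).
suff -> : c = 0 by rewrite scale0r subr0.
by rewrite /c; field.
Qed.

Lemma refl_conj g u : isom g -> g *m refl u *m invmx g = refl (g *m u).
Proof.
move=> gi; have gu := isom_unit gi; rewrite -[RHS](mulmxK gu); congr (_ *m _).
by apply: mx_col_eq => x; rewrite -!mulmxA !reflE mulmxBr -scalemxAr !gi isom_lorentz.
Qed.

Lemma reflZ (c : R) u : c != 0 -> refl (c *: u) = refl u.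
Proof.
move=> c0; rewrite /refl !lorentzE; congr (_ - _).
rewrite -scalemxAr [(c *: _)^T]linearZ /= -scalemxAr -scalemxAl !scalerA.
congr (_ *: _); have [->|u0] := eqVneq (lorentz u u) 0; last by field; rewrite u0 c0.
by rewrite !mulr0 invr0 !mulr0 !mul0r.
Qed.

(** Matrix determinant lemma: compare determinants in two factorisations of the same block
    matrix. *)
Lemma det_1Dmul m (a : 'cV[R]_m) (b : 'rV[R]_m) :
  \det (1%:M + a *m b) = 1 + (b *m a) 0 0.
Proof.
have E : block_mx 1%:M 0 a 1%:M *m block_mx (1%:M : 'M[R]_1) (- b) 0 (1%:M + a *m b)
   = block_mx (1%:M + b *m a) (- b) 0 1%:M *m block_mx 1%:M 0 a 1%:M.
  rewrite !mulmx_block !mul1mx !mul0mx !mulmx1 !mulmx0 !addr0 !add0r mulmxN.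
  by rewrite mulNmx addrK [- _ + _]addrC addrK.
have := congr1 determinant E; rewrite !det_mulmx !det_lblock !det_ublock !det1 !mul1r !mulr1.
by move=> ->; rewrite det_mx11 !mxE eqxx.
Qed.

Lemma det_refl u : lorentz u u != 0 -> \det (refl u) = -1.
Proof.
move=> u0; rewrite /refl -scaleNr scalemxAl det_1Dmul -scalemxAr mxE -lorentz_mx.
by field.
Qed.

Lemma refl_swap w x : lorentz (w - x) (w - x) != 0 -> lorentz w w = lorentz x x ->
  refl (w - x) *m w = x.
Proof.
move=> wx ww; rewrite reflE.
have -> : 2 * lorentz (w - x) w = lorentz (w - x) (w - x).
  by rewrite !lorentzE ww (lorentzC w x); ring.
by rewrite divff // scale1r opprB addrC subrK.
Qed.

Definition reflprod (s : seq 'cV[R]_n.+1) := foldr (fun u g => refl u *m g) 1%:M s.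

Lemma reflprod_cat s1 s2 : reflprod (s1 ++ s2) = reflprod s1 *m reflprod s2.
Proof. by elim: s1 => [|u s IH] /=; rewrite ?mul1mx // IH mulmxA. Qed.
End Isometries.
Arguments lorJ {R n}.

(** * The identity component: determinant one and sheet preserving *)

Section Component.
Context {R : realType} {n : nat}.
Implicit Types (x y z w a u v : 'cV[R]_n.+1) (g h : 'M[R]_n.+1).

(** Cartan-Dieudonne with spacelike vectors: bring back the base point, then the basis vectors one
    at a time, each by the reflection in the difference between image and target. Vectors already
    fixed are orthogonal to that difference and stay fixed. *)
Lemma oplus_reflprod g : oplus g ->
  exists s, (forall u, u \in s -> 0 < lorentz u u) /\ g = reflprod s.
Proof.
(* [k] is the number of basis vectors, among the first [n], not yet known to be fixed. *)
have main k : (k <= n)%N -> forall h, oplus h -> h *m base_point = base_point ->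
   (forall i : 'I_n.+1, (i < n - k)%N -> h *m delta_mx i 0 = delta_mx i 0 :> 'cV[R]_n.+1) ->
   exists s, (forall u, u \in s -> 0 < lorentz u u) /\ h = reflprod s.
  elim: k => [_|k IH kn] h ho hb hi.
    exists [::]; split => //=; apply/matrixP => i j.
    suff : h *m delta_mx j 0 = delta_mx j 0 :> 'cV[R]_n.+1.
      by rewrite -colE => /colP /(_ i); rewrite !mxE eqxx andbT.
    have [->//|jn] := eqVneq j ord_max.
    by apply: hi; rewrite subn0 ltn_neqAle -ltnS ltn_ord andbT.
  have in0 : (n - k.+1 < n.+1)%N by lia.
  pose i0 := Ordinal in0; pose e : 'cV[R]_n.+1 := delta_mx i0 0.
  have oe : lorentz base_point e = 0.
    rewrite lorentz_basel !mxE (_ : ord_max == i0 = false) ?mulr0 //.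
    by apply/eqP => /(congr1 val) /=; lia.
  have [f0|f0] := eqVneq (h *m e) e.
    apply: IH; [lia|exact: ho|exact: hb|] => i ik.
    have [ii0|ii0] := eqVneq i i0; first by rewrite ii0.
    by apply: hi; have : (i : nat) <> (n - k.+1)%N;
      [move=> E; case/eqP: ii0; exact: val_inj | lia].
  pose f := h *m e - e.
  have hif : isom h := oplus_isom ho.
  have of0 : lorentz base_point f = 0.
    by rewrite lorentzDr lorentzNr oe -{1}hb isom_lorentz // oe subr0.
  have fp : 0 < lorentz f f.
    rewrite lt_neqAle (perp_hyp_ge0 base_hyp of0) andbT eq_sym.
    apply/eqP => /(perp_hyp_eq0 base_hyp of0) /eqP; rewrite subr_eq0.
    by rewrite (negbTE f0).
  have fo := refl_oplus fp.
  have [|||i ik|s [sp sE]] := IH _ (refl f *m h).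
  - lia.
  - exact: oplusM.
  - by rewrite -mulmxA hb reflE lorentzC of0 mulr0 mul0r scale0r subr0.
  - have [->|ii0] := eqVneq i i0.
      by rewrite -mulmxA refl_swap ?hif // gt_eqF.
    have hei : h *m delta_mx i 0 = delta_mx i 0 :> 'cV[R]_n.+1.
      by apply: hi; have : (i : nat) <> (n - k.+1)%N;
      [move=> E; case/eqP: ii0; exact: val_inj | lia].
    rewrite -mulmxA hei reflE (_ : lorentz f _ = 0) ?mulr0 ?mul0r ?scale0r ?subr0 //.
    by rewrite lorentzDl lorentzNl -{1}hei isom_lorentz // subrr.
  exists (f :: s); split => [u|/=].
    by rewrite inE => /orP[/eqP ->//|]; exact: sp.
  by rewrite -sE mulmxA reflK ?mul1mx // gt_eqF.
move=> go; have gi := oplus_isom go.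
have [g0|g0] := eqVneq (g *m base_point) base_point.
  by apply: (main n) => // i; rewrite subnn.
pose f := g *m base_point - base_point.
have fp : 0 < lorentz f f.
  have hgo := oplus_hyp go base_hyp; have [oo _] := @base_hyp R n.
  have := lorentz_add_sqr_ge0 (g *m base_point) base_hyp.
  have : lorentz f f = 2 * (tau (g *m base_point) base_point - 1).
    by rewrite /tau !lorentzE gi oo (lorentzC base_point); ring.
  move=> -> H; have := tau_ge1 hgo base_hyp; rewrite le_eqVlt => /orP[/eqP E|]; last by lra.
  case/eqP: g0; apply/eqP; rewrite -subr_eq0; apply/eqP.
  apply: (perp_hyp_eq0 base_hyp); move: E; rewrite /tau !lorentzE ?gi oo (lorentzC base_point); lra.
have [//||||s [sp sE]] := main n _ (refl f *m g).
- by apply: oplusM => //; apply: refl_oplus.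
- by rewrite -mulmxA refl_swap ?gi // gt_eqF.
- by move=> i; rewrite subnn.
exists (f :: s); split => [u|/=].
  by rewrite inE => /orP[/eqP ->//|]; exact: sp.
by rewrite -sE mulmxA reflK ?mul1mx // gt_eqF.
Qed.

Lemma mx_continuous (U : topologicalType) m p (f : U -> 'M[R]_(m, p)) (x : U) :
  (forall i j, {for x, continuous (fun t => f t i j)}) -> {for x, continuous f}.
Proof.
move=> fc A [P MP PA]; apply: (@filterS _ _ _ (fun t => forall i j, P i j (f t i j))).
  by move=> t Ht; apply: PA => i j; exact: Ht.
apply: filter_forall => i; apply: filter_forall => j.
exact: fc.
Qed.

Lemma continuous_sum (U : topologicalType) (I : Type) (r : seq I) (P : pred I) (F : I -> U -> R) (x : U) :
  (forall i, {for x, continuous (F i)}) ->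
  {for x, continuous (fun t => \sum_(i <- r | P i) F i t)}.
Proof. by move=> Fc; apply: (cvg_big add_continuous) => i _; exact: Fc. Qed.

Lemma mulmx_continuous m p q (U : topologicalType) (f : U -> 'M[R]_(m, p))
  (f' : U -> 'M[R]_(p, q)) (x : U) : {for x, continuous f} -> {for x, continuous f'} ->
  {for x, continuous (fun t => f t *m f' t)}.
Proof.
move=> fc f'c; apply: mx_continuous => i j.
under [X in {for _, continuous X}]funext do rewrite mxE.
apply: continuous_sum => k; apply: cvgM.
  by apply: (@continuous_comp _ _ _ f (fun M : 'M[R]_(m, p) => M i k)) => //; exact: coord_continuous.
by apply: (@continuous_comp _ _ _ f' (fun M : 'M[R]_(p, q) => M k j)) => //; exact: coord_continuous.
Qed.

Definition SO_plus : set 'M[R]_n.+1 := [set g | oplus g /\ \det g = 1].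

Lemma isomE g : lorentz_isometries g <-> isom g /\ \det g = 1.
Proof. by split => -[]. Qed.

Lemma SO_n1_1 : SO_n1 (1%:M : 'M[R]_n.+1).
Proof. by apply: connected_component_refl; apply/isomE; split; [exact: isom1|exact: det1]. Qed.

Lemma SO_n1_mul g h : SO_n1 g -> SO_n1 h -> SO_n1 (g *m h).
Proof.
move=> gS hS; have /isomE[gi gd] := connected_component_sub gS.
apply: connected_component_trans gS _.
apply: (@connected_component_max _ _ (mulmx g @` SO_n1)).
- by exists 1%:M; [exact: SO_n1_1 | rewrite mulmx1].
- move=> _ [k /connected_component_sub /isomE[ki kd] <-]; apply/isomE.
  by rewrite det_mulmx gd kd mulr1; split => //; exact: isomM.
- apply: connected_continuous_connected; first exact: component_connected.
  apply: continuous_subspaceT => k; apply: (@mulmx_continuous _ _ _ _ (fun=> g) id); [exact: (@cst_continuous _ _ g k)|exact: (fun A => id)].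
- by exists h.
Qed.

Lemma refl_line_continuous u w (t : R) :
  lorentz (w + t *: u) (w + t *: u) != 0 ->
  {for t, continuous (fun t : R => refl (w + t *: u))}.
Proof.
move=> H.
have Ec i : {for t, continuous (fun t : R => (w + t *: u) i 0)}.
  under [X in {for _, continuous X}]funext do rewrite !mxE.
  apply: cvgD; first exact: cvg_cst.
  by apply: cvgM; [exact: cvg_id | exact: cvg_cst].
have Lc : {for t, continuous (fun t : R => lorentz (w + t *: u) (w + t *: u))}.
  under [X in {for _, continuous X}]funext do rewrite !lorentzE.
  by repeat first [exact: cvg_cst | exact: cvg_id | apply: cvgD | apply: cvgM].
apply: mx_continuous => i j.
have -> : (fun t => refl (w + t *: u) i j) = (fun t => (i == j)%:R - 2 / lorentz (w + t *: u) (w + t *: u)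
   * ((w + t *: u) i 0 * ((if j == ord_max then -1 else 1) * (w + t *: u) j 0))).
  apply/funext => s; rewrite /refl.
  move: (w + s *: u) => a; rewrite !mxE; congr (_ - _ * _).
  by rewrite big_ord1 mxE lorJ_mulE.
apply: cvgB; first exact: cvg_cst.
apply: cvgM; first by apply: cvgM; [exact: cvg_cst | apply: cvgV].
by apply: cvgM; [exact: Ec | apply: cvgM; [exact: cvg_cst|exact: Ec]].
Qed.

(** Up to replacing [u] by [- u], which has the same reflection, the segment from [w] to [u] stays
    spacelike; reflecting along it gives a path of isometries from the identity to the product. *)
Lemma SO_n1_refl2 u w : 0 < lorentz u u -> 0 < lorentz w w -> SO_n1 (refl u *m refl w).
Proof.
wlog uw : u / 0 <= lorentz u w.
  move=> H u0 w0; have [uw|uw] := leP 0 (lorentz u w); first exact: H.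
  rewrite -(reflZ u (_ : -1 != 0)) ?oppr_eq0 ?oner_eq0 //.
  by apply: H => //; rewrite ?lorentzZl ?lorentzZr; lra.
move=> u0 w0.
pose p (t : R) := w + t *: (u - w).
have pn t : 0 <= t <= 1 -> 0 < lorentz (p t) (p t).
  move=> /andP[t0 t1]; rewrite /p !lorentzE (lorentzC w u).
  have [->|tn] := eqVneq t 0; first by lra.
  have : 0 < t ^+ 2 * lorentz u u by rewrite mulr_gt0 // exprn_even_gt0.
  have : 0 <= (1 - t) ^+ 2 * lorentz w w by rewrite mulr_ge0 ?sqr_ge0 // ltW.
  have : 0 <= t * (1 - t) * lorentz u w by rewrite !mulr_ge0 //; lra.
  nra.
have p0 : p 0 = w by rewrite /p scale0r addr0.
have p1 : p 1 = u by rewrite /p scale1r addrC subrK.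
apply: (@connected_component_max _ _ ((fun t => refl (p t) *m refl w) @` `[0, 1])).
- by exists 0 => /=; rewrite ?in_itv /= ?lexx ?ler01 // p0 reflK // gt_eqF.
- move=> _ [t /= tI <-]; move: tI; rewrite in_itv /= => /pn pt; apply/isomE.
  split; last by rewrite det_mulmx !det_refl ?gt_eqF // mulrNN mulr1.
  by apply: isomM; apply: refl_isom; rewrite gt_eqF.
- apply: connected_continuous_connected; first exact: segment_connected.
  apply: continuous_in_subspaceT => t; rewrite inE /= in_itv /= => /pn pt.
  apply: (@mulmx_continuous _ _ _ _ (fun t : R => refl (p t)) (fun=> refl w)); last exact: (@cst_continuous _ _ (refl w) t).
  by apply: refl_line_continuous; rewrite gt_eqF.
- by exists 1 => /=; rewrite ?in_itv /= ?lexx ?ler01 // p1.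
Qed.

Lemma det_reflprod s : (forall u, u \in s -> 0 < lorentz u u) ->
  \det (reflprod s : 'M[R]_n.+1) = (-1) ^+ size s.
Proof.
elim: s => [|u s IH] H /=; first by rewrite det1.
rewrite det_mulmx det_refl ?gt_eqF ?H ?mem_head // exprS IH //.
by move=> v vs; apply: H; rewrite inE vs orbT.
Qed.

(** The corner entry vanishes on no isometry, so it stays positive on the component of the identity.
    Conversely, determinant one makes the number of reflections even, and products of two
    reflections are in the component. *)
Lemma SO_n1E : (SO_n1 : set 'M[R]_n.+1) = SO_plus.
Proof.
apply/seteqP; split => g.
  move=> gS; have /isomE[gi gd] := connected_component_sub gS.
  split => //; split => //; rewrite ltNge; apply/negP => gn.
  have := @connected_continuous_connected _ _ SO_n1 (fun M : 'M[R]_n.+1 => (M ord_max ord_max : R)) (@component_connected _ lorentz_isometries 1%:M).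
  move=> /(_ (continuous_subspaceT (@coord_continuous _ _ _ _ _))).
  move/connected_intervalP => /(_ (g ord_max ord_max) 1).
  case/(_ _ _ 0).
  - by exists g.
  - by exists 1%:M; [exact: SO_n1_1 | rewrite mxE eqxx].
  - by rewrite gn ler01.
  move=> h /connected_component_sub /isomE [hi _] h0.
  have := hi base_point; have [-> _] := @base_hyp R n.
  rewrite lorentz_sqr mul_base h0 expr0n /= subr0 => H.
  have : 0 <= \sum_(i < n) (h *m base_point) (lift ord_max i) 0 ^+ 2.
    by apply: sumr_ge0 => i _; exact: sqr_ge0.
  by rewrite H ler0N1.
move=> [go gd]; have [s [sp gE]] := oplus_reflprod go.
have := det_reflprod sp; rewrite -gE gd => /esym.
rewrite -signr_odd; case so: (odd _); first by rewrite expr1; lra.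
move=> _; rewrite {g go gd}gE.
have [m ms] : exists m, (size s <= m)%N by exists (size s).
elim: m s ms sp so => [|m IH] [|u [|w s]] //= ms sp so; try exact: SO_n1_1.
rewrite mulmxA; apply: SO_n1_mul.
  by apply: SO_n1_refl2; apply: sp; rewrite !inE eqxx ?orbT.
apply: IH; [by move: ms; rewrite ltnS => /ltnW | | by rewrite negbK in so].
by move=> v vs; apply: sp; rewrite !inE vs !orbT.
Qed.
End Component.

(** * Borel structure on matrices *)

Definition borel_mx (R : realType) m p := g_sigma_algebraType (@open 'M[R]_(m, p)).

Section BorelMatrices.
Context {R : realType}.

Lemma open_measurable_mx m p (U : set 'M[R]_(m, p)) :
  open U -> measurable (U : set (borel_mx R m p)).
Proof. by move=> oU; apply: sub_sigma_algebra. Qed.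

Lemma closed_measurable_mx m p (U : set 'M[R]_(m, p)) :
  closed U -> measurable (U : set (borel_mx R m p)).
Proof.
move=> cU; rewrite -[U]setCK; apply: measurableC; apply: open_measurable_mx.
exact: closed_openC.
Qed.

Lemma continuous_measurable_mx m p (f : 'M[R]_(m, p) -> R) :
  continuous f -> measurable_fun setT (f : borel_mx R m p -> R).
Proof.
move=> /continuousP cf.
apply: (measurability _ (RGenOInfty.measurableE R)).
move=> _ [_ [x ->] <-]; rewrite setTI; apply: open_measurable_mx.
exact/cf/interval_open.
Qed.

Lemma coord_measurable_mx m p (i : 'I_m) (j : 'I_p) :
  measurable_fun setT (fun M : borel_mx R m p => (M : 'M[R]_(m, p)) i j).
Proof. by apply: continuous_measurable_mx; exact: coord_continuous. Qed.

(** Entrywise measurability suffices because an open set of matrices is a countable union of boxes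
    with rational centres and radii 1/(k+1). *)
Lemma measurable_fun_mx d (T : measurableType d) m p (f : T -> 'M[R]_(m, p)) :
  (forall i j, measurable_fun setT (fun t => f t i j)) ->
  measurable_fun setT (f : T -> borel_mx R m p).
Proof.
move=> mf; apply: (measurability _ (erefl : @measurable _ (borel_mx R m p) = <<s open >>)).
move=> _ [U oU <-]; rewrite setTI.
pose box (qk : 'M[rat]_(m, p) * nat) : set 'M[R]_(m, p) :=
  [set M | forall i j, `|ratr (qk.1 i j) - M i j| < qk.2.+1%:R^-1].
have -> : f @^-1` U = \bigcup_(qk in [set qk | box qk `<=` U]) (f @^-1` box qk).
  apply/seteqP; split => [t Ut|t [qk /= bU]]; last by exact: bU.
  have /nbhs_ballP[e /= e0 eU] : nbhs (f t) U by apply: open_nbhs_nbhs.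
  pose k := Num.truncn (2 / e); have ke : k.+1%:R^-1 * 2 < e.
    rewrite mulrC ltr_pdivrMr ?ltr0n // mulrC -ltr_pdivrMr //.
    by have /andP[] := truncn_itv (divr_ge0 (ler0n R 2) (ltW e0)).
  have qP i j : {q : rat | `|ratr q - f t i j| < k.+1%:R^-1}.
    apply: cid; have k0 : (0 : R) < k.+1%:R^-1 by rewrite invr_gt0 ltr0n.
    move: (k.+1%:R^-1 : R) k0 => e' k0.
    have : f t i j - e' < f t i j + e' by lra.
    by case/rat_in_itvoo => q; rewrite in_itv /= => ?; exists q; rewrite ltr_distl.
  exists (\matrix_(i, j) sval (qP i j), k) => [M /= HM|i j] /=; last first.
    by rewrite mxE; exact: (svalP (qP i j)).
  apply: eU; split => // i j /=; have := HM i j; rewrite mxE => H1.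
  have H2 := svalP (qP i j); rewrite /ball /=.
  move: (sval (qP i j)) H1 H2 => q H1 H2.
  have -> : f t i j - M i j = (f t i j - ratr q) + (ratr q - M i j) by ring.
  apply: le_lt_trans (ler_normD _ _) _; rewrite distrC.
  apply: lt_trans ke; rewrite mulrDr mulr1; exact: ltrD.
rewrite bigcup_mkcond; apply: countable_bigcupT_measurable; first exact: countableP.
move=> [q k]; case: ifP => // _.
have -> : f @^-1` box (q, k) = \bigcap_(ij in [set: 'I_m * 'I_p])
    [set t | `|ratr (q ij.1 ij.2) - f t ij.1 ij.2| < k.+1%:R^-1].
  by apply/seteqP; split => t /= Ht => [[i j] _|i j]; [exact: Ht | exact: (Ht (i, j))].
apply: fin_bigcap_measurable => [|[i j] _ /=]; first exact: finite_finset.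
have -> : [set t | `|ratr (q i j) - f t i j| < k.+1%:R^-1] =
    (fun t => `|ratr (q i j) - f t i j|) @^-1` `]-oo, k.+1%:R^-1[%classic.
  by apply/seteqP; split => t /=; rewrite in_itv.
rewrite -[X in measurable X]setTI.
have : measurable_fun setT (fun t => `|ratr (q i j) - f t i j|).
  by apply: measurableT_comp; [exact: normr_measurable|apply: measurable_funB; [exact: measurable_cst|exact: mf]].
apply => //; exact: measurable_itv.
Qed.

Lemma sigma_finite_pack d (T : measurableType d) (mu : {measure set T -> \bar R}) :
  sigma_finite setT mu -> exists L : {sigma_finite_measure set T -> \bar R}, L = mu :> (set T -> \bar R).
Proof.
move=> sf; pose H3 := @isSigmaFinite.Build _ _ _ mu sf.
pose H2 := isSFinite.Build _ _ _ mu (sfinite_measure_sigma_finite sf).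
pose L : {sigma_finite_measure set T -> \bar R} := HB.pack (Measure.sort mu) H2 H3.
by exists L.
Qed.
End BorelMatrices.

(** * Lebesgue measure on matrices, as iterated product *)

Section LebesgueMatrices.
Context {R : realType}.

Definition mx_box {m p} (r : R) : set 'M[R]_(m, p) := [set M | forall i j, `|M i j| <= r].

(** What the construction of Haar measure needs to know about Lebesgue measure. *)
Record leb_prop m p (L : set (borel_mx R m p) -> \bar R) : Prop := LebProp {
  leb_transl : forall (v : 'M[R]_(m, p)) (A : set (borel_mx R m p)), measurable A ->
    L ((fun y : 'M[R]_(m, p) => y + v) @^-1` A) = L A;
  leb_bounded : forall r : R, (L (@mx_box m p r) < +oo)%E;
  leb_pos : forall r : R, 0 < r ->
    (0 < L (@mx_box m p r))%E }.

Lemma measurable_box m p (r : R) :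
  measurable (@mx_box m p r : set (borel_mx R m p)).
Proof.
have -> : @mx_box m p r =
   \bigcap_(ij in [set: 'I_m * 'I_p]) ((fun M : borel_mx R m p => `|(M : 'M[R]_(m, p)) ij.1 ij.2|) @^-1` `]-oo, r]%classic).
  apply/seteqP; split => M /= H => [[i j] _|i j] /=; first by rewrite in_itv /= H.
  by have := H (i, j) Logic.I; rewrite /= in_itv.
apply: fin_bigcap_measurable => [|[i j] _ /=]; first exact: finite_finset.
rewrite -[X in measurable X]setTI.
have : measurable_fun setT (fun M : borel_mx R m p => `|(M : 'M[R]_(m, p)) i j|).
  by apply: measurableT_comp; [exact: normr_measurable|exact: coord_measurable_mx].
by apply => //; exact: measurable_itv.
Qed.

Lemma box_cover m p : [set: 'M[R]_(m, p)] = \bigcup_k mx_box k%:R.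
Proof.
apply/seteqP; split => // M _.
have H i j : `|M i j| <= \sum_k \sum_l `|M k l|.
  rewrite (bigD1 i) //= (bigD1 j) //= -addrA lerDl addr_ge0 // ?sumr_ge0 // => k _.
  by rewrite sumr_ge0.
exists (Num.truncn (\sum_k \sum_l `|M k l|)).+1 => // i j; apply: le_trans (H i j) _.
by apply/ltW/truncnS_gt.
Qed.

Lemma sigma_finite_boxes m p (L : set (borel_mx R m p) -> \bar R) :
  (forall r : R, (L (@mx_box m p r) < +oo)%E) ->
  sigma_finite setT L.
Proof.
move=> H; exists (fun k => @mx_box m p k%:R).
  exact: box_cover.
by move=> k; split; [exact: measurable_box | exact: H].
Qed.

Lemma pushforward_pack d d' (T1 : measurableType d) (T2 : measurableType d')
    (mu : {measure set T1 -> \bar R}) (f : T1 -> T2) : measurable_fun setT f ->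
  exists nu : {measure set T2 -> \bar R}, forall A, nu A = mu (f @^-1` A).
Proof.
by move=> mf; unshelve (eexists (pushforward mu f : {measure set T2 -> \bar R})).
Qed.

Lemma leb_trivial m p : (forall M M' : 'M[R]_(m, p), M = M') ->
  exists L : {sigma_finite_measure set (borel_mx R m p) -> \bar R}, leb_prop L.
Proof.
move=> MM; pose mu : {measure set (borel_mx R m p) -> \bar R} := @dirac _ (borel_mx R m p) (0 : 'M[R]_(m, p)) R.
have muE A : mu A = ((((0 : 'M[R]_(m, p)) : borel_mx R m p) \in A)%:R%:E) by rewrite /mu /= diracE.
have sf : sigma_finite setT mu by apply: sigma_finite_boxes => r; rewrite muE ltry.
have [L LE] := sigma_finite_pack sf; exists L; rewrite LE; split.
- by move=> v A _; rewrite !muE (_ : _ @^-1` _ = A) //; apply/seteqP; split => M /=;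
    rewrite (MM (M + v) M).
- by move=> r; rewrite muE ltry.
- move=> r r0; rewrite muE mem_set ?lte01 // => i j; rewrite mxE normr0; exact: ltW.
Qed.

Lemma lebesgue_translation (v : R) (A : set (measurableTypeR R)) : measurable A ->
  lebesgue_measure ((fun x : R => x + v) @^-1` A) = lebesgue_measure A.
Proof.
have mf : measurable_fun setT (fun x : measurableTypeR R => (x + v : measurableTypeR R)).
  by apply: measurable_funD; [exact: measurable_id|exact: measurable_cst].
pose f : {mfun measurableTypeR R >-> measurableTypeR R} := HB.pack (fun x : R => x + v) (isMeasurableFun.Build _ _ _ _ _ mf).
move=> mA; symmetry.
apply: (lebesgue_measure_unique (mu := pushforward lebesgue_measure f)) => // X [[a b] /= _ <-].
rewrite /pushforward /= (_ : _ @^-1` _ = `]a - v, b - v]%classic); last first.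
  by apply/seteqP; split => x /=; rewrite !in_itv /= => /andP[h1 h2]; apply/andP; split; lra.
rewrite !lebesgue_measure_itv /= !lte_fin ltrD2r.
by case: ifP => // _; rewrite -!EFinD; congr (_%:E); lra.
Qed.

Lemma leb_scalar : exists L : {sigma_finite_measure set (borel_mx R 1 1) -> \bar R}, leb_prop L.
Proof.
have mc : measurable_fun setT ((fun x => const_mx x) : measurableTypeR R -> borel_mx R 1 1).
  apply: measurable_fun_mx => i j; under eq_fun do rewrite mxE; exact: measurable_id.
have [mu muE] := pushforward_pack lebesgue_measure mc.
have boxE r : mu (@mx_box 1 1 r) = lebesgue_measure (`[-r, r]%classic : set R).
  rewrite muE; congr (lebesgue_measure _); apply/seteqP; split => x /=.
    by move=> /(_ 0 0); rewrite mxE in_itv /= ler_norml.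
  by rewrite in_itv /= -ler_norml => xr i j; rewrite mxE.
have bd r : (mu (@mx_box 1 1 r) < +oo)%E.
  by rewrite boxE lebesgue_measure_itv /=; case: ifP => _; rewrite ?ltry // -EFinD ltry.
have [L LE] := sigma_finite_pack (sigma_finite_boxes bd); exists L; rewrite LE; split => //.
- move=> v A mA; rewrite !muE.
  rewrite -[RHS](lebesgue_translation (v 0 0)); last by rewrite -[X in measurable X]setTI; exact: mc.
  congr (lebesgue_measure _); apply/seteqP; split => x /=;
  by rewrite (_ : const_mx x + v = const_mx (x + v 0 0)) //; apply/matrixP => i j; rewrite !mxE !ord1.
- move=> r r0; rewrite boxE lebesgue_measure_itv /= lte_fin.
  by rewrite (_ : - r < r) -?EFinD ?lte_fin; lra.
Qed.

Section Product.
Context {m1 p1 m2 p2 m p : nat}.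
Variable L1 : {sigma_finite_measure set (borel_mx R m1 p1) -> \bar R}.
Variable L2 : {sigma_finite_measure set (borel_mx R m2 p2) -> \bar R}.
Variable c : 'M[R]_(m1, p1) -> 'M[R]_(m2, p2) -> 'M[R]_(m, p).

Definition join_fun (z : borel_mx R m1 p1 * borel_mx R m2 p2) : borel_mx R m p :=
  c z.1 z.2.

Hypothesis mc : measurable_fun setT join_fun.

(** Fubini: [G] preserves each slice with [x] fixed and acts on it by a measure-preserving map. *)
Lemma join_left_invariant (G : 'M[R]_(m, p) -> 'M[R]_(m, p))
  (phi : 'M[R]_(m1, p1) -> 'M[R]_(m2, p2) -> 'M[R]_(m2, p2)) (A : set (borel_mx R m p)) :
  (forall x y, G (c x y) = c x (phi x y)) ->
  (forall x (B : set (borel_mx R m2 p2)), measurable B -> L2 (phi x @^-1` B) = L2 B) ->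
  measurable A ->
  (L1 \x L2)%E (join_fun @^-1` (G @^-1` A)) = (L1 \x L2)%E (join_fun @^-1` A).
Proof.
move=> GE phiL mA; apply: eq_integral => x _ /=.
have mcA : measurable (join_fun @^-1` A) by rewrite -[X in measurable X]setTI; exact: mc.
rewrite -[RHS](phiL x); last exact: measurable_xsection.
congr (L2 _); apply/seteqP; split => y /=;
by rewrite !xsectionE /= /join_fun /= GE.
Qed.

Lemma join_right_invariant (G : 'M[R]_(m, p) -> 'M[R]_(m, p))
  (psi : 'M[R]_(m2, p2) -> 'M[R]_(m1, p1) -> 'M[R]_(m1, p1)) (A : set (borel_mx R m p)) :
  (forall x y, G (c x y) = c (psi y x) y) ->
  (forall y (B : set (borel_mx R m1 p1)), measurable B -> L1 (psi y @^-1` B) = L1 B) ->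
  measurable_fun setT (G : borel_mx R m p -> borel_mx R m p) ->
  measurable A ->
  (L1 \x L2)%E (join_fun @^-1` (G @^-1` A)) = (L1 \x L2)%E (join_fun @^-1` A).
Proof.
move=> GE psiL mG mA.
have mcA (B : set (borel_mx R m p)) : measurable B -> measurable (join_fun @^-1` B).
  by move=> mB; rewrite -[X in measurable X]setTI; exact: mc.
have mGA : measurable (G @^-1` A : set (borel_mx R m p)) by rewrite -[X in measurable X]setTI; exact: mG.
(* By uniqueness of the product measure both orders of integration agree, so slices with [y] fixed
   may be used. *)
have E X : measurable X -> (L1 \x L2)%E X = (L1 \x^ L2)%E X.
  move=> mX; apply: (@product_measure_unique _ _ _ _ R L1 L2) => // B C mB mC.
  exact: product_measure2E.
rewrite !E; try exact: mcA.
apply: eq_integral => y _ /=.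
rewrite -[RHS](psiL y); last by apply: measurable_ysection; exact: mcA.
congr (L1 _); apply/seteqP; split => x /=;
by rewrite !ysectionE /= /join_fun /= GE.
Qed.

Hypothesis cD : forall x y x' y', c (x + x') (y + y') = c x y + c x' y'.
Hypothesis csurj : forall M, exists x y, M = c x y.
Hypothesis cbox : forall r x y, (forall i j, `|c x y i j| <= r) <->
  ((forall i j, `|x i j| <= r) /\ (forall i j, `|y i j| <= r)).

Lemma leb_product : leb_prop L1 -> leb_prop L2 ->
  exists L : {sigma_finite_measure set (borel_mx R m p) -> \bar R},
    leb_prop L /\ forall A, L A = (L1 \x L2)%E (join_fun @^-1` A).
Proof.
move=> H1 H2.
have [mu muE] := pushforward_pack (L1 \x L2)%E mc.
have boxE r : mu (@mx_box m p r) =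
   (L1 (@mx_box m1 p1 r) * L2 (@mx_box m2 p2 r))%E.
  rewrite muE -product_measure1E; try exact: measurable_box.
  congr ((_ \x _)%E _); apply/seteqP; split => -[x y] /=; by move/cbox.
have bd r : (mu (@mx_box m p r) < +oo)%E.
  rewrite boxE lte_mul_pinfty //; last exact: leb_bounded.
  by rewrite ge0_fin_numE //; exact: leb_bounded.
have [L LE] := sigma_finite_pack (sigma_finite_boxes bd).
exists L; split => [|A]; last by rewrite LE.
rewrite LE; split => //; last first.
  by move=> r r0; rewrite boxE mule_gt0 //; apply: leb_pos.
move=> v A mA; have [v1 [v2 vE]] := csurj v.
have mcA (B : set (borel_mx R m p)) : measurable B -> measurable (join_fun @^-1` B).
  by move=> mB; rewrite -[X in measurable X]setTI; exact: mc.
have step1 (B : set (borel_mx R m p)) : measurable B -> mu ((fun y : 'M[R]_(m, p) => y + c 0 v2) @^-1` B) = mu B.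
  move=> mB; rewrite !muE.
  apply: (@join_left_invariant (fun y => y + c 0 v2) (fun _ y => y + v2)) => //.
    by move=> x y; rewrite -cD addr0.
  by move=> _ C mC; exact: leb_transl.
have step2 (B : set (borel_mx R m p)) : measurable B -> mu ((fun y : 'M[R]_(m, p) => y + c v1 0) @^-1` B) = mu B.
  move=> mB; rewrite !muE.
  apply: (@join_right_invariant (fun y => y + c v1 0) (fun _ x => x + v1)) => //.
  - by move=> x y; rewrite -cD addr0.
  - by move=> _ C mC; exact: leb_transl.
  - apply: measurable_fun_mx => i j; under eq_fun do rewrite mxE.
    by apply: measurable_funD; [exact: coord_measurable_mx|exact: measurable_cst].
rewrite -[RHS]step1 // -[RHS]step2; last first.
  rewrite -[X in measurable X]setTI.
  have : measurable_fun setT ((fun y => y + c 0 v2) : borel_mx R m p -> borel_mx R m p).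
    apply: measurable_fun_mx => i j; under eq_fun do rewrite mxE.
    by apply: measurable_funD; [exact: coord_measurable_mx|exact: measurable_cst].
  exact.
congr (mu _); apply/seteqP; split => x /=;
by rewrite -addrA -cD add0r addr0 -vE.
Qed.
End Product.
End LebesgueMatrices.

(** * Invariance of Lebesgue measure under determinant-one matrices *)

Section SpecialLinear.
Context {R : realType}.

(** Gaussian elimination. If the pivot is 1, the matrix splits into a lower shear, a smaller block
    and an upper shear; if the column below the pivot is nonzero, an upper shear makes the pivot
    1. *)
Lemma SL_ind m (P : 'M[R]_(1 + m) -> Prop) :
  (forall g h, P g -> P h -> P (g *m h)) ->
  (forall c, P (block_mx 1%:M 0 c 1%:M)) ->
  (forall r, P (block_mx 1%:M r 0 1%:M)) ->
  (forall g', \det g' = 1 -> P (block_mx 1%:M 0 0 g')) ->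
  forall g, \det g = 1 -> P g.
Proof.
move=> PM Pl Pu Pd.
have stepA g : \det g = 1 -> ulsubmx g = 1%:M -> P g.
  move=> gd g1; have E : g = block_mx 1%:M 0 (dlsubmx g) 1%:M *m
      (block_mx 1%:M 0 0 (drsubmx g - dlsubmx g *m ursubmx g) *m block_mx 1%:M (ursubmx g) 0 1%:M).
    rewrite !mulmx_block !mul1mx !mul0mx !mulmx1 !mulmx0 !addr0 !add0r.
    by rewrite -{1}[g]submxK g1 addrC subrK mulmx1.
  rewrite E; apply: (PM _ _ (Pl _)); apply: PM (Pu _); apply: Pd.
  by have := congr1 determinant E; rewrite gd !det_mulmx !det_lblock !det_ublock !det1 !mul1r !mulr1.
have stepB g : \det g = 1 -> dlsubmx g != 0 -> P g.
  move=> gd; have [c0|[i ci] _] : dlsubmx g = 0 \/ exists i, dlsubmx g i 0 != 0.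
    have [|H] := pselect (exists i, dlsubmx g i 0 != 0); [by right|left].
    apply/colP => i; rewrite [RHS]mxE; apply: contrapT => h; apply: H; exists i; exact/eqP.
    by rewrite c0 eqxx.
  pose r : 'rV[R]_m := ((1 - ulsubmx g 0 0) / dlsubmx g i 0) *: delta_mx 0 i.
  have rc : r *m dlsubmx g = 1%:M - ulsubmx g.
    rewrite [RHS]mx11_scalar [LHS]mx11_scalar; congr (_%:M).
    have -> : (1%:M - ulsubmx g) 0 0 = 1 - ulsubmx g 0 0.
      by rewrite mxE [X in X + _]mxE [X in _ + X]mxE.
    have E : row i (dlsubmx g) 0 0 = dlsubmx g i 0 by rewrite [LHS]mxE.
    by rewrite -scalemxAl -rowE [LHS]mxE E divfK.
  have E : g = block_mx 1%:M (- r) 0 1%:M *m (block_mx 1%:M r 0 1%:M *m g).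
    rewrite mulmxA !mulmx_block !mul1mx !mul0mx !mulmx1 !mulmx0 !addr0 !add0r subrr.
    by rewrite -scalar_mx_block mul1mx.
  rewrite E; apply: (PM _ _ (Pu _)); apply: stepA.
    by rewrite det_mulmx gd det_ublock !det1 !mulr1.
  rewrite -{1}[g]submxK mulmx_block block_mxKul mul1mx rc addrC subrK //.
(* With zeros below the pivot the pivot is nonzero, so adding the first row to the next one reduces
   to the previous case. *)
move=> g gd; have [c0|] := eqVneq (dlsubmx g) 0; last exact: stepB.
have gd2 : \det g = ulsubmx g 0 0 * \det (drsubmx g).
  by rewrite -{1}[g]submxK c0 det_ublock det_mx11.
case: m => [|m] in P PM Pl Pu Pd stepA stepB g gd c0 gd2 *.
  apply: stepA => //; rewrite [LHS]mx11_scalar.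
  by rewrite -[RHS]/(1%:M); move: gd2; rewrite gd [drsubmx g]flatmx0 det_mx00 mulr1 => <-.
have E : g = block_mx 1%:M 0 (- delta_mx 0 0) 1%:M *m (block_mx 1%:M 0 (delta_mx 0 0) 1%:M *m g).
  rewrite mulmxA !mulmx_block !mul1mx !mul0mx !mulmx1 !mulmx0 !addr0 !add0r addNr.
  by rewrite -scalar_mx_block mul1mx.
rewrite E; apply: (PM _ _ (Pl _)); apply: stepB.
  by rewrite det_mulmx gd det_lblock !det1 !mulr1.
rewrite -{1}[g]submxK mulmx_block block_mxKdl c0 mulmx0 addr0.
apply/eqP => /matrixP /(_ 0 0); rewrite [ulsubmx g]mx11_scalar mul_mx_scalar !mxE eqxx mulr1.
move=> g0; move/eqP: gd2; rewrite gd (_ : ulsubmx g 0 0 = 0) ?mul0r ?oner_eq0 //.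
by rewrite !mxE.
Qed.

Lemma leb_row p : exists L : {sigma_finite_measure set (borel_mx R 1 p) -> \bar R}, leb_prop L.
Proof.
elim: p => [|p [L2 H2]]; first by apply: leb_trivial => M M'; rewrite !thinmx0.
have [L1 H1] := @leb_scalar R.
have [||||L [HL _]] := @leb_product R _ _ _ _ 1 (1 + p)%N L1 L2 (@row_mx _ 1 1 p) _ _ _ _ H1 H2; last by exists L.
- apply: measurable_fun_mx => i j; rewrite /join_fun.
  case: (split_ordP j) => k ->.
    under eq_fun do rewrite row_mxEl.
    by apply: (measurableT_comp (coord_measurable_mx i k)); exact: measurable_fst.
  under eq_fun do rewrite row_mxEr.
  by apply: (measurableT_comp (coord_measurable_mx i k)); exact: measurable_snd.
- by move=> x y x' y'; rewrite add_row_mx.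
- by move=> M; exists (lsubmx M), (rsubmx M); rewrite hsubmxK.
- move=> r x y; split => [H|[Hx Hy] i j].
    split=> i j; [have := H i (lshift p j) | have := H i (rshift 1 j)];
    by rewrite ?row_mxEl ?row_mxEr.
  by case: (split_ordP j) => k ->; rewrite ?row_mxEl ?row_mxEr.
Qed.

Lemma measurable_mulmx m p (g : 'M[R]_m) :
  measurable_fun setT (mulmx g : borel_mx R m p -> borel_mx R m p).
Proof.
apply: measurable_fun_mx => i j; under eq_fun do rewrite mxE.
apply: measurable_sum => k; apply: measurable_funM; first exact: measurable_cst.
exact: coord_measurable_mx.
Qed.

(** The measure is built as a product over the rows, and each generator of [SL_ind] acts slicewise
    by translations or by a smaller determinant-one matrix. *)
Lemma lebesgue_matrices m p :
  exists L : {sigma_finite_measure set (borel_mx R m p) -> \bar R}, leb_prop L /\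
  forall g (A : set (borel_mx R m p)), \det g = 1 -> measurable A -> L (mulmx g @^-1` A) = L A.
Proof.
elim: m => [|m [L2 [H2 I2]]].
  have [|L HL] := @leb_trivial R 0 p; first by move=> M M'; rewrite !flatmx0.
  exists L; split => // g A _ mA; congr (L _); apply/seteqP; split => M /=;
  by rewrite [_ *m _](_ : _ = M) // [LHS]flatmx0 [RHS]flatmx0.
have [L1 H1] := leb_row p.
have mc : measurable_fun setT (join_fun (@col_mx R 1 m p)).
  apply: measurable_fun_mx => i j; rewrite /join_fun.
  case: (split_ordP i) => k ->.
    under eq_fun do rewrite col_mxEu.
    by apply: (measurableT_comp (coord_measurable_mx k j)); exact: measurable_fst.
  under eq_fun do rewrite col_mxEd.
  by apply: (measurableT_comp (coord_measurable_mx k j)); exact: measurable_snd.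
have [|||L [HL LE]] := @leb_product R _ _ _ _ (1 + m)%N p L1 L2 (@col_mx _ 1 m p) mc _ _ _ H1 H2.
- by move=> x y x' y'; rewrite add_col_mx.
- by move=> M; exists (usubmx M), (dsubmx M); rewrite vsubmxK.
- move=> r x y; split => [H|[Hx Hy] i j].
    split=> i j; [have := H (lshift m i) j | have := H (rshift 1 i) j];
    by rewrite ?col_mxEu ?col_mxEd.
  by case: (split_ordP i) => k ->; rewrite ?col_mxEu ?col_mxEd.
exists L; split => // g A gd; move: A.
apply: (@SL_ind m (fun g => forall A : set (borel_mx R (1 + m) p), measurable A -> L (mulmx g @^-1` A) = L A) _ _ _ _ g gd).
- move=> h k Hh Hk A mA; rewrite -[RHS]Hh // -[RHS]Hk.
    by congr (L _); apply/seteqP; split => M /=; rewrite mulmxA.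
  by rewrite -[X in measurable X]setTI; exact: (measurable_mulmx h).
- move=> c A mA; rewrite !LE.
  apply: (@join_left_invariant _ _ _ _ _ _ _ L1 L2 _ mc _ (fun x y => y + c *m x)) => //.
    by move=> x y; rewrite mul_block_col !mul1mx mul0mx addr0 addrC.
  by move=> x B mB; exact: leb_transl.
- move=> r A mA; rewrite !LE.
  apply: (@join_right_invariant _ _ _ _ _ _ _ L1 L2 _ mc _ (fun y x => x + r *m y)) => //.
  + by move=> x y; rewrite mul_block_col !mul1mx mul0mx add0r.
  + by move=> x B mB; exact: leb_transl.
  + exact: measurable_mulmx.
- move=> g' gd' A mA; rewrite !LE.
  apply: (@join_left_invariant _ _ _ _ _ _ _ L1 L2 _ mc _ (fun x y => g' *m y)) => //.
    by move=> x y; rewrite mul_block_col !mul1mx !mul0mx addr0 add0r.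
  by move=> x B mB; exact: I2.
Qed.
End SpecialLinear.

(** * Gram-Schmidt for the Lorentz form *)

Section GramSchmidt.
Context {R : realType} {n : nat}.
Implicit Types (x y w : 'cV[R]_n.+1) (M g : 'M[R]_n.+1).

(** The absolute value is there for the last vector, which is timelike near the identity. *)
Definition lor_normalize w := (Num.sqrt `|lorentz w w|)^-1 *: w.

(** The coefficients are those for vectors of norm 1. This is right for [gs_frame]: only the first
    [n] vectors are subtracted there, and the timelike one comes last. *)
Fixpoint gram_schmidt M k : seq 'cV[R]_n.+1 :=
  if k is k'.+1 then
    let s := gram_schmidt M k' in let c := col (inord k') M in
    rcons s (lor_normalize (c - \sum_(e <- s) lorentz c e *: e))
  else [::].

Definition gs_residue M k : 'cV[R]_n.+1 :=
  col (inord k) M - \sum_(e <- gram_schmidt M k) lorentz (col (inord k) M) e *: e.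

Definition gs_vec M k := lor_normalize (gs_residue M k).

Lemma size_gs M k : size (gram_schmidt M k) = k.
Proof. by elim: k => //= k IH; rewrite size_rcons IH. Qed.

Lemma nth_gs M k j : (j < k)%N -> nth 0 (gram_schmidt M k) j = gs_vec M j.
Proof.
elim: k => // k IH jk /=; rewrite nth_rcons size_gs.
case: (ltngtP j k) => jk'; [exact: IH | by lia | by rewrite jk'].
Qed.

Lemma gs_residueE M k : gs_residue M k =
  col (inord k) M - \sum_(j < k) lorentz (col (inord k) M) (gs_vec M j) *: gs_vec M j.
Proof.
rewrite /gs_residue (big_nth 0) size_gs big_mkord; congr (_ - _).
by apply: eq_bigr => j _; rewrite nth_gs.
Qed.

Lemma gs_residue_isom g M k : isom g -> gs_residue (g *m M) k = g *m gs_residue M k.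
Proof.
move=> gi; elim/ltn_ind: k => k IH; rewrite !gs_residueE mulmxBr mulmx_sumr.
have E j : (j < k)%N -> gs_vec (g *m M) j = g *m gs_vec M j.
  by move=> jk; rewrite /gs_vec /lor_normalize IH // gi scalemxAr.
rewrite !colE -mulmxA; congr (_ - _); apply: eq_bigr => j _.
by rewrite E // isom_lorentz // scalemxAr.
Qed.

Definition gs_frame M : 'M[R]_n.+1 := \matrix_(i, j) gs_vec M j i 0.

Lemma col_gs_frame M (j : 'I_n.+1) : col j (gs_frame M) = gs_vec M j.
Proof. by apply/colP => i; rewrite !mxE. Qed.

(** The process uses only Lorentz products of columns, so it commutes with isometries. This
    equivariance is what turns Lebesgue measure into Haar measure. *)
Lemma gs_frame_isom g M : isom g -> gs_frame (g *m M) = g *m gs_frame M.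
Proof.
move=> gi; apply/matrixP => i j.
have E : gs_vec (g *m M) j = g *m gs_vec M j.
  by rewrite /gs_vec /lor_normalize gs_residue_isom // gi scalemxAr.
by rewrite mxE E -col_gs_frame !mxE; apply: eq_bigr => k _; rewrite !mxE.
Qed.

Lemma isom_cols g : (forall i j : 'I_n.+1, lorentz (col i g) (col j g) = lorJ i j) -> isom g.
Proof.
move=> H x; have E : (lorJ *m g)^T *m g = lorJ.
  apply/matrixP => i j; rewrite -H lorentz_mx !mxE; apply: eq_bigr => k _.
  by rewrite !mxE; congr (_ * _); apply: eq_bigr => l _; rewrite !mxE.
suff H1 : (lorJ *m (g *m x))^T *m (g *m x) = (lorJ *m x)^T *m x by rewrite !lorentz_mx H1.
by rewrite [lorJ *m (g *m x)]mulmxA trmx_mul -[LHS]mulmxA [_ *m (g *m x)]mulmxA E trmx_mul lorJT mulmxA.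
Qed.

Lemma gs_orthonormal M :
  (forall k, (k < n)%N -> 0 < lorentz (gs_residue M k) (gs_residue M k)) ->
  lorentz (gs_residue M n) (gs_residue M n) < 0 -> isom (gs_frame M).
Proof.
move=> Hs Ht.
have nrm w : lorentz w w != 0 -> lorentz (lor_normalize w) (lor_normalize w) = Num.sg (lorentz w w).
  move=> w0; rewrite /lor_normalize !lorentzE mulrA -expr2 exprVn sqr_sqrtr //.
  by rewrite {2}[lorentz w w]numEsg mulrCA mulVf ?mulr1 // normr_eq0.
have nn k : (k <= n)%N -> lorentz (gs_vec M k) (gs_vec M k) = if k == n then -1 else 1.
  move=> kn; rewrite /gs_vec; case: eqVneq => [->|kn']; rewrite nrm.
  - by rewrite ltr0_sg.
  - by rewrite lt_eqF.
  - by rewrite gtr0_sg // Hs //; lia.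
  - by rewrite gt_eqF // Hs //; lia.
have oo k : (k <= n)%N -> forall j, (j < k)%N -> lorentz (gs_vec M k) (gs_vec M j) = 0.
  elim/ltn_ind: k => k IH kn j jk.
  suff H : lorentz (gs_residue M k) (gs_vec M j) = 0 by rewrite lorentzZl H mulr0.
  rewrite gs_residueE lorentzDl lorentzNl lorentz_suml (bigD1 (Ordinal jk)) //=.
  rewrite lorentzZl nn; last by lia.
  rewrite ifF; last by apply/eqP; lia.
  rewrite mulr1 big1 ?addr0 ?subrr // => i ij; rewrite lorentzZl.
  case: (ltngtP i j) => h.
  - by rewrite (lorentzC (gs_vec M i)) (IH j jk _ i h) ?mulr0 // (leq_trans (ltnW jk)).
  - by rewrite (IH i (ltn_ord i) _ j h) ?mulr0 // (leq_trans (ltnW (ltn_ord i))).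
  - by case/eqP: ij; apply: val_inj.
apply: isom_cols => i j; rewrite !col_gs_frame /lorJ !mxE.
have [->|ij] := eqVneq i j.
  rewrite nn; last by rewrite -ltnS.
  by rewrite mulr1n; congr (if _ then _ else _).
rewrite mulr0n; case: (ltngtP i j) => h.
- by rewrite lorentzC oo // -ltnS.
- by rewrite oo // -ltnS.
- by case/eqP: ij; apply: val_inj.
Qed.

Lemma gs_frame_measurable : measurable_fun setT (gs_frame : borel_mx R n.+1 n.+1 -> borel_mx R n.+1 n.+1).
Proof.
have ml d (T : measurableType d) (f h : T -> 'cV[R]_n.+1) :
  (forall i, measurable_fun setT (fun t => f t i 0)) -> (forall i, measurable_fun setT (fun t => h t i 0)) ->
  measurable_fun setT (fun t => lorentz (f t) (h t)).
  move=> mf mh; rewrite /lorentz; apply: measurable_funB; last by apply: measurable_funM; [exact: mf|exact: mh].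
  by apply: measurable_sum => i; apply: measurable_funM; [exact: mf|exact: mh].
suff mv k i : measurable_fun setT (fun M : borel_mx R n.+1 n.+1 => gs_vec M k i 0).
  by apply: measurable_fun_mx => i j; under eq_fun do rewrite mxE; exact: mv.
elim/ltn_ind: k i => k IH.
have mc i : measurable_fun setT (fun M : borel_mx R n.+1 n.+1 => col (inord k) (M : 'M[R]_n.+1) i 0).
  by under eq_fun do rewrite mxE; exact: coord_measurable_mx.
have mr i : measurable_fun setT (fun M : borel_mx R n.+1 n.+1 => gs_residue M k i 0).
  under eq_fun do rewrite gs_residueE mxE [in X in _ + X]mxE summxE.
  apply: measurable_funB => //; apply: measurable_sum => j.
  under eq_fun do rewrite mxE.
  by apply: measurable_funM; [apply: ml => // i'; apply: IH|apply: IH].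
move=> i; rewrite /gs_vec /lor_normalize.
under eq_fun do rewrite mxE.
apply: measurable_funM; last exact: mr.
have E (M : 'M[R]_n.+1) : (Num.sqrt `|lorentz (gs_residue M k) (gs_residue M k)|)^-1 =
    (Num.sqrt `|lorentz (gs_residue M k) (gs_residue M k)|) `^ (-1).
  by rewrite powR_inv1 // sqrtr_ge0.
under eq_fun do rewrite E.
apply: (measurableT_comp (f := @powR R ^~ (-1))) => //.
apply: (measurableT_comp (f := @Num.sqrt R)).
  by apply: continuous_measurable_fun; exact: sqrt_continuous.
by apply: (measurableT_comp (@normr_measurable _ _)); apply: ml.
Qed.
End GramSchmidt.

(** * Existence of a Haar measure on SO(n,1) *)

Section Haar.
Context {R : realType} {n : nat}.
Implicit Types (M g : 'M[R]_n.+1).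

Lemma for_continuousM (U : topologicalType) (f h : U -> R) (x : U) :
  {for x, continuous f} -> {for x, continuous h} -> {for x, continuous (fun t => f t * h t)}.
Proof. by move=> fc hc; apply: cvgM. Qed.

Lemma for_continuousB (U : topologicalType) (f h : U -> R) (x : U) :
  {for x, continuous f} -> {for x, continuous h} -> {for x, continuous (fun t => f t - h t)}.
Proof. by move=> fc hc; apply: cvgB. Qed.

Lemma for_continuousV (U : topologicalType) (f : U -> R) (x : U) : f x != 0 ->
  {for x, continuous f} -> {for x, continuous (fun t => (f t)^-1)}.
Proof. by move=> f0 fc; apply: cvgV. Qed.

Lemma for_continuous_cst (U : topologicalType) (c : R) (x : U) : {for x, continuous (fun=> c)}.
Proof. exact: cvg_cst. Qed.

Lemma for_continuous_prod (U : topologicalType) (I : Type) (r : seq I) (P : pred I) (F : I -> U -> R) (x : U) :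
  (forall i, {for x, continuous (F i)}) ->
  {for x, continuous (fun t => \prod_(i <- r | P i) F i t)}.
Proof. by move=> Fc; apply: (cvg_big mul_continuous) => i _; exact: Fc. Qed.

Lemma near_gt (U : topologicalType) (f : U -> R) (x : U) (a : R) :
  {for x, continuous f} -> a < f x -> \forall t \near x, a < f t.
Proof. by move=> fc; apply: (cvgr_gt _ fc). Qed.

Lemma near_lt (U : topologicalType) (f : U -> R) (x : U) (a : R) :
  {for x, continuous f} -> f x < a -> \forall t \near x, f t < a.
Proof. by move=> fc; apply: (cvgr_lt _ fc). Qed.

Lemma near_forall (U : topologicalType) (I : finType) (P : I -> U -> Prop) (x : U) :
  (forall i, \forall t \near x, P i t) -> \forall t \near x, forall i, P i t.
Proof. by move=> H; apply: filter_forall. Qed.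

Lemma near_imp (U : topologicalType) (P Q : U -> Prop) (x : U) :
  (forall t, P t -> Q t) -> (\forall t \near x, P t) -> \forall t \near x, Q t.
Proof. by move=> PQ; apply: filterS. Qed.

Lemma continuous_entry (U : topologicalType) m p (f : U -> 'M[R]_(m, p)) (x : U) i j :
  {for x, continuous f} -> {for x, continuous (fun t => f t i j)}.
Proof.
move=> fc; apply: (@continuous_comp _ _ _ f (fun M : 'M[R]_(m, p) => M i j)) => //.
exact: coord_continuous.
Qed.

Lemma lorentz_continuous (U : topologicalType) (f h : U -> 'cV[R]_n.+1) (x : U) :
  (forall i, {for x, continuous (fun t => f t i 0)}) ->
  (forall i, {for x, continuous (fun t => h t i 0)}) ->
  {for x, continuous (fun t => lorentz (f t) (h t))}.
Proof.
move=> fc hc; rewrite /lorentz; apply: cvgB; last by apply: cvgM; [exact: fc|exact: hc].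
by apply: continuous_sum => i; apply: cvgM; [exact: fc|exact: hc].
Qed.

Lemma det_continuous m : continuous (fun M : 'M[R]_m => \det M).
Proof.
move=> M; rewrite /determinant; apply: continuous_sum => s.
apply: for_continuousM; first exact: for_continuous_cst.
by apply: for_continuous_prod => i; exact: coord_continuous.
Qed.

Lemma closed_level (U : topologicalType) (f : U -> R) (c : R) : continuous f ->
  closed [set x | f x = c].
Proof.
move=> fc; apply: (@preimage_closed U R f [set x | x = c]) => [x _|]; first exact: fc.
exact: closed_eq.
Qed.

Lemma lorentz_isometries_closed : closed (@lorentz_isometries R n).
Proof.
have -> : @lorentz_isometries R n = [set M : 'M[R]_n.+1 | \det M = 1] `&`
   \bigcap_(x in setT) [set M | lorentz (M *m x) (M *m x) = lorentz x x].
  apply/seteqP; split => g /= [gd gi]; split => //; first by move=> x _; exact: gi.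
  by move=> x; exact: (gi x).
apply: closedI.
  by apply: closed_level; exact: det_continuous.
apply: closed_bigI => x _; apply: closed_level => M.
have c i : {for M, continuous (fun t : 'M[R]_n.+1 => (t *m x) i 0)}.
  apply: continuous_entry; apply: (@mulmx_continuous _ _ _ _ _ id (fun=> x)); first by move=> ?.
  exact: (@cst_continuous _ _ x M).
exact: (@lorentz_continuous _ (fun t : 'M[R]_n.+1 => t *m x) (fun t => t *m x) M).
Qed.

Lemma SO_n1_closed : closed (SO_n1 : set 'M[R]_n.+1).
Proof. exact/component_closed/lorentz_isometries_closed. Qed.

Lemma lorentz_delta_neq (i j : 'I_n.+1) : i != j ->
  lorentz (delta_mx i 0 : 'cV[R]_n.+1) (delta_mx j 0) = 0.
Proof. by move=> ij; rewrite lorentz_basel mxE (negbTE ij) mulr0. Qed.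

Lemma lorentz_delta_eq (i : 'I_n.+1) :
  lorentz (delta_mx i 0 : 'cV[R]_n.+1) (delta_mx i 0) = if i == ord_max then -1 else 1.
Proof. by rewrite lorentz_basel mxE !eqxx mulr1. Qed.

Lemma gs_vec1 (k : 'I_n.+1) : gs_residue (1%:M : 'M[R]_n.+1) k = delta_mx k 0 /\
  gs_vec (1%:M : 'M[R]_n.+1) k = delta_mx k 0.
Proof.
case: k => k kn /=; elim/ltn_ind: k kn => k IH kn.
have E : gs_residue (1%:M : 'M[R]_n.+1) k = delta_mx (Ordinal kn) 0.
  rewrite gs_residueE (_ : inord k = Ordinal kn); last by apply: val_inj; rewrite /= inordK.
  rewrite big1 ?subr0; first by rewrite colE mul1mx.
  move=> j _; have jn : (j < n.+1)%N by apply: ltn_trans kn.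
  have [_ ->] := IH _ (ltn_ord j) jn; rewrite colE mul1mx lorentz_delta_neq ?scale0r //.
  by apply/eqP => /(congr1 val) /= E; have := ltn_ord j; rewrite -E ltnn.
split => //; rewrite /gs_vec E /lor_normalize lorentz_delta_eq.
by case: ifP => _; rewrite ?normrN normr1 sqrtr1 invr1 scale1r.
Qed.

Lemma gs_continuous1 (k : 'I_n.+1) i :
  {for 1%:M, continuous (fun M : 'M[R]_n.+1 => gs_residue M k i 0)} /\
  {for 1%:M, continuous (fun M : 'M[R]_n.+1 => gs_vec M k i 0)}.
Proof.
case: k => k kn /=; elim/ltn_ind: k kn i => k IH kn.
have cc i : {for 1%:M, continuous (fun M : 'M[R]_n.+1 => col (inord k) M i 0)}.
  under [X in {for _, continuous X}]funext do rewrite mxE.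
  exact: coord_continuous.
have cr i : {for 1%:M, continuous (fun M : 'M[R]_n.+1 => gs_residue M k i 0)}.
  under [X in {for _, continuous X}]funext do rewrite gs_residueE mxE [in X in _ + X]mxE summxE.
  apply: for_continuousB; first exact: cc.
  apply: continuous_sum => j.
  under [X in {for _, continuous X}]funext do rewrite mxE.
  have jn : (j < n.+1)%N by apply: ltn_trans kn.
  apply: (@for_continuousM _ (fun M : 'M[R]_n.+1 => lorentz (col (inord k) M) (gs_vec M j)) (fun M => gs_vec M j i 0)); last exact: (IH _ (ltn_ord j) jn i).2.
  apply: lorentz_continuous => // l; exact: (IH _ (ltn_ord j) jn l).2.
move=> i; split => //; rewrite /gs_vec /lor_normalize.
under [X in {for _, continuous X}]funext do rewrite mxE.
have := gs_vec1 (Ordinal kn) => -[/= E _].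
have q1 : `|lorentz (gs_residue (1%:M : 'M[R]_n.+1) k) (gs_residue (1%:M : 'M[R]_n.+1) k)| = 1.
  by rewrite E lorentz_delta_eq; case: ifP => _; rewrite ?normrN normr1.
apply: (@for_continuousM _ (fun M : 'M[R]_n.+1 => (Num.sqrt `|lorentz (gs_residue M k) (gs_residue M k)|)^-1) (fun M => gs_residue M k i 0)); last exact: cr.
apply: (@for_continuousV _ (fun M : 'M[R]_n.+1 => Num.sqrt `|lorentz (gs_residue M k) (gs_residue M k)|)); first by rewrite q1 sqrtr1 oner_eq0.
apply: (@continuous_comp _ _ _ (fun M => `|lorentz (gs_residue M k) (gs_residue M k)|) (@Num.sqrt R)).
  apply: (@continuous_comp _ _ _ (fun M => lorentz (gs_residue M k) (gs_residue M k)) (fun x : R => `|x|)).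
    exact: lorentz_continuous.
  exact: norm_continuous.
exact: sqrt_continuous.
Qed.

(** When the frame F of [M] is an isometry this is F^-1 M, the factor of [M] that left
    multiplication by isometries does not change. *)
Definition gs_tame M : 'M[R]_n.+1 := lorJ *m (gs_frame M)^T *m lorJ *m M.

Definition gs_dom : set 'M[R]_n.+1 := [set M | SO_n1 (gs_frame M) /\ mx_box 2 (gs_tame M)].

(** At the identity the residues are the basis vectors, so all sign conditions hold strictly there
    and persist nearby by continuity. This gives the Haar measure positive mass. *)
Lemma gs_dom_nbhs : nbhs (1%:M : 'M[R]_n.+1) gs_dom.
Proof.
have fr1 : gs_frame (1%:M : 'M[R]_n.+1) = 1%:M.
  by apply/matrixP => i j; rewrite mxE (gs_vec1 j).2 !mxE eqxx andbT.
have cf : {for 1%:M, continuous (@gs_frame R n)}.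
  apply: mx_continuous => i j; under [X in {for _, continuous X}]funext do rewrite mxE.
  exact: (gs_continuous1 j i).2.
have ct : {for 1%:M, continuous gs_tame}.
  apply: (@mulmx_continuous _ _ _ _ _ _ id); last by move=> ?.
  apply: (@mulmx_continuous _ _ _ _ _ _ (fun=> lorJ)); last exact: (@cst_continuous _ _ (lorJ : 'M[R]_n.+1) (1%:M : 'M[R]_n.+1)).
  apply: (@mulmx_continuous _ _ _ _ _ (fun=> lorJ)); first exact: (@cst_continuous _ _ (lorJ : 'M[R]_n.+1) (1%:M : 'M[R]_n.+1)).
  apply: mx_continuous => i j; under [X in {for _, continuous X}]funext do rewrite mxE.
  exact: continuous_entry.
have cl (k : 'I_n.+1) : {for 1%:M, continuous (fun M => lorentz (gs_residue M k) (gs_residue M k))}.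
  by apply: lorentz_continuous => i; exact: (gs_continuous1 k i).1.
have N1 : \forall M \near (1%:M : 'M[R]_n.+1), 0 < \det (gs_frame M).
  have c : {for 1%:M, continuous (fun M => \det (gs_frame M))}.
    by apply: (@continuous_comp _ _ _ _ (fun M : 'M[R]_n.+1 => \det M)) => //; exact: det_continuous.
  by apply: (near_gt c); rewrite fr1 det1.
have N2 : \forall M \near (1%:M : 'M[R]_n.+1), 0 < gs_frame M ord_max ord_max.
  have c : {for (1%:M : 'M[R]_n.+1), continuous (fun M : 'M[R]_n.+1 => gs_frame M ord_max ord_max)}.
    exact: continuous_entry.
  by apply: (near_gt c); rewrite fr1 mxE eqxx.
have N3 : \forall M \near (1%:M : 'M[R]_n.+1), forall i j, `|gs_tame M i j| <= 2.
  apply: near_forall => i; apply: near_forall => j.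
  have c : {for 1%:M, continuous (fun M => `|gs_tame M i j|)}.
    apply: (@continuous_comp _ _ _ (fun M => gs_tame M i j) (fun x : R => `|x|)); last exact: norm_continuous.
    exact: continuous_entry.
  suff : \forall M \near (1%:M : 'M[R]_n.+1), `|gs_tame M i j| < 2 by apply: near_imp => M; exact: ltW.
  apply: (near_lt c); rewrite /gs_tame fr1 trmx1 !mulmx1 lorJK mxE.
  by case: (i == j); rewrite ?normr1 ?normr0; lra.
have N4 : \forall M \near (1%:M : 'M[R]_n.+1), forall k : 'I_n.+1, (k < n)%N ->
    0 < lorentz (gs_residue M k) (gs_residue M k).
  apply: near_forall => k; have [kn|kn] := ltnP k n; last by near=> M; move=> ?.
  suff : \forall M \near (1%:M : 'M[R]_n.+1), 0 < lorentz (gs_residue M k) (gs_residue M k).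
    by apply: near_imp => M H _.
  apply: (near_gt (cl k)); rewrite (gs_vec1 k).1 lorentz_delta_eq.
  rewrite ifF ?ltr01 //; by apply/eqP => /(congr1 val) /= ?; lia.
have N5 : \forall M \near (1%:M : 'M[R]_n.+1), lorentz (gs_residue M n) (gs_residue M n) < 0.
  apply: (near_lt (cl ord_max)); rewrite (gs_vec1 ord_max).1 lorentz_delta_eq eqxx.
  by rewrite ltrN10.
near=> M.
have Mi : isom (gs_frame M).
  apply: gs_orthonormal => [k kn|]; last by near: M; exact: N5.
  have kn' : (k < n.+1)%N by apply: ltnW.
  by have : (forall k : 'I_n.+1, (k < n)%N -> 0 < lorentz (gs_residue M k) (gs_residue M k));
    [near: M; exact: N4 | move=> /(_ (Ordinal kn') kn)].
split; last by move=> i j; move: i j; near: M; exact: N3.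
rewrite SO_n1E; split; first by split => //; near: M; exact: N2.
have d0 : 0 < \det (gs_frame M) by near: M; exact: N1.
have := congr1 determinant (isom_mx Mi); rewrite !det_mulmx det_tr det1.
have := congr1 determinant (@lorJK R n); rewrite det_mulmx det1 => J2 D2.
have : \det (gs_frame M) ^+ 2 = 1.
  rewrite -D2 -[LHS]mul1r -{1}J2; ring.
by move=> /eqP; rewrite sqrf_eq1 => /orP[/eqP //|/eqP H]; rewrite H in d0; lra.
Unshelve. all: by end_near.
Qed.

Lemma isom_invM m g (A : 'M[R]_(n.+1, m)) : isom g -> invmx g *m (g *m A) = A.
Proof. by move=> gi; rewrite mulmxA mulVmx ?isom_unit // mul1mx. Qed.

Lemma isom_mulMV m g (A : 'M[R]_(n.+1, m)) : isom g -> g *m (invmx g *m A) = A.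
Proof. by move=> gi; rewrite mulmxA mulmxV ?isom_unit // mul1mx. Qed.

Lemma gs_tame_isom g M : isom g -> gs_tame (g *m M) = gs_tame M.
Proof.
move=> gi; have E : g^T *m lorJ *m g = lorJ.
  have := congr1 (mulmx lorJ) (isom_mx gi).
  by rewrite mulmx1 -!mulmxA (mulmxA lorJ lorJ) lorJK mul1mx !mulmxA.
have E2 : g^T *m (lorJ *m (g *m M)) = lorJ *m M by rewrite !mulmxA E.
by rewrite /gs_tame gs_frame_isom // trmx_mul -!mulmxA E2.
Qed.

Lemma SO_n1_inv g : SO_n1 g -> SO_n1 (invmx g).
Proof.
rewrite !SO_n1E => -[go gd]; split; first exact: oplusV.
by rewrite det_inv gd invr1.
Qed.

(** Restrict Lebesgue measure to [gs_dom] and push it forward by the frame map. Left translation by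
    a determinant-one isometry preserves Lebesgue measure and [gs_tame] and commutes with the frame.
    Compact sets have finite measure because a matrix is the product of its frame and of a factor
    with entries at most 2. *)
Lemma haar_exists : exists mu : {measure set (@borel_matrix R n) -> \bar R}, is_haar mu.
Proof.
have [L [HL IL]] := @lebesgue_matrices R n.+1 n.+1.
have mSO : measurable (SO_n1 : set (borel_mx R n.+1 n.+1)).
  by apply: closed_measurable_mx; exact: SO_n1_closed.
have mfr : measurable_fun setT (@gs_frame R n : borel_mx R n.+1 n.+1 -> borel_mx R n.+1 n.+1).
  exact: gs_frame_measurable.
have mdom : measurable (gs_dom : set (borel_mx R n.+1 n.+1)).
  have -> : gs_dom = (@gs_frame R n) @^-1` SO_n1 `&` gs_tame @^-1` (mx_box 2) by [].
  apply: measurableI; first by rewrite -[X in measurable X]setTI; exact: mfr.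
  have mt : measurable_fun setT (gs_tame : borel_mx R n.+1 n.+1 -> borel_mx R n.+1 n.+1).
    apply: measurable_fun_mx => i j.
    under eq_fun do rewrite mxE.
    apply: measurable_sum => k; apply: measurable_funM; last exact: coord_measurable_mx.
    under eq_fun do rewrite mxE.
    apply: measurable_sum => l; apply: measurable_funM; last exact: measurable_cst.
    under eq_fun do rewrite mxE.
    apply: measurable_sum => l'; apply: measurable_funM; first exact: measurable_cst.
    under eq_fun do rewrite mxE.
    by apply: (measurableT_comp (coord_measurable_mx l l')).
  by rewrite -[X in measurable X]setTI; apply: mt => //; exact: measurable_box.
have [mu muE] := pushforward_pack (mrestr L mdom) mfr.
have {}muE A : mu A = L ((@gs_frame R n) @^-1` A `&` gs_dom) by rewrite muE.
have mpre (A : set (borel_mx R n.+1 n.+1)) : measurable A -> measurable ((@gs_frame R n) @^-1` A `&` gs_dom : set (borel_mx R n.+1 n.+1)).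
  by move=> mA; apply: measurableI => //; rewrite -[X in measurable X]setTI; exact: mfr.
exists mu; split.
- rewrite muE (_ : _ `&` _ = set0) ?measure0 //.
  by apply/seteqP; split => // M [/= H [H' _]].
- rewrite muE.
  have /nbhs_ballP[e /= e0 eD] := gs_dom_nbhs.
  have e2 : 0 < e / 2 by rewrite divr_gt0.
  apply: lt_le_trans (leb_pos HL e2) _.
  rewrite -(leb_transl HL (- 1%:M)); last exact: measurable_box.
  apply: le_measure; rewrite ?inE.
  + rewrite -[X in measurable X]setTI.
    have : measurable_fun setT ((fun y => y + - 1%:M) : borel_mx R n.+1 n.+1 -> borel_mx R n.+1 n.+1).
      apply: measurable_fun_mx => i j; under eq_fun do rewrite mxE.
      by apply: measurable_funD; [exact: coord_measurable_mx|exact: measurable_cst].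
    by apply => //; exact: measurable_box.
  + exact: mpre.
  + move=> M HM; have : gs_dom M.
      apply: eD; split => // i j; have := HM i j.
      rewrite /ball /= distrC !mxE => H; apply: le_lt_trans H _; lra.
    by case.
- move=> A cA; rewrite muE.
  have mA : measurable (A : set (borel_mx R n.+1 n.+1)).
    by apply: closed_measurable_mx; apply: compact_closed => //; exact: norm_hausdorff.
  have [r [_ rA]] := compact_bounded cA.
  have {rA} rA M : A M -> `|M| <= r + 1 by move=> AM; apply: rA => //; rewrite ltrDl.
  apply: le_lt_trans (leb_bounded HL (\sum_(k < n.+1) (r + 1) * 2)).
  apply: le_measure; rewrite ?inE; [exact: mpre|exact: measurable_box|].
  move=> M [/= AM [/connected_component_sub /isomE [Fi _] HM]] i j.
  have -> : M = gs_frame M *m gs_tame M.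
    have FV : gs_frame M *m (lorJ *m (gs_frame M)^T *m lorJ) = 1%:M by apply: mulmx1C; exact: isom_mx.
    by rewrite /gs_tame mulmxA FV mul1mx.
  rewrite mxE; apply: le_trans (ler_norm_sum _ _ _) _; apply: ler_sum => k _.
  have h1 : `|gs_frame M i k| <= r + 1.
    apply: le_trans (rA _ AM); rewrite [leRHS]/Num.Def.normr /= mx_normrE.
    by apply/bigmax_geP; right; exists (i, k).
  by rewrite normrM; apply: ler_pM => //; exact: (HM k j).
- move=> g A gS mA; rewrite !muE.
  have /connected_component_sub /isomE [gi gd] := gS.
  have gVi := isom_inv gi; have gVS := SO_n1_inv gS.
  have gVd : \det (invmx g) = 1 by rewrite det_inv gd invr1.
  rewrite -[RHS](IL _ _ gVd); last exact: mpre.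
  congr (L _); apply/seteqP; split => M /=; rewrite /gs_dom /= gs_frame_isom //.
  + move=> [[h Ah Eh] [MS MB]]; rewrite -Eh isom_invM //; split => //; split.
      by rewrite (_ : h = invmx g *m gs_frame M); [exact: SO_n1_mul | rewrite -Eh isom_invM].
    by rewrite gs_tame_isom.
  + move=> [AM [MS MB]]; split; first by exists (invmx g *m gs_frame M); rewrite // isom_mulMV.
    split; first by rewrite -[gs_frame M](isom_mulMV _ gi); exact: SO_n1_mul.
    by rewrite -(gs_tame_isom _ gVi).
Qed.
End Haar.

(** * Compactness and measurable choice of representatives *)

Section Lattices.
Context {R : realType} {n : nat}.
Implicit Types (M g c : 'M[R]_n.+1) (Gam : set 'M[R]_n.+1).

(** The corner entry is the cosh of the displacement of the base point. It controls the last row,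
    through the Euclidean norm of g^-1 o, and then every column, whose Lorentz norm is 1 or -1. *)
Lemma oplus_entry_bound g i j : oplus g -> `|g i j| <= 1 + 2 * g ord_max ord_max.
Proof.
move=> go; have gi := oplus_isom go; have [_ g0] := go.
set r := g ord_max ord_max in g0 *.
have row_bd k : g ord_max k ^+ 2 <= 2 * r ^+ 2.
  have H : g ord_max k ^+ 2 = (invmx g *m base_point) k 0 ^+ 2.
    have H : lorentz base_point (g *m delta_mx k 0) = lorentz (delta_mx k 0) (invmx g *m base_point).
      by rewrite [LHS]lorentzC isom_adj.
    have E : (g *m delta_mx k 0 : 'cV[R]_n.+1) ord_max 0 = g ord_max k by rewrite -colE mxE.
    rewrite lorentz_base E lorentz_basel in H.
    by rewrite -[LHS]sqrrN H; case: ifP => _; rewrite ?mulN1r ?sqrrN ?mul1r.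
  rewrite H; set w := invmx g *m base_point.
  have wn : w ord_max 0 = r.
    have := isom_adj base_point base_point gi; rewrite lorentzC !lorentz_base mul_base -/w -/r.
    by move=> /oppr_inj.
  have ww : dot w w = 2 * r ^+ 2 - 1.
    by rewrite dotE /w isom_inv // -/w wn; have [-> _] := @base_hyp R n; ring.
  have : w k 0 ^+ 2 <= dot w w.
    rewrite /dot (bigD1 k) //= -expr2 lerDl sumr_ge0 // => l _; by rewrite -expr2 sqr_ge0.
  by rewrite ww; lra.
have H : g i j ^+ 2 <= 1 + 4 * r ^+ 2.
  have cj : col j g = g *m delta_mx j 0 by rewrite colE.
  have : (col j g) i 0 ^+ 2 <= dot (col j g) (col j g).
    rewrite /dot (bigD1 i) //= -expr2 lerDl sumr_ge0 // => l _; by rewrite -expr2 sqr_ge0.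
  rewrite dotE (_ : lorentz (col j g) (col j g) = lorentz (delta_mx j 0) (delta_mx j 0)); last by rewrite cj gi.
  rewrite [(col j g) i 0]mxE [(col j g) ord_max 0]mxE.
  have := row_bd j; rewrite lorentz_delta_eq.
  by case: ifP => _; nra.
rewrite -ler_sqr ?nnegrE ?normr_ge0 //; last by lra.
by rewrite real_normK ?num_real //; nra.
Qed.

Lemma mx_box_compact m p (r : R) : compact (@mx_box R m p r).
Proof.
have -> : @mx_box R m p r = vec_mx @` [set v : 'rV[R]_(m * p) | forall k, v 0 k \in `[-r, r]].
  apply/seteqP; split => [M HM|_ [v vr <-] i j].
    exists (mxvec M); last by rewrite mxvecK.
    move=> k; case/mxvec_indexP: k => i j; rewrite mxvecE in_itv /= -ler_norml.
    exact: HM.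
  by rewrite mxE ler_norml; have := vr (mxvec_index i j); rewrite in_itv.
apply: continuous_compact; last first.
  by apply: (@rV_compact R (m * p) (fun=> `[-r, r]%classic)) => _; exact: segment_compact.
apply: continuous_subspaceT => v; apply: mx_continuous => i j.
under [X in {for _, continuous X}]funext do rewrite mxE.
exact: coord_continuous.
Qed.

(** Comparison by a list of real keys, used to select one matrix per coset in a measurable way. *)
Fixpoint lexle (ks : seq ('M[R]_n.+1 -> R)) M M' : bool :=
  if ks is f :: ks' then (f M < f M') || ((f M == f M') && lexle ks' M M') else true.

Lemma lexle_total ks M M' : lexle ks M M' || lexle ks M' M.
Proof.
elim: ks => //= f ks IH; case: (ltgtP (f M) (f M')) => //= _.
Qed.

Lemma lexle_trans ks M M' M'' : lexle ks M M' -> lexle ks M' M'' -> lexle ks M M''.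
Proof.
elim: ks => //= f ks IH /orP[h|/andP[/eqP h1 h2]] /orP[k|/andP[/eqP k1 k2]].
- by rewrite (lt_trans h k).
- by rewrite -k1 h.
- by rewrite h1 k.
- by rewrite h1 k1 eqxx IH ?orbT.
Qed.

Lemma lexle_antisym ks M M' : lexle ks M M' -> lexle ks M' M ->
  forall f : 'M[R]_n.+1 -> R, List.In f ks -> f M = f M'.
Proof.
elim: ks => //= f ks IH.
by case: (ltgtP (f M) (f M')) => //= fE h1 h2 f' [<-//|]; exact: IH.
Qed.

Lemma lexle_measurable ks (k : 'M[R]_n.+1 -> 'M[R]_n.+1) :
  (forall f, List.In f ks -> measurable_fun setT (f : borel_mx R n.+1 n.+1 -> R)) ->
  measurable_fun setT (k : borel_mx R n.+1 n.+1 -> borel_mx R n.+1 n.+1) ->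
  measurable ([set M | lexle ks M (k M)] : set (borel_mx R n.+1 n.+1)).
Proof.
move=> mks mk; elim: ks mks => [|f ks IH] mks /=.
  by rewrite (_ : [set _ | _] = setT) //; apply/seteqP.
have mf : measurable_fun setT (f : borel_mx R n.+1 n.+1 -> R) by apply: mks; left.
have mfk : measurable_fun setT (fun M : borel_mx R n.+1 n.+1 => f (k M)) by exact: (measurableT_comp (f := (f : borel_mx R n.+1 n.+1 -> R)) mf mk).
have md : measurable_fun setT (fun M : borel_mx R n.+1 n.+1 => f (k M) - f M) by exact: (@measurable_funB _ (borel_mx R n.+1 n.+1) _ _ (f \o k) f).
have -> : [set M | (f M < f (k M)) || ((f M == f (k M)) && lexle ks M (k M))] =
  ((fun M => f (k M) - f M) @^-1` `]0, +oo[%classic) `|`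
  (((fun M => f (k M) - f M) @^-1` `[0, 0]%classic) `&` [set M | lexle ks M (k M)]).
  apply/seteqP; split => M /=; rewrite !in_itv /= andbT subr_gt0 -eq_le.
    by move=> /orP[h|/andP[/eqP -> h]]; [left | right; rewrite subrr].
  by move=> [->//|[/eqP h ->]]; rewrite andbT -subr_eq0 -opprB oppr_eq0 -h eqxx orbT.
apply: measurableU; first by rewrite -[X in measurable X]setTI; apply: md => //; exact: measurable_itv.
apply: measurableI; first by rewrite -[X in measurable X]setTI; apply: md => //; exact: measurable_itv.
by apply: IH => f' f'k; apply: mks; right.
Qed.

Lemma finite_set_min (T : choiceType) (le : rel T) (A : set T) :
  (forall x y, le x y || le y x) -> (forall x y z, le x y -> le y z -> le x z) ->
  finite_set A -> A !=set0 -> exists2 m, A m & forall x, A x -> le m x.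
Proof.
move=> tot tr /finite_seqP[s ->] [x0 /= x0s].
elim: s x0 x0s => // a s IH x0 _; have aa : le a a by have := tot a a; rewrite orbb.
case: s IH => [_|b s IH].
  by exists a => [|x]; rewrite /= ?inE // => /eqP ->.
have [|m ms mle] := IH b; first by rewrite inE eqxx.
have [am|ma] := orP (tot a m).
  exists a => [|x /=]; rewrite /= inE ?eqxx // => /orP[/eqP ->//|xs].
  exact: tr am (mle _ xs).
exists m => [|x /=]; first by rewrite /= inE ms orbT.
by rewrite inE => /orP[/eqP ->//|xs]; exact: mle.
Qed.
End Lattices.

(** * Discrete cocompact groups are lattices *)

Section LatticeCriterion.
Context {R : realType} {n : nat}.
Implicit Types (M g c : 'M[R]_n.+1).

(** The corner entry comes first, so minimal elements move the base point least, as in a Dirichlet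
    domain; the other entries break ties and make the minimum unique. *)
Definition entry_keys : seq ('M[R]_n.+1 -> R) :=
  (fun M => M ord_max ord_max) :: [seq (fun M : 'M[R]_n.+1 => M ij.1 ij.2) | ij <- enum {: 'I_n.+1 * 'I_n.+1}].

Lemma entry_keys_coord f : List.In f entry_keys -> exists i j, f = fun M : 'M[R]_n.+1 => M i j.
Proof.
case=> [<-|]; first by exists ord_max, ord_max.
by elim: (enum _) => //= ij s IH [<-|]; [exists ij.1, ij.2 | exact: IH].
Qed.

Lemma entry_keys_all i j : List.In (fun M : 'M[R]_n.+1 => M i j) entry_keys.
Proof.
right; have : (i, j) \in enum {: 'I_n.+1 * 'I_n.+1} by rewrite mem_enum.
by elim: (enum _) => //= ij s IH; rewrite inE => /orP[/eqP <-|/IH]; [left | right].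
Qed.

Variable Gam : set 'M[R]_n.+1.
Hypothesis Gsub : is_subgroup Gam.
Hypothesis Gfin : forall r : R, finite_set [set g | Gam g /\ g ord_max ord_max <= r].
Hypothesis Gcoc : exists C : R, forall x, hyp x -> exists g, Gam g /\ tau (g *m x) base_point <= C.

Let GSO g : Gam g -> oplus g /\ \det g = 1.
Proof. by move=> Gg; have [+ _ _ _] := Gsub => /(_ _ Gg); rewrite SO_n1E. Qed.

Let Gfund : set 'M[R]_n.+1 := [set g | SO_n1 g /\ forall c, Gam c -> lexle entry_keys g (c *m g)].

Let Gorbit_fin g r : oplus g -> finite_set [set c | Gam c /\ (c *m g) ord_max ord_max <= r].
Proof.
move=> go; apply: sub_finite_set (Gfin (2 * tau base_point (g *m base_point) * r)) => c [Gc cr].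
split => //; have [co _] := GSO Gc.
have hgo := oplus_hyp go base_hyp.
rewrite -tau_base; apply: le_trans (tau_tri (oplus_hyp co base_hyp) (oplus_hyp co hgo) base_hyp) _.
rewrite oplus_tau // mulmxA tau_base ler_wpM2l //.
by rewrite mulr_ge0 // ltW // tau_gt0 //; exact: base_hyp.
Qed.

Let Gfund_exists g : SO_n1 g -> exists c, Gam c /\ Gfund (c *m g).
Proof.
move=> gS; have : SO_plus g by rewrite -SO_n1E.
move=> [go _]; have [_ G1 GM GV] := Gsub.
have [||||c [Gc cr] cmin] := @finite_set_min _ (fun c c' => lexle entry_keys (c *m g) (c' *m g))
   [set c | Gam c /\ (c *m g) ord_max ord_max <= g ord_max ord_max].
- by move=> x y; exact: lexle_total.
- by move=> x y z; exact: lexle_trans.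
- exact: Gorbit_fin.
- by exists 1%:M; split; rewrite ?mul1mx.
exists c; split => //; split.
  by apply: SO_n1_mul => //; have [+ _ _ _] := Gsub; apply.
move=> d Gd; rewrite mulmxA.
have [dr|dr] := leP ((d *m c *m g) ord_max ord_max) (g ord_max ord_max).
  by apply: cmin; split => //; exact: GM.
by rewrite /= (le_lt_trans cr dr).
Qed.

Let Gfund_domain : is_fundamental_domain Gam Gfund.
Proof.
split=> [g []//|g gS]; have [c [Gc Fc]] := Gfund_exists gS.
exists c; split => // d [Gd Fd].
have [_ _ GM GV] := Gsub.
have cu : c \in unitmx by apply/isom_unit/oplus_isom; have [] := GSO Gc.
have du : d \in unitmx by apply/isom_unit/oplus_isom; have [] := GSO Gd.
have h1 : lexle entry_keys (c *m g) (d *m g).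
  by have := Fc.2 _ (GM _ _ Gd (GV _ Gc)); rewrite -mulmxA mulKmx.
have h2 : lexle entry_keys (d *m g) (c *m g).
  by have := Fd.2 _ (GM _ _ Gc (GV _ Gd)); rewrite -mulmxA mulKmx.
have E : c *m g = d *m g.
  by apply/matrixP => i j; exact: (lexle_antisym h1 h2 (entry_keys_all i j)).
have gu : g \in unitmx.
  by move: gS; rewrite SO_n1E => -[/oplus_isom/isom_unit].
by rewrite -(mulmxK gu c) E mulmxK.
Qed.

Let Gfund_measurable : measurable (Gfund : set (borel_mx R n.+1 n.+1)).
Proof.
have -> : Gfund = SO_n1 `&` ~` (\bigcup_k \bigcup_(c in [set c | Gam c /\ c ord_max ord_max <= k%:R])
     ~` [set g | lexle entry_keys g (c *m g)]).
  apply/seteqP; split => g [gS H]; split => //.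
    by move=> [k _ [c [Gc _]]] /=; apply; exact: H.
  move=> c Gc; apply: contrapT => h; apply: H.
  exists (Num.truncn (c ord_max ord_max)).+1 => //; exists c => //; split => //.
  by apply/ltW/truncnS_gt.
apply: measurableI; first by apply: closed_measurable_mx; exact: SO_n1_closed.
apply: measurableC; apply: bigcupT_measurable => k; apply: fin_bigcup_measurable => // c _.
apply: measurableC; apply: lexle_measurable; last exact: measurable_mulmx.
by move=> f /entry_keys_coord [i [j ->]]; exact: coord_measurable_mx.
Qed.

(** Finiteness of balls gives discreteness and the existence of minimal representatives;
    cocompactness bounds the Dirichlet domain. *)
Lemma cocompact_lattice : is_lattice Gam.
Proof.
split.
  split => // g Gg; have [go _] := GSO Gg; split; first exact: mem_set.
  pose B := [set h : 'M[R]_n.+1 | Gam h /\ h ord_max ord_max <= g ord_max ord_max + 1] `\ g.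
  have fB : finite_set B by apply: finite_setD; exact: Gfin.
  exists ([set h : 'M[R]_n.+1 | h ord_max ord_max < g ord_max ord_max + 1] `&` ~` B).
    apply: filterI.
      apply: (@near_lt R 'M[R]_n.+1 (fun h => h ord_max ord_max)); last by rewrite ltrDl.
      exact: coord_continuous.
    apply: open_nbhs_nbhs; split; last by move=> [_ /=].
    apply: closed_openC; move: B fB; apply/accessible_finite_set_closed.
    by apply: hausdorff_accessible; exact: norm_hausdorff.
  apply/seteqP; split => h /=.
    move=> [[hr hB] Gh]; apply: contrapT => hg; apply: hB; split => //; split => //; exact: ltW.
  move=> ->; split => //; split; first by rewrite ltrDl.
  by move=> [_ /=]; apply.
have [mu muH] := @haar_exists R n; exists mu; split => //.
exists Gfund; split => //.
have [C HC] := Gcoc; have [_ _ muK _] := muH.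
(* Minimality of the corner entry confines the domain to cosh radius [C], hence to a compact box of
   matrices. *)
have cK : compact (SO_n1 `&` @mx_box R n.+1 n.+1 (1 + 2 * C)).
  apply: (subclosed_compact _ (@mx_box_compact R n.+1 n.+1 (1 + 2 * C))); last by move=> g [].
  apply: closedI; first exact: SO_n1_closed.
  by apply: compact_closed; [exact: norm_hausdorff | exact: mx_box_compact].
apply: le_lt_trans (muK _ cK); apply: le_measure; rewrite ?inE //.
  by apply: closed_measurable_mx; apply: compact_closed => //; exact: norm_hausdorff.
move=> g [gS gmin]; split => //.
have : SO_plus g by rewrite -SO_n1E.
move=> [go _] i j; have [c [Gc cC]] := HC _ (oplus_hyp go base_hyp).
apply: le_trans (oplus_entry_bound i j go) _; rewrite lerD2l ler_pM2l //.
apply: le_trans cC; rewrite mulmxA tau_base.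
have := gmin _ Gc; rewrite /= => /orP[/ltW//|/andP[/eqP -> _]]; exact: lexx.
Qed.
End LatticeCriterion.

(** * Hermite reduction of quadratic forms *)

Section HermiteReduction.
Context {R : realType}.

Definition toR {m p} (z : 'M[int]_(m, p)) : 'M[R]_(m, p) := map_mx intr z.

Lemma toRM m p q (a : 'M[int]_(m, p)) (b : 'M[int]_(p, q)) : toR (a *m b) = toR a *m toR b.
Proof. exact: map_mxM. Qed.

Lemma toRD m p (a b : 'M[int]_(m, p)) : toR (a + b) = toR a + toR b.
Proof. exact: map_mxD. Qed.

Lemma toRN m p (a : 'M[int]_(m, p)) : toR (- a) = - toR a.
Proof. exact: map_mxN. Qed.

Lemma toR1 m : toR (1%:M : 'M[int]_m) = 1%:M.
Proof. exact: map_mx1. Qed.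

Lemma toR0 m p : toR (0 : 'M[int]_(m, p)) = 0.
Proof. exact: map_mx0. Qed.

Lemma toR_inj m p : injective (@toR m p).
Proof. by move=> a b /matrixP H; apply/matrixP => i j; have := H i j; rewrite !mxE => /intr_inj. Qed.

Lemma finite_int_box m p (b : nat) :
  finite_set [set z : 'M[int]_(m, p) | forall i j, `|z i j| <= b%:Z].
Proof.
pose f (x : 'M['I_(2 * b).+1]_(m, p)) : 'M[int]_(m, p) := \matrix_(i, j) ((x i j : nat)%:Z - b%:Z).
apply: (@sub_finite_set _ _ (f @` setT)).
  move=> z /= Hz; exists (\matrix_(i, j) inord `|(z i j + b%:Z)%R|%N) => //.
  apply/matrixP => i j; have := Hz i j; rewrite ler_norml => /andP[h1 h2].
  rewrite !mxE; move: (z i j) h1 h2 => w h1 h2; rewrite inordK; lia.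
by apply: finite_image; exact: finite_finset.
Qed.

Definition qform {m} (A : 'M[R]_m) (x : 'cV[R]_m) : R := (x^T *m A *m x) 0 0.

Lemma qform_mul m p (A : 'M[R]_m) (B : 'M[R]_(m, p)) (x : 'cV[R]_p) :
  qform A (B *m x) = qform (B^T *m A *m B) x.
Proof. by rewrite /qform trmx_mul !mulmxA. Qed.

Lemma qformZ m (A : 'M[R]_m) (k : R) x : qform A (k *: x) = k ^+ 2 * qform A x.
Proof. by rewrite /qform [(k *: x)^T]linearZ /= -!scalemxAl -scalemxAr scalerA mxE expr2. Qed.

(** Completing the square in the first variable. *)
Lemma qform_block m (al : R) (r : 'rV[R]_m) (D : 'M[R]_m) t y : al != 0 ->
  qform (block_mx al%:M r r^T D) (col_mx t%:M y) =
  al * (t + (r *m y) 0 0 / al) ^+ 2 + qform (D - al^-1 *: (r^T *m r)) y.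
Proof.
move=> al0; rewrite /qform tr_col_mx mul_row_block mul_row_col tr_scalar_mx.
rewrite mulmxBr mulmxBl -scalemxAr -scalemxAl !mulmxDl -!scalar_mxM.
rewrite !mul_scalar_mx !mulmxA.
have -> : y^T *m r^T *m r *m y = (r *m y)^T *m (r *m y) by rewrite trmx_mul !mulmxA.
have -> : y^T *m r^T *m t%:M = t *: (r *m y)^T by rewrite mul_mx_scalar trmx_mul.
rewrite -!scalemxAl.
move: (r *m y) => w; rewrite [w]mx11_scalar; move: (w 0 0) => {}w.
rewrite tr_scalar_mx -scalar_mxM; move: (y^T *m D *m y) => v.
by rewrite !mxE !eqxx /= !mulr1n; field.
Qed.

Lemma round_exists (x : R) : exists k : int, `|k%:~R + x| <= 2^-1.
Proof.
exists (- Num.floor (x + 2^-1)); have := real_floor_itv (num_real (x + 2^-1)).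
move: (Num.floor _) => k; rewrite intrD !rmorphN /= => /andP[h1 h2].
by rewrite ler_norml; apply/andP; split; lra.
Qed.

(** Smith normal form of a column: every nonzero integral vector is a multiple of the first vector
    of some basis. *)
Lemma unimodular_first m (z : 'cV[int]_(1 + m)) : z != 0 ->
  exists (L L' : 'M[int]_(1 + m)) (k : int), [/\ L *m L' = 1%:M, L' *m L = 1%:M, k != 0 &
    z = k *: (L *m col_mx 1%:M 0)].
Proof.
move=> z0; have [L uL [R' uR [d _ E]]] := int_Smith_normal_form z.
exists L, (invmx L), (d`_0 * R' 0 0).
have zE : z = (d`_0 * R' 0 0) *: (L *m col_mx 1%:M 0).
  rewrite {1}E -mulmxA scalemxAr; congr (_ *m _).
  apply/matrixP => i j; rewrite !mxE big_ord1 !ord1 !mxE.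
  by case: splitP => k /=; rewrite ?ord1 => ->; rewrite !mxE ?eqxx ?mulr1n ?mulr1 // mulr0n mul0r mulr0.
split; rewrite ?mulmxV ?mulVmx //.
by apply: contra z0 => /eqP h; rewrite zE h scale0r.
Qed.

Lemma col_mul m p q (A : 'M[int]_(m, p)) (B : 'M[int]_(p, q)) j : col j (A *m B) = A *m col j B.
Proof. by rewrite !colE mulmxA. Qed.

(** Take a shortest vector as first basis vector, reduce the form projected along it, and lift the
    basis found there with first coefficient rounded to at most 1/2. The bound depends only on the
    minimum and on the determinant; this uniformity is what yields cocompactness. *)
Lemma hermite_reduction m (c Dl : R) : 0 < c -> 0 <= Dl ->
  exists C : R, forall A : 'M[R]_m, A^T = A ->
   (forall r, finite_set [set z : 'cV[int]_m | qform A (toR z) <= r]) ->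
   (forall z : 'cV[int]_m, z != 0 -> c <= qform A (toR z)) ->
   \det A <= Dl ->
   exists U U' : 'M[int]_m, U *m U' = 1%:M /\ forall i, qform A (toR (col i U)) <= C.
Proof.
elim: m c Dl => [|m IH] c Dl c0 D0.
  by exists 0 => A _ _ _ _; exists 1%:M, 1%:M; split; [rewrite mulmx1 | case].
have aux (a b : R) : a <= 4 / 3 * b -> a / 4 + b <= 4 / 3 * b by lra.
(* Lifting costs at most [al / 4], and lifts are no shorter than [al]: the projected form keeps
   three quarters of the minimum. Its determinant is divided by [al >= c]. *)
have [C' HC'] := IH (3 / 4 * c) (Dl / c) ltac:(lra) ltac:(by rewrite divr_ge0 // ltW).
exists (Num.max Dl (4 / 3 * C')) => A; rewrite -[m.+1]/(1 + m)%N in A * => At Afin Ac Ad.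
have [z1 z10 z1min] : exists2 z : 'cV[int]_(1 + m), z != 0 & forall z', z' != 0 -> qform A (toR z) <= qform A (toR z').
  pose e : 'cV[int]_(1 + m) := col_mx 1%:M 0.
  have e0 : e != 0.
    apply/eqP => /matrixP /(_ 0 0); rewrite (_ : (0 : 'I_(1 + m)) = lshift m 0) ?col_mxEu ?mxE ?eqxx //.
    exact: val_inj.
  have [||||z [z0 ze] zmin] := @finite_set_min 'cV[int]_(1 + m) (fun a b => qform A (toR a) <= qform A (toR b))
     [set z | z != 0 /\ qform A (toR z) <= qform A (toR e)].
  - by move=> x y /=; exact: le_total.
  - by move=> x y w h1 h2; exact: le_trans h1 h2.
  - by apply: sub_finite_set (Afin (qform A (toR e))) => z [].
  - by exists e.
  exists z => // z' z'0; have [h|h] := leP (qform A (toR z')) (qform A (toR e)); first exact: zmin.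
  exact: le_trans ze (ltW h).
have [L [L' [k [LL' L'L k0 zE]]]] := unimodular_first z10.
pose e : 'cV[int]_(1 + m) := col_mx 1%:M 0.
have Linj (z : 'cV[int]_(1 + m)) : z != 0 -> L *m z != 0.
  by move=> z0; apply: contra z0 => /eqP h; rewrite -[z]mul1mx -L'L -mulmxA h mulmx0.
have e0 : e != 0.
  by apply: contra z10 => /eqP h; rewrite zE -/e h mulmx0 scaler0.
pose A1 := (toR L)^T *m A *m toR L.
have A1E (z : 'cV[int]_(1 + m)) : qform A (toR (L *m z)) = qform A1 (toR z) by rewrite toRM qform_mul.
pose al := qform A1 (toR e).
have alE : al = qform A (toR (L *m e)) by rewrite A1E.
have alc : c <= al by rewrite alE; apply: Ac; exact: Linj.
have al0 : 0 < al by apply: lt_le_trans alc.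
(* The shortest vector is [k] times the basis vector [L *m e] with |k| >= 1, so the latter is
   shortest as well. *)
have almin (z : 'cV[int]_(1 + m)) : z != 0 -> al <= qform A1 (toR z).
  move=> z0; rewrite -A1E; have := z1min _ (Linj _ z0); apply: le_trans.
  rewrite zE (_ : toR _ = k%:~R *: toR (L *m e)).
    rewrite qformZ -alE ler_peMl ?(ltW al0) //.
    rewrite -rmorphXn /= -[1]/(1%:~R) ler_int.
    have : 0 < k ^+ 2 by rewrite exprn_even_gt0.
    lia.
  by apply/matrixP => i j; rewrite !mxE rmorphM.
have A1t : A1^T = A1 by rewrite /A1 !trmx_mul trmxK At mulmxA.
pose r := ursubmx A1; pose D := drsubmx A1.
have A1b : A1 = block_mx al%:M r r^T D.
  rewrite -[LHS]submxK /r -[in (ursubmx A1)^T]A1t -trmx_dlsub trmxK; congr block_mx.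
  rewrite [LHS]mx11_scalar; congr (_%:M).
  rewrite /al /qform (_ : toR e = col_mx 1%:M 0); last by rewrite /toR map_col_mx map_mx1 map_mx0.
  rewrite -[in RHS](submxK A1) tr_col_mx mul_row_block mul_row_col trmx1 trmx0.
  by rewrite !mul1mx !mul0mx !mulmx0 !mulmx1 !addr0.
pose A' := D - al^-1 *: (r^T *m r).
have qE t y : qform A1 (toR (col_mx t%:M y)) = al * (t%:~R + (r *m toR y) 0 0 / al) ^+ 2 + qform A' (toR y).
  have -> : toR (col_mx t%:M y) = col_mx (t%:~R)%:M (toR y).
    by rewrite /toR map_col_mx map_scalar_mx.
  by rewrite {1}A1b qform_block ?gt_eqF.
have lift y : exists t : int, qform A1 (toR (col_mx t%:M y)) <= al / 4 + qform A' (toR y).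
  have [t ht] := round_exists ((r *m toR y) 0 0 / al); exists t.
  rewrite qE lerD2r (_ : al / 4 = al * (2^-1) ^+ 2); last by field.
  by rewrite ler_pM2l // -[leLHS]real_normK ?num_real // ler_sqr ?nnegrE ?normr_ge0.
have colneq (t : int) (y : 'cV[int]_m) : y != 0 -> col_mx (t%:M : 'M[int]_1) y != 0.
  by apply: contra => /eqP h; have := congr1 dsubmx h; rewrite col_mxKd linear0 => ->.
have A't : A'^T = A'.
  rewrite /A' linearB linearZ /= trmx_mul trmxK; congr (_ - _).
  by rewrite /D trmx_drsub A1t.
have dA1 : \det A1 = \det A.
  have d1 : \det (toR L) ^+ 2 = 1.
    have H : \det L * \det L' = 1 by rewrite -det_mulmx LL' det1.
    have /eqP : (`|\det L| * `|\det L'|)%N = 1%N by rewrite -abszM H.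
  rewrite muln_eq1 => /andP[/eqP H2 _].
  have H3 : \det L = 1 \/ \det L = -1 by move: (\det L) H2 => d; lia.
  have -> : \det (toR L) = (\det L)%:~R by rewrite /toR det_map_mx.
    by case: H3 => ->; rewrite ?rmorphN /= ?sqrrN expr1n.
  by rewrite /A1 !det_mulmx det_tr mulrC mulrA -expr2 d1 mul1r.
have dA1' : \det A1 = al * \det A'.
  have E : A1 *m block_mx 1%:M (- al^-1 *: r) 0 1%:M = block_mx al%:M 0 r^T A'.
    rewrite {1}A1b mulmx_block !mulmx1 !mulmx0 !addr0 -scalemxAr mul_scalar_mx -scalemxAr scalerA.
    by rewrite mulNr mulVf ?gt_eqF // scaleN1r addNr scaleNr addrC.
  have := congr1 determinant E; rewrite det_mulmx det_ublock det_lblock !det1 !mulr1 => ->.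
  by rewrite det_mx11 mxE eqxx mulr1n.
have [U2 [U2' [U2E U2C]]] : exists U U' : 'M[int]_m, U *m U' = 1%:M /\ forall i, qform A' (toR (col i U)) <= C'.
  apply: HC' => //.
  - move=> q; apply: (@sub_finite_set _ _ ((fun z => dsubmx (L' *m z)) @` [set z : 'cV[int]_(1 + m) | qform A (toR z) <= al / 4 + q])).
      move=> y /= yq; have [t ht] := lift y; exists (L *m col_mx t%:M y).
        by rewrite /= A1E; apply: le_trans ht _; rewrite lerD2l.
      by rewrite mulmxA L'L mul1mx col_mxKd.
    exact/finite_image/Afin.
  - move=> y y0; have [t ht] := lift y; have := almin _ (colneq t _ y0); lra.
  - have -> : \det A' = \det A / al by rewrite -dA1 dA1' mulrC mulKf // gt_eqF.
    apply: (@le_trans _ _ (Dl / al)); first by rewrite ler_pM2r // invr_gt0.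
    by apply: ler_wpM2l => //; rewrite lef_pV2.
(* Any lifted vector is at least as long as the shortest one, so al <= al / 4 + C'. In rank one
   there is nothing to lift, and [al] is the determinant. *)
have alC : al <= Num.max Dl (4 / 3 * C') /\ (forall j : 'I_m, al / 4 + C' <= Num.max Dl (4 / 3 * C')).
  have key (j : 'I_m) : al <= 4 / 3 * C'.
    have y0 : col j U2 != 0.
      apply/eqP => h; have := congr1 (mulmx U2') (esym h).
      rewrite mulmx0 colE mulmxA (mulmx1C U2E) mul1mx => /matrixP /(_ j 0); rewrite !mxE !eqxx /=.
      by [].
    have [t ht] := lift (col j U2); have := almin _ (colneq t _ y0); have := U2C j; lra.
  split; last first.
    by move=> j; rewrite le_max (aux _ _ (key j)) orbT.
  rewrite le_max; case: (posnP m) => [m0|m0]; last by rewrite (key (Ordinal m0)) orbT.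
  suff -> : al = \det A by rewrite Ad.
  have det0 (k' : nat) (B : 'M[R]_k') : k' = 0%N -> \det B = 1 by case: k' B => // B _; exact: det_mx00.
  by rewrite -dA1 dA1' det0 // mulr1.
have /choice [t Ht] : forall j, exists t : int, qform A1 (toR (col_mx t%:M (col j U2))) <= al / 4 + qform A' (toR (col j U2)).
  by move=> j; exact: lift.
pose tr : 'rV[int]_m := \row_j t j.
exists (L *m block_mx 1%:M tr 0 U2), (block_mx 1%:M (- tr *m U2') 0 U2' *m L'); split.
  rewrite mulmxA -(mulmxA L) mulmx_block !mul1mx !mul0mx !mulmx0 !addr0 !add0r U2E.
  by rewrite mulNmx addNr -scalar_mx_block mulmx1.
move=> i; rewrite col_mul A1E; have [alC1 alC2] := alC.
case: (split_ordP i) => j ->.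
  rewrite (_ : col _ _ = e) //; apply/colP => l; rewrite !mxE.
  by case: splitP => k' ?; rewrite !mxE; case: splitP => j' /=; rewrite ?ord1 ?mxE // => /eqP; rewrite ?ord1; have := ltn_ord j; lia.
rewrite (_ : col _ _ = col_mx (t j)%:M (col j U2)).
  apply: le_trans (Ht j) _; apply: le_trans (alC2 j); by rewrite lerD2l.
apply/colP => l; case: (split_ordP l) => l' ->.
  by rewrite mxE block_mxEur col_mxEu !mxE !ord1 eqxx.
by rewrite mxE block_mxEdr col_mxEd [RHS]mxE.
Qed.
End HermiteReduction.

(** * The module over Z[sqrt 2] and its two real embeddings *)

Section Arithmetic.
Context {R : realType} {n : nat}.
Local Notation N := n.+1.
Implicit Types (x y w : 'cV[R]_N) (g h : 'M[R]_N) (z u : 'cV[int]_(N + N)) (T : 'M[int]_(N + N)).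

Definition s2 : R := Num.sqrt 2.

Lemma s2_sqr : s2 ^+ 2 = 2. Proof. by rewrite sqr_sqrtr. Qed.

Lemma s2_ge1 : 1 <= s2.
Proof. by rewrite -sqrtr1 ler_sqrt //; lra. Qed.

(** Irrationality of sqrt 2, by parity of the 2-adic valuations. *)
Lemma s2_int_sqr (p q : int) : p ^+ 2 = 2 * q ^+ 2 -> p = 0 /\ q = 0.
Proof.
move=> H; have E : (`|p| ^ 2 = 2 * `|q| ^ 2)%N.
  have := congr1 absz H; rewrite abszM !abszX /=; lia.
have [q0|q0] := posnP `|q|%N.
  by move: E; rewrite q0 => /eqP; rewrite muln0 expn_eq0 andbT; lia.
have p0 : (0 < `|p|)%N by rewrite lt0n; apply/eqP => h; move: E; rewrite h; lia.
have := congr1 (logn 2) E; rewrite lognM ?expn_gt0 ?q0 // !lognX; have -> : logn 2 2 = 1%N by [].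
lia.
Qed.

(** The product is the absolute norm of a nonzero element of Z[sqrt 2], a nonzero integer. *)
Lemma s2_norm (p q : int) : (p != 0) || (q != 0) ->
  1 <= `|p%:~R + s2 * q%:~R| * `|p%:~R - s2 * q%:~R|.
Proof.
move=> pq; rewrite -normrM.
have -> : (p%:~R + s2 * q%:~R) * (p%:~R - s2 * q%:~R) = (p ^+ 2 - 2 * q ^+ 2)%:~R :> R.
  rewrite intrB intrM !rmorphXn /=; have := s2_sqr; move: s2 => s; rewrite expr2 => H; ring: H.
rewrite -intr_norm -[1]/(1%:~R) ler_int.
suff : p ^+ 2 - 2 * q ^+ 2 != 0 by move: (p ^+ 2 - _) => k; lia.
by rewrite subr_eq0; apply/eqP => /s2_int_sqr [p0 q0]; move: pq; rewrite p0 q0.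
Qed.


Lemma s2_indep (p q : int) : p%:~R - s2 * q%:~R = 0 -> p = 0 /\ q = 0.
Proof.
move=> H; have [h|] := boolP ((p != 0) || (q != 0)); last by rewrite negb_or !negbK => /andP[/eqP -> /eqP ->].
by have := s2_norm h; rewrite H normr0 mulr0 ler10.
Qed.

(** Stretches the last coordinate by the fourth root of 2, which turns x_1^2 + ... + x_n^2 - sqrt 2
    x_{n+1}^2 into the standard form. *)
Definition wscale (i : 'I_N) : R := if i == ord_max then Num.sqrt s2 else 1.

Lemma wscale_ge1 i : 1 <= wscale i.
Proof.
rewrite /wscale; case: ifP => // _.
by rewrite -[X in X <= _]sqrtr1 ler_sqrt ?s2_ge1 // (le_trans _ s2_ge1).
Qed.

Lemma wscale_gt0 i : 0 < wscale i. Proof. exact: lt_le_trans (wscale_ge1 i). Qed.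

Lemma wscale_max_sqr : wscale ord_max ^+ 2 = s2.
Proof. by rewrite /wscale eqxx sqr_sqrtr // (le_trans _ s2_ge1). Qed.

Definition cmat : 'M[R]_N := diag_mx (\row_i wscale i).
Definition cmatV : 'M[R]_N := diag_mx (\row_i (wscale i)^-1).

Lemma cmatK : cmat *m cmatV = 1%:M.
Proof.
apply/matrixP => i j; rewrite mul_diag_mx !mxE.
by case: eqP => [->|]; rewrite ?mulr1n ?mulr0n ?mulr0 // mulfV // gt_eqF // wscale_gt0.
Qed.

(** A vector a + sqrt 2 b over Z[sqrt 2] is stored as the integral column of [a] above [b]. [E1] and
    [E2] are its two real embeddings, rescaled; [Ri] is a right inverse of both. *)
Definition E1 : 'M[R]_(N, N + N) := cmat *m row_mx 1%:M (s2%:M).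
Definition E2 : 'M[R]_(N, N + N) := cmat *m row_mx 1%:M ((- s2)%:M).
Definition Ri : 'M[R]_(N + N, N) := col_mx cmatV 0.

Lemma E1_Ri : E1 *m Ri = 1%:M.
Proof. by rewrite -mulmxA mul_row_col mulmx0 addr0 mul1mx cmatK. Qed.

Lemma E2_Ri : E2 *m Ri = 1%:M.
Proof. by rewrite -mulmxA mul_row_col mulmx0 addr0 mul1mx cmatK. Qed.

Definition e1 z : 'cV[R]_N := E1 *m toR z.
Definition e2 z : 'cV[R]_N := E2 *m toR z.

Lemma e1E z i : e1 z i 0 = wscale i * ((z (lshift N i) 0)%:~R + s2 * (z (rshift N i) 0)%:~R).
Proof.
rewrite /e1 /E1 -mulmxA mul_diag_mx [LHS]mxE [X in X * _]mxE; congr (_ * _).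
rewrite -[toR z]vsubmxK mul_row_col mul1mx mul_scalar_mx; by rewrite !mxE.
Qed.

Lemma e2E z i : e2 z i 0 = wscale i * ((z (lshift N i) 0)%:~R - s2 * (z (rshift N i) 0)%:~R).
Proof.
rewrite /e2 /E2 -mulmxA mul_diag_mx [LHS]mxE [X in X * _]mxE; congr (_ * _).
rewrite -[toR z]vsubmxK mul_row_col mul1mx mul_scalar_mx; rewrite !mxE mulNr.
by [].
Qed.

Lemma e1D z u : e1 (z + u) = e1 z + e1 u. Proof. by rewrite /e1 toRD mulmxDr. Qed.
Lemma e2D z u : e2 (z + u) = e2 z + e2 u. Proof. by rewrite /e2 toRD mulmxDr. Qed.
Lemma e1N z : e1 (- z) = - e1 z. Proof. by rewrite /e1 toRN mulmxN. Qed.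
Lemma e2N z : e2 (- z) = - e2 z. Proof. by rewrite /e2 toRN mulmxN. Qed.
Lemma toRZ m p (k : int) (a : 'M[int]_(m, p)) : toR (k *: a) = k%:~R *: toR a :> 'M[R]_(m, p).
Proof. by apply/matrixP => i j; rewrite !mxE rmorphM. Qed.
Lemma e1Z k z : e1 (k *: z) = k%:~R *: e1 z. Proof. by rewrite /e1 toRZ scalemxAr. Qed.
Lemma e2Z k z : e2 (k *: z) = k%:~R *: e2 z. Proof. by rewrite /e2 toRZ scalemxAr. Qed.

Lemma norm_double_le (c t r : R) : 1 <= c -> `|c * (t + t)| <= r + r -> `|t| <= r.
Proof.
move=> c1; rewrite normrM (ger0_norm (le_trans ler01 c1)) -mulr2n -[t *+ 2]mulr_natl normrM normr_nat.
by move: `|t| (normr_ge0 t) => w w0; rewrite mulr2n; nra.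
Qed.

(** The integral coordinates are recovered from the sum and the difference of the two embeddings, so
    the module is discrete in the product. *)
Lemma lattice_box_bound (r : R) z i : mx_box r (e1 z) -> mx_box r (e2 z) ->
  `|z i 0| <= (Num.truncn r).+1%:Z.
Proof.
move=> H1 H2; rewrite -(ler_int R) intr_norm.
apply: (@le_trans _ _ r); last by apply/ltW/truncnS_gt.
case: (split_ordP i) => k ->.
  apply: (norm_double_le (wscale_ge1 k)).
  suff -> : wscale k * ((z (lshift N k) 0)%:~R + (z (lshift N k) 0)%:~R) = e1 z k 0 + e2 z k 0.
    exact: le_trans (ler_normD _ _) (lerD (H1 k 0) (H2 k 0)).
  by rewrite e1E e2E; ring.
apply: (@norm_double_le (wscale k * s2)).
  by have := wscale_ge1 k; have := s2_ge1; move: (wscale k) s2 => c s; nra.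
suff -> : wscale k * s2 * ((z (rshift N k) 0)%:~R + (z (rshift N k) 0)%:~R) = e1 z k 0 - e2 z k 0.
  exact: le_trans (ler_normB _ _) (lerD (H1 k 0) (H2 k 0)).
by rewrite e1E e2E; ring.
Qed.

Lemma finite_lattice_box (r : R) : finite_set [set z | mx_box r (e1 z) /\ mx_box r (e2 z)].
Proof.
apply: sub_finite_set (finite_int_box (N + N) 1 (Num.truncn r).+1) => z [H1 H2] i j.
by rewrite (ord1 j); exact: lattice_box_bound.
Qed.
End Arithmetic.

(** * The arithmetic group and its congruence subgroups *)

Section ArithmeticGroup.
Context {R : realType} {n : nat}.
Local Notation N := n.+1.
Local Notation E1 := (@E1 R n).
Local Notation E2 := (@E2 R n).
Local Notation Ri := (@Ri R n).
Local Notation e1 := (@e1 R n).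
Local Notation e2 := (@e2 R n).
Local Notation s2 := (@s2 R).
Local Notation lorJ := (@lorJ R n).
Implicit Types (x y w : 'cV[R]_N) (g h : 'M[R]_N) (z u : 'cV[int]_(N + N)) (T : 'M[int]_(N + N)).

Definition D0 : 'M[int]_N := diag_mx (\row_i (i != ord_max)%:Z).
Definition D1 : 'M[int]_N := diag_mx (\row_i (i == ord_max)%:Z).
(** [Pm] and [Qm] are the rational part and the sqrt 2 part of the form over Z[sqrt 2], written in
    integral coordinates. *)
Definition Pm : 'M[int]_(N + N) := block_mx D0 (- (D1 + D1)) (- (D1 + D1)) (D0 + D0).
Definition Qm : 'M[int]_(N + N) := block_mx (- D1) D0 D0 (- (D1 + D1)).

Lemma toR_block (A B C D : 'M[int]_N) :
  toR (block_mx A B C D) = block_mx (toR A) (toR B) (toR C) (toR D) :> 'M[R]_(N + N).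
Proof. exact: map_block_mx. Qed.

Lemma cmat_tr : (@cmat R n)^T = cmat. Proof. exact: tr_diag_mx. Qed.

Lemma cmat_J : @cmat R n *m lorJ *m cmat = toR D0 - s2 *: toR D1.
Proof.
apply/matrixP => i j; rewrite mul_mx_diag [LHS]mxE /lorJ mul_mx_diag [X in X * _]mxE !mxE.
rewrite -(wscale_max_sqr (R := R) (n := n)) /wscale. rewrite eqxx; case: (eqVneq i j) => [->|ij]; rewrite ?mulr1n ?mulr0n; last by ring.
by case: eqP => _ /=; ring.
Qed.

Lemma cmat_sqr : @cmat R n *m cmat = toR D0 + s2 *: toR D1.
Proof.
apply/matrixP => i j; rewrite mul_mx_diag [LHS]mxE !mxE.
rewrite -(wscale_max_sqr (R := R) (n := n)) /wscale eqxx; case: (eqVneq i j) => [->|ij]; rewrite ?mulr1n ?mulr0n; last by ring.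
by case: eqP => _ /=; ring.
Qed.

Lemma E1_gram : E1^T *m lorJ *m E1 = toR Pm + s2 *: toR Qm.
Proof.
rewrite /E1 trmx_mul tr_row_mx trmx1 tr_scalar_mx cmat_tr.
rewrite -!mulmxA (mulmxA lorJ) (mulmxA cmat) (mulmxA cmat) cmat_J.
rewrite mul_mx_row mul_col_row !mul1mx !mulmx1 !mul_scalar_mx !mul_mx_scalar scalerA -expr2 s2_sqr.
rewrite /Pm /Qm !toR_block !toRN !toRD scale_block_mx add_block_mx !scalerBr !scalerA -expr2 s2_sqr.
rewrite !scalerN.
congr block_mx; rewrite // ?[2 *: _]scalerDl; apply/matrixP => i j; rewrite !mxE; ring.
Qed.

(** Conjugation turns - sqrt 2 into sqrt 2, so the second embedding carries a definite form, which
    after the same rescaling is [dot]. *)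
Lemma E2_gram : E2^T *m E2 = toR Pm - s2 *: toR Qm.
Proof.
rewrite /E2 trmx_mul tr_row_mx trmx1 tr_scalar_mx cmat_tr.
rewrite -!mulmxA (mulmxA cmat) cmat_sqr.
rewrite mul_mx_row mul_col_row !mul1mx !mulmx1 !mul_scalar_mx !mul_mx_scalar scalerA mulrNN -expr2 s2_sqr.
rewrite /Pm /Qm !toR_block !toRN !toRD scale_block_mx opp_block_mx add_block_mx !scalerDr !scalerA !scaleNr !mulNr -!expr2 s2_sqr.
rewrite !scalerN.
congr block_mx; apply/matrixP => i j; rewrite !mxE; ring.
Qed.

Lemma lorentz_E1 (a b : 'cV[R]_(N + N)) :
  lorentz (E1 *m a) (E1 *m b) = (a^T *m (toR Pm + s2 *: toR Qm) *m b) 0 0.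
Proof. by rewrite lorentz_mx -E1_gram !trmx_mul lorJT !mulmxA. Qed.

Lemma dot_mx x y : dot x y = (x^T *m y) 0 0.
Proof. by rewrite mxE; apply: eq_bigr => i _; rewrite mxE. Qed.

Lemma dot_E2 (a b : 'cV[R]_(N + N)) :
  dot (E2 *m a) (E2 *m b) = (a^T *m (toR Pm - s2 *: toR Qm) *m b) 0 0.
Proof. by rewrite dot_mx -E2_gram !trmx_mul !mulmxA. Qed.

Definition pform z u : int := (z^T *m Pm *m u) 0 0.
Definition sform z u : int := (z^T *m Qm *m u) 0 0.

Lemma toR_tr m p (a : 'M[int]_(m, p)) : (toR a)^T = toR a^T :> 'M[R]_(p, m).
Proof. by apply/matrixP => i j; rewrite !mxE. Qed.

Lemma toR_form (A : 'M[int]_(N + N)) z u :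
  ((toR z)^T *m toR A *m toR u) 0 0 = ((z^T *m A *m u) 0 0)%:~R :> R.
Proof. by rewrite toR_tr -!toRM mxE. Qed.

Lemma lorentz_e1 z u : lorentz (e1 z) (e1 u) = (pform z u)%:~R + s2 * (sform z u)%:~R.
Proof.
by rewrite lorentz_E1 mulmxDr mulmxDl mxE toR_form -scalemxAr -scalemxAl [X in _ + X]mxE toR_form.
Qed.

Lemma dot_e2 z u : dot (e2 z) (e2 u) = (pform z u)%:~R - s2 * (sform z u)%:~R.
Proof.
by rewrite dot_E2 mulmxBr mulmxBl mxE toR_form -scalemxAr -scalemxAl [X in _ + X]mxE [X in _ - X]mxE toR_form.
Qed.

Lemma e2_inj : injective e2.
Proof.
move=> z u H; apply/eqP; rewrite -subr_eq0; apply/eqP.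
have {}H i : e2 (z - u) i 0 = 0 by rewrite e2D e2N H subrr mxE.
apply/matrixP => i j; rewrite (ord1 j) [RHS]mxE.
have K k : (z - u) (lshift N k) 0 = 0 /\ (z - u) (rshift N k) 0 = 0.
  apply: (@s2_indep R); apply/eqP; have /eqP := H k; rewrite e2E mulf_eq0.
  by rewrite gt_eqF ?wscale_gt0.
by case: (split_ordP i) => k ->; case: (K k).
Qed.

Lemma e1_inj : injective e1.
Proof.
move=> z u H; apply/eqP; rewrite -subr_eq0; apply/eqP.
have {}H i : e1 (z - u) i 0 = 0 by rewrite e1D e1N H subrr mxE.
apply/matrixP => i j; rewrite (ord1 j) [RHS]mxE.
have K k : (z - u) (lshift N k) 0 = 0 /\ - (z - u) (rshift N k) 0 = 0.
  apply: (@s2_indep R); apply/eqP; have /eqP := H k; rewrite e1E mulf_eq0.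
  by rewrite gt_eqF ?wscale_gt0 //= intrN mulrN opprK.
case: (split_ordP i) => k ->; case: (K k) => // _ /eqP.
by rewrite oppr_eq0 => /eqP.
Qed.

Lemma E1_mx_inj m (A B : 'M[int]_(N + N, m)) : E1 *m toR A = E1 *m toR B -> A = B.
Proof.
move=> H; apply/matrixP => i j.
suff : col j A = col j B by move=> /matrixP/(_ i 0); rewrite !mxE.
have E (C : 'M[int]_(N + N, m)) : e1 (col j C) = col j (E1 *m toR C) by apply/matrixP => a b; rewrite !mxE; apply: eq_bigr => l _; rewrite !mxE.
by apply: e1_inj; rewrite !E H.
Qed.

(** [T] is the integral matrix inducing [g] in the first embedding and the orthogonal conjugate [g']
    in the second; it is invertible over the integers and congruent to 1 mod [q]. *)
Definition arith (q : nat) : set 'M[R]_N := [set g | oplus g /\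
  exists g' T T' Y, [/\ g'^T *m g' = 1%:M, T *m T' = 1%:M, T = 1%:M + q%:Z *: Y,
    g *m E1 = E1 *m toR T & g' *m E2 = E2 *m toR T]].

Lemma arith_oplus q g : arith q g -> oplus g. Proof. by case. Qed.

Lemma arith_isom q g : arith q g -> isom g. Proof. by case => /oplus_isom. Qed.

Lemma arith1 q : arith q 1%:M.
Proof.
split; first exact: oplus1.
by exists 1%:M, 1%:M, 1%:M, 0; split; rewrite ?trmx1 ?mulmx1 ?scaler0 ?addr0 ?toR1 ?mul1mx ?mulmx1.
Qed.

Lemma arithM q g h : arith q g -> arith q h -> arith q (g *m h).
Proof.
move=> [go [g' [T [T' [Y [gg TT TY gE gE2]]]]]] [ho [h' [S [S' [X [hh SS SX hE hE2]]]]]].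
split; first exact: oplusM.
exists (g' *m h'), (T *m S), (S' *m T'), (Y + X + q%:Z *: (Y *m X)); split.
- by rewrite trmx_mul -mulmxA (mulmxA g'^T) gg mul1mx.
- by rewrite -mulmxA (mulmxA S) SS mul1mx.
- rewrite TY SX mulmxDl mul1mx mulmxDr mulmx1 -!scalemxAl -!scalemxAr !scalerDr addrA.
  by rewrite -!addrA; congr (_ + _); rewrite addrCA.
- by rewrite -mulmxA hE mulmxA gE toRM mulmxA.
- by rewrite -mulmxA hE2 mulmxA gE2 toRM mulmxA.
Qed.

Lemma arithV q g : arith q g -> arith q (invmx g).
Proof.
move=> [go [g' [T [T' [Y [gg TT TY gE gE2]]]]]].
have TT' : T' *m T = 1%:M by apply: mulmx1C.
split; first exact: oplusV.
exists g'^T, T', T, (- (T' *m Y)); split => //.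
- by rewrite trmxK; apply: mulmx1C.
- by rewrite scalerN; apply/eqP; rewrite -subr_eq opprK scalemxAr -[T' in X in X + _]mulmx1 -mulmxDr -TY TT'.
- rewrite -[E1 in LHS]mulmx1 -toR1 -TT toRM (mulmxA E1) -gE !mulmxA.
  by rewrite mulVmx ?mul1mx //; apply/isom_unit/oplus_isom.
- by rewrite -[E2 in LHS]mulmx1 -toR1 -TT toRM (mulmxA E2) -gE2 !mulmxA gg mul1mx.
Qed.

Lemma arith_dvd q M g : (q %| M)%N -> arith M g -> arith q g.
Proof.
move=> /dvdnP[k ->] [go [g' [T [T' [Y [gg TT TY gE gE2]]]]]]; split => //.
exists g', T, T', (k%:Z *: Y); split => //.
by rewrite scalerA TY -PoszM mulnC.
Qed.

Lemma arith_e1 q g : arith q g -> exists T Y, [/\ T = 1%:M + q%:Z *: Y,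
  forall u, g *m e1 u = e1 (T *m u) & forall u v, dot (e2 (T *m u)) (e2 (T *m v)) = dot (e2 u) (e2 v)].
Proof.
move=> [go [g' [T [T' [Y [gg TT TY gE gE2]]]]]]; exists T, Y; split => //.
  by move=> v; rewrite /e1 toRM mulmxA gE mulmxA.
have H z : e2 (T *m z) = g' *m e2 z by rewrite /e2 toRM mulmxA -gE2 mulmxA.
by move=> u v; rewrite !H !dot_mx trmx_mul -mulmxA (mulmxA g'^T) gg mul1mx.
Qed.

Lemma isom_E1 g : (forall a b : 'cV[R]_(N + N),
    lorentz (g *m (E1 *m a)) (g *m (E1 *m b)) = lorentz (E1 *m a) (E1 *m b)) -> isom g.
Proof. by move=> H x; have := H (Ri *m x) (Ri *m x); rewrite !(mulmxA E1) E1_Ri !mul1mx. Qed.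

(* The kernel of E1 (resp. E2) is the radical of the first (resp. second) form, hence it is preserved by T. *)
Lemma gram_descend T T' : T *m T' = 1%:M -> T^T *m Pm *m T = Pm -> T^T *m Qm *m T = Qm ->
  exists g g', [/\ isom g, g'^T *m g' = 1%:M, g *m E1 = E1 *m toR T & g' *m E2 = E2 *m toR T].
Proof.
move=> TT TP TQ; pose g := E1 *m toR T *m Ri; pose g' := E2 *m toR T *m Ri.
have TPR : (toR T)^T *m toR Pm *m toR T = toR Pm :> 'M[R]_(N + N) by rewrite toR_tr -!toRM TP.
have TQR : (toR T)^T *m toR Qm *m toR T = toR Qm :> 'M[R]_(N + N) by rewrite toR_tr -!toRM TQ.
have L a b : lorentz (E1 *m (toR T *m a)) (E1 *m (toR T *m b)) = lorentz (E1 *m a) (E1 *m b).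
  have G : (toR T)^T *m (toR Pm + s2 *: toR Qm) *m toR T = toR Pm + s2 *: toR Qm.
    by rewrite mulmxDr mulmxDl -scalemxAr -scalemxAl TPR TQR.
  by rewrite !lorentz_E1 trmx_mul -[in RHS]G !mulmxA.
have L2 a b : dot (E2 *m (toR T *m a)) (E2 *m (toR T *m b)) = dot (E2 *m a) (E2 *m b).
  have G : (toR T)^T *m (toR Pm - s2 *: toR Qm) *m toR T = toR Pm - s2 *: toR Qm.
    by rewrite mulmxBr mulmxBl -scalemxAr -scalemxAl TPR TQR.
  by rewrite !dot_E2 trmx_mul -[in RHS]G !mulmxA.
have gE : g *m E1 = E1 *m toR T.
  apply: mx_col_eq => a; apply/eqP; rewrite -subr_eq0 -mulmxBl; apply/eqP; apply: lorentz_inj => b.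
  have -> : b = E1 *m (toR T *m (toR T' *m (Ri *m b))).
    by rewrite (mulmxA (toR T)) -toRM TT toR1 mul1mx mulmxA E1_Ri mul1mx.
  have -> : (g *m E1 - E1 *m toR T) *m a = E1 *m (toR T *m (Ri *m (E1 *m a))) - E1 *m (toR T *m a).
    by rewrite mulmxBl /g !mulmxA.
  rewrite lorentzDr lorentzNr !L (mulmxA E1 Ri) E1_Ri mul1mx subrr.
  by rewrite lorentzC lorentz0l.
have gE2 : g' *m E2 = E2 *m toR T.
  apply: mx_col_eq => a; apply/eqP; rewrite -subr_eq0 -mulmxBl; apply/eqP; apply: dot_eq0.
  have -> : (g' *m E2 - E2 *m toR T) *m a = E2 *m (toR T *m (Ri *m (E2 *m a) - a)).
    by rewrite mulmxBl /g' !mulmxBr !mulmxA.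
  rewrite L2 mulmxBr (mulmxA E2) E2_Ri mul1mx subrr.
  by rewrite dot_mx mulmx0 mxE.
have K (a : 'cV[R]_(N + N)) : g *m (E1 *m a) = E1 *m (toR T *m a) by rewrite mulmxA gE mulmxA.
exists g, g'; split => //.
  by apply: isom_E1 => a b; rewrite !K L.
have D x y : dot (g' *m x) (g' *m y) = dot x y.
  have K2 v : g' *m v = E2 *m (toR T *m (Ri *m v)) by rewrite /g' !mulmxA.
  by rewrite !K2 L2 !(mulmxA E2 Ri) E2_Ri !mul1mx.
apply/matrixP => i j; have := D (delta_mx i 0) (delta_mx j 0).
rewrite !dot_mx trmx_mul -mulmxA (mulmxA g'^T) !trmx_delta -rowE -colE.
by rewrite -rowE [_ 0 0]mxE [X in X = _]mxE [X in _ = X]mxE => ->; rewrite !mxE eqxx andbT eq_sym.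
Qed.

(** [- T] induces [- g] and [- g'], so the sign can be chosen to preserve the sheet. The modulus 1
    imposes no congruence. *)
Lemma arith_pm T T' g g' : T *m T' = 1%:M -> isom g -> g'^T *m g' = 1%:M ->
  g *m E1 = E1 *m toR T -> g' *m E2 = E2 *m toR T -> arith 1 g \/ arith 1 (- g).
Proof.
move=> TT gi gg gE gE2.
have A h h' S S' : oplus h -> h'^T *m h' = 1%:M -> S *m S' = 1%:M -> h *m E1 = E1 *m toR S -> h' *m E2 = E2 *m toR S -> arith 1 h.
  by move=> ho hh SS hE hE2; split => //; exists h', S, S', (S - 1%:M); split => //; rewrite scale1r addrC subrK.
have [go|gn] := ltP 0 (g ord_max ord_max); first by left; apply: A gg TT gE gE2; split.
right; apply: (A _ (- g') (- T) (- T')); rewrite ?toRN ?mulNmx ?mulmxN ?gE ?gE2 ?mulNmx ?opprK //.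
  have hb := base_hyp (R := R) (n := n); split; first by move=> x; rewrite mulNmx lorentzNl lorentzNr opprK gi.
  rewrite mxE oppr_gt0 lt_neqAle gn andbT; apply/eqP => g0.
  have := gi base_point; have [-> _] := hb; rewrite lorentz_sqr mul_base g0 expr0n /= subr0 => H.
  have : 0 <= \sum_(i < n) (g *m (base_point : 'cV[R]_N)) (lift ord_max i) 0 ^+ 2 by apply: sumr_ge0 => i _; exact: sqr_ge0.
  by rewrite H lerNr oppr0 ler10.
by rewrite linearN mulNmx opprK.
Qed.

End ArithmeticGroup.

(** * Integral roots, their separation, discreteness and cocompactness *)

Section IntegralWalls.
Context {R : realType} {n : nat}.
Local Notation N := n.+1.
Local Notation E1 := (@E1 R n).
Local Notation E2 := (@E2 R n).
Local Notation Ri := (@Ri R n).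
Local Notation e1 := (@e1 R n).
Local Notation e2 := (@e2 R n).
Local Notation s2 := (@s2 R).
Local Notation lorJ := (@lorJ R n).
Implicit Types (x y w : 'cV[R]_N) (g h : 'M[R]_N) (z u : 'cV[int]_(N + N)) (T : 'M[int]_(N + N)).

Lemma dotDl x y w : dot (x + y) w = dot x w + dot y w.
Proof. by rewrite !dotE lorentzDl mxE; ring. Qed.

Lemma dotZl (c : R) x w : dot (c *: x) w = c * dot x w.
Proof. by rewrite !dotE lorentzZl mxE; ring. Qed.

Lemma dotNl x w : dot (- x) w = - dot x w.
Proof. by rewrite -scaleN1r dotZl mulN1r. Qed.

Lemma dotDr x y w : dot w (x + y) = dot w x + dot w y.
Proof. by rewrite !(dotC w) dotDl. Qed.

Lemma dotZr (c : R) x w : dot w (c *: x) = c * dot w x.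
Proof. by rewrite !(dotC w) dotZl. Qed.

Lemma dotNr x w : dot w (- x) = - dot w x.
Proof. by rewrite !(dotC w) dotNl. Qed.

Definition dot_lin := (dotDl, dotDr, dotZl, dotZr, dotNl, dotNr).

(** Norm 1 over Z[sqrt 2], expressed in both embeddings. Having norm 1 makes the reflection
    integral. *)
Definition iroot z : Prop := lorentz (e1 z) (e1 z) = 1 /\ dot (e2 z) (e2 z) = 1.

(** Multiplication by sqrt 2: it sends a + sqrt 2 b to 2 b + sqrt 2 a. *)
Definition mul_s2 z : 'cV[int]_(N + N) := col_mx (dsubmx z + dsubmx z) (usubmx z).

Lemma e1_mul_s2 z : e1 (mul_s2 z) = s2 *: e1 z.
Proof.
apply/matrixP => i j; rewrite (ord1 j) [RHS]mxE !e1E /mul_s2 col_mxEu col_mxEd !mxE intrD.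
have := s2_sqr (R := R); rewrite expr2; move: (_ _ _)%:~R (_ _ _)%:~R s2 => a b s H; ring: H.
Qed.

Lemma e2_mul_s2 z : e2 (mul_s2 z) = - s2 *: e2 z.
Proof.
apply/matrixP => i j; rewrite (ord1 j) [RHS]mxE !e2E /mul_s2 col_mxEu col_mxEd !mxE intrD.
have := s2_sqr (R := R); rewrite expr2; move: (_ _ _)%:~R (_ _ _)%:~R s2 => a b s H; ring: H.
Qed.

(** Integral matrix of the rank-one map sending x to (z, x) z, for the pairing with values in
    Z[sqrt 2]. *)
Definition root_mx z : 'M[int]_(N + N) := z *m (z^T *m Pm) + mul_s2 z *m (z^T *m Qm).

Lemma root_mx_act z (a : 'cV[R]_(N + N)) : toR (root_mx z) *m a =
  ((toR z)^T *m toR Pm *m a) 0 0 *: toR z + ((toR z)^T *m toR Qm *m a) 0 0 *: toR (mul_s2 z).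
Proof.
rewrite /root_mx toRD !toRM mulmxDl -!toR_tr -!mulmxA.
move: ((toR z)^T *m (toR Pm *m a)) ((toR z)^T *m (toR Qm *m a)) => A B.
by rewrite [A]mx11_scalar [B]mx11_scalar !mul_mx_scalar !mxE !mulr1n.
Qed.

Lemma refl_arith z : iroot z -> arith 1 (refl (e1 z)).
Proof.
move=> [z1 z2]; pose T : 'M[int]_(N + N) := 1%:M - (root_mx z + root_mx z).
pose g' : 'M[R]_N := 1%:M - 2 *: (e2 z *m (e2 z)^T).
have g'E x : g' *m x = x - (2 * dot (e2 z) x) *: e2 z.
  rewrite /g' mulmxBl mul1mx -scalemxAl -mulmxA -scalerA; congr (_ - _ *: _).
  by rewrite [(e2 z)^T *m x]mx11_scalar mul_mx_scalar dot_mx.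
have TE a : toR T *m a = a - (toR (root_mx z) *m a + toR (root_mx z) *m a).
  by rewrite /T toRD toRN toRD toR1 mulmxBl mul1mx mulmxDl.
have LE a : lorentz (e1 z) (E1 *m a) =
    ((toR z)^T *m toR Pm *m a) 0 0 + s2 * ((toR z)^T *m toR Qm *m a) 0 0.
  by rewrite /e1 lorentz_E1 mulmxDr mulmxDl mxE -scalemxAr -scalemxAl [X in _ + X]mxE.
have DE a : dot (e2 z) (E2 *m a) =
    ((toR z)^T *m toR Pm *m a) 0 0 - s2 * ((toR z)^T *m toR Qm *m a) 0 0.
  by rewrite /e2 dot_E2 mulmxBr mulmxBl mxE -scalemxAr -scalemxAl [X in _ + X]mxE [X in _ - X]mxE.
have gE : refl (e1 z) *m E1 = E1 *m toR T.
  apply: mx_col_eq => a; rewrite -[LHS]mulmxA -[RHS]mulmxA refl_unitE // TE root_mx_act.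
  rewrite mulmxBr !mulmxDr -!scalemxAr.
  rewrite (e1_mul_s2 z : E1 *m toR (mul_s2 z) = s2 *: (E1 *m toR z)).
  rewrite LE.
  rewrite !scalerA -scalerDl -scalerDl; congr (_ - _ *: _); ring.
have gE2 : g' *m E2 = E2 *m toR T.
  apply: mx_col_eq => a; rewrite -[LHS]mulmxA -[RHS]mulmxA g'E TE root_mx_act.
  rewrite mulmxBr !mulmxDr -!scalemxAr.
  rewrite (e2_mul_s2 z : E2 *m toR (mul_s2 z) = - s2 *: (E2 *m toR z)).
  rewrite DE.
  rewrite !scalerA -scalerDl -scalerDl; congr (_ - _ *: _); ring.
split; first exact: refl_unit_oplus.
exists g', T, T, (T - 1%:M); split => //.
- have gs : g'^T = g'.
    by rewrite /g' linearB /= trmx1 linearZ /= trmx_mul trmxK.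
  rewrite gs; apply: mx_col_eq => x; rewrite -mulmxA !g'E mul1mx.
  have -> : dot (e2 z) (x - (2 * dot (e2 z) x) *: e2 z) = - dot (e2 z) x.
    by rewrite !dot_lin z2; ring.
  by rewrite mulrN scaleNr opprK subrK.
- apply: (@E1_mx_inj R n); rewrite toRM mulmxA -gE -mulmxA -gE mulmxA reflK ?z1 ?oner_neq0 //.
  by rewrite mul1mx toR1 mulmx1.
- by rewrite scale1r addrC subrK.
Qed.

Lemma irootN z : iroot z -> iroot (- z).
Proof. by rewrite /iroot e1N e2N lorentzNl lorentzNr !dot_lin !opprK. Qed.

Lemma e2_norm_gt0 z : z != 0 -> 0 < dot (e2 z) (e2 z).
Proof.
move=> z0; rewrite lt_neqAle dot_ge0 andbT eq_sym; apply: contra z0 => /eqP/dot_eq0 H.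
apply/eqP/(@e2_inj R n); rewrite H.
have := @e2D R n 0 0; rewrite addr0 => /eqP; rewrite -subr_eq0 opprD addrA subrr sub0r oppr_eq0.
by move=> /eqP ->.
Qed.

Lemma norm_form_ge1 z : z != 0 -> 1 <= `|lorentz (e1 z) (e1 z)| * dot (e2 z) (e2 z).
Proof.
move=> z0; have := e2_norm_gt0 z0 => h; rewrite -(gtr0_norm h) lorentz_e1; move: h; rewrite dot_e2 => h.
apply: s2_norm; apply/negP => /negP; rewrite negb_or !negbK => /andP[/eqP p0 /eqP s0].
by move: h; rewrite p0 s0 mulr0 subr0 ltxx.
Qed.

(** If u - z = q k with k nonzero, the conjugates of [z] and [u] are Euclidean unit vectors, so that
    of [k] has square norm at most 4 / q^2. The norm inequality then forces the Lorentz norm of [k]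
    to be at least q^2 / 4 in absolute value, and q^2 times that norm is 2 - 2 <z,u>. *)
Lemma iroot_separation (q : nat) z u k : (0 < q)%N -> iroot z -> iroot u -> u = z + q%:Z *: k ->
  u = z \/ q%:R ^+ 4 / 8 - 1 <= `|lorentz (e1 z) (e1 u)|.
Proof.
move=> q0 [z1 z2] [u1 u2] uE; have [k0|k0] := eqVneq k 0; first by left; rewrite uE k0 scaler0 addr0.
right; have := norm_form_ge1 k0; have := e2_norm_gt0 k0.
have dE : u - z = q%:Z *: k by rewrite uE addrC addKr.
have L : q%:R ^+ 2 * lorentz (e1 k) (e1 k) = 2 - 2 * lorentz (e1 z) (e1 u).
  have := congr1 (fun v => lorentz (e1 v) (e1 v)) dE.
  rewrite e1Z e1D e1N !lorentzE u1 z1 (lorentzC (e1 u)) => H.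
  have <- : q%:Z%:~R = q%:R :> R by [].
  rewrite expr2 -mulrA -H; ring.
have D : q%:R ^+ 2 * dot (e2 k) (e2 k) <= 4.
  have h0 := dot_ge0 (e2 u + e2 z).
  have H1 : q%:R ^+ 2 * dot (e2 k) (e2 k) = 2 - 2 * dot (e2 z) (e2 u).
    have := congr1 (fun v => dot (e2 v) (e2 v)) dE.
    rewrite e2Z e2D e2N !dot_lin z2 u2 (dotC (e2 u)) => H.
    have <- : q%:Z%:~R = q%:R :> R by [].
    rewrite expr2 -mulrA -H; ring.
  have H2 : dot (e2 u + e2 z) (e2 u + e2 z) = 2 + 2 * dot (e2 z) (e2 u).
    by rewrite !dot_lin z2 u2 (dotC (e2 u)); ring.
  by rewrite H1; move: h0; rewrite H2; lra.
have Q1 : 1 <= q%:R ^+ 2 :> R by rewrite expr_ge1 // ler1n.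
have -> : q%:R ^+ 4 = (q%:R ^+ 2) ^+ 2 :> R by rewrite -exprM.
move: (q%:R ^+ 2) (lorentz (e1 z) (e1 u)) Q1 L D => Q bet Q1 L D.
move: (lorentz (e1 k) (e1 k)) (dot (e2 k) (e2 k)) L D => a b L D b0 ab.
have H1 : Q <= 4 * `|a|.
  have : Q * 1 <= Q * (`|a| * b) by rewrite ler_wpM2l // (le_trans ler01).
  by have := normr_ge0 a; nra.
have H2 : `|Q * a| <= 2 + 2 * `|bet|.
  rewrite L ler_norml; have := ler_norm bet; have := ler_norm (- bet); rewrite normrN.
  by move: `|bet| => w h1 h2; apply/andP; split; lra.
rewrite normrM ger0_norm ?(le_trans ler01) // in H2.
have : Q * Q <= Q * (4 * `|a|) by rewrite ler_wpM2l // (le_trans ler01).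
by rewrite [Q ^+ 2]expr2; lra.
Qed.

Lemma mulmx_entry_bound (m p k : nat) (A : 'M[R]_(m, p)) (B : 'M[R]_(p, k)) (c : R) i j :
  (forall i j, `|A i j| <= c) -> `|(A *m B) i j| <= c * \sum_l \sum_r `|B l r|.
Proof.
move=> Ac; rewrite mxE; apply: le_trans (ler_norm_sum _ _ _) _; rewrite mulr_sumr; apply: ler_sum => l _.
rewrite normrM; apply: ler_pM => //.
by rewrite (bigD1 j) //= lerDl sumr_ge0.
Qed.

Lemma orthogonal_entry (g : 'M[R]_N) i j : g^T *m g = 1%:M -> `|g i j| <= 1.
Proof.
move=> gg; have : (g^T *m g) j j = 1 by rewrite gg mxE eqxx.
rewrite mxE (bigD1 i) //= mxE -expr2 => H.
rewrite -ler_sqr ?nnegrE // expr1n real_normK ?num_real // -H lerDl sumr_ge0 // => k _.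
by rewrite mxE -expr2 sqr_ge0.
Qed.

(** The height bounds the entries of [g], orthogonality those of its conjugate; together they bound
    the integral matrix [T]. *)
Lemma finite_arith_ball (r : R) : finite_set [set g : 'M[R]_N | arith 1 g /\ g ord_max ord_max <= r].
Proof.
pose c1 := (1 + 2 * r) * \sum_l \sum_r `|E1 l r|; pose c2 := 1 * \sum_l \sum_r `|E2 l r|.
pose c := Num.max c1 c2.
apply: (@sub_finite_set _ _ ((fun T => E1 *m toR T *m Ri) @`
   [set T : 'M[int]_(N + N) | forall i j, `|T i j| <= (Num.truncn c).+1%:Z])); last first.
  by apply: finite_image; exact: finite_int_box.
move=> g [[go [g' [T [T' [Y [gg TT TY gE gE2]]]]]] gr]; exists T; last by rewrite -gE -mulmxA E1_Ri mulmx1.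
move=> i j; have -> : T i j = (col j T) i 0 by rewrite mxE.
have C (B : 'M[R]_(N, N + N)) (k : 'I_N) : (B *m toR (col j T)) k 0 = (B *m toR T) k j.
  by rewrite !mxE; apply: eq_bigr => l _; rewrite !mxE.
apply: (@lattice_box_bound R n) => k l; rewrite (ord1 l).
  rewrite /e1 C -gE; apply: le_trans (mulmx_entry_bound _ _ _ _) _.
    by move=> a b; exact: oplus_entry_bound.
  rewrite le_max; apply/orP; left; rewrite ler_wpM2r ?sumr_ge0 // => [s _|]; first exact: sumr_ge0.
  by rewrite lerD2l ler_wpM2l.
rewrite /e2 C -gE2; apply: le_trans (mulmx_entry_bound _ _ _ _) _.
  by move=> a b; exact: orthogonal_entry.
by rewrite le_max; apply/orP; right.
Qed.

(** Pigeonhole scheme shared by the cocompactness proofs: attach to each point one of finitely many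
    types, and bound each type separately. *)
Lemma finite_bound (T : choiceType) (X : Type) (F : set T) (P : X -> T -> Prop) (Q : X -> R -> Prop) :
  finite_set F -> (forall a c c', Q a c -> c <= c' -> Q a c') ->
  (forall t, F t -> exists c, forall a, P a t -> Q a c) ->
  exists c, forall a t, F t -> P a t -> Q a c.
Proof.
move=> Ff mono.
have /finite_seqP[s ->] := Ff; elim: s => [|a s IH] H; first by exists 0 => b t.
have [|c Hc] := IH; first by move=> t ts; apply: H; rewrite /= inE ts orbT.
have [|c' Hc'] := H a; first by rewrite /= inE eqxx.
exists (Num.max c c') => b t /=; rewrite inE => /orP[/eqP -> /Hc' h|ts /(Hc _ _ ts) h]; apply: mono h _.
  by rewrite le_max lexx orbT.
by rewrite le_max lexx.
Qed.

Lemma hyp_transitive x : hyp x -> exists2 h, oplus h & h *m x = base_point.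
Proof.
move=> hx; have hb := base_hyp (R := R) (n := n).
have E : lorentz (x - base_point) (x - base_point) = 2 * tau x base_point - 2.
  by rewrite !lorentzE hx.1 hb.1 (lorentzC base_point) /tau; ring.
have := tau_ge1 hx hb; rewrite le_eqVlt => /orP[/eqP t1|t1].
  exists 1%:M; first exact: oplus1.
  rewrite mul1mx; apply/eqP; rewrite -subr_eq0; apply/eqP.
  apply: (perp_hyp_eq0 hb); last by rewrite E -t1; ring.
  by rewrite lorentzDr lorentzNr hb.1 lorentzC -[lorentz x _]opprK -/(tau x base_point) -t1; ring.
have p : 0 < lorentz (x - base_point) (x - base_point) by rewrite E; lra.
exists (refl (x - base_point)); first exact: refl_oplus.
by apply: refl_swap; rewrite ?gt_eqF // hx.1 hb.1.
Qed.

Lemma dot_entry x i : x i 0 ^+ 2 <= dot x x.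
Proof. by rewrite /dot (bigD1 i) //= -expr2 lerDl sumr_ge0 // => j _; rewrite -expr2 sqr_ge0. Qed.

Lemma dot_entry_le x i (r : R) : dot x x <= r -> `|x i 0| <= r + 1.
Proof.
move=> xr; have := le_trans (dot_entry x i) xr; rewrite -[_ ^+ 2]real_normK ?num_real //.
by move: `|x i 0| (normr_ge0 (x i 0)) => a a0 H; nra.
Qed.

Lemma lorentz_dot_lorJ x y : lorentz x y = dot (lorJ *m x) y.
Proof. by rewrite lorentz_mx dot_mx. Qed.

Lemma dot_lorJ x : dot (lorJ *m x) (lorJ *m x) = dot x x.
Proof. by rewrite !dot_mx trmx_mul lorJT -mulmxA (mulmxA lorJ) lorJK mul1mx. Qed.

Lemma dot_le_dot x y : 2 * `|dot x y| <= dot x x + dot y y.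
Proof.
have := dot_ge0 (x + y); have := dot_ge0 (x - y); rewrite !dot_lin (dotC y x) => h1 h2.
by case: ger0P => _; lra.
Qed.

Lemma lorentz_le_dot x y : 2 * `|lorentz x y| <= dot x x + dot y y.
Proof. by rewrite lorentz_dot_lorJ -(dot_lorJ x) dot_le_dot. Qed.

Lemma lorentz_combination m (A : 'M[R]_(N, m)) (k : 'cV[R]_m) y :
  lorentz y (A *m k) = \sum_i lorentz y (col i A) * k i 0.
Proof.
rewrite lorentz_mx mulmxA mxE; apply: eq_bigr => i _; congr (_ * _).
by rewrite lorentz_mx !mxE; apply: eq_bigr => j _; rewrite !mxE.
Qed.

Lemma isom_det_sqr h : isom h -> \det h ^+ 2 = 1.
Proof.
move=> /isom_mx/(congr1 (fun M : 'M[R]_N => \det M)); rewrite !det_mulmx det_tr det1.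
have := congr1 (fun M : 'M[R]_N => \det M) (lorJK (R := R) (n := n)); rewrite det_mulmx det1 => JJ.
by move=> H; rewrite expr2 -[RHS]H; ring: JJ.
Qed.

Section Cocompact.

Let C := projT1 (cid (@hermite_reduction R (N + N) 1 (\det (col_mx E1 E2) ^+ 2) ltr01 (sqr_ge0 _))).

(** Apply Hermite reduction to the definite form |h e1 z|^2 + |e2 z|^2, where [h] moves [x] to the
    base point. Its minimum is at least 1 by the norm inequality, and its determinant does not
    depend on [x]. *)
Lemma reduced_basis x : hyp x -> exists U U' : 'M[int]_(N + N), exists h, 
  [/\ U *m U' = 1%:M, oplus h, h *m x = base_point & forall i,
   dot (h *m e1 (col i U)) (h *m e1 (col i U)) + dot (e2 (col i U)) (e2 (col i U)) <= C].
Proof.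
move=> hx; have [h ho hxo] := hyp_transitive hx; have hi := oplus_isom ho.
pose M : 'M[R]_(N + N) := col_mx (h *m E1) E2.
have qE z : qform (M^T *m M) (toR z) = dot (h *m e1 z) (h *m e1 z) + dot (e2 z) (e2 z).
  rewrite /qform mulmxA -trmx_mul -mulmxA /M mul_col_mx tr_col_mx mul_row_col mxE -!dot_mx /e1 /e2.
  by rewrite mulmxA.
have [A1 A2 A3 A4] : [/\ (M^T *m M)^T = M^T *m M,
  forall r, finite_set [set z | qform (M^T *m M) (toR z) <= r],
  forall z, z != 0 -> 1 <= qform (M^T *m M) (toR z) & \det (M^T *m M) <= \det (col_mx E1 E2) ^+ 2].
  split.
  - by rewrite trmx_mul trmxK.
  - move=> r; set c := 1 + 2 * invmx h ord_max ord_max; set b := r + 1.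
    pose d := c * \sum_(l < N) \sum_(k < 1) b.
    apply: sub_finite_set (finite_lattice_box (R := R) (n := n) (Num.max d b)) => z /=; rewrite qE => Hz.
    have H1 : dot (h *m e1 z) (h *m e1 z) <= r by have := dot_ge0 (e2 z); lra.
    have H2 : dot (e2 z) (e2 z) <= r by have := dot_ge0 (h *m e1 z); lra.
    split => i j; rewrite (ord1 j) le_max; last by rewrite (dot_entry_le _ H2) orbT.
    apply/orP; left; rewrite -[e1 z](isom_invK _ hi).
    have io := oplusV ho; apply: le_trans (mulmx_entry_bound _ _ _ _) _.
      by move=> a k; exact: oplus_entry_bound.
    rewrite ler_wpM2l // ?addr_ge0 ?mulr_ge0 //; first by case: io => _ /ltW.
    by apply: ler_sum => l _; apply: ler_sum => k _; rewrite (ord1 k); exact: dot_entry_le.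
  - move=> z z0; rewrite qE; have := norm_form_ge1 z0; have := dot_ge0 (e2 z).
    have := lorentz_le_dot (h *m e1 z) (h *m e1 z); rewrite hi.
    by move: `|_| (dot _ _) (dot _ _) (normr_ge0 (lorentz (e1 z) (e1 z))) => a b c a0 H c0 ac; nra.
  - have -> : M = block_mx h 0 0 1%:M *m col_mx E1 E2.
      by rewrite mul_block_col !mul0mx addr0 add0r mul1mx.
    rewrite det_mulmx det_tr det_mulmx det_ublock det1 mulr1 -expr2 exprMn isom_det_sqr //.
    by rewrite mul1r.
have [U [U' [UU HU]]] := projT2 (cid (@hermite_reduction R (N + N) 1 (\det (col_mx E1 E2) ^+ 2) ltr01 (sqr_ge0 _))) _ A1 A2 A3 A4.
by exists U, U', h; split => // i; rewrite -qE.
Qed.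

Let k := (Num.truncn (C + C)).+1.

Lemma reduced_form_bound (U : 'M[int]_(N + N)) h : oplus h -> (forall i,
   dot (h *m e1 (col i U)) (h *m e1 (col i U)) + dot (e2 (col i U)) (e2 (col i U)) <= C) ->
  forall i j, `|pform (col i U) (col j U)| <= k%:Z /\ `|sform (col i U) (col j U)| <= k%:Z.
Proof.
move=> ho H i j; move: (col i U) (col j U) (H i) (H j) => {}z u Hz Hu.
have hi := oplus_isom ho.
have L := lorentz_le_dot (h *m e1 z) (h *m e1 u); rewrite isom_lorentz // lorentz_e1 in L.
have D := dot_le_dot (e2 z) (e2 u); rewrite [in `|_|]dot_e2 in D.
have z1 := dot_ge0 (e2 z); have z2 := dot_ge0 (h *m e1 z).
have u1 := dot_ge0 (e2 u); have u2 := dot_ge0 (h *m e1 u).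
have kC : C + C <= k%:R by apply/ltW/truncnS_gt.
have s1 := s2_ge1 (R := R).
rewrite -!(ler_int R) !intr_norm.
have -> : k%:Z%:~R = k%:R :> R by [].
move: (pform z u)%:~R (sform z u)%:~R kC L D => p s kC L D.
have [d1 d2] : `|p + s2 * s| <= C /\ `|p - s2 * s| <= C by split; lra.
have pk : `|p| <= C by move: d1 d2; rewrite !ler_norml => /andP[? ?] /andP[? ?]; apply/andP; split; lra.
have sk : `|s2 * s| <= C by move: d1 d2; rewrite !ler_norml => /andP[? ?] /andP[? ?]; apply/andP; split; lra.
split; first by have := normr_ge0 p; lra.
apply: le_trans kC; rewrite normrM ger0_norm in sk; last by lra.
by have := normr_ge0 s; nra.
Qed.

(** The integral Gram matrices of reduced bases take finitely many values. If [x] and [x0] have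
    bases U and V with equal Gram matrices, V U^-1 is an integral isometry [g], and it moves [x] to
    a bounded distance from the base point. *)
Lemma arith1_cocompact : exists c, forall x, hyp x -> exists g, arith 1 g /\ tau (g *m x) base_point <= c.
Proof.
pose P x (t : 'M[int]_(N + N) * 'M[int]_(N + N)) := hyp x /\ exists U U' : 'M[int]_(N + N),
  [/\ U *m U' = 1%:M, t = (U^T *m Pm *m U, U^T *m Qm *m U) &
   forall i, `|lorentz x (e1 (col i U))| <= C + 1].
pose box := [set A : 'M[int]_(N + N) | forall i j, `|A i j| <= k%:Z].
have [||t _|c Hc] := @finite_bound _ _ (box `*` box) P (fun x c => exists g, arith 1 g /\ tau (g *m x) base_point <= c).
- by apply: finite_setX; exact: finite_int_box.
- by move=> x c c' [g [ga gc]] cc; exists g; split => //; exact: le_trans cc.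
- have [[x0 [hx0 [V [V' [VV tV _]]]]]|N0] := pselect (exists x, P x t); last first.
    by exists 0 => x Px; exfalso; apply: N0; exists x.
  (* Coordinates of the base point in the basis of [x0]. As [g] carries the basis of [x] to that of
     [x0], the pairing of [g *m x] with the base point is a combination of the bounded pairings of
     [x] with its own basis. *)
  pose ka := toR V' *m (Ri *m (base_point : 'cV[R]_N)).
  have kaE : E1 *m toR V *m ka = base_point.
    by rewrite -mulmxA (mulmxA (toR V)) -toRM VV toR1 mul1mx mulmxA E1_Ri mul1mx.
  exists (\sum_i (C + 1) * `|ka i 0|) => x [hx [U [U' [UU tU xU]]]].
  have UU' : U' *m U = 1%:M by apply: mulmx1C.
  pose T := V *m U'.
  have TT : T *m (U *m V') = 1%:M by rewrite -mulmxA (mulmxA U') UU' mul1mx.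
  have F (A : 'M[int]_(N + N)) : U^T *m A *m U = V^T *m A *m V -> T^T *m A *m T = A.
    move=> H; rewrite /T trmx_mul -!mulmxA (mulmxA V^T) (mulmxA _ V) -H !mulmxA -trmx_mul UU trmx1 mul1mx.
    by rewrite -mulmxA UU mulmx1.
  have [tP tQ] : U^T *m Pm *m U = V^T *m Pm *m V /\ U^T *m Qm *m U = V^T *m Qm *m V.
    by have := tU; rewrite tV => -[-> ->].
  have [g [g' [gi gg gE gE2]]] := @gram_descend R n _ _ TT (F _ tP) (F _ tQ).
  have B : `|lorentz (g *m x) base_point| <= \sum_i (C + 1) * `|ka i 0|.
    rewrite -kaE lorentz_combination; apply: le_trans (ler_norm_sum _ _ _) _; apply: ler_sum => i _.
    rewrite normrM ler_wpM2r //.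
    have -> : col i (E1 *m toR V) = g *m e1 (col i U).
      rewrite /e1 mulmxA gE -mulmxA -toRM /T -mulmxA.
      have -> : U' *m col i U = delta_mx i 0 by rewrite colE mulmxA UU' mul1mx.
      by apply/matrixP => a b; rewrite -colE !mxE; apply: eq_bigr => l _; rewrite !mxE.
    by rewrite isom_lorentz.
  have [ga|ga] := arith_pm TT gi gg gE gE2; [exists g|exists (- g)]; split => //.
    by apply: le_trans B; rewrite /tau -normrN ler_norm.
  by apply: le_trans B; rewrite /tau mulNmx lorentzNl opprK ler_norm.
exists c => x hx; have [U [U' [h [UU ho hxo HU]]]] := reduced_basis hx.
apply: (Hc x (U^T *m Pm *m U, U^T *m Qm *m U)).
  have E (A : 'M[int]_(N + N)) i j : (U^T *m A *m U) i j = ((col i U)^T *m A *m col j U) 0 0.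
    by rewrite !mxE; apply: eq_bigr => a _; rewrite !mxE; congr (_ * _); apply: eq_bigr => b _; rewrite !mxE.
  by split => i j /=; rewrite E; have [] := reduced_form_bound ho HU i j.
split => //; exists U, U'; split => // i.
rewrite -(isom_lorentz _ _ (oplus_isom ho)) hxo lorentz_base normrN.
by apply: dot_entry_le; have := HU i; have := dot_ge0 (e2 (col i U)); lra.
Qed.
End Cocompact.
End IntegralWalls.

(** * The walls and their labels *)

Section Walls.
Context {R : realType} {n : nat}.
Local Notation N := n.+1.
Local Notation e1 := (@e1 R n).
Local Notation e2 := (@e2 R n).
Local Notation s2 := (@s2 R).
Local Notation iroot := (@iroot R n).
Implicit Types (x y w v : 'cV[R]_N) (g h : 'M[R]_N) (z u : 'cV[int]_(N + N)).

(* x_1 + 2^(1/4) x_{n+1} with x_1 = 3 + 2 sqrt 2, x_{n+1} = 2 + 2 sqrt 2 has relative norm 1; since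
   x_{n+1} is not 0, the wall of this vector misses base_point. *)
Definition zv : 'cV[int]_(N + N) :=
  col_mx (\col_i if i == ord_max then 2 else if i == ord0 then 3 else 0)
         (\col_i if i == ord_max then 2 else if i == ord0 then 2 else 0).

Lemma root_zv : (0 < n)%N -> iroot zv.
Proof.
move=> n0; pose i0 := Ordinal n0; have l0 : lift ord_max i0 = ord0 :> 'I_N.
  by apply: val_inj; rewrite /= /bump leqNgt n0.
have ln (i : 'I_n) : (lift ord_max i == ord_max :> 'I_N) = false by rewrite eq_sym -[RHS](negbTE (neq_lift ord_max i)).
have ss := s2_sqr (R := R).
have c0 i : wscale (lift ord_max i : 'I_N) = 1 :> R by rewrite /wscale ln.
have cn := wscale_max_sqr (R := R) (n := n).
have z1 (i : 'I_n) : i != i0 -> (lift ord_max i == ord0 :> 'I_N) = false.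
  by move=> ii; rewrite -l0 (inj_eq (@lift_inj _ _)) (negbTE ii).
have E1i (i : 'I_n) : i != i0 -> e1 zv (lift ord_max i) 0 = 0.
  by move=> ii; rewrite e1E /zv col_mxEu col_mxEd !mxE ln z1 // mulr0 addr0 mulr0.
have E2i (i : 'I_n) : i != i0 -> e2 zv (lift ord_max i) 0 = 0.
  by move=> ii; rewrite e2E /zv col_mxEu col_mxEd !mxE ln z1 // mulr0 subr0 mulr0.
have E10 : e1 zv (lift ord_max i0) 0 = 3 + 2 * s2.
  by rewrite e1E /zv col_mxEu col_mxEd !mxE c0 ln l0 eqxx mul1r mulrC.
have E20 : e2 zv (lift ord_max i0) 0 = 3 - 2 * s2.
  by rewrite e2E /zv col_mxEu col_mxEd !mxE c0 ln l0 eqxx mul1r mulrC.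
have E1n : e1 zv ord_max 0 = wscale (ord_max : 'I_N) * (2 + 2 * s2).
  by rewrite e1E /zv col_mxEu col_mxEd !mxE eqxx (mulrC s2).
have E2n : e2 zv ord_max 0 = wscale (ord_max : 'I_N) * (2 - 2 * s2).
  by rewrite e2E /zv col_mxEu col_mxEd !mxE eqxx (mulrC s2).
have S f : (forall i : 'I_n, i != i0 -> f i = 0) -> \sum_i f i = f i0 :> R.
  by move=> H; rewrite (bigD1 i0) //= big1 ?addr0.
have X1 : lorentz (e1 zv) (e1 zv) = 1.
  rewrite lorentz_sqr S => [|i ii]; last by rewrite E1i // expr0n.
  by rewrite E10 E1n exprMn cn; move: s2 ss => s; rewrite expr2 => ss; ring: ss.
split => //; rewrite dotE lorentz_sqr S => [|i ii]; last by rewrite E2i // expr0n.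
rewrite E20 E2n; move: (wscale _) cn => c; move: s2 ss => s; rewrite !expr2 => ss cc; ring: ss cc.
Qed.

Definition congv (q : nat) z : Prop := exists k, z = zv + q%:Z *: k \/ z = - zv + q%:Z *: k.

Definition wall (q : nat) : set 'cV[R]_N := [set v | exists z, [/\ v = e1 z, iroot z & congv q z]].

Lemma wall_unit q v : wall q v -> lorentz v v = 1.
Proof. by move=> [z [-> [z1 _] _]]. Qed.

Lemma wall_zv q : (0 < n)%N -> wall q (e1 zv).
Proof. by move=> n0; exists zv; split => //; [exact: root_zv | exists 0; left; rewrite scaler0 addr0]. Qed.

Lemma wallN q v : wall q v -> wall q (- v).
Proof.
move=> [z [-> zr [k zk]]]; exists (- z); split; [by rewrite e1N | exact: irootN | exists (- k)].
by case: zk => ->; [right|left]; rewrite opprD scalerN ?opprK.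
Qed.

(** The bound of [iroot_separation]. It exceeds 1, so that distinct walls are disjoint, from q = 3
    on. *)
Definition sep (q : nat) : R := q%:R ^+ 4 / 8 - 1.

Lemma wall_sep q v w : (0 < q)%N -> wall q v -> wall q w ->
  [\/ v = w, v = - w | sep q <= `|lorentz v w|].
Proof.
move=> q0 [z [-> zr zk]] [u [-> ur uk]].
have [k [E|E]] : exists k, z = u + q%:Z *: k \/ z = - u + q%:Z *: k.
  case: zk => k kE; case: uk => l lE.
  move: zv kE lE => a kE lE.
  have ring_mx (c d : 'cV[int]_(N + N)) : (forall i, c i 0 = d i 0) -> c = d.
    by move=> H; apply/matrixP => i j; rewrite (ord1 j).
  case: kE => ->; case: lE => ->; [exists (k - l); left|exists (k + l); right|exists (k + l); right|exists (k - l); left];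
    apply: ring_mx => i; rewrite !mxE; ring.
- have [->|h] := iroot_separation q0 ur zr E; first by constructor 1.
  by constructor 3; rewrite lorentzC.
- have [->|h] := iroot_separation q0 (irootN ur) zr E; first by constructor 2; rewrite e1N.
  by constructor 3; rewrite lorentzC -normrN -lorentzNl -e1N.
Qed.

Lemma wall_arith q g v : arith q g -> wall q v -> wall q (g *m v).
Proof.
move=> ga [z [-> [z1 z2] zk]]; have gi := arith_isom ga.
have [T [Y [-> gE gE2]]] := arith_e1 ga.
exists ((1%:M + q%:Z *: Y) *m z); split => //.
  by split; rewrite ?gE2 // -gE isom_lorentz.
rewrite mulmxDl mul1mx -scalemxAl.
by case: zk => k zE; exists (k + Y *m z); rewrite scalerDr !addrA; case: zE => <-; [left|right].
Qed.

Lemma wall_refl q v : wall q v -> arith 1 (refl v).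
Proof. by move=> [z [-> zr _]]; exact: refl_arith. Qed.

(** The rational part of the last coordinate of the root is 2 or -2 mod [q], hence nonzero for q >
    2, and sqrt 2 is irrational. *)
Lemma wall_base q v : (2 < q)%N -> wall q v -> lorentz v base_point != 0.
Proof.
move=> q2 [z [-> _ zk]]; rewrite lorentzC lorentz_base oppr_eq0 e1E mulf_neq0 //; first by rewrite gt_eqF ?wscale_gt0.
have H : (z (lshift N ord_max) 0) != 0.
  have zvE : zv (lshift N ord_max) 0 = 2 by rewrite /zv col_mxEu mxE eqxx.
  move: zk; rewrite /congv; move: zv zvE => a aE [k [->|->]]; rewrite !mxE aE; move: (k _ _) => m; apply/eqP => h.
    have : (q%:Z %| 2)%Z by apply/dvdzP; exists (- m); lia.
    by rewrite dvdzE /= => /dvdn_leq; lia.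
  have : (q%:Z %| 2)%Z by apply/dvdzP; exists m; lia.
  by rewrite dvdzE /= => /dvdn_leq; lia.
apply/eqP => h; have [] := @s2_indep R (z (lshift N ord_max) 0) (- z (rshift N ord_max) 0).
  by rewrite intrN mulrN opprK -[RHS]h.
by move=> h0; move: H; rewrite h0 eqxx.
Qed.

(** The second embedding has norm 1; in the first, the norm 1 and a bounded last coordinate bound
    all the others. *)
Lemma finite_wall q (r : R) : finite_set [set v | wall q v /\ `|lorentz v base_point| <= r].
Proof.
pose c := Num.max (2 + r ^+ 2) 2.
apply: (@sub_finite_set _ _ (e1 @` [set z | mx_box c (e1 z) /\ mx_box c (e2 z)])); last first.
  by apply: finite_image; exact: finite_lattice_box.
move=> v [[z [-> [z1 z2] _]] zr]; exists z => //; split => i j; rewrite (ord1 j) le_max.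
  have D : dot (e1 z) (e1 z) <= 1 + 2 * r ^+ 2.
    rewrite dotE z1; move: zr; rewrite lorentzC lorentz_base normrN => h.
    by rewrite -mulrA -expr2 -[_ ^+ 2]real_normK ?num_real //; have := normr_ge0 (e1 z ord_max 0); nra.
  apply/orP; left; have := le_trans (dot_entry (e1 z) i) D.
  rewrite -[_ ^+ 2]real_normK ?num_real //.
  by move: `|_| (normr_ge0 (e1 z i 0)) => a a0 H; nra.
apply/orP; right; have := dot_entry (e2 z) i; rewrite z2 -[_ ^+ 2]real_normK ?num_real //.
by move: `|_| (normr_ge0 (e2 z i 0)) => a a0 H; nra.
Qed.

Definition zof v : 'cV[int]_(N + N) := xget 0 [set z | e1 z = v].

Lemma zofK z : zof (e1 z) = z.
Proof. by apply: (@e1_inj R n); apply: (@xgetPex _ 0 [set u | e1 u = e1 z]); exists z. Qed.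

(** Residue of the root mod [M.+1]. Labels are the letters of the free product through which the
    endomorphism factors. *)
Definition lab (M : nat) v : 'cV['I_M.+1]_(N + N) := \col_i inord `|(zof v i ord0 %% M.+1%:Z)%Z|%N.

Lemma labE M z u : lab M (e1 z) = lab M (e1 u) <-> exists k, u = z + M.+1%:Z *: k.
Proof.
have b (a : int) : (`|(a %% M.+1%:Z)%Z| < M.+1)%N by have := ltz_mod a (isT : M.+1%:Z != 0); have := modz_ge0 a (isT : M.+1%:Z != 0); lia.
rewrite /lab !zofK; split => [H|[k ->]].
  have D i : (M.+1%:Z %| u i ord0 - z i ord0)%Z.
    have /matrixP/(_ i 0) := H; rewrite !mxE => /(congr1 val) /=; rewrite !inordK // => h.
    rewrite -eqz_mod_dvd; have := modz_ge0 (z i 0) (isT : M.+1%:Z != 0).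
    by have := modz_ge0 (u i 0) (isT : M.+1%:Z != 0); lia.
  exists (\col_i ((u i ord0 - z i ord0) %/ M.+1%:Z)%Z); apply/matrixP => i j; rewrite (ord1 j) !mxE.
  by rewrite mulrC divzK // addrC subrK.
by apply/matrixP => i j; rewrite !mxE addrC mulrC modzMDl.
Qed.

Lemma lab_arith M g v q : arith M.+1 g -> wall q v -> lab M (g *m v) = lab M v.
Proof.
move=> ga [z [-> zr _]]; have [T [Y [-> gE _]]] := arith_e1 ga; rewrite gE; apply/esym/labE.
by exists (Y *m z); rewrite mulmxDl mul1mx -scalemxAl.
Qed.

(** Walls with one label are congruent mod [M.+1], so their separation grows with [M] while the wall
    system, governed by [q], stays fixed. *)
Lemma lab_sep M v w q : wall q v -> wall q w -> lab M v = lab M w ->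
  v = w \/ sep M.+1 <= `|lorentz v w|.
Proof.
move=> [z [-> zr _]] [u [-> ur _]] /labE[k E].
by have [->|h] := iroot_separation (ltn0Sn M) zr ur E; [left|right].
Qed.
End Walls.

(** * Reduced words in free products of groups of order 2 *)

Section ReducedWords.
Variable T : eqType.
Implicit Types (u v : T) (a b : seq T).

(** Left multiplication of a reduced word by a letter of order 2; [nf] is then the normal form in
    the free product and [red] recognises it. *)
Definition push (S : eqType) (u : S) (a : seq S) :=
  if a is v :: b then if u == v then b else u :: a else [:: u].

Definition nf (S : eqType) (a : seq S) := foldr (@push S) [::] a.

Definition red (S : eqType) (a : seq S) := sorted (fun x y : S => x != y) a.

Lemma red_push u a : red a -> red (push u a).
Proof.
case: a => [//|v b] /=; case: eqP => [_|/eqP uv] h; first exact: path_sorted h.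
by rewrite /red /= uv.
Qed.

Lemma red_nf a : red (nf a).
Proof. by elim: a => // u a IH /=; exact: red_push. Qed.

Lemma push_push u a : red a -> push u (push u a) = a.
Proof.
case: a => [|v b] /=; first by rewrite eqxx.
have [->|uv] := eqVneq u v; last by rewrite /= eqxx.
by case: b => [//|w b] /= /andP[vw _]; rewrite (negbTE vw).
Qed.

Lemma nf_id a : red a -> nf a = a.
Proof.
elim: a => // u a IH h; rewrite /= IH; last exact: path_sorted h.
by case: a h {IH} => //= v a /andP[/negbTE ->].
Qed.

Lemma odd_push u a : odd (size (push u a)) = ~~ odd (size a).
Proof. by case: a => // v b /=; case: ifP => _ //=; rewrite negbK. Qed.

Lemma odd_nf a : odd (size (nf a)) = odd (size a).
Proof. by elim: a => // u a IH /=; rewrite odd_push IH. Qed.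

Lemma push_sub (P : T -> Prop) u a : P u -> (forall v, v \in a -> P v) ->
  forall v, v \in push u a -> P v.
Proof.
move=> Pu H v; case: a H => [|w b] H /=; first by rewrite inE => /eqP ->.
case: ifP => _ vb; first by apply: H; rewrite inE vb orbT.
by move: vb; rewrite inE => /orP[/eqP ->//|]; exact: H.
Qed.

Lemma nf_sub (P : T -> Prop) a : (forall v, v \in a -> P v) -> forall v, v \in nf a -> P v.
Proof.
elim: a => // u a IH H /=; apply: push_sub; first by apply: H; rewrite inE eqxx.
by apply: IH => v va; apply: H; rewrite inE va orbT.
Qed.

Lemma red_cons u a : red (u :: a) -> red a. Proof. exact: path_sorted. Qed.

Lemma red_rcons a u : red (rcons a u) -> red a /\ forall v, a != [::] -> last v a != u.
Proof. by case: a => [//|v b]; rewrite /red /= rcons_path => /andP[]. Qed.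

End ReducedWords.

Lemma nf_map_push (T T' : eqType) (f : T -> T') u a : nf (map f (push u a)) = push (f u) (nf (map f a)).
Proof.
case: a => [//|v b]; rewrite [push u _]/=; have [->|uv] //= := eqVneq u v.
by rewrite -[LHS](push_push (f v)) // red_nf.
Qed.

(** Renaming letters, even non-injectively, is a homomorphism of free products. *)
Lemma nf_map_nf (T T' : eqType) (f : T -> T') a : nf (map f (nf a)) = nf (map f a).
Proof. by elim: a => // u a IH; rewrite [nf (u :: a)]/= nf_map_push -/(nf a) IH. Qed.

Lemma red_map (T T' : eqType) (f : T -> T') (a : seq T) : injective f -> red a -> red (map f a).
Proof. by move=> fi; rewrite /red sorted_map; apply: sub_sorted => x y /=; rewrite inj_eq. Qed.


(** * The chamber, its reflection group and the tree of half-spaces *)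

Section Chamber.
Context {R : realType} {n : nat}.
Local Notation N := n.+1.
Local Notation o := (base_point : 'cV[R]_n.+1).
Implicit Types (x y w v u p : 'cV[R]_N) (g h s : 'M[R]_N) (a b : seq 'cV[R]_N).

(** What the reflection group needs to know about the walls. [K > 1] in [ws_sep] makes distinct
    walls disjoint. *)
Record wall_system (W : set 'cV[R]_N) (K : R) : Prop := WallSystem {
  ws_gt1 : 1 < K;
  ws_unit : forall u, W u -> lorentz u u = 1;
  ws_neg : forall u, W u -> W (- u);
  ws_sep : forall u w, W u -> W w -> [\/ u = w, u = - w | K <= `|lorentz u w|];
  ws_refl : forall u, W u -> arith 1 (refl u);
  ws_base : forall u, W u -> lorentz u o != 0;
  ws_fin : forall r, finite_set [set u | W u /\ `|lorentz u o| <= r] }.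

Context (W : set 'cV[R]_N) (K : R) (HW : wall_system W K).

Definition Wneg : set 'cV[R]_N := [set u | W u /\ lorentz u o < 0].

(* The walls of the chamber of [o], with normals pointing out of it. *)
Definition bdry : set 'cV[R]_N := [set u | Wneg u /\
  forall w, Wneg w -> 1 < lorentz u w -> lorentz w o < lorentz u o].

Definition chamber : set 'cV[R]_N := [set x | hyp x /\ forall w, Wneg w -> lorentz w x <= 0].

Let hb : hyp o := base_hyp.

Lemma Wneg_unit u : Wneg u -> lorentz u u = 1. Proof. by case=> /(ws_unit HW). Qed.
Lemma bdry_unit u : bdry u -> lorentz u u = 1. Proof. by case=> /Wneg_unit. Qed.
Lemma bdry_base u : bdry u -> lorentz u o < 0. Proof. by case=> -[]. Qed.

Lemma base_chamber : chamber o. Proof. by split=> // w [_ /ltW]. Qed.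

Lemma Wneg_sep u w : Wneg u -> Wneg w -> [\/ u = w, lorentz u w <= - K | K <= lorentz u w].
Proof.
move=> [Wu uo] [Ww wo]; have [->|E|] := ws_sep HW Wu Ww; first by constructor 1.
  by move: uo; rewrite E lorentzNl; lra.
case: ger0P => _ h; first by constructor 3.
by constructor 2; lra.
Qed.

Lemma bdry_dir u w x : bdry u -> Wneg w -> 1 < lorentz u w -> hyp x -> lorentz w x < lorentz u x.
Proof.
move=> [uW uA] wW uw hx; apply: (nested_halfspaces _ _ _ hb hx (uA w wW uw)).
- exact: Wneg_unit. - exact: Wneg_unit. - by rewrite lorentzC.
Qed.

(** Nested half-spaces would contradict the maximality of one of the two, so the only possibility
    left is that they are disjoint. *)
Lemma bdry_sep u w : bdry u -> bdry w -> u != w -> lorentz u w <= - K.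
Proof.
move=> uA wA uw; have K1 := ws_gt1 HW.
have [/eqP E|//|h] := Wneg_sep uA.1 wA.1; first by rewrite E in uw.
have h1 := bdry_dir uA wA.1 (lt_le_trans K1 h) hb.
rewrite lorentzC in h; have := bdry_dir wA uA.1 (lt_le_trans K1 h) hb; lra.
Qed.

Lemma bdry_opp u w y : bdry u -> bdry w -> u != w -> hyp y -> 0 <= lorentz u y -> lorentz w y < 0.
Proof.
move=> uA wA uw hy uy; apply: (opposite_halfspaces _ _ _ hb hy (bdry_base uA) (bdry_base wA) uy).
- exact: bdry_unit. - exact: bdry_unit.
- by have := bdry_sep uA wA uw; have := ws_gt1 HW; lra.
Qed.

Lemma bdry_wall_chamber u p : bdry u -> hyp p -> lorentz u p = 0 -> chamber p.
Proof.
move=> uA hp up; split => // w wW; have K1 := ws_gt1 HW.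
have [<-|h|h] := Wneg_sep uA.1 wW; first by rewrite up.
  apply: ltW; apply: (opposite_halfspaces _ _ _ hb hp (bdry_base uA) wW.2).
  - exact: bdry_unit. - exact: Wneg_unit. - lra. - by rewrite up.
by rewrite -up ltW // bdry_dir //; lra.
Qed.

(** Among the finitely many walls that separate [x] from the base point and lie no farther than [w],
    the one closest to the base point bounds the chamber. *)
Lemma bdry_separates x w : hyp x -> Wneg w -> 0 < lorentz w x -> exists2 u, bdry u & 0 < lorentz u x.
Proof.
move=> hx wW wx.
have [||||u [uW ux uw] umin] := @finite_set_min _ (fun u v => lorentz v o <= lorentz u o)
   [set u | [/\ Wneg u, 0 < lorentz u x & lorentz w o <= lorentz u o]].
- by move=> u v; exact: le_total.
- by move=> u v v' h1 h2; exact: le_trans h1.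
- apply: sub_finite_set (ws_fin HW (- lorentz w o)) => u [[Wu uo] _ h]; split => //.
  by rewrite ltr0_norm // lerN2.
- by exists w.
exists u => //; split => // v vW uv; rewrite ltNge; apply/negP; rewrite le_eqVlt => /orP[/eqP E|h].
  (* Two nested walls cannot be equally far from the base point: [u - v] would be timelike and
     orthogonal to it. *)
  have T : lorentz (u - v) (u - v) < 0.
    by rewrite !lorentzE (Wneg_unit uW) (Wneg_unit vW) (lorentzC v u); lra.
  by have := timelike_sign T hb hb; rewrite lorentzDl lorentzNl E subrr mul0r ltxx.
have vx := nested_halfspaces (Wneg_unit uW) (Wneg_unit vW) uv hb hx h.
have := umin v; rewrite leNgt h => /(_ _)/negP; apply=> //; first by split => //; lra.
Qed.

Lemma chamberP x : hyp x -> (forall u, bdry u -> lorentz u x <= 0) -> chamber x.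
Proof.
move=> hx H; split => // w wW; rewrite leNgt; apply/negP => /(bdry_separates hx wW)[u /H].
by rewrite leNgt => /negP.
Qed.

Definition chamber_stab : set 'M[R]_N := [set s | oplus s /\ forall w, Wneg w <-> Wneg (s *m w)].

Lemma stab1 : chamber_stab 1%:M.
Proof. by split; [exact: oplus1 | move=> w; rewrite mul1mx]. Qed.

Lemma stabM s t : chamber_stab s -> chamber_stab t -> chamber_stab (s *m t).
Proof.
move=> [so sW] [to tW]; split; first exact: oplusM.
by move=> w; rewrite -mulmxA -sW -tW.
Qed.

Lemma stabV s : chamber_stab s -> chamber_stab (invmx s).
Proof.
move=> [so sW]; split; first exact: oplusV.
by move=> w; rewrite [X in _ <-> X]sW isom_mulK //; exact: oplus_isom.
Qed.

Lemma stab_bdry s u : chamber_stab s -> bdry u -> bdry (s *m u).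
Proof.
move=> sS uA; have si := oplus_isom sS.1; split; first by apply/(sS.2 u).1; exact: uA.1.
move=> w wW uw; have [so' sW'] := stabV sS.
have wW' : Wneg (invmx s *m w) by apply: (sW' w).1.
have uw' : 1 < lorentz u (invmx s *m w) by rewrite -isom_adj.
have := bdry_dir uA wW' uw' (oplus_hyp so' hb).
by rewrite -!(isom_adj _ o si) isom_mulK.
Qed.

Lemma stab_bdry_lt0 s u : chamber_stab s -> bdry u -> lorentz u (s *m o) < 0.
Proof.
move=> sS uA; have si := oplus_isom sS.1; rewrite lorentzC isom_adj // lorentzC.
by apply: bdry_base; apply: stab_bdry => //; exact: stabV.
Qed.

Lemma stab_chamber s x : chamber_stab s -> chamber x -> chamber (s *m x).
Proof.
move=> sS [hx xW]; have si := oplus_isom sS.1; split; first exact: oplus_hyp sS.1 hx.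
move=> w wW; rewrite lorentzC isom_adj // lorentzC; apply: xW.
by apply: ((stabV sS).2 w).1.
Qed.

(** The head of the list acts first. Adding a letter in front crosses one more wall, seen from the
    last chamber reached, so a word is a path in the tree of chambers read from its end. *)
Fixpoint rp a : 'M[R]_N := if a is u :: b then rp b *m refl u else 1%:M.

Lemma rp_rcons a u : rp (rcons a u) = refl u *m rp a.
Proof. by elim: a => [|v a IH] /=; rewrite ?mulmx1 ?mul1mx // IH mulmxA. Qed.

Lemma rp_cat a b : rp (a ++ b) = rp b *m rp a.
Proof. by elim: a => [|v a IH] /=; rewrite ?mulmx1 // IH mulmxA. Qed.

Definition unit_word a := forall u, u \in a -> lorentz u u = 1.

Lemma refl_unitK u : lorentz u u = 1 -> refl u *m refl u = 1%:M.
Proof. by move=> u1; rewrite reflK // u1 oner_neq0. Qed.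

Lemma rp_rev a : unit_word a -> rp (rev a) *m rp a = 1%:M.
Proof.
elim: a => [|u a IH] H /=; first by rewrite mulmx1.
rewrite rev_cons rp_rcons -mulmxA (mulmxA (rp _)) IH => [|v va]; last by apply: H; rewrite inE va orbT.
by rewrite mul1mx refl_unitK //; apply: H; rewrite inE eqxx.
Qed.

Lemma rp_oplus a : unit_word a -> oplus (rp a).
Proof.
elim: a => [|u a IH] H; first exact: oplus1.
apply: oplusM; last by apply: refl_unit_oplus; apply: H; rewrite inE eqxx.
by apply: IH => v va; apply: H; rewrite inE va orbT.
Qed.

Lemma rp_det a : unit_word a -> \det (rp a) = (-1) ^+ odd (size a).
Proof.
elim: a => [|u a IH] H; first by rewrite det1.
rewrite /= det_mulmx IH => [|v va]; last by apply: H; rewrite inE va orbT.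
rewrite det_refl; last by rewrite H ?inE ?eqxx // oner_neq0.
by case: odd => /=; rewrite ?expr0 ?expr1; ring.
Qed.

Lemma rp_map_nf (T : eqType) (F : T -> 'cV[R]_N) (c : seq T) : unit_word (map F c) ->
  rp (map F (nf c)) = rp (map F c).
Proof.
elim: c => // u c IH H /=; rewrite -IH => [|v va]; last by apply: H; rewrite inE va orbT.
have u1 : lorentz (F u) (F u) = 1 by apply: H; rewrite inE eqxx.
case: (nf c) => [//|v b] /=; case: eqP => [<-|//].
by rewrite -mulmxA refl_unitK // mulmx1.
Qed.

Lemma rp_nf a : unit_word a -> rp (nf a) = rp a.
Proof. by move=> H; have := @rp_map_nf _ id a; rewrite !map_id => /(_ H). Qed.

Lemma rp_conj s a : isom s -> s *m rp a = rp (map (mulmx s) a) *m s.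
Proof.
move=> si; elim: a => [|u a IH] /=; first by rewrite mulmx1 mul1mx.
by rewrite mulmxA IH -!mulmxA; congr (_ *m _); rewrite -refl_conj // -!mulmxA mulVmx ?mulmx1 //; exact: isom_unit.
Qed.

Definition word a := forall u, u \in a -> bdry u.

Lemma word_unit a : word a -> unit_word a.
Proof. by move=> H u /H /bdry_unit. Qed.

Lemma word_cons u a : word (u :: a) -> bdry u /\ word a.
Proof. by move=> H; split=> [|v va]; apply: H; rewrite inE ?eqxx ?va ?orbT. Qed.

Lemma word_rcons a u : word (rcons a u) -> word a /\ bdry u.
Proof. by move=> H; split=> [v va|]; apply: H; rewrite mem_rcons inE ?eqxx ?va ?orbT. Qed.

Lemma word_consI u a : bdry u -> word a -> word (u :: a).
Proof. by move=> uA aA v; rewrite inE => /orP[/eqP ->|/aA]. Qed.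

Lemma rp_arith a : word a -> arith 1 (rp a).
Proof.
elim: a => [|u a IH] H; first exact: arith1.
by have [uA aA] := word_cons H; apply: arithM; [exact: IH|exact: (ws_refl HW uA.1.1)].
Qed.

(** Ping-pong: each reflection carries the complement of its half-space into it, and half-spaces of
    distinct boundary walls are disjoint. *)
Lemma word_last a u0 x : word a -> red a -> a != [::] -> hyp x ->
  (forall u, bdry u -> lorentz u x < 0) -> 0 < lorentz (last u0 a) (rp a *m x).
Proof.
elim/last_ind: a u0 => // a u IH u0 wA /red_rcons[ra la] _ hx Hx.
have [aA uA] := word_rcons wA; have u1 := bdry_unit uA.
rewrite last_rcons rp_rcons -mulmxA.
have -> : lorentz u (refl u *m (rp a *m x)) = - lorentz u (rp a *m x).
  by rewrite refl_unitE // lorentzDr lorentzNr lorentzZr u1; ring.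
rewrite oppr_gt0; case: a IH aA ra la {wA} => [|v a] IH aA ra la; first by rewrite mul1mx Hx.
apply: (bdry_opp _ uA (la v isT)).
- by apply: aA; rewrite /=; exact: mem_last.
- by apply: oplus_hyp hx; apply: rp_oplus; exact: word_unit.
- by apply/ltW/(IH v).
Qed.

(** The position of the translate of the base point reveals the last letter ([word_last]); peel it
    off and repeat. So the reflections generate a free product, meeting the chamber stabiliser
    trivially. *)
Lemma word_unique a b s t : word a -> red a -> word b -> red b -> chamber_stab s -> chamber_stab t ->
  rp a *m s = rp b *m t -> a = b.
Proof.
move=> + + + + sS tS.
have ho r : chamber_stab r -> hyp (r *m o) by move=> [ro _]; exact: oplus_hyp.
have lt0 c r u : word (rcons c u) -> red (rcons c u) -> chamber_stab r -> 0 < lorentz u (rp (rcons c u) *m (r *m o)).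
  move=> cA cr rS; have := @word_last (rcons c u) u (r *m o) cA cr; rewrite last_rcons; apply.
  - by case: (c). - exact: ho. - by move=> v vA; exact: stab_bdry_lt0.
elim/last_ind: a b => [|a u IH] b; elim/last_ind: b => [|b v _] // aA ar bA br E.
- have := lt0 _ _ _ bA br tS; rewrite mulmxA -E mul1mx.
  by rewrite ltNge (ltW (stab_bdry_lt0 sS (word_rcons bA).2)).
- have := lt0 _ _ _ aA ar sS; rewrite mulmxA E mul1mx.
  by rewrite ltNge (ltW (stab_bdry_lt0 tS (word_rcons aA).2)).
have h1 := lt0 _ _ _ aA ar sS; have h2 := lt0 _ _ _ bA br tS; rewrite mulmxA E -mulmxA in h1.
have [aA' uA] := word_rcons aA; have [bA' vA] := word_rcons bA.
have [uv|uv] := eqVneq u v; last first.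
  have := bdry_opp uA vA uv _ (ltW h1); rewrite (lt_gtF h2) => H; suff : false by [].
  by apply: H; apply: oplus_hyp (ho _ tS); apply: rp_oplus; exact: word_unit.
rewrite uv; congr rcons; apply: IH (red_rcons ar).1 bA' (red_rcons br).1 _ => //.
move: E; rewrite !rp_rcons uv -!mulmxA => /(congr1 (mulmx (refl v))).
by rewrite !mulmxA refl_unitK ?mul1mx //; exact: bdry_unit.
Qed.

(** Take the translate of [x] closest to the base point. Were it beyond a boundary wall, reflecting
    in that wall would bring it closer. *)
Lemma folding x : hyp x -> exists a y, [/\ word a, chamber y & x = rp a *m y].
Proof.
move=> hx.
have [||||g [[a aA aE] gx] gmin] := @finite_set_min _ (fun g h => tau (g *m x) o <= tau (h *m x) o)
   [set g | (exists2 a, word a & g = rp a) /\ tau (g *m x) o <= tau x o].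
- by move=> g h; exact: le_total.
- by move=> g h k; exact: le_trans.
- apply: sub_finite_set (finite_arith_ball (2 * tau x o * tau x o)) => g [[a aA ->] gx].
  split; first exact: rp_arith.
  have go := rp_oplus (word_unit aA); have h1 := oplus_hyp go hb; have h2 := oplus_hyp go hx.
  rewrite -tau_base; apply: le_trans (tau_tri h1 h2 hb) _; rewrite oplus_tau // tauC.
  by rewrite ler_wpM2l // mulr_ge0 // ltW // tau_gt0.
- by exists 1%:M; rewrite /= mul1mx; split => //; exists [::].
have go := rp_oplus (word_unit aA); rewrite -aE in go.
have hgx := oplus_hyp go hx.
exists (rev a), (g *m x); split.
- by move=> v; rewrite mem_rev; exact: aA.
- apply: chamberP => [|u uA]; first exact: hgx.
  rewrite leNgt; apply/negP => ux; have u1 := bdry_unit uA.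
  have L : tau (refl u *m (g *m x)) o < tau (g *m x) o.
    rewrite /tau refl_unitE // lorentzDl lorentzNl lorentzZl.
    by have := bdry_base uA; move: ux; nra.
  have := gmin (refl u *m g); rewrite -mulmxA leNgt L /= => H; suff : false by [].
  apply: H; split; last by rewrite -mulmxA; exact: le_trans (ltW L) gx.
  by exists (rcons a u); [move=> v; rewrite mem_rcons inE => /orP[/eqP ->|/aA] | rewrite rp_rcons aE].
- by rewrite aE mulmxA rp_rev ?mul1mx //; exact: word_unit.
Qed.

Lemma wall_nested g u v y : oplus g -> bdry u -> bdry v -> u != v -> hyp y ->
  0 <= lorentz (g *m (refl v *m u)) y -> 0 < lorentz (g *m v) y.
Proof.
move=> go uA vA uv hy; have v1 := bdry_unit vA; have gi := oplus_isom go.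
rewrite !(isom_adj _ _ gi); have := oplus_hyp (oplusV go) hy; move: (invmx g *m y) => z hz H.
have : lorentz v (refl v *m z) < 0.
  apply: (bdry_opp uA vA uv); first by apply: oplus_hyp hz; exact: refl_unit_oplus.
  by move: H; rewrite !refl_unitE // !lorentzE (lorentzC v u); lra.
by rewrite refl_unitE // !lorentzE v1; lra.
Qed.

(** Outward normal of the wall between the chambers of [a] and of [u :: a]. The nonempty reduced
    words [u :: a] are the nodes of a tree of half-spaces: children are nested in parents, siblings
    are disjoint. *)
Definition nrm u a : 'cV[R]_N := rp a *m u.

Lemma nrm_nested u v a y : word (u :: v :: a) -> red (u :: v :: a) -> hyp y ->
  0 <= lorentz (nrm u (v :: a)) y -> 0 < lorentz (nrm v a) y.
Proof.
move=> /word_cons[uA /word_cons[vA aA]] /andP[uv _] hy.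
rewrite /nrm /= -mulmxA => H.
by apply: wall_nested H => //; apply: rp_oplus; exact: word_unit.
Qed.

Lemma nrm_disjoint u v a y : bdry u -> bdry v -> word a -> u != v -> hyp y ->
  0 <= lorentz (nrm u a) y -> lorentz (nrm v a) y < 0.
Proof.
move=> uA vA aA uv hy; have go := rp_oplus (word_unit aA); have gi := oplus_isom go.
rewrite /nrm !isom_adj //; apply: bdry_opp => //.
by apply: oplus_hyp hy; exact: oplusV.
Qed.

Lemma nrm_base_lt0 u a : word (u :: a) -> red (u :: a) -> lorentz (nrm u a) o < 0.
Proof.
move=> wA ra; rewrite ltNge; apply/negP => H.
suff : forall a u, word (u :: a) -> red (u :: a) -> 0 <= lorentz (nrm u a) o -> exists2 v, bdry v & 0 <= lorentz v o.
  by move=> /(_ a u wA ra H)[v vA]; rewrite leNgt bdry_base.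
elim=> [|v b IH] {}u {}wA {}ra {}H; first by exists u; [exact: (word_cons wA).1 | move: H; rewrite /nrm mul1mx].
by apply: (IH v); [exact: (word_cons wA).2 | exact: red_cons ra | apply/ltW/(nrm_nested wA ra hb H)].
Qed.

Lemma nrm_unit u a : word (u :: a) -> lorentz (nrm u a) (nrm u a) = 1.
Proof.
move=> /word_cons[uA aA]; rewrite isom_lorentz ?bdry_unit //.
by apply: oplus_isom; apply: rp_oplus; exact: word_unit.
Qed.
End Chamber.

(** * Congruence subgroups; cocompactness of the stabiliser on the chamber *)

Section CocompactSubgroups.
Context {R : realType} {n : nat}.
Local Notation N := n.+1.
Local Notation o := (base_point : 'cV[R]_n.+1).
Implicit Types (x y w v u p : 'cV[R]_N) (g h s : 'M[R]_N) (a b : seq 'cV[R]_N).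

Let hb : hyp o := base_hyp.

Definition arithS (q : nat) : set 'M[R]_N := [set g | arith q g /\ \det g = 1].

Lemma arithS_oplus q g : arithS q g -> oplus g. Proof. by case=> /arith_oplus. Qed.

Lemma arithS1 q : arithS q 1%:M. Proof. by split; [exact: arith1 | exact: det1]. Qed.

Lemma arithSM q g h : arithS q g -> arithS q h -> arithS q (g *m h).
Proof. by move=> [ga gd] [ha hd]; split; [exact: arithM | rewrite det_mulmx gd hd mulr1]. Qed.

Lemma arithSV q g : arithS q g -> arithS q (invmx g).
Proof. by move=> [ga gd]; split; [exact: arithV | rewrite det_inv gd invr1]. Qed.

Lemma adjV g x y : isom g -> lorentz (invmx g *m x) y = lorentz x (g *m y).
Proof. by move=> gi; rewrite [RHS]lorentzC isom_adj // lorentzC. Qed.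

Lemma tau_translate g h x c : oplus g -> oplus h -> hyp x -> tau (g *m x) o <= c ->
  tau (invmx h *m g *m x) o <= 2 * c * tau o (h *m o).
Proof.
move=> go ho hx gx; rewrite -(oplus_tau _ _ ho) !mulmxA mulmxV ?mul1mx; last exact/isom_unit/oplus_isom.
have h1 := oplus_hyp go hx; have h2 := oplus_hyp ho hb.
apply: le_trans (tau_tri h1 hb h2) _.
by rewrite ler_wpM2r ?ler_wpM2l //; have := tau_gt0 hb h2; lra.
Qed.

Lemma sign_eq (a b : R) : a ^+ 2 = 1 -> b ^+ 2 = 1 -> (a == 1) = (b == 1) -> b^-1 * a = 1.
Proof.
move=> a1 b1 ab; suff -> : a = b.
  by apply: mulVf; apply/eqP => b0; move: b1; rewrite b0 expr0n /= => /eqP; rewrite eq_sym oner_eq0.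
have pm (c : R) : c ^+ 2 = 1 -> c != 1 -> c = -1.
  by move=> /eqP; rewrite sqrf_eq1 => /orP[/eqP ->|/eqP ->] //; rewrite eqxx.
have [aE|aE] := eqVneq a 1; first by move: ab; rewrite aE eqxx => /esym/eqP.
by rewrite (pm a) // (pm b) // -ab.
Qed.

(** Pigeonhole on the residue of [T] mod [M.+1] and on the determinant: the quotient of two elements
    with equal data lies in the congruence subgroup. *)
Lemma arithS_cocompact M : exists c, forall x, hyp x -> exists g, arithS M.+1 g /\ tau (g *m x) o <= c.
Proof.
have [c1 Hc1] := @arith1_cocompact R n.
pose red_mod (T : 'M[int]_(N + N)) : 'M['I_M.+1]_(N + N) := \matrix_(i, j) inord `|(T i j %% M.+1%:Z)%Z|%N.
have red_modE T T0 : red_mod T = red_mod T0 -> exists Y, T = T0 + M.+1%:Z *: Y.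
  have b (a : int) : (`|(a %% M.+1%:Z)%Z| < M.+1)%N by have := ltz_mod a (isT : M.+1%:Z != 0); have := modz_ge0 a (isT : M.+1%:Z != 0); lia.
  move=> H; exists (\matrix_(i, j) ((T i j - T0 i j) %/ M.+1%:Z)%Z); apply/matrixP => i j.
  have /matrixP/(_ i j) := H; rewrite !mxE => /(congr1 val) /=; rewrite !inordK // => h.
  have D : (M.+1%:Z %| T i j - T0 i j)%Z.
    by rewrite -eqz_mod_dvd; have := modz_ge0 (T i j) (isT : M.+1%:Z != 0); have := modz_ge0 (T0 i j) (isT : M.+1%:Z != 0); lia.
  by rewrite mulrC divzK // addrC subrK.
pose P x (t : 'M['I_M.+1]_(N + N) * bool) := hyp x /\ exists g g' T T', [/\ oplus g, tau (g *m x) o <= c1 &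
   [/\ g'^T *m g' = 1%:M, T *m T' = 1%:M, g *m E1 = E1 *m toR T, g' *m E2 = E2 *m toR T &
    t = (red_mod T, \det g == 1)]].
have [||t _|c Hc] := @finite_bound R _ _ setT P (fun x c => exists g, arithS M.+1 g /\ tau (g *m x) o <= c).
- exact: finite_finset.
- by move=> x c c' [g [ga gc]] cc; exists g; split => //; exact: le_trans cc.
- have [[x0 [hx0 [h [h' [S [S' [ho hx0o [hh SS hE hE2 tS]]]]]]]]|N0] := pselect (exists x, P x t); last first.
    by exists 0 => x Px; exfalso; apply: N0; exists x.
  exists (2 * c1 * tau o (h *m o)) => x [hx [g [g' [T [T' [go gxo [gg TT gE gE2 tT]]]]]]].
  exists (invmx h *m g); split; last exact: tau_translate.
  have [Y YE] : exists Y, T = S + M.+1%:Z *: Y by apply: red_modE; move: tT; rewrite tS => -[->].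
  have hi := oplus_isom ho; have S'S : S' *m S = 1%:M by apply: mulmx1C.
  have E : S' *m T = 1%:M + M.+1%:Z *: (S' *m Y) by rewrite YE mulmxDr S'S -scalemxAr.
  split; last first.
    rewrite det_mulmx det_inv; have := isom_det_sqr (oplus_isom go); have := isom_det_sqr hi.
    have : (\det g == 1) = (\det h == 1) by move: tT; rewrite tS => -[_ ->].
    by move=> e1 h1 g1; apply: sign_eq.
  split; first by apply: oplusM => //; exact: oplusV.
  exists (h'^T *m g'), (S' *m T), (T' *m S), (S' *m Y); split => //.
  - by rewrite trmx_mul trmxK -mulmxA (mulmxA h') (mulmx1C hh) mul1mx.
  - by rewrite -mulmxA (mulmxA T) TT mul1mx.
  - rewrite -mulmxA gE toRM [RHS]mulmxA -[E1 in RHS](isom_invM _ hi) hE !mulmxA -(mulmxA _ (toR S)) -toRM SS toR1 mulmx1.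
    by [].
  - rewrite -mulmxA gE2 toRM [RHS]mulmxA -[E2 in RHS]mul1mx -hh -[h'^T *m h' *m E2]mulmxA hE2 !mulmxA -(mulmxA _ (toR S)) -toRM SS toR1 mulmx1.
    by [].
exists c => x hx; have [g [ga gx]] := Hc1 x hx.
have [go [g' [T [T' [Y [gg TT TY gE gE2]]]]]] := ga.
by apply: (Hc x (red_mod T, \det g == 1)) => //; split => //; exists g, g', T, T'.
Qed.

Section Stabilizer.
Variables (q M : nat).
Hypotheses (q2 : (2 < q)%N) (qM : (q %| M.+1)%N).

Lemma wall_system_q : wall_system (@wall R n q) (sep q).
Proof.
have q0 : (0 < q)%N by apply: leq_ltn_trans q2.
split.
- have : (3%:R : R) ^+ 4 <= q%:R ^+ 4 by rewrite lerXn2r ?nnegrE ?ler0n // ler_nat.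
  by rewrite /sep !exprS expr0 mulr1; move: (q%:R) => Q; lra.
- exact: wall_unit.
- exact: wallN.
- by move=> u w; exact: wall_sep.
- exact: wall_refl.
- by move=> u; exact: wall_base.
- exact: finite_wall.
Qed.

Let HW := wall_system_q.
Local Notation Wneg := (Wneg (@wall R n q)).
Local Notation chamber := (chamber (@wall R n q)).

Definition stabS : set 'M[R]_N := [set s | arithS M.+1 s /\ chamber_stab (@wall R n q) s].

(** The wall separates the base point from a point at cosh distance at most [c], so it passes near
    the base point. *)
Lemma far_wall_sign w y c : lorentz w w = 1 -> hyp y -> tau y o <= c -> lorentz w o < 0 ->
  0 <= lorentz w y -> `|lorentz w o| <= c.
Proof.
move=> w1 hy yc wo wy; apply: le_trans yc; apply: le_trans (abs_le_cosh_wall w o) _.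
rewrite tauC; have := halfspace_tau w1 (ltW wo) wy.
have := tau_ge1 (wall_proj_hyp w1 hb) hy; have := cosh_wall_gt0 w o; nra.
Qed.

Lemma WnegN w : wall q w -> ~ Wneg w -> Wneg (- w).
Proof.
move=> wW H; split; first exact: wallN.
rewrite lorentzNl oppr_lt0 lt_neqAle eq_sym (wall_base q2 wW) /= leNgt; apply/negP => h.
exact: H.
Qed.

(** Suppose [g] and [h] bring points of the chamber near the base point. The images of the chamber
    are determined by the side they take of the finitely many walls near the base point; if these
    sides agree, h^-1 g preserves the chamber. *)
Lemma stabS_cocompact : exists c, forall x, chamber x -> exists s, stabS s /\ tau (s *m x) o <= c.
Proof.
have [c1 Hc1] := arithS_cocompact M.
have /finite_seqP[l lE] := @finite_wall R n q c1.
pose mask g : (size l).-tuple bool := map_tuple (fun w => `[< Wneg (invmx g *m w) >]) (in_tuple l).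
pose P x (t : (size l).-tuple bool) := chamber x /\ exists g, [/\ arithS M.+1 g, tau (g *m x) o <= c1 & t = mask g].
have gW g w : arithS M.+1 g -> wall q w -> wall q (g *m w).
  by move=> [ga _]; apply: wall_arith; exact: arith_dvd ga.
have [||t _|c Hc] := @finite_bound R _ _ setT P (fun x c => exists s, stabS s /\ tau (s *m x) o <= c).
- exact: finite_finset.
- by move=> x c c' [g [ga gc]] cc; exists g; split => //; exact: le_trans cc.
- have [[x0 [x0D [h [hA hx0 tE]]]]|N0] := pselect (exists x, P x t); last first.
    by exists 0 => x Px; exfalso; apply: N0; exists x.
  exists (2 * c1 * tau o (h *m o)) => x [xD [g [gA gx tE']]].
  have go := arithS_oplus gA; have ho := arithS_oplus hA.
  (* A wall far from the base point does not separate it from [k *m y], so its side is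
     prescribed. *)
  have far k y w : arithS M.+1 k -> chamber y -> tau (k *m y) o <= c1 -> wall q w -> ~ `|lorentz w o| <= c1 ->
      (Wneg (invmx k *m w) <-> lorentz w o < 0).
    move=> kA yD ky wW wf; have ko := arithS_oplus kA; have ki := oplus_isom ko.
    have hy := oplus_hyp ko yD.1; have w1 := wall_unit wW.
    have kw := gW _ _ (arithSV kA) wW; split => H.
      have := yD.2 _ H; rewrite adjV // => hk.
      rewrite ltNge; apply/negP; rewrite le_eqVlt eq_sym (negbTE (wall_base q2 wW)) /= => wo.
      apply: wf; rewrite -normrN -lorentzNl.
      by apply: far_wall_sign ky _ _ => //; rewrite ?lorentzNl ?lorentzNr ?opprK // ?oppr_lt0 ?oppr_ge0.
    have [//|hk] := pselect (Wneg (invmx k *m w)).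
    have := yD.2 _ (WnegN kw hk); rewrite lorentzNl adjV // oppr_le0 => wy.
    by exfalso; apply: wf; exact: far_wall_sign ky H wy.
  have K w : wall q w -> (Wneg (invmx g *m w) <-> Wneg (invmx h *m w)).
    move=> wW; have [wn|wf] := pselect (`|lorentz w o| <= c1); last by rewrite (far g x) // (far h x0).
    have wl : w \in l by have : [set` l] w by rewrite -lE.
    have /(congr1 (@tval _ _)) : mask g = mask h by rewrite -tE' -tE.
    move=> /eq_in_map/(_ w wl); have [H|H] := pselect (Wneg (invmx g *m w)).
      by rewrite (asboolT H) => /esym/asboolP.
    by rewrite (asboolF H) => /esym/asboolP H'; split.
  exists (invmx h *m g); split; last by apply: tau_translate => //; exact: xD.1.
  split; first by apply: arithSM => //; exact: arithSV.
  split; first by apply: oplusM => //; exact: oplusV.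
  have gi := oplus_isom go; have hi := oplus_isom ho.
  move=> w; split => wW.
    by rewrite -mulmxA; apply: (K _ (gW _ _ gA wW.1)).1; rewrite isom_invK.
  have gw : wall q (g *m w).
    by have := gW _ _ hA wW.1; rewrite -mulmxA isom_mulK.
  have := (K _ gw).2; rewrite isom_invK //; apply; by rewrite mulmxA.
exists c => x xD; have [g [ga gx]] := Hc1 x xD.1.
by apply: (Hc x (mask g)) => //; split => //; exists g.
Qed.

Lemma stabS1 : stabS 1%:M. Proof. by split; [exact: arithS1 | exact: stab1]. Qed.

Lemma stabSM s t : stabS s -> stabS t -> stabS (s *m t).
Proof. by move=> [sa ss] [ta ts]; split; [exact: arithSM | exact: stabM]. Qed.

Lemma stabSV s : stabS s -> stabS (invmx s).
Proof. by move=> [sa ss]; split; [exact: arithSV | exact: stabV]. Qed.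

End Stabilizer.
End CocompactSubgroups.

(** * The lattice and its endomorphisms *)

Section MirrorGroup.
Context {R : realType} {n : nat}.
Local Notation N := n.+1.
Local Notation o := (base_point : 'cV[R]_n.+1).
Implicit Types (x y w v u p : 'cV[R]_N) (g h s t : 'M[R]_N) (a b : seq 'cV[R]_N).
Variables (q M : nat).
Hypotheses (n2 : (2 <= n)%N) (q2 : (2 < q)%N) (qM : (q %| M.+1)%N).

Let hb : hyp o := base_hyp.
Let HW := @wall_system_q R n q q2.
Local Notation bdry := (bdry (@wall R n q)).
Local Notation word := (word (@wall R n q)).
Local Notation stabS := (@stabS R n q M).
Local Notation lab := (@lab R n M).

(** Even words in the wall reflections, extended by the chamber stabiliser; evenness makes the
    determinant 1. *)
Definition Gam : set 'M[R]_N :=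
  [set g | exists a s, [/\ word a, ~~ odd (size a), stabS s & g = rp a *m s]].

Lemma bdry_nonempty : exists u, bdry u.
Proof.
have W0 : wall q (e1 zv : 'cV[R]_N) by apply: wall_zv; exact: ltnW n2.
have [w [wW wo]] : exists w, wall q w /\ lorentz w o < 0.
  have := wall_base q2 W0; rewrite neq_lt => /orP[h|h]; first by exists (e1 zv).
  by exists (- e1 zv); rewrite lorentzNl oppr_lt0; split => //; exact: wallN.
have w1 := wall_unit wW; have hx : hyp (refl w *m o) by apply: oplus_hyp hb; exact: refl_unit_oplus.
have [|u uA _] := bdry_separates HW hx (conj wW wo); last by exists u.
by rewrite refl_unitE // !lorentzE w1; lra.
Qed.

Lemma stabS_oplus s : stabS s -> oplus s. Proof. by case=> /arithS_oplus. Qed.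

Lemma Gam_oplus g : Gam g -> oplus g.
Proof.
move=> [a [s [aA _ sS ->]]]; apply: oplusM; last exact: stabS_oplus.
by apply: rp_oplus; exact: (word_unit HW).
Qed.

Lemma Gam_arith g : Gam g -> arith 1 g.
Proof.
move=> [a [s [aA _ sS ->]]]; apply: arithM; first exact: (rp_arith HW aA).
by apply: (arith_dvd (dvd1n M.+1)); exact: sS.1.1.
Qed.

Lemma word_map_stab s a : stabS s -> word a -> word (map (mulmx s) a).
Proof. by move=> sS aA _ /mapP[u /aA uA ->]; exact: (stab_bdry HW sS.2 uA). Qed.

Lemma word_rev a : word a -> word (rev a).
Proof. by move=> aA u; rewrite mem_rev; exact: aA. Qed.

Lemma word_cat a b : word a -> word b -> word (a ++ b).
Proof. by move=> aA bA u; rewrite mem_cat => /orP[/aA|/bA]. Qed.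

(** Law of the semidirect product: the stabiliser acts on words by permuting the boundary walls. *)
Lemma Gam_mulE a b s t : isom s ->
  (rp a *m s) *m (rp b *m t) = rp (map (mulmx s) b ++ a) *m (s *m t).
Proof. by move=> si; rewrite rp_cat -!mulmxA; congr (_ *m _); rewrite !mulmxA rp_conj. Qed.

Lemma Gam_subgroup : is_subgroup Gam.
Proof.
split.
- move=> g Gg; rewrite SO_n1E; split; first exact: Gam_oplus.
  have [a [s [aA ea sS ->]]] := Gg; rewrite det_mulmx rp_det; last exact: (word_unit HW).
  by rewrite (negbTE ea) expr0 mul1r; exact: sS.1.2.
- by exists [::], 1%:M; split => //; [exact: stabS1 | rewrite mulmx1].
- move=> _ _ [a [s [aA ea sS ->]]] [b [t [bA eb tS ->]]].
  exists (map (mulmx s) b ++ a), (s *m t); split.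
  + by apply: word_cat => //; exact: word_map_stab.
  + by rewrite size_cat size_map oddD (negbTE ea) (negbTE eb).
  + exact: stabSM.
  + by rewrite Gam_mulE //; exact/oplus_isom/stabS_oplus.
- move=> _ [a [s [aA ea sS ->]]]; have sV := stabSV sS.
  exists (map (mulmx (invmx s)) (rev a)), (invmx s); split => //.
  + by apply: word_map_stab => //; exact: word_rev.
  + by rewrite size_map size_rev.
  + have si := isom_unit (oplus_isom (stabS_oplus sS)).
    rewrite -rp_conj; last exact/oplus_isom/stabS_oplus.
    have au := word_unit HW aA.
    have E : (invmx s *m rp (rev a)) *m (rp a *m s) = 1%:M.
      by rewrite -mulmxA (mulmxA (rp (rev a))) rp_rev // mul1mx mulVmx.
    have gi : rp a *m s \in unitmx by apply/isom_unit/oplus_isom/oplusM; [exact: rp_oplus|exact: stabS_oplus].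
    by rewrite -[RHS]mulmx1 -(mulmxV gi) mulmxA E mul1mx.
Qed.

Lemma Gam_cocompact : exists c, forall x, hyp x -> exists g, Gam g /\ tau (g *m x) o <= c.
Proof.
have [c Hc] := @stabS_cocompact R n q M q2 qM; have [u0 uA] := bdry_nonempty.
have u01 := bdry_unit HW uA; have ro := refl_unit_oplus u01.
exists (Num.max c (2 * c * tau o (refl u0 *m o))) => x hx.
have [a [y [aA yD xE]]] := folding HW hx; have [s [sS sy]] := Hc y yD.
have au := word_unit HW aA; have so := stabS_oplus sS; have si := oplus_isom so.
have E : (rp (map (mulmx s) (rev a)) *m s) *m x = s *m y.
  by rewrite -rp_conj // xE -mulmxA (mulmxA (rp (rev a))) rp_rev // mul1mx.
have [ea|ea] := boolP (odd (size a)); last first.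
  exists (rp (map (mulmx s) (rev a)) *m s); rewrite E le_max sy; split => //.
  exists (map (mulmx s) (rev a)), s; split => //; last by rewrite size_map size_rev.
  by apply: word_map_stab => //; exact: word_rev.
(* An odd folding word is made even by one extra reflection, in a fixed wall, which costs only a
   constant. *)
exists (rp (rcons (map (mulmx s) (rev a)) u0) *m s); split.
  exists (rcons (map (mulmx s) (rev a)) u0), s; split => //; last by rewrite size_rcons size_map size_rev /= ea.
  move=> v; rewrite mem_rcons inE => /orP[/eqP -> //|].
  by apply: word_map_stab => //; exact: word_rev.
rewrite rp_rcons -!mulmxA (mulmxA (rp _)) E le_max; apply/orP; right.
have hy := oplus_hyp so yD.1; have h1 := oplus_hyp ro hy; have h2 := oplus_hyp ro hb.
apply: le_trans (tau_tri h1 h2 hb) _; rewrite oplus_tau // [tau (refl u0 *m o) o]tauC.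
by rewrite ler_wpM2r ?ler_wpM2l //; have := tau_gt0 hb h2; lra.
Qed.

Lemma Gam_lattice : is_lattice Gam.
Proof.
apply: cocompact_lattice.
- exact: Gam_subgroup.
- move=> r; apply: sub_finite_set (finite_arith_ball r) => g [Gg gr].
  by split => //; exact: Gam_arith.
- exact: Gam_cocompact.
Qed.

Section Endomorphism.
Variable X : 'cV['I_M.+1]_(N + N) -> 'cV[R]_N.
Hypotheses (Xb : forall j, bdry (X j)) (Xi : injective X).

Let F u := X (lab u).

(** The word of some decomposition of [g]; [phiE] shows that the choice is immaterial. Off [Gam] the
    default is the empty word. *)
Definition word_of g : seq 'cV[R]_N :=
  (xget ([::], 1%:M) [set p : seq 'cV[R]_N * 'M[R]_N | [/\ word p.1, ~~ odd (size p.1), stabS p.2 &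
     g = rp p.1 *m p.2]]).1.

Definition phi g : 'M[R]_N := rp (map F (word_of g)).

Lemma word_map_X (c : seq 'cV['I_M.+1]_(N + N)) : word (map X c).
Proof. by move=> _ /mapP[j _ ->]; exact: Xb. Qed.

Lemma map_F a : map F a = map X (map lab a).
Proof. by rewrite -map_comp. Qed.

Lemma rp_map_F_nf a : rp (map F (nf a)) = rp (map F a).
Proof. by apply: rp_map_nf; rewrite map_F; apply: (word_unit HW); exact: word_map_X. Qed.

Lemma word_nf a : word a -> word (nf a).
Proof. by move=> aA; exact: nf_sub. Qed.

(** Two decompositions have the same reduced word by [word_unique], and the image does not change
    under reduction since equal letters have equal images. *)
Lemma phiE a s : word a -> ~~ odd (size a) -> stabS s -> phi (rp a *m s) = rp (map F a).
Proof.
move=> aA ea sS; rewrite /phi /word_of.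
have [bA eb tS E] := @xgetPex _ ([::], 1%:M) [set p : seq 'cV[R]_N * 'M[R]_N | [/\ word p.1, ~~ odd (size p.1), stabS p.2 &
     rp a *m s = rp p.1 *m p.2]] (ex_intro _ (a, s) (And4 aA ea sS erefl)).
move: (xget _ _) bA eb tS E => [b t] /= bA eb tS E.
rewrite -rp_map_F_nf -[RHS]rp_map_F_nf; congr (rp (map F _)); apply/esym.
apply: (word_unique HW (word_nf aA) (red_nf a) (word_nf bA) (red_nf b) sS.2 tS.2).
by rewrite !rp_nf //; exact: (word_unit HW).
Qed.

Lemma phi_Gam c : ~~ odd (size c) -> Gam (rp (map X c)).
Proof.
move=> ec; exists (map X c), 1%:M; rewrite size_map mulmx1; split => //; first exact: word_map_X.
exact: stabS1.
Qed.

(** The stabiliser is congruent to 1 mod [M.+1], hence preserves labels; this is what makes [phi]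
    multiplicative although it kills the stabiliser. *)
Lemma F_stab s u : stabS s -> bdry u -> F (s *m u) = F u.
Proof. by move=> sS uA; rewrite /F (lab_arith sS.1.1 uA.1.1). Qed.

Lemma phi_endo : is_endomorphism Gam phi.
Proof.
split=> [_ [a [s [aA ea sS ->]]]|_ _ [a [s [aA ea sS ->]]] [b [t [bA eb tS ->]]]].
  by rewrite phiE // map_F; apply: phi_Gam; rewrite size_map.
have si := oplus_isom (stabS_oplus sS).
rewrite Gam_mulE // !phiE //; last exact: stabSM.
- rewrite map_cat rp_cat; congr (_ *m rp _); rewrite -map_comp; apply/eq_in_map => u ub /=.
  by apply: F_stab => //; exact: bA.
- by apply: word_cat => //; exact: word_map_stab.
- by rewrite size_cat size_map oddD (negbTE ea) (negbTE eb).
Qed.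

(** The [X j] are distinct boundary walls, so the reflections in them generate a free product on the
    labels: the image is trivial only if the word of labels reduces to the empty one. This
    description does not involve [X]. *)
Lemma Ker_phi g : Ker Gam phi g -> exists a s,
  [/\ word a, red a, nf (map lab a) = [::], stabS s & g = rp a *m s].
Proof.
move=> [[a [s [aA ea sS ->]]]]; rewrite phiE // => H.
exists (nf a), s; split => //; [exact: word_nf|exact: red_nf| |by rewrite rp_nf //; exact: (word_unit HW)].
rewrite nf_map_nf.
have E : rp (map X (nf (map lab a))) *m 1%:M = rp [::] *m 1%:M.
  by rewrite rp_map_nf -?map_F ?H // map_F; apply: (word_unit HW); exact: word_map_X.
have S1 := stab1 (@wall R n q).
have w1 : word (map X (nf (map lab a))) by exact: word_map_X.
have w0 : word [::] by [].
have := word_unique HW w1 (red_map Xi (red_nf (map lab a))) w0 isT S1 S1 E.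
by case: (nf _).
Qed.

Lemma phi_image g : (phi @` Gam) g -> exists c, red c /\ g = rp (map X c).
Proof.
move=> [_ [a [s [aA ea sS ->]]] <-]; rewrite phiE //; exists (nf (map lab a)); split; first exact: red_nf.
by rewrite rp_map_nf ?map_F //; apply: (word_unit HW); exact: word_map_X.
Qed.
End Endomorphism.
End MirrorGroup.

(** * Nonnegative series through their finite partial sums *)

Section BoundedSums.
Context {R : realType}.

(** For nonnegative [f], convergence over [A] with sum at most [B], kept at the level of finite sums
    of reals. *)
Definition sum_le (T : eqType) (A : set T) (f : T -> R) (B : R) : Prop :=
  forall l : seq T, uniq l -> (forall x, x \in l -> A x) -> \sum_(x <- l) f x <= B.

Lemma sum_le_ge0 (T : eqType) (A : set T) f B : sum_le A f B -> 0 <= B.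
Proof. by move=> /(_ [::] isT); rewrite big_nil; apply. Qed.

Lemma sum_le_sub (T : eqType) (A A' : set T) f g B :
  (forall x, A x -> A' x /\ f x <= g x) -> sum_le A' g B -> sum_le A f B.
Proof.
move=> H HB l ul lA; apply: le_trans (HB l ul _); last by move=> x /lA /H[].
by rewrite [leLHS]big_seq [leRHS]big_seq; apply: ler_sum => x /lA /H[].
Qed.

Lemma sum_le_scale (T : eqType) (A : set T) f B c : 0 <= c -> sum_le A f B ->
  sum_le A (fun x => c * f x) (c * B).
Proof. by move=> c0 H l ul lA; rewrite -mulr_sumr ler_wpM2l // H. Qed.

Lemma sum_le_weaken (T : eqType) (A : set T) f B B' : B <= B' -> sum_le A f B -> sum_le A f B'.
Proof. by move=> BB H l ul lA; exact: le_trans (H l ul lA) BB. Qed.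

Lemma sum_le_cst (T : eqType) (s : seq T) (c : R) : 0 <= c ->
  sum_le [set` s] (fun=> c) ((size s)%:R * c).
Proof.
move=> c0 l ul ls; have -> : \sum_(x <- l) c = (size l)%:R * c.
  by rewrite big_const_seq count_predT iter_addr addr0 mulr_natl.
by rewrite ler_wpM2r // ler_nat; apply: uniq_leq_size.
Qed.

(** Choose one pair of parameters for each element of [A]; distinct elements get distinct pairs,
    which are then summed fibre by fibre. [h] itself need not be injective. *)
Lemma sum_le_pairs (T T1 T2 : eqType) (A : set T) (B : set T1) (C : T1 -> set T2)
    (h : T1 -> T2 -> T) f (F : T1 -> T2 -> R) b bb :
  (forall x, A x -> exists y z, [/\ B y, C y z, x = h y z & f x <= F y z]) ->
  (forall y, B y -> sum_le (C y) (F y) (b y)) -> sum_le B b bb -> sum_le A f bb.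
Proof.
move=> HA HC HB [|x0 l] ul lA; first by rewrite big_nil; exact: sum_le_ge0 HB.
have [y0 [z0 _]] := HA x0 (lA x0 (mem_head _ _)).
move: (x0 :: l) ul lA => {}l ul lA.
have [k Hk] : exists k : T -> T1 * T2, forall x, x \in l ->
    [/\ B (k x).1, C (k x).1 (k x).2, x = h (k x).1 (k x).2 & f x <= F (k x).1 (k x).2].
  have : forall x, exists p : T1 * T2, x \in l -> [/\ B p.1, C p.1 p.2, x = h p.1 p.2 & f x <= F p.1 p.2].
    move=> x; have [xl|xl] := boolP (x \in l); last by exists (y0, z0).
    by have [y [z H]] := HA x (lA x xl); exists (y, z).
  by move=> /choice[k Hk]; exists k.
pose L := map k l; pose Y := undup (map fst L).
have uL : uniq L.
  rewrite map_inj_in_uniq // => x x' /Hk[_ _ E _] /Hk[_ _ E' _] kk.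
  by rewrite E E' kk.
have LB p : p \in L -> B p.1 /\ C p.1 p.2 by move=> /mapP[x /Hk[? ? _ _] ->].
apply: (@le_trans _ _ (\sum_(p <- L) F p.1 p.2)).
  by rewrite big_map [leLHS]big_seq [leRHS]big_seq; apply: ler_sum => x /Hk[].
have -> : \sum_(p <- L) F p.1 p.2 = \sum_(y <- Y) \sum_(p <- L | p.1 == y) F p.1 p.2.
  rewrite (exchange_big_dep xpredT) //= big_seq [RHS]big_seq; apply: eq_bigr => p pL.
  under eq_bigl do rewrite eq_sym.
  rewrite -big_filter filter_pred1_uniq ?undup_uniq ?big_seq1 // mem_undup.
  by apply/mapP; exists p.
apply: (@le_trans _ _ (\sum_(y <- Y) b y)); last first.
  by apply: HB; [exact: undup_uniq | move=> y; rewrite mem_undup => /mapP[p /LB[? _] ->]].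
rewrite [leLHS]big_seq [leRHS]big_seq; apply: ler_sum => y; rewrite mem_undup => /mapP[p0 /LB[By _] yE].
rewrite -yE in By.
rewrite -big_filter; have -> : \sum_(p <- [seq p <- L | p.1 == y]) F p.1 p.2 =
    \sum_(z <- [seq p.2 | p <- L & p.1 == y]) F y z.
  by rewrite big_map big_seq [RHS]big_seq; apply: eq_bigr => p; rewrite mem_filter => /andP[/eqP -> _].
apply: HC => //.
  rewrite map_inj_in_uniq ?filter_uniq // => -[p1 p2] [p1' p2']; rewrite !mem_filter /=.
  by move=> /andP[/eqP -> _] /andP[/eqP -> _] ->.
by move=> z /mapP[p]; rewrite mem_filter => /andP[/eqP <- /LB[_ ?]] ->.
Qed.

Lemma sum_le_fin (T T1 T2 : eqType) (A : set T) (B : set T1) (s : seq T2)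
    (h : T1 -> T2 -> T) f (F : T1 -> R) bb : (forall y, B y -> 0 <= F y) ->
  (forall x, A x -> exists y z, [/\ B y, z \in s, x = h y z & f x <= F y]) ->
  sum_le B F bb -> sum_le A f ((size s)%:R * bb).
Proof.
move=> F0 HA HB; apply: (@sum_le_pairs _ _ _ A B (fun=> [set` s]) h f (fun y _ => F y) (fun y => (size s)%:R * F y)).
- by move=> x /HA[y [z [By zs xE fF]]]; exists y, z.
- by move=> y By; apply: sum_le_cst; exact: F0.
- by apply: sum_le_scale.
Qed.

Lemma sum_le_inj (T T1 : eqType) (A : set T) (B : set T1) (h : T1 -> T) f (F : T1 -> R) bb :
  (forall y, B y -> 0 <= F y) -> (forall x, A x -> exists y, [/\ B y, x = h y & f x <= F y]) ->
  sum_le B F bb -> sum_le A f bb.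
Proof.
move=> F0 HA HB; rewrite -[bb]mul1r.
apply: (@sum_le_fin _ _ unit A B [:: tt] (fun y _ => h y) f F) => // x /HA[y [By xE fF]].
by exists y, tt.
Qed.

(** Meaningful only for bounded partial sums, hence the [sum_le] hypotheses of the lemmas below. *)
Definition tsum (T : eqType) (A : set T) (f : T -> R) : R :=
  sup [set r | exists l : seq T, [/\ uniq l, forall x, x \in l -> A x & r = \sum_(x <- l) f x]].

Lemma tsum_has_sup (T : eqType) (A : set T) f B : sum_le A f B ->
  has_sup [set r | exists l : seq T, [/\ uniq l, forall x, x \in l -> A x & r = \sum_(x <- l) f x]].
Proof.
by move=> H; split; [exists 0, [::]; rewrite big_nil | exists B => _ [l [ul lA ->]]; exact: H].
Qed.

Lemma tsum_ub (T : eqType) (A : set T) f B : sum_le A f B -> sum_le A f (tsum A f).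
Proof.
move=> H l ul lA; have [_ hs] := tsum_has_sup H.
by apply: ub_le_sup => //; exists l.
Qed.

Lemma tsum_le (T : eqType) (A : set T) f B : sum_le A f B -> tsum A f <= B.
Proof.
move=> H; apply: ge_sup; first by exists 0, [::]; rewrite big_nil.
by move=> _ [l [ul lA ->]]; exact: H.
Qed.

Lemma tsum_disjoint (T I : eqType) (l : seq I) (A : I -> set T) (A0 : set T) f B :
  sum_le A0 f B -> uniq l -> (forall i x, i \in l -> A i x -> A0 x) ->
  (forall i j x, i \in l -> j \in l -> A i x -> A j x -> i = j) ->
  \sum_(i <- l) tsum (A i) f <= tsum A0 f.
Proof.
elim: l A0 => [|i l IH] A0 HA ul sub dis.
  by rewrite big_nil; exact: sum_le_ge0 (tsum_ub HA).
have {ul} /andP[il ul] := ul; rewrite big_cons.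
pose A1 := [set x | A0 x /\ ~ A i x].
have HA1 : sum_le A1 f B by apply: sum_le_sub HA => x [].
have HAi : sum_le (A i) f B by apply: sum_le_sub HA => x /(sub i); rewrite mem_head => /(_ isT).
have := IH A1 HA1 ul; move=> /(_ _ _) IH1.
have {}IH1 : \sum_(j <- l) tsum (A j) f <= tsum A1 f.
  apply: IH1.
    move=> j x jl jx; split; first by apply: (sub j) => //; rewrite inE jl orbT.
    move=> ix; move: il; rewrite (dis i j x) ?mem_head ?inE ?jl ?orbT //.
  by move=> j k x jl kl; apply: dis; rewrite inE ?jl ?kl orbT.
have : tsum A1 f <= tsum A0 f - tsum (A i) f; last by lra.
apply: tsum_le => L2 uL2 L2A; suff : tsum (A i) f <= tsum A0 f - \sum_(x <- L2) f x by lra.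
apply: tsum_le => L1 uL1 L1A; suff : \sum_(x <- L1) f x + \sum_(x <- L2) f x <= tsum A0 f by lra.
rewrite -big_cat /=; apply: (tsum_ub HA).
  rewrite cat_uniq uL1 uL2 andbT /=; apply/hasPn => x /L2A[_ nx]; apply/negP => /L1A //.
by move=> x; rewrite mem_cat => /orP[/L1A/(sub i _ (mem_head _ _))|/L2A[]].
Qed.

End BoundedSums.

(** * Negative powers *)

Section PowerDecay.
Context {R : realType}.
Implicit Types (a b c s t : R).

(** With [a] the cosh of a distance d, this replaces e^(-s d). *)
Definition pw a s : R := a `^ (- s).

Lemma pw_gt0 a s : 0 < a -> 0 < pw a s. Proof. exact: powR_gt0. Qed.

Lemma pw_ge0 a s : 0 <= pw a s. Proof. exact: powR_ge0. Qed.

Lemma pw_mul a b s : 0 <= a -> 0 <= b -> pw (a * b) s = pw a s * pw b s.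
Proof. by move=> a0 b0; rewrite /pw powRM. Qed.

Lemma pw_pow a s t : (pw a s) `^ t = pw a (s * t).
Proof. by rewrite /pw -powRrM mulNr. Qed.

Lemma pw_le a b s : 0 < a -> a <= b -> 0 <= s -> pw b s <= pw a s.
Proof.
move=> a0 ab s0; have b0 := lt_le_trans a0 ab.
rewrite /pw !powRN lef_pV2 ?posrE ?powR_gt0 //.
by apply: ge0_ler_powR => //; rewrite nnegrE ltW.
Qed.

Lemma pw_exp a s t : 1 <= a -> s <= t -> pw a t <= pw a s.
Proof. by move=> a1 st; apply: ler_powR => //; rewrite lerN2. Qed.

Lemma pw_le1 a s : 1 <= a -> 0 <= s -> pw a s <= 1.
Proof. by move=> a1 s0; rewrite -(powRr0 a) -oppr0; exact: pw_exp. Qed.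

Lemma pw_add a s t : 0 < a -> pw a (s + t) = pw a s * pw a t.
Proof. by move=> a0; rewrite /pw opprD powRD // (gt_eqF a0) implybT. Qed.

Lemma pw_scale a b c s : 0 < a -> 0 < b -> 0 < c -> a <= c * b -> 0 <= s ->
  pw b s <= c `^ s * pw a s.
Proof.
move=> a0 b0 c0 ab s0; have := pw_le a0 ab s0; rewrite pw_mul ?(ltW b0) ?(ltW c0) // => H.
have cs := powR_gt0 s c0; rewrite -(ler_pM2l (pw_gt0 s c0)) mulrA /pw [c `^ _]powRN mulVf ?gt_eqF //.
by rewrite mul1r -powRN.
Qed.

Lemma powR_small_exp a (eta : R) : 1 <= a -> 0 < eta -> exists2 e, 0 < e <= eta & a `^ e <= 2.
Proof.
move=> a1 e0; have l2 : 0 < ln (2 : R) by apply: ln_gt0; lra.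
have la : 0 <= ln a by exact: ln_ge0.
have lp : 0 < ln a + 1 by lra.
exists (Num.min eta (ln 2 / (ln a + 1))).
  by rewrite lt_min e0 divr_gt0 //= ge_min lexx.
apply: (@le_trans _ _ (a `^ (ln 2 / (ln a + 1)))).
  by apply: ler_powR => //; rewrite ge_min lexx orbT.
rewrite /powR gt_eqF; last lra.
rewrite -[X in _ <= X](@lnK _ 2) ?posrE // ler_expR.
by rewrite mulrAC ler_pdivrMr // ler_wpM2l ?(ltW l2) //; lra.
Qed.

Lemma pw_small (e eta : R) : 0 < e -> 0 < eta -> exists2 L, 1 <= L & forall a, L <= a -> pw a e <= eta.
Proof.
move=> e0 h0; exists (Num.max 1 (eta^-1 `^ e^-1)); first by rewrite le_max lexx.
move=> a; rewrite ge_max => /andP[a1 ae].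
rewrite /pw powRN -[eta]invrK lef_pV2 ?posrE ?invr_gt0 ?powR_gt0 //; last lra.
have -> : eta^-1 = (eta^-1 `^ e^-1) `^ e.
  by rewrite -powRrM mulVf ?gt_eqF // powRr1 // invr_ge0 ltW.
by apply: ge0_ler_powR => //; rewrite ?nnegrE ?powR_ge0 ?(ltW e0) //; lra.
Qed.

(** Young's inequality with exponents 1 / th and 1 / (1 - th). *)
Lemma pow_interpolate (r t0 th : R) : 0 < r -> 0 < th < 1 ->
  r `^ (th + (1 - th) * t0) <= r + (1 - th) * r `^ t0.
Proof.
move=> r0 /andP[h0 h1].
have P : 0 < th^-1 by rewrite invr_gt0.
have Q : 0 < (1 - th)^-1 by rewrite invr_gt0; lra.
have PQ : th^-1^-1 + (1 - th)^-1^-1 = 1 by rewrite !invrK; ring.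
have := conjugate_powR (powR_ge0 r th) (powR_ge0 (r `^ t0) (1 - th)) P Q PQ.
have n0 : 1 - th != 0 by rewrite gt_eqF //; lra.
rewrite -!powRrM !invrK mulfV ?gt_eqF // mulfK // powRr1 ?(ltW r0) //.
rewrite -powRD ?(gt_eqF r0) ?implybT // [(1 - th) * t0]mulrC => H; apply: le_trans H _.
rewrite [_ * (1 - th)]mulrC lerD2r.
by rewrite ler_piMr ?(ltW r0) ?(ltW h1).
Qed.
End PowerDecay.

(** * Orbit growth of a group [H] cocompact on a convex set [D] *)

Section OrbitGrowth.
Context {R : realType} {n : nat}.
Local Notation N := n.+1.
Local Notation o := (base_point : 'cV[R]_n.+1).
Implicit Types (x y z w v u p : 'cV[R]_N) (g h k : 'M[R]_N) (s C r : R).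

Let hb : hyp o := base_hyp.

Definition ht g : R := g ord_max ord_max.

Lemma htE g : ht g = tau (g *m o) o. Proof. by rewrite tau_base. Qed.

Lemma ht_ge1 g : oplus g -> 1 <= ht g.
Proof. by move=> go; rewrite htE; apply: tau_ge1 => //; exact: oplus_hyp. Qed.

Lemma ht_gt0 g : oplus g -> 0 < ht g. Proof. by move=> /ht_ge1; apply: lt_le_trans. Qed.

Lemma tau_move g x y : oplus g -> tau (g *m x) y = tau x (invmx g *m y).
Proof. by move=> go; rewrite -(oplus_tau x _ go) isom_mulK //; exact: oplus_isom. Qed.

Lemma htV g : oplus g -> ht (invmx g) = ht g.
Proof. by move=> go; rewrite !htE [RHS]tau_move // tauC. Qed.

Definition orb (s : R) g : R := pw (ht g) s.

Lemma orb_ge0 s g : 0 <= orb s g. Proof. exact: pw_ge0. Qed.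

Lemma rho_ge2 C r : 1 <= C -> 8 * C <= r -> 2 <= r / (4 * C).
Proof. by move=> C1 rC; rewrite ler_pdivlMr; lra. Qed.

Lemma r_le_2rC C r : 1 <= C -> 8 * C <= r -> r <= 2 * r * C.
Proof.
move=> C1 rC; have r0 : 0 <= r by lra.
have c0 : 0 <= C - 1 by lra.
have := mulr_ge0 r0 c0; rewrite mulrBr mulr1 => H.
by rewrite -mulrA; lra.
Qed.

Section Criterion.
Variables (H : set 'M[R]_N) (D : set 'cV[R]_N) (C : R).
Hypotheses (HA : H `<=` arith 1) (HM : forall g h, H g -> H h -> H (g *m h))
  (HV : forall g, H g -> H (invmx g)) (Do : forall h, H h -> D (h *m o)) (D1 : D o)
  (Dconv : forall x y (al be : R), D x -> D y -> 0 <= al -> 0 <= be -> hyp (al *: x + be *: y) ->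
     D (al *: x + be *: y))
  (C1 : 1 <= C) (coc : forall x, D x -> exists h, H h /\ tau (h *m x) o <= C).

Let Hop h : H h -> oplus h. Proof. by move=> /HA /arith_oplus. Qed.

(** Stop at cosh distance [r] on the segment from the base point to its image, which stays in [D],
    and use cocompactness to return from there to near the base point. *)
Lemma orbit_split h r : H h -> 1 <= r -> r <= ht h -> exists h1 h2,
  [/\ H h1, H h2, h = h1 *m h2, ht h1 <= 2 * r * C & ht h2 <= 4 * C * ht h / r].
Proof.
move=> Hh r1 rh; have ho := Hop Hh; have hho := oplus_hyp ho hb.
have rh' : r <= tau o (h *m o) by rewrite tauC -htE.
have [al [be [z [al0 be0 zE hz [zr zh]]]]] := hyp_segment hb hho r1 rh'.
have Dz : D z by rewrite zE; apply: Dconv; rewrite -?zE //; exact: Do.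
have [k [Hk kz]] := coc Dz; have ko := Hop Hk; have ki := oplus_isom ko.
have hk := oplus_hyp ko hz; have t0 := tau_gt0 hk hb.
exists (invmx k), (k *m h); split.
- exact: HV.
- exact: HM.
- by rewrite isom_invM.
- rewrite htV // htE; have hko := oplus_hyp ko hb.
  apply: le_trans (tau_tri hko hk hb) _; rewrite oplus_tau // zr -!mulrA.
  by rewrite ler_wpM2l // ler_wpM2l //; lra.
- rewrite htE -mulmxA; have hkh := oplus_hyp ko hho.
  apply: le_trans (tau_tri hkh hk hb) _; rewrite oplus_tau // [tau (h *m o) z]tauC.
  have zp := tau_gt0 hz hho; rewrite [tau o _]tauC -htE in zh.
  have h0 := ht_gt0 ho; move: zh; set w := ht h / r; have -> : 2 * ht h / r = 2 * w by rewrite /w mulrA.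
  have -> : 4 * C * ht h / r = 4 * C * w by rewrite /w mulrA.
  by nra.
Qed.

(** Splitting off factors of height about [r] divides heights by [rho]. If the number of such
    factors times rho^-s is at most 1/2, then the sum up to height r rho^(j+1) is at most K plus
    half the sum up to r rho^j, so 2 K bounds all of them. *)
Lemma growth_criterion (r s : R) (l : seq 'M[R]_N) : 8 * C <= r -> 0 <= s ->
  (forall h, H h -> ht h <= 2 * r * C -> h \in l) ->
  (size l)%:R * pw (r / (4 * C)) s <= 2^-1 -> sum_le H (orb s) (2 * (size l)%:R).
Proof.
move=> rC s0 lH small; have r1 : 1 <= r.
  by apply: le_trans rC; apply: le_trans C1 _; rewrite ler_peMl ?(le_trans ler01 C1) // ler1n.
set K := (size l)%:R; set rho := r / (4 * C).
have r2 : 2 <= rho := rho_ge2 C1 rC.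
have rho0 : 0 < rho by apply: lt_le_trans r2.
have rho1 : 1 <= rho by apply: le_trans r2; rewrite ler1n.
have K0 : 0 <= K by exact: ler0n.
pose Hj (j : nat) := [set h | H h /\ ht h <= r * rho ^+ j].
have main j : sum_le (Hj j) (orb s) (2 * K).
  elim: j => [|j IH].
    move=> l' ul' l'H; apply: (@le_trans _ _ K); last lra.
    rewrite -[K]mulr1; apply: le_trans (_ : \sum_(x <- l') 1 <= _).
      rewrite [leLHS]big_seq [leRHS]big_seq; apply: ler_sum => x /l'H[Hx _].
      by apply: pw_le1 => //; apply: ht_ge1; exact: Hop.
    apply: sum_le_cst => // x /l'H[Hx hx]; apply: lH => //.
    by apply: le_trans (r_le_2rC C1 rC); rewrite expr0 mulr1 in hx.
  move=> l' ul' l'H; rewrite (bigID (fun h => ht h <= r)) /=.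
  have -> : 2 * K = K + K by ring.
  apply: lerD.
    rewrite -big_filter; rewrite -[K]mulr1; apply: le_trans (_ : \sum_(x <- [seq i <- l' | ht i <= r]) 1 <= _).
      rewrite [leLHS]big_seq [leRHS]big_seq; apply: ler_sum => x; rewrite mem_filter => /andP[_ /l'H[Hx _]].
      by apply: pw_le1 => //; apply: ht_ge1; exact: Hop.
    apply: sum_le_cst => //; first exact: filter_uniq.
    move=> x; rewrite mem_filter => /andP[xr /l'H[Hx _]]; apply: lH => //.
    exact: le_trans xr (r_le_2rC C1 rC).
  rewrite -big_filter.
  have : sum_le [set h | [/\ H h, r < ht h & ht h <= r * rho ^+ j.+1]] (orb s)
      (K * (pw rho s * (2 * K))).
    apply: (@sum_le_fin _ _ _ _ _ (Hj j) l (fun h2 h1 => h1 *m h2) _ (fun h => pw rho s * orb s h)).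
    - by move=> h _; rewrite mulr_ge0 ?pw_ge0.
    - move=> h [Hh rh hj]; have [|h1 [h2 [H1 H2 hE h1r h2r]]] := @orbit_split h r Hh _ (ltW rh) => //.
      have e : 4 * C * ht h / r = ht h / rho by rewrite /rho invf_div; ring.
      rewrite e in h2r; exists h2, h1; split => //; last first.
        rewrite /orb -pw_mul ?(ltW rho0) ?(ltW (ht_gt0 (Hop H2))) //; apply: pw_le => //.
          by rewrite mulr_gt0 // ht_gt0 //; exact: Hop.
        by rewrite mulrC -ler_pdivlMr.
      + exact: lH.
      + split => //; apply: le_trans h2r _; rewrite ler_pdivrMr // -mulrA -exprSr.
        by [].
    - by apply: sum_le_scale => //; exact: pw_ge0.
  move=> /(_ [seq i <- l' | ~~ (ht i <= r)] (filter_uniq _ ul')) HH.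
  apply: le_trans (HH _) _.
    by move=> x; rewrite mem_filter -ltNge => /andP[xr /l'H[]].
  by rewrite mulrA; move: small; rewrite -/K -/rho => h; nra.
move=> l' ul' l'H.
have [j Hj'] : exists j, forall g, g \in l' -> ht g <= r * rho ^+ j.
  elim: l' {ul'} l'H => [|x l' IH] l'H; first by exists 0%N.
  have [|j Hj'] := IH; first by move=> y yl; apply: l'H; rewrite inE yl orbT.
  exists (maxn j (Num.truncn (ht x)).+1) => y; rewrite inE => /orP[/eqP ->|/Hj' yj].
    apply: (@le_trans _ _ (rho ^+ maxn j (Num.truncn (ht x)).+1)); last first.
      by rewrite ler_peMl ?exprn_ge0 ?(ltW rho0).
    apply: (@le_trans _ _ (2 ^+ (Num.truncn (ht x)).+1)).
      apply: le_trans (ltW (truncnS_gt _)) _; rewrite -natrX ler_nat; exact/ltnW/ltn_expl.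
    apply: (@le_trans _ _ (rho ^+ (Num.truncn (ht x)).+1)).
      by rewrite lerXn2r ?nnegrE ?(ltW rho0).
    by apply: ler_weXn2l => //; rewrite leq_maxr.
  apply: le_trans yj _; rewrite ler_wpM2l ?(le_trans ler01) //.
  by apply: ler_weXn2l => //; rewrite leq_maxl.
by apply: (main j) => // x xl; split; [exact: l'H | exact: Hj'].
Qed.

Lemma ball_list r : exists l : seq 'M[R]_N, uniq l /\ forall h, (H h /\ ht h <= r) <-> h \in l.
Proof.
have /finite_seqP[l lE] : finite_set [set h | H h /\ ht h <= r].
  by apply: sub_finite_set (finite_arith_ball r) => h [/HA ha hr].
exists (undup l); split; first exact: undup_uniq.
move=> h; rewrite mem_undup; have <- : [set` l] h = (h \in l) by [].
by rewrite -lE.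
Qed.

Lemma orbit_growth_finite : exists2 s, 0 <= s & exists B, sum_le H (orb s) B.
Proof.
have [l [ul lE]] := ball_list (2 * (8 * C) * C).
(* At r = 8 C the scale [rho] equals 2, and 2^-s beats the number k of elements of the ball, as 2 k
   <= 2^(2 k). *)
pose s : R := (2 * size l)%:R.
exists s; first exact: ler0n.
exists (2 * (size l)%:R); apply: (@growth_criterion (8 * C)) => //.
  by move=> h Hh hr; apply/lE.
have -> : 8 * C / (4 * C) = 2 by field; rewrite gt_eqF // (lt_le_trans ltr01 C1).
rewrite /pw powRN powR_mulrn // ler_pdivrMr ?exprn_gt0 //.
have : ((2 * size l)%:R : R) <= 2 ^+ (2 * size l) by rewrite -natrX ler_nat ltnW // ltn_expl.
by rewrite natrM; lra.
Qed.

(** Convergence at [d] makes the size of the ball of radius T, times T^-d, arbitrarily small. So the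
    growth criterion holds at [d] with room to spare, and still holds slightly below [d]. *)
Lemma orbit_gap (d B : R) : 0 < d -> sum_le H (orb d) B ->
  exists2 s0, 0 <= s0 < d & exists B', sum_le H (orb s0) B'.
Proof.
move=> d0 HB; have C1l := C1; set S := tsum H (orb d).
pose E := (8 * C ^+ 2) `^ d; have E0 : 0 < E by apply: powR_gt0; rewrite mulr_gt0 // exprn_gt0 //; lra.
pose ep := (4 * E)^-1; have ep0 : 0 < ep by rewrite invr_gt0; lra.
(* A finite set carrying all of the sum but [ep / 2]. *)
have [L [uL LH LS]] : exists L : seq 'M[R]_N, [/\ uniq L, forall g, g \in L -> H g & S - ep / 2 < \sum_(g <- L) orb d g].
  have ep2 : 0 < ep / 2 by lra.
  have [r [L [uL LH rE]] rS] := sup_adherent ep2 (tsum_has_sup HB).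
  by exists L; split => //; rewrite -rE.
have ep3 : 0 < ep / 2 / ((size L)%:R + 1) by rewrite divr_gt0 ?ltr_pwDr //; lra.
have [T0 T01 HT] := pw_small d0 ep3.
pose r := Num.max (8 * C) T0; have r8 : 8 * C <= r by rewrite le_max lexx.
have rT : T0 <= r by rewrite le_max lexx orbT.
have [l [ul lE]] := ball_list (2 * r * C).
pose rho := r / (4 * C); have rho2 : 2 <= rho := rho_ge2 C1 r8.
pose T := 2 * r * C; have TT0 : T0 <= T := le_trans rT (r_le_2rC C1 r8).
have T0' : 0 < T by lra.
have pT := pw_gt0 d T0'.
(* Each element of the ball outside [L] contributes at least [pw T d] to the remainder, while [T] is
   large enough for [L] itself to count for at most [ep / 2]. *)
have sz : (size l)%:R * pw T d <= ep.
  have c1 : (size l <= size L + size [seq x <- l | x \notin L])%N.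
    rewrite size_filter -(count_predC (mem L) l) leq_add2r -size_filter.
    by apply: uniq_leq_size; [exact: filter_uniq | move=> x; rewrite mem_filter => /andP[]].
  have c2 : (size [seq x <- l | x \notin L])%:R * pw T d <= ep / 2.
    have : \sum_(x <- L ++ [seq x <- l | x \notin L]) orb d x <= S.
      apply: (tsum_ub HB).
        rewrite cat_uniq uL filter_uniq // andbT /=; apply/hasPn => x; rewrite mem_filter => /andP[xL _]; exact: xL.
      by move=> x; rewrite mem_cat mem_filter => /orP[/LH//|/andP[_ /lE[]]].
    rewrite big_cat /= => H1; apply: (@le_trans _ _ (\sum_(x <- [seq x <- l | x \notin L]) orb d x)); last by lra.
    have -> : (size [seq x <- l | x \notin L])%:R * pw T d = \sum_(x <- [seq x <- l | x \notin L]) pw T d.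
      by rewrite big_const_seq count_predT iter_addr addr0 mulr_natl.
    rewrite [leLHS]big_seq [leRHS]big_seq; apply: ler_sum => x; rewrite mem_filter => /andP[_ /lE[Hx xT]].
    by apply: pw_le => //; [exact/ht_gt0/Hop | exact: ltW].
  have c3 : (size L)%:R * pw T d <= ep / 2.
    apply: le_trans (_ : ((size L)%:R + 1) * pw T d <= _).
      by rewrite ler_wpM2r ?(ltW pT) //; lra.
    rewrite mulrC -ler_pdivlMr; first exact: HT.
    by rewrite ltr_pwDr.
  have : (size l)%:R <= (size L)%:R + (size [seq x <- l | x \notin L])%:R :> R by rewrite -natrD ler_nat.
  by move=> c4; have : (size l)%:R * pw T d <= ((size L)%:R + (size [seq x <- l | x \notin L])%:R) * pw T d; [rewrite ler_wpM2r // ltW | lra].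
have pr : pw rho d <= E * pw T d.
  apply: pw_scale => //; [lra | nra | | exact: ltW].
  by rewrite /T /rho le_eqVlt; apply/orP; left; apply/eqP; field; lra.
(* The criterion asks for 1/2; the spare factor 2 pays for lowering the exponent by [e]. *)
have sz2 : (size l)%:R * pw rho d <= 4^-1.
  apply: (@le_trans _ _ ((size l)%:R * (E * pw T d))); first by rewrite ler_wpM2l.
  rewrite mulrCA; apply: (@le_trans _ _ (E * ep)); first by rewrite ler_wpM2l // ltW.
  by rewrite /ep le_eqVlt; apply/orP; left; apply/eqP; field; rewrite gt_eqF.
have rho1 : 1 <= rho by lra.
have [e /andP[e0 ed] re] := powR_small_exp rho1 d0.
exists (d - e); first by apply/andP; split; lra.
exists (2 * (size l)%:R); apply: (@growth_criterion r) => //; first lra.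
  by move=> h Hh hr; apply/lE.
rewrite -/rho; have rp : 0 < rho by lra.
have : pw rho (d - e) <= 2 * pw rho d.
  have -> : pw rho d = pw rho (d - e) * pw rho e by rewrite -pw_add // subrK.
  rewrite [pw rho e]/pw powRN; have w0 := powR_gt0 e rp; have := pw_gt0 (d - e) rp.
  move: (pw rho (d - e)) (rho `^ e) re w0 => a b b2 b0 a0.
  by rewrite mulrA ler_pdivlMr // mulrC ler_wpM2r // ltW.
move=> h; apply: (@le_trans _ _ ((size l)%:R * (2 * pw rho d))); first by rewrite ler_wpM2l.
lra.
Qed.
End Criterion.
End OrbitGrowth.

(** * Masses of half-spaces *)

Section Shadows.
Context {R : realType} {n : nat}.
Local Notation N := n.+1.
Local Notation o := (base_point : 'cV[R]_n.+1).
Implicit Types (x y z w v u p U : 'cV[R]_N) (g h k : 'M[R]_N) (s C r : R).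

Let hb : hyp o := base_hyp.

Lemma cosh_wallN u x : cosh_wall (- u) x = cosh_wall u x.
Proof. by rewrite /cosh_wall lorentzNl sqrrN. Qed.

Lemma cosh_wall_isom g u x : isom g -> cosh_wall (g *m u) x = cosh_wall u (invmx g *m x).
Proof. by move=> gi; rewrite /cosh_wall isom_adj. Qed.

Lemma wall_dist u x p : lorentz u u = 1 -> hyp x -> hyp p -> lorentz u p = 0 ->
  cosh_wall u x <= tau x p.
Proof.
move=> u1 hx hp up.
have main v : lorentz v v = 1 -> lorentz v p = 0 -> lorentz v x <= 0 -> cosh_wall v x <= tau x p.
  move=> v1 vp vx; have vp0 : 0 <= lorentz v p by rewrite vp.
  apply: le_trans (halfspace_tau v1 vx vp0).
  by rewrite ler_peMr ?(ltW (cosh_wall_gt0 _ _)) //; apply: tau_ge1 => //; exact: wall_proj_hyp.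
have [ux|/ltW ux] := leP (lorentz u x) 0; first exact: main.
by rewrite -cosh_wallN; apply: main; rewrite ?lorentzNl ?lorentzNr ?opprK ?up ?oppr0 ?oppr_le0.
Qed.

Lemma cosh_wall_lip u x y : lorentz u u = 1 -> hyp x -> hyp y ->
  cosh_wall u x <= 2 * tau x y * cosh_wall u y.
Proof.
move=> u1 hx hy; have hp := wall_proj_hyp u1 hy.
apply: le_trans (wall_dist u1 hx hp (wall_proj_wall _ u1)) _.
by rewrite -(wall_proj_tau u1 hy); exact: tau_tri.
Qed.

Section Mass.
Variables (C s B : R).
Hypotheses (C1 : 1 <= C) (s0 : 0 <= s) (HB : sum_le (arith 1) (orb (R := R) (n := n) s) B)
  (coc : forall x, hyp x -> exists h, arith 1 h /\ tau (h *m x) o <= C).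

Definition half_orbit U : set 'M[R]_N := [set g | arith 1 g /\ 0 <= lorentz U (g *m o)].
Definition orbit_sum : R := tsum (arith 1) (orb (R := R) (n := n) s).
(** Plays the role of the Patterson measure of a half-space, at an exponent [s] where the series
    converges. *)
Definition mass U : R := tsum (half_orbit U) (orb s).

Lemma half_orbit_sum U : sum_le (half_orbit U) (orb s) B.
Proof. by apply: sum_le_sub HB => g []. Qed.

Lemma orbit_sum_ge1 : 1 <= orbit_sum.
Proof.
have := @tsum_ub R _ _ _ _ HB [:: 1%:M] isT; rewrite big_seq1 /orb /ht mxE eqxx /pw powR1.
by apply => g; rewrite inE => /eqP ->; exact: arith1.
Qed.

Lemma mass_ge0 U : 0 <= mass U.
Proof. by apply: (@sum_le_ge0 R _ (half_orbit U) (orb s)); exact: tsum_ub (@half_orbit_sum U). Qed.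

(** Orbit points behind the wall are seen through its foot [p], which costs the factor
    [cosh_wall U o] by [halfspace_tau]; seen from [p], which is close to the orbit, the sum is at
    most a constant times the full one. *)
Lemma mass_upper U : lorentz U U = 1 -> lorentz U o <= 0 ->
  mass U <= (2 * C) `^ s * pw (cosh_wall U o) s * orbit_sum.
Proof.
move=> U1 Uo; have hp := wall_proj_hyp U1 hb; set p := wall_proj U o in hp.
have [h [hA hpC]] := coc hp; have ho := arith_oplus hA; have hi := oplus_isom ho.
have C0 : 0 < 2 * C by have := C1; lra.
have c0 := cosh_wall_gt0 U o.
apply: tsum_le; apply: (@sum_le_inj _ _ _ _ (arith 1) (fun g => invmx h *m g) _
    (fun g => ((2 * C) `^ s * pw (cosh_wall U o) s) * orb s g)).
- by move=> g _; rewrite !mulr_ge0 ?powR_ge0 ?pw_ge0.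
- move=> g [gA Ug]; exists (h *m g); split; [exact: arithM | by rewrite isom_invM |].
  have go := arith_oplus gA; have hgo := oplus_hyp go hb; have hgoh := oplus_hyp ho hgo; have hph := oplus_hyp ho hp.
  have hto := ht_gt0 (oplusM ho go).
  have L : ht (h *m g) <= (2 * C) * tau p (g *m o).
    rewrite htE -mulmxA; apply: le_trans (tau_tri hgoh hph hb) _.
    rewrite oplus_tau // [tau (g *m o) p]tauC mulrAC ler_wpM2r ?(ltW (tau_gt0 hp hgo)) //.
    by rewrite ler_wpM2l.
  have := halfspace_tau U1 Uo Ug; rewrite -/p => L2.
  rewrite /orb (htE g) [tau (g *m o) o]tauC.
  have t0 := tau_gt0 hp hgo.
  apply: le_trans (pw_le (mulr_gt0 c0 t0) L2 s0) _; rewrite pw_mul ?(ltW c0) ?(ltW t0) //.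
  rewrite -mulrA mulrCA ler_wpM2l ?pw_ge0 //.
  exact: pw_scale.
- apply: sum_le_scale; first by rewrite mulr_ge0 ?powR_ge0 ?pw_ge0.
  exact: tsum_ub HB.
Qed.

(** The reflection in [U] fixes the foot [p] and folds the orbit into the half-space, so the latter
    carries at least half of the sum as seen from [p]. *)
Lemma mass_lower U : lorentz U U = 1 -> arith 1 (refl U) ->
  pw (cosh_wall U o) s * orbit_sum <= 2 * (4 * C) `^ s * mass U.
Proof.
move=> U1 rA; have hp := wall_proj_hyp U1 hb; set p := wall_proj U o in hp.
have Up : lorentz U p = 0 by exact: wall_proj_wall.
have [h [hA hpC]] := coc hp; have ho := arith_oplus hA; have hi := oplus_isom ho.
have ro := arith_oplus rA; have ri := oplus_isom ro.
have rp' : refl U *m p = p by rewrite refl_unitE // Up mulr0 scale0r subr0.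
have c0 := cosh_wall_gt0 U o.
have C0 : 0 < 4 * C by have := C1; lra.
have po : tau o p = cosh_wall U o by exact: wall_proj_tau.
suff : orbit_sum <= (size [:: true; false])%:R * ((4 * C * cosh_wall U o) `^ s * mass U).
  rewrite /= powRM ?(ltW C0) ?(ltW c0) // => H.
  rewrite mulrC -ler_pdivlMr ?pw_gt0 //; apply: le_trans H _.
  rewrite /pw powRN invrK le_eqVlt; apply/orP; left; apply/eqP; ring.
apply: tsum_le; apply: (@sum_le_fin _ _ _ _ _ (half_orbit U) [:: true; false]
  (fun g (b : bool) => if b then h *m g else h *m (refl U *m g)) _ (fun g => (4 * C * cosh_wall U o) `^ s * orb s g)).
- by move=> g _; rewrite mulr_ge0 ?powR_ge0 ?pw_ge0.
- move=> g gA; have go := arith_oplus gA; have hgo := oplus_hyp go hb.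
  have hV : oplus (invmx h) by exact: oplusV.
  have g1A : arith 1 (invmx h *m g) by apply: arithM => //; exact: arithV.
  have est k : arith 1 k -> tau p (k *m o) = tau p (invmx h *m g *m o) -> orb s g <= (4 * C * cosh_wall U o) `^ s * orb s k.
    move=> kA kE; have ko := arith_oplus kA; have hko := oplus_hyp ko hb; have hph := oplus_hyp ho hp.
    have cc : 0 < 4 * C * cosh_wall U o by exact: mulr_gt0.
    apply: pw_scale (ht_gt0 ko) (ht_gt0 go) cc _ s0.
    rewrite (htE k); apply: le_trans (tau_tri hko hp hb) _; rewrite [tau p o]tauC po [tau (k *m o) p]tauC kE.
    have -> : tau p (invmx h *m g *m o) = tau (h *m p) (g *m o).
      by rewrite -mulmxA -(oplus_tau p _ ho) isom_mulK.
    rewrite [leRHS]mulrAC ler_wpM2r ?(ltW c0) //.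
    have := tau_tri hph hb hgo; rewrite [tau o (g *m o)]tauC -(htE g) => L.
    have := ht_gt0 go; have := hpC; move: (ht g) (tau (h *m p) (g *m o)) (tau (h *m p) o) L => a b c L ca a0.
    have : c * a <= C * a by rewrite ler_wpM2r // ltW.
    by lra.
  have e : invmx h *m g *m o = invmx h *m (g *m o) by rewrite mulmxA.
  have [Ug|Ug] := leP 0 (lorentz U (invmx h *m g *m o)).
    exists (invmx h *m g), true; split; rewrite ?mem_head ?isom_mulMV //.
    exact: est.
  exists (refl U *m (invmx h *m g)), false; split.
  + split; first exact: arithM.
    by rewrite -mulmxA refl_unitE // !lorentzE U1; lra.
  + by rewrite !inE.
  + by rewrite (mulmxA (refl U)) refl_unitK // mul1mx isom_mulMV.
  + apply: est; first exact: arithM.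
    by rewrite -{1}rp' -[refl U *m _ *m o]mulmxA oplus_tau.
- apply: sum_le_scale; first exact: powR_ge0.
  exact: tsum_ub (@half_orbit_sum U).
Qed.
End Mass.
End Shadows.

(** * The exponent of the arithmetic group and the gap for the chamber stabiliser *)

Section CriticalGap.
Context {R : realType} {n : nat}.
Local Notation N := n.+1.
Local Notation o := (base_point : 'cV[R]_n.+1).
Implicit Types (x y z w v u p U : 'cV[R]_N) (g h k : 'M[R]_N).

Let hb : hyp o := base_hyp.

Lemma cocompact_constant : exists2 C : R, 1 <= C &
  forall x, hyp x -> exists h, arith 1 h /\ tau (h *m x) o <= C.
Proof.
have [c Hc] := @arith1_cocompact R n; exists (Num.max 1 c); first by rewrite le_max lexx.
by move=> x /Hc[h [hA hc]]; exists h; split => //; rewrite le_max hc orbT.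
Qed.

Definition convergent (s : R) : Prop := exists B, sum_le (arith 1) (orb (R := R) (n := n) s) B.

(** Critical exponent of the full arithmetic group, computed with heights. Its value is never
    computed; it serves only for comparison. *)
Definition delta : R := inf [set s | 0 <= s /\ convergent s].

Lemma sum_le_exp (H : set 'M[R]_N) (s t B : R) : H `<=` arith 1 -> s <= t ->
  sum_le H (orb s) B -> sum_le H (orb t) B.
Proof.
move=> HA st; apply: sum_le_sub => g Hg; split => //; apply: pw_exp => //.
by apply: ht_ge1; apply: (@arith_oplus R n 1); exact: HA.
Qed.

Lemma convergent_exists : exists s, 0 <= s /\ convergent s.
Proof.
have [C C1 coc] := cocompact_constant.
have Ho h : arith 1 h -> hyp (h *m o) by move=> /arith_oplus ho; exact: oplus_hyp.
have Hc x y (al be : R) : hyp x -> hyp y -> 0 <= al -> 0 <= be ->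
  hyp (al *: x + be *: y) -> hyp (al *: x + be *: y) by [].
have [s s0 [B HB]] := orbit_growth_finite (@subset_refl _ (arith 1)) (@arithM R n 1) (@arithV R n 1) Ho hb Hc C1 coc.
by exists s; split => //; exists B.
Qed.

Lemma delta_ge0 : 0 <= delta.
Proof. by apply: lb_le_inf; [exact: convergent_exists | move=> s []]. Qed.

Lemma delta_lb s : 0 <= s -> convergent s -> delta <= s.
Proof. by move=> s0 sC; apply: ge_inf; [exists 0 => t [] | split]. Qed.

Lemma delta_convergent s : delta < s -> convergent s.
Proof.
move=> ds; have [t [t0 [B tB]] ts] : exists2 t, 0 <= t /\ convergent t & t < s.
  by apply: inf_lt ds; exact: convergent_exists.
by exists B; apply: sum_le_exp tB => //; exact: ltW.
Qed.

Lemma powR_ge1 (a t : R) : 1 <= a -> 0 <= t -> 1 <= a `^ t.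
Proof. by move=> a1 t0; rewrite -(powRr0 a); apply: ler_powR. Qed.

Section Stabilizer.
Variables (q M : nat).
Hypotheses (n2 : (2 <= n)%N) (q2 : (2 < q)%N) (qM : (q %| M.+1)%N).
Let HW := @wall_system_q R n q q2.
Local Notation bdry := (bdry (@wall R n q)).
Local Notation chamber := (chamber (@wall R n q)).
Local Notation S := (@stabS R n q M).

Lemma stab_arith1 : S `<=` arith 1.
Proof. by move=> g [[gA _] _]; exact: arith_dvd (dvd1n _) gA. Qed.

Lemma S_oplus g : S g -> oplus g. Proof. by move=> /stab_arith1/arith_oplus. Qed.

Lemma chamber_convex x y (al be : R) : chamber x -> chamber y -> 0 <= al -> 0 <= be ->
  hyp (al *: x + be *: y) -> chamber (al *: x + be *: y).
Proof.
move=> [_ xW] [_ yW] al0 be0 h; split => // w wW; rewrite !lorentzE.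
by have := xW w wW; have := yW w wW; nra.
Qed.

Lemma chamber_cocompact : exists2 C : R, 1 <= C & forall x, chamber x -> exists h, S h /\ tau (h *m x) o <= C.
Proof.
have [c Hc] := @stabS_cocompact R n q M q2 qM; exists (Num.max 1 c); first by rewrite le_max lexx.
by move=> x /Hc[h [hA hc]]; exists h; split => //; rewrite le_max hc orbT.
Qed.

(** Since n >= 2, the wall has a unit tangent vector [e] at [p0]. Follow the geodesic along [e] or
    [- e], whichever does not approach the base point. *)
Lemma wall_unbounded u (L : R) : lorentz u u = 1 -> exists p, [/\ hyp p, lorentz u p = 0 & L <= tau p o].
Proof.
move=> u1; pose p0 := wall_proj u o; have hp0 : hyp p0 := wall_proj_hyp u1 hb.
have up0 : lorentz u p0 = 0 by exact: wall_proj_wall.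
clearbody p0.
have [e [e1 eu ep]] : exists e, [/\ lorentz e e = 1, lorentz u e = 0 & lorentz p0 e = 0].
  pose A : 'M[R]_(N, 1 + 1) := row_mx (lorJ *m u) (lorJ *m p0).
  have /rowV0Pn[v /sub_kermxP vA v0] : kermx A != 0.
    rewrite -mxrank_eq0 mxrank_ker -lt0n subn_gt0; apply: leq_ltn_trans (rank_leq_col A) _.
    by rewrite ltnS.
  have vJ x : v *m (lorJ *m x) = 0 -> lorentz x v^T = 0.
    by move=> H; rewrite lorentz_mx -[X in X *m _]trmxK -trmx_mul trmxK H trmx0 mxE.
  have /eqP := vA; rewrite mul_mx_row -row_mx0 => /eqP/eq_row_mx[/vJ vu /vJ vp].
  have e0 : 0 < lorentz v^T v^T.
    rewrite lt_neqAle (perp_hyp_ge0 hp0 vp) andbT.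
    rewrite eq_sym; apply: contra v0 => /eqP/(perp_hyp_eq0 hp0 vp) vT.
    by rewrite -[v]trmxK vT trmx0.
  exists ((Num.sqrt (lorentz v^T v^T))^-1 *: v^T); rewrite !lorentzE vu vp !mulr0; split => //.
  have sq : Num.sqrt (lorentz v^T v^T) ^+ 2 = lorentz v^T v^T by rewrite sqr_sqrtr // ltW.
  have s0 : Num.sqrt (lorentz v^T v^T) != 0 by rewrite gt_eqF // sqrtr_gt0.
  by rewrite -{3}sq; field.
wlog eo : e e1 eu ep / lorentz e o <= 0.
  move=> H; have [eo|/ltW eo] := leP (lorentz e o) 0; first exact: (H e).
  by apply: (H (- e)); rewrite ?lorentzNl ?lorentzNr ?opprK ?eu ?ep ?oppr0 ?oppr_le0.
pose t := Num.max 0 L; have t0 : 0 <= t by rewrite le_max lexx.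
pose c := Num.sqrt (1 + t ^+ 2); have c2 : c ^+ 2 = 1 + t ^+ 2 by rewrite sqr_sqrtr // addr_ge0 // sqr_ge0.
have ct : t <= c by rewrite -[t]ger0_norm // -sqrtr_sqr ler_sqrt ?addr_ge0 ?sqr_ge0 // lerDr.
have c0 : 0 < c by rewrite sqrtr_gt0 ltr_pwDl // sqr_ge0.
have lo x : lorentz (c *: p0 + t *: e) x = c * lorentz p0 x + t * lorentz e x by rewrite !lorentzE.
have P : L <= tau (c *: p0 + t *: e) o.
  rewrite /tau lo opprD -mulrN -[- lorentz p0 o]/(tau p0 o) -mulrN.
  have h1 := tau_ge1 hp0 hb; have h2 : 0 <= t * - lorentz e o by rewrite mulr_ge0 // oppr_ge0.
  have h3 : c <= c * tau p0 o by rewrite ler_peMr // ltW.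
  by apply: (@le_trans _ _ t); [rewrite le_max lexx orbT | lra].
exists (c *: p0 + t *: e); split => //; last by rewrite lorentzC lo lorentzC up0 [lorentz e u]lorentzC eu !mulr0 addr0.
have T : 0 < tau (c *: p0 + t *: e) o.
  rewrite /tau lo opprD -mulrN -[- lorentz p0 o]/(tau p0 o) -mulrN.
  have h1 := tau_gt0 hp0 hb; have h2 : 0 <= t * - lorentz e o by rewrite mulr_ge0 // oppr_ge0.
  by rewrite ltr_pwDl // mulr_gt0.
split; last by move: T; rewrite tauC /tau lorentz_base opprK.
by rewrite lo !lorentzE hp0.1 e1 ep [lorentz e p0]lorentzC ep; move: c2; rewrite !expr2; lra.
Qed.

(** With a single boundary wall the stabiliser would fix it and preserve the distance to it, while
    the chamber, a half-space, contains points arbitrarily far from it; this contradicts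
    cocompactness. *)
Lemma bdry_two : exists u w, [/\ bdry u, bdry w & u != w].
Proof.
have [u uA] := @bdry_nonempty R n q n2 q2; have u1 := bdry_unit HW uA.
have [[w [wA uw]]|N0] := pselect (exists w, bdry w /\ u != w); first by exists u, w.
have only w : bdry w -> w = u.
  by move=> wA; apply/eqP; rewrite eq_sym; apply: contrapT => /negP h; apply: N0; exists w.
have [C C1 coc] := chamber_cocompact.
pose p0 := wall_proj u o; have hp0 : hyp p0 := wall_proj_hyp u1 hb.
have up0 : lorentz u p0 = 0 by exact: wall_proj_wall.
clearbody p0.
pose t := 2 * C * cosh_wall u o + 1.
have k0 := cosh_wall_gt0 u o.
have t0 : 0 < t by rewrite /t ltr_wpDl // !mulr_ge0 // ?(ltW k0) //; lra.
pose c := Num.sqrt (1 + t ^+ 2); have c2 : c ^+ 2 = 1 + t ^+ 2 by rewrite sqr_sqrtr // addr_ge0 // sqr_ge0.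
have c0 : 0 < c by rewrite sqrtr_gt0 ltr_pwDl // sqr_ge0.
pose x := c *: p0 - t *: u.
have ux : lorentz u x = - t by rewrite /x !lorentzE up0 u1; lra.
have x2 : lorentz x x = -1.
  by rewrite /x !lorentzE hp0.1 u1 (lorentzC p0 u) up0; move: c2; rewrite !expr2; lra.
have hx : hyp x.
  split => //; have xp : lorentz x p0 < 0.
    by rewrite /x !lorentzE hp0.1 up0; lra.
  have x0 : lorentz x x < 0 by rewrite x2; lra.
  by have := timelike_hyp x0 hp0; rewrite nmulr_rlt0.
have xD : chamber x by apply: (chamberP HW) => // w /only ->; rewrite ux; lra.
have [s [sS sx]] := coc x xD; have so := S_oplus sS; have si := oplus_isom so.
have su : s *m u = u by apply: only; exact: (stab_bdry HW sS.2).
have := cosh_wall_lip u1 (oplus_hyp so hx) hb.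
have := abs_le_cosh_wall u (s *m x); rewrite -{1}su isom_lorentz // ux normrN gtr0_norm // => h1 h2.
have := le_trans h1 h2; rewrite /t.
have : 2 * tau (s *m x) o * cosh_wall u o <= 2 * C * cosh_wall u o by rewrite ler_wpM2r ?(ltW k0) // ler_wpM2l.
by lra.
Qed.

(** [u + w] is timelike; rescaled, it is a point of hyperbolic space fixed by these elements. *)
Lemma bdry_pair_stab u w : bdry u -> bdry w -> u != w ->
  finite_set [set f | [/\ S f, f *m u = u & f *m w = w]].
Proof.
move=> uA wA uw; have K1 := ws_gt1 HW; have uwK := bdry_sep HW uA wA uw.
have u1 := bdry_unit HW uA; have w1 := bdry_unit HW wA.
have T : lorentz (u + w) (u + w) < 0 by rewrite !lorentzE u1 w1 (lorentzC w); lra.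
have To : lorentz (u + w) o < 0 by rewrite !lorentzE; have := bdry_base uA; have := bdry_base wA; lra.
have hp := hyp_scale T To hb; set p := _ *: (u + w) in hp.
apply: sub_finite_set (finite_arith_ball (2 * tau o p * tau p o)) => f [fS fu fw].
split; first exact: stab_arith1.
have fo := S_oplus fS; have fp : f *m p = p by rewrite /p -scalemxAr mulmxDr fu fw.
rewrite -tau_base; apply: le_trans (tau_tri (oplus_hyp fo hb) hp hb) _.
by rewrite -{1}fp oplus_tau.
Qed.

Definition rep_pair u w (y : 'cV[R]_N * 'cV[R]_N) : 'M[R]_N := xget 1%:M [set s | S s /\ y = (s *m u, s *m w)].

Lemma rep_pairP u w s : S s -> exists f, [/\ S f, f *m u = u, f *m w = w &
  s = rep_pair u w (s *m u, s *m w) *m f].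
Proof.
move=> sS; have H : S (rep_pair u w (s *m u, s *m w)) /\
    (s *m u, s *m w) = (rep_pair u w (s *m u, s *m w) *m u, rep_pair u w (s *m u, s *m w) *m w).
  exact: (@xgetPex _ 1%:M [set r | S r /\ (s *m u, s *m w) = (r *m u, r *m w)] (ex_intro _ s (conj sS erefl))).
move: (rep_pair _ _ _) H => r [rS [ru rw]]; have ri := oplus_isom (S_oplus rS).
exists (invmx r *m s); split; [|by rewrite -mulmxA ru isom_invK|by rewrite -mulmxA rw isom_invK|by rewrite isom_mulMV].
by apply: stabSM => //; exact: stabSV.
Qed.

(** The chamber contains a whole wall, hence is unbounded, and the stabiliser is cocompact on it. *)
Lemma S_infinite : infinite_set S.
Proof.
move=> fS; have [u [_ [uA _ _]]] := bdry_two; have u1 := bdry_unit HW uA.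
have [C C1 coc] := chamber_cocompact.
have [L HL] : exists L, forall s, S s -> ht s <= L.
  have /finite_seqP[l lE] := fS; rewrite lE; elim: l {lE} => [|a l [L HL]]; first by exists 0.
  exists (Num.max (ht a) L) => s /=; rewrite inE le_max => /orP[/eqP ->|/HL ->]; first by rewrite lexx.
  by rewrite orbT.
have [p [hp up pL]] := wall_unbounded (2 * C * L + 1) u1.
have [s [sS sp]] := coc p (bdry_wall_chamber HW uA hp up); have so := S_oplus sS.
have : tau p o <= 2 * tau (s *m p) o * ht s.
  rewrite htE [tau (s *m o) o]tauC -(oplus_tau p o so).
  by apply: tau_tri => //; exact: oplus_hyp.
have h1 := HL s sS; have h2 := ht_ge1 so.
have : tau (s *m p) o * ht s <= C * L.
  apply: ler_pM => //; first exact/ltW/tau_gt0/hb/oplus_hyp/hp.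
  by lra.
rewrite -!mulrA; lra.
Qed.

Lemma bdry_infinite : infinite_set bdry.
Proof.
move=> bF; apply: S_infinite; have [u [w [uA wA uw]]] := bdry_two.
apply: (@sub_finite_set _ _ ((fun yf : ('cV[R]_N * 'cV[R]_N) * 'M[R]_N => rep_pair u w yf.1 *m yf.2) @`
  ((bdry `*` bdry) `*` [set f | [/\ S f, f *m u = u & f *m w = w]]))).
  move=> s sS; have [f [fS fu fw sE]] := rep_pairP u w sS.
  exists ((s *m u, s *m w), f) => //=; split => //; split; exact: (stab_bdry HW sS.2).
by apply: finite_image; apply: finite_setX (bdry_pair_stab uA wA uw); exact: finite_setX.
Qed.

(** These are the half-spaces at depth two of the tree: the first letter is determined by nesting,
    the second by disjointness after one reflection. *)
Lemma mirror_disjoint y1 y2 z1 z2 x : bdry y1 -> bdry y2 -> bdry z1 -> bdry z2 -> y1 != y2 -> z1 != z2 -> hyp x ->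
  0 <= lorentz (refl y1 *m y2) x -> 0 <= lorentz (refl z1 *m z2) x -> y1 = z1 /\ y2 = z2.
Proof.
move=> y1A y2A z1A z2A y12 z12 hx hy hz.
have N1 v w : bdry v -> bdry w -> v != w -> 0 <= lorentz (refl v *m w) x -> 0 < lorentz v x.
  move=> vA wA vw H; rewrite -[v]mul1mx; apply: (wall_nested HW (@oplus1 R n) wA vA) => //; first by rewrite eq_sym.
  by rewrite mul1mx.
have y0 := N1 _ _ y1A y2A y12 hy; have z0 := N1 _ _ z1A z2A z12 hz.
have E1 : y1 = z1.
  apply/eqP; apply: contrapT => /negP h.
  by have := bdry_opp HW y1A z1A h hx (ltW y0); rewrite lt_gtF.
split => //; subst z1; apply/eqP; apply: contrapT => /negP h.
have ro := refl_unit_oplus (bdry_unit HW y1A); have ri := oplus_isom ro.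
rewrite isom_adj // in hy; rewrite isom_adj // in hz.
by have := bdry_opp HW y2A z2A h (oplus_hyp (oplusV ro) hx) hy; rewrite ltNge hz.
Qed.

(** To [g] attach the depth-two half-space of the pair of walls (g u, g w). It determines [g] up to
    a finite group, which one wall alone need not do. Its mass is at least a constant times
    [ht g]^-s times the total, and disjointness bounds the sum of the masses by the total. *)
Lemma stab_sum_delta : exists B, sum_le S (orb delta) B.
Proof.
have [C C1 coc] := cocompact_constant.
have [u [w [uA wA uw]]] := bdry_two.
have u1 := bdry_unit HW uA; have w1 := bdry_unit HW wA.
have ro := refl_unit_oplus u1; have ri := oplus_isom ro.
have /finite_seqP[l lE] := bdry_pair_stab uA wA uw.
pose U0 := refl u *m w; pose ka := cosh_wall U0 o; have ka1 : 1 <= ka by exact: cosh_wall_ge1.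
have U01 : lorentz U0 U0 = 1 by rewrite isom_lorentz.
pose B1 := (size l)%:R * (2 * (8 * C * ka) `^ (delta + 1)).
have d0 := delta_ge0.
have E1 : 1 <= 8 * C * ka by apply: mulr_ege1 => //; lra.
(* [B1] is the same for all these [s], so [s] may tend to [delta]. *)
have main s : delta < s -> s <= delta + 1 -> sum_le S (orb s) B1.
  move=> ds s1; have s0 : 0 <= s by lra.
  have [B HB] := delta_convergent ds.
  have P1 := orbit_sum_ge1 HB; set P := orbit_sum s in P1; have P0 : 0 < P by lra.
  pose Y := [set y : 'cV[R]_N * 'cV[R]_N | exists2 g, S g & y = (g *m u, g *m w)].
  pose UU (y : 'cV[R]_N * 'cV[R]_N) := refl y.1 *m y.2.
  pose E := 2 * (8 * C * ka) `^ s.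
  have E0 : 0 <= E by rewrite mulr_ge0 ?powR_ge0.
  apply: (@sum_le_weaken _ _ _ _ ((size l)%:R * (E / P * P))).
    rewrite divfK ?gt_eqF // ler_wpM2l // ler_wpM2l //; exact: ler_powR.
  apply: (@sum_le_fin _ _ _ _ _ Y l (fun (y : 'cV[R]_N * 'cV[R]_N) f => rep_pair u w y *m f) _ (fun y : 'cV[R]_N * 'cV[R]_N => E / P * mass s (UU y))).
  - by move=> y _; rewrite mulr_ge0 ?divr_ge0 ?(ltW P0) //; exact: mass_ge0 HB _.
  - move=> g gS; have [f [fS fu fw gE]] := rep_pairP u w gS.
    exists (g *m u, g *m w), f; split => //.
    + by exists g.
    + by have : [set` l] f by rewrite -lE.
    have go := S_oplus gS; have gi := oplus_isom go; have gV := oplusV go.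
    have UE : UU (g *m u, g *m w) = g *m U0.
      by rewrite /UU /= -refl_conj // -!mulmxA isom_invK.
    have UA : arith 1 (refl (UU (g *m u, g *m w))).
      rewrite UE -refl_conj // -refl_conj //.
      have ua := ws_refl HW uA.1.1; have wa := ws_refl HW wA.1.1; have ga := stab_arith1 gS.
      by apply: arithM; [apply: arithM => //; apply: arithM; [apply: arithM|exact: arithV] | exact: arithV].
    have UU1 : lorentz (UU (g *m u, g *m w)) (UU (g *m u, g *m w)) = 1 by rewrite UE isom_lorentz.
    have L := mass_lower C1 s0 HB coc UU1 UA; rewrite -/P in L.
    have K : cosh_wall (UU (g *m u, g *m w)) o <= (2 * ka) * ht g.
      rewrite UE cosh_wall_isom //; apply: le_trans (cosh_wall_lip U01 (oplus_hyp gV hb) hb) _.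
      by rewrite -htE htV // mulrAC.
    have ka2 : 0 < 2 * ka by lra.
    have H := pw_scale (cosh_wall_gt0 _ _) (ht_gt0 go) ka2 K s0.
    apply: le_trans H _.
    have -> : E / P * mass s (UU (g *m u, g *m w)) =
       (2 * ka) `^ s * ((2 * (4 * C) `^ s * mass s (UU (g *m u, g *m w))) / P).
      have P1' : 0 <= 2 * ka by lra.
      have P2' : 0 <= 4 * C by lra.
      have EE : E = 2 * ((2 * ka) `^ s * (4 * C) `^ s).
        by rewrite -powRM // /E; congr (2 * (_ `^ s)); ring.
      by rewrite EE; move: (mass _ _) (_ `^ s) (_ `^ s) P^-1 => m' a' b' P'; ring.
    by rewrite ler_wpM2l ?powR_ge0 // ler_pdivlMr.
  - apply: sum_le_scale; first by rewrite divr_ge0 // ltW.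
    move=> ys uys ysY; apply: (tsum_disjoint (A := fun y : 'cV[R]_N * 'cV[R]_N => half_orbit (UU y)) HB) => //.
      by move=> y g _ [].
    move=> [y1 y2] [z1 z2] g /ysY[a aS [-> ->]] /ysY[b bS [-> ->]] [gA gy] [_ gz].
    have nq c : S c -> c *m u != c *m w.
      move=> /S_oplus/oplus_isom ci; apply: contra uw => /eqP/(congr1 (mulmx (invmx c))).
      by rewrite !isom_invK // => ->.
    have bq c v : S c -> bdry v -> bdry (c *m v) by move=> cS; exact: (stab_bdry HW cS.2).
    have [-> ->] // := mirror_disjoint (bq _ _ aS uA) (bq _ _ aS wA) (bq _ _ bS uA) (bq _ _ bS wA) (nq _ aS) (nq _ bS)
      (oplus_hyp (arith_oplus gA) hb) gy gz.
exists (2 * B1) => l' ul' l'S.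
have [T T1 HT] : exists2 T, 1 <= T & forall g, g \in l' -> ht g <= T.
  elim: l' {ul' l'S} => [|a l' [T T1 HT]]; first by exists 1.
  exists (Num.max (ht a) T) => [|g]; first by rewrite le_max T1 orbT.
  by rewrite inE le_max => /orP[/eqP ->|/HT ->]; rewrite ?lexx ?orbT.
(* On a finite list the heights are bounded, so a small change of exponent costs at most a factor
   2. *)
have [e /andP[e0 e1] Te] := powR_small_exp T1 ltr01.
have ds : delta < delta + e by lra.
have s1 : delta + e <= delta + 1 by lra.
apply: (@le_trans _ _ (\sum_(g <- l') 2 * orb (delta + e) g)); last first.
  by rewrite -mulr_sumr ler_wpM2l //; exact: (main _ ds s1).
rewrite [leLHS]big_seq [leRHS]big_seq; apply: ler_sum => g gl.
have go := S_oplus (l'S g gl); have g0 := ht_gt0 go.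
rewrite /orb pw_add // mulrCA -[leLHS]mulr1 ler_wpM2l ?pw_ge0 //.
rewrite /pw powRN -ler_pdivrMr ?invr_gt0 ?powR_gt0 // invrK mul1r; apply: le_trans Te.
by apply: ge0_ler_powR; rewrite ?nnegrE ?(ltW e0) ?(ltW g0) ?(le_trans ler01 T1) ?HT.
Qed.

(** At exponent 0 each of the infinitely many elements of the stabiliser would contribute 1 to a
    bounded sum. *)
Lemma delta_gt0 : 0 < delta.
Proof.
rewrite lt_neqAle delta_ge0 andbT; apply/eqP => d0; have [B HB] := stab_sum_delta.
have /infinite_set_fsetP/(_ (Num.truncn B).+1)[l lS ll] := S_infinite.
have := HB (finmap.enum_fset l) (finmap.fset_uniq l) (fun g gl => lS g gl).
have -> : \sum_(g <- finmap.enum_fset l) orb delta g = (size (finmap.enum_fset l))%:R.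
  under eq_bigr do rewrite /orb /pw -d0 oppr0 powRr0.
  by rewrite big_const_seq count_predT iter_addr addr0.
move=> h; have := truncnS_gt B; have : ((Num.truncn B).+1%:R : R) <= (size (finmap.enum_fset l))%:R by rewrite ler_nat.
by move: h; lra.
Qed.

Lemma stab_gap : exists2 s0, 0 <= s0 < delta & exists B, sum_le S (orb s0) B.
Proof.
have [B HB] := stab_sum_delta; have [C C1 coc] := chamber_cocompact.
have Ho h : S h -> chamber (h *m o) by move=> hS; apply: (stab_chamber hS.2); exact: base_chamber.
exact: (orbit_gap stab_arith1 (fun g h => @stabSM R n q M g h) (fun g => @stabSV R n q M g) Ho
  (base_chamber _) chamber_convex C1 coc delta_gt0 HB).
Qed.

(** Every boundary wall is a stabiliser translate of one of the finitely many near the base point,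
    by an element of height comparable to the cosh of its distance, up to moving [p] near the base
    point. *)
Lemma wall_sum (s B : R) : 0 <= s -> sum_le S (orb s) B -> exists B0, forall p, chamber p ->
  sum_le bdry (fun u => pw (cosh_wall u p) s) B0.
Proof.
move=> s0 HB; have [C C1 coc] := chamber_cocompact.
have /finite_seqP[l lE] := @finite_wall R n q C.
have C0 : 0 < 4 * C ^+ 2 by rewrite mulr_gt0 // exprn_gt0 //; lra.
exists ((size l)%:R * ((4 * C ^+ 2) `^ s * B)) => p pD; have hp := pD.1.
have [r [rS rp']] := coc p pD; have ro := S_oplus rS; have ri := oplus_isom ro.
apply: (@sum_le_fin _ _ _ _ _ S l (fun (g : 'M[R]_N) v => invmx r *m (g *m v)) _ (fun g => (4 * C ^+ 2) `^ s * orb s g)).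
- by move=> y _; rewrite mulr_ge0 ?powR_ge0 ?pw_ge0.
- move=> u uA; have u1 := bdry_unit HW uA; have hq := wall_proj_hyp u1 hp; set pu := wall_proj u p in hq.
  have upu : lorentz u pu = 0 by exact: wall_proj_wall.
  have [t [tS tp]] := coc pu (bdry_wall_chamber HW uA hq upu); have to := S_oplus tS; have ti := oplus_isom to.
  have tVo := oplusV to.
  exists (r *m invmx t), (t *m u); split.
  + by apply: stabSM => //; exact: stabSV.
  + have : [set` l] (t *m u); last by [].
    rewrite -lE; split; first exact: ((stab_bdry HW tS.2 uA).1.1).
    apply: le_trans (abs_le_cosh_wall _ _) _; have tu1 : lorentz (t *m u) (t *m u) = 1 by rewrite isom_lorentz.
    apply: le_trans (wall_dist tu1 hb (oplus_hyp to hq) _) _; first by rewrite isom_lorentz.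
    by rewrite tauC.
  + by rewrite -mulmxA isom_invK // isom_invK.
  + apply: pw_scale => //; rewrite ?ht_gt0 ?cosh_wall_gt0 //; first by apply: oplusM.
    rewrite htE -mulmxA; have hto := oplus_hyp tVo hb.
    apply: le_trans (tau_tri (oplus_hyp ro hto) (oplus_hyp ro hp) hb) _; rewrite oplus_tau //.
    have a1 := tau_tri hto hq hp; rewrite [tau pu p]tauC (wall_proj_tau u1 hp) in a1.
    have a2 : tau (invmx t *m o) pu = tau (t *m pu) o by rewrite tauC tau_move.
    rewrite a2 in a1; have k0 := cosh_wall_gt0 u p; have b0 := tau_gt0 (oplus_hyp ro hp) hb.
    have b1 : tau (t *m pu) o * cosh_wall u p <= C * cosh_wall u p by rewrite ler_wpM2r // ltW.
    have b2 := tau_gt0 hto hp.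
    have b3 : tau (invmx t *m o) p * tau (r *m p) o <= (2 * (C * cosh_wall u p)) * C.
      by apply: ler_pM => //; [exact: ltW | exact: ltW | rewrite -mulrA in a1; lra].
    by rewrite -mulrA; move: b3; rewrite expr2; lra.
- by apply: sum_le_scale => //; exact: powR_ge0.
Qed.

Lemma stab_orbit_sum (s B : R) : 0 <= s -> sum_le S (orb s) B -> exists B0, forall p, chamber p ->
  sum_le S (fun g => pw (tau p (g *m o)) s) B0.
Proof.
move=> s0 HB; have [C C1 coc] := chamber_cocompact; have C0 : 0 < 2 * C by lra.
exists ((2 * C) `^ s * B) => p pD; have hp := pD.1.
have [r [rS rp']] := coc p pD; have ro := S_oplus rS; have ri := oplus_isom ro.
apply: (@sum_le_inj _ _ _ _ S (fun g : 'M[R]_N => invmx r *m g) _ (fun g => (2 * C) `^ s * orb s g)).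
- by move=> y _; rewrite mulr_ge0 ?powR_ge0 ?pw_ge0.
- move=> g gS; have go := S_oplus gS; have hgo := oplus_hyp go hb.
  exists (r *m g); split; [exact: stabSM | by rewrite isom_invM | ].
  have t0 := tau_gt0 hp hgo.
  apply: pw_scale => //; first by apply: ht_gt0; exact: oplusM.
  rewrite htE -mulmxA; apply: le_trans (tau_tri (oplus_hyp ro hgo) (oplus_hyp ro hp) hb) _.
  rewrite oplus_tau // [tau (g *m o) p]tauC mulrAC ler_wpM2r ?(ltW t0) //.
  by rewrite ler_wpM2l.
- by apply: sum_le_scale => //; exact: powR_ge0.
Qed.
End Stabilizer.
End CriticalGap.

(** * Geometric decay of weights along the tree *)

Section Contraction.
Context {R : realType} {n : nat}.
Local Notation N := n.+1.
Local Notation o := (base_point : 'cV[R]_n.+1).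
Implicit Types (x y z w v u p U : 'cV[R]_N) (g h k : 'M[R]_N) (a b : seq 'cV[R]_N).

Let hb : hyp o := base_hyp.

Variables (q M : nat).
Hypotheses (q2 : (2 < q)%N).
Let HW := @wall_system_q R n q q2.
Local Notation bdry := (bdry (@wall R n q)).
Local Notation chamber := (chamber (@wall R n q)).
Local Notation word := (word (@wall R n q)).
Local Notation lab := (@lab R n M).

Lemma wall_point_cosh u w p : bdry u -> bdry w -> w != u -> hyp p -> lorentz u p = 0 ->
  - lorentz w u <= cosh_wall w p.
Proof.
move=> uA wA wu hp up; have uw := bdry_sep HW wA uA wu; have K1 := ws_gt1 HW.
have := wall_point_far (bdry_unit HW uA) (bdry_unit HW wA) hp up; rewrite lorentzC => h.
rewrite -ler_sqr ?nnegrE ?(ltW (cosh_wall_gt0 _ _)) //; last by lra.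
by rewrite cosh_wall_sqr sqrrN; lra.
Qed.

Variables (C s B : R).
Hypotheses (C1 : 1 <= C) (s0 : 0 < s) (HB : sum_le (arith 1) (orb (R := R) (n := n) s) B)
  (coc : forall x, hyp x -> exists h, arith 1 h /\ tau (h *m x) o <= C).

Local Notation mass := (@mass R n s).
Local Notation orbit_sum := (@orbit_sum R n).

(** [p] is the foot on the wall of the node, carried back by the word to the boundary wall [u] of
    the original chamber, where bounds uniform over the chamber apply. *)
Lemma node_point u a : word (u :: a) -> red (u :: a) -> exists p, [/\ hyp p, lorentz u p = 0 &
  forall z, hyp z -> 0 <= lorentz u z -> cosh_wall (nrm u a) o * tau p z <= tau o (rp a *m z)].
Proof.
move=> aA ra; have U1 := nrm_unit HW aA; have Uo := nrm_base_lt0 HW aA ra.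
have go := rp_oplus (word_unit HW (word_cons aA).2); have gi := oplus_isom go.
have hp := wall_proj_hyp U1 hb; have hp' := oplus_hyp (oplusV go) hp.
exists (invmx (rp a) *m wall_proj (nrm u a) o); split => //.
  by rewrite -isom_adj //; exact: wall_proj_wall.
move=> z hz uz; rewrite -[tau (invmx _ *m _) z](oplus_tau _ _ go) isom_mulK //.
by apply: halfspace_tau => //; [exact: ltW | rewrite isom_lorentz].
Qed.

Lemma nrm_refl u a : word (u :: a) -> arith 1 (refl (nrm u a)).
Proof.
move=> /word_cons[uA aA]; have go := rp_oplus (word_unit HW aA).
rewrite -refl_conj; last exact: oplus_isom.
have ga := rp_arith HW aA; apply: arithM; last exact: arithV.
by apply: arithM => //; exact: (ws_refl HW uA.1.1).
Qed.

Lemma mass_node_lower u a : word (u :: a) ->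
  pw (cosh_wall (nrm u a) o) s * orbit_sum s <= 2 * (4 * C) `^ s * mass (nrm u a).
Proof.
by move=> aA; apply: (mass_lower C1 (ltW s0) HB coc); [exact: (nrm_unit HW aA) | exact: nrm_refl].
Qed.

Lemma mass_node_gt0 u a : word (u :: a) -> 0 < mass (nrm u a).
Proof.
move=> /mass_node_lower H; have P1 := orbit_sum_ge1 HB; have c0 := pw_gt0 s (cosh_wall_gt0 (nrm u a) o).
have C0 : 0 < 4 * C by have := C1; lra.
have : 0 < 2 * (4 * C) `^ s * mass (nrm u a) by apply: lt_le_trans H; rewrite mulr_gt0 //; lra.
by rewrite pmulr_rgt0 // mulr_gt0 // powR_gt0.
Qed.

(** Every path to the child's wall crosses the parent's; [node_point] applied to the foot on the
    child's wall makes the two distances combine multiplicatively. *)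
Lemma child_cosh u a p w : word (u :: a) -> red (u :: a) -> hyp p -> lorentz u p = 0 ->
  (forall z, hyp z -> 0 <= lorentz u z -> cosh_wall (nrm u a) o * tau p z <= tau o (rp a *m z)) ->
  bdry w -> w != u ->
  cosh_wall (nrm u a) o * cosh_wall w p <= cosh_wall (nrm w (u :: a)) o.
Proof.
move=> aA ra hp up Hp wA wu; have [uA aA'] := word_cons aA; have u1 := bdry_unit HW uA; have w1 := bdry_unit HW wA.
have waA : word (w :: u :: a) by exact: word_consI.
have rwa : red (w :: u :: a) by rewrite /red /= wu.
have U1 := nrm_unit HW waA.
have go := rp_oplus (word_unit HW aA'); have gi := oplus_isom go.
have ro := refl_unit_oplus u1; have ri := oplus_isom ro.
have hpw := wall_proj_hyp U1 hb; set pw' := wall_proj (nrm w (u :: a)) o in hpw.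
pose z := invmx (rp a) *m pw'; have hz : hyp z := oplus_hyp (oplusV go) hpw.
have Upw : lorentz (nrm w (u :: a)) pw' = 0 by exact: wall_proj_wall.
have uz : 0 <= lorentz u z.
  by rewrite -isom_adj // ltW // (nrm_nested HW waA rwa hpw) // Upw.
have rp' : invmx (refl u) *m p = p.
  by have e : refl u *m p = p; [rewrite refl_unitE // up mulr0 scale0r subr0 | rewrite -{1}e isom_invK].
rewrite -(wall_proj_tau U1 hb) -/pw'; have := Hp z hz uz; rewrite isom_mulK //; apply: le_trans.
rewrite ler_wpM2l ?(ltW (cosh_wall_gt0 _ _)) //.
have := @wall_dist R n (refl u *m w) p z; rewrite cosh_wall_isom // rp'; apply => //.
  by rewrite isom_lorentz.
by rewrite -isom_adj // mulmxA.
Qed.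

(** Upper bound for the child, lower bound for the parent, and [child_cosh] in between: the ratio
    decays like the distance from [p] to the wall [w]. *)
Lemma mass_child u a p w : word (u :: a) -> red (u :: a) -> hyp p -> lorentz u p = 0 ->
  (forall z, hyp z -> 0 <= lorentz u z -> cosh_wall (nrm u a) o * tau p z <= tau o (rp a *m z)) ->
  bdry w -> w != u ->
  mass (nrm w (u :: a)) <= 2 * (8 * C ^+ 2) `^ s * pw (cosh_wall w p) s * mass (nrm u a).
Proof.
move=> aA ra hp up Hp wA wu; have L := child_cosh aA ra hp up Hp wA wu.
have waA : word (w :: u :: a) by exact: word_consI.
have rwa : red (w :: u :: a) by rewrite /red /= wu.
have U1 := nrm_unit HW waA; have Uo := nrm_base_lt0 HW waA rwa.
have C0 : 0 <= 2 * C /\ 0 <= 4 * C by have := C1; split; lra.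
have H1 := mass_upper C1 (ltW s0) HB coc U1 (ltW Uo).
have H2 := mass_node_lower aA; have P1 := orbit_sum_ge1 HB.
have c0 := cosh_wall_gt0 (nrm u a) o; have c0' := cosh_wall_gt0 w p.
have H3 := pw_le (mulr_gt0 c0 c0') L (ltW s0); rewrite pw_mul ?(ltW c0) ?(ltW c0') // in H3.
apply: le_trans H1 _.
have -> : (8 * C ^+ 2) `^ s = (2 * C) `^ s * (4 * C) `^ s.
  by rewrite -powRM ?C0.1 ?C0.2 //; congr (_ `^ s); rewrite expr2; ring.
apply: (@le_trans _ _ ((2 * C) `^ s * (pw (cosh_wall (nrm u a) o) s * pw (cosh_wall w p) s) * orbit_sum s)).
  by rewrite ler_wpM2r ?(le_trans ler01 P1) // ler_wpM2l ?powR_ge0.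
have := ler_wpM2l (mulr_ge0 (powR_ge0 (2 * C) s) (pw_ge0 (cosh_wall w p) s)) H2.
by congr (_ <= _); ring.
Qed.

Lemma mass_children u a : word (u :: a) -> red (u :: a) ->
  sum_le [set w | bdry w /\ w != u] (fun w => mass (nrm w (u :: a))) (mass (nrm u a)).
Proof.
move=> aA ra l ul lA.
have W w : w \in l -> word (w :: u :: a) /\ red (w :: u :: a).
  by move=> /lA[wA wu]; split; [exact: word_consI | rewrite /red /= wu].
apply: (tsum_disjoint (A := fun w => half_orbit (nrm w (u :: a))) (@half_orbit_sum _ _ _ _ HB _)) => //.
  move=> w g /W[wA rw] [gA gw]; split => //; apply/ltW/(nrm_nested HW wA rw) => //.
  exact: oplus_hyp (arith_oplus gA) hb.
move=> w v g wl vl [gA gw] [_ gv]; apply/eqP; apply: contrapT => /negP wv.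
have := nrm_disjoint HW (lA w wl).1 (lA v vl).1 aA wv (oplus_hyp (arith_oplus gA) hb) gw.
by rewrite ltNge gv.
Qed.

(** [s1] is an exponent at which sums over boundary walls are bounded, by [B0]; [t] lies between s1
    / s and 1. [small1] controls the total of the t-th powers, [small2] the wall of a given label
    nearer than [Lm], [small3] all farther ones; [LmE] allows at most one nearer wall per label. *)
Variables (s1 t th c3 B0 Lm : R).
Hypotheses (s10 : 0 <= s1) (s1s : s1 <= s) (th01 : 0 < th < 1) (tE : t = th + (1 - th) * (s1 / s))
  (c3E : 2 * (8 * C ^+ 2) `^ s <= c3) (c31 : 1 <= c3)
  (HB0 : forall p, chamber p -> sum_le bdry (fun u => pw (cosh_wall u p) s1) B0)
  (small1 : (1 - th) * (c3 * B0) <= 2^-1) (small2 : c3 * pw (sep q) (t * s) <= 20^-1)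
  (small3 : c3 * (pw Lm (t * s - s1) * B0) <= 20^-1) (Lm1 : 1 <= Lm) (LmE : 2 * Lm ^+ 2 <= sep M.+1).

Let t01 : 0 < t <= 1.
Proof.
have := th01 => /andP[h0 h1]; have h2 : 0 <= s1 / s by rewrite divr_ge0 // ltW.
have h3 : s1 / s <= 1 by rewrite ler_pdivrMr // mul1r.
rewrite tE; apply/andP; split; first by rewrite ltr_pwDl // mulr_ge0 //; lra.
have : (1 - th) * (s1 / s) <= (1 - th) * 1 by rewrite ler_wpM2l //; lra.
by lra.
Qed.

Let st : s1 <= t * s.
Proof.
have := th01 => /andP[h0 h1]; rewrite tE mulrDl -mulrA divfK ?gt_eqF //.
by have : th * s1 <= th * s; [rewrite ler_wpM2l // ltW | lra].
Qed.

Lemma ratio_pow p w (r : R) (e : R) : 0 <= r -> r <= c3 * pw (cosh_wall w p) s -> 0 <= e <= 1 ->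
  r `^ e <= c3 * pw (cosh_wall w p) (e * s).
Proof.
move=> r0 rc /andP[e0 e1]; have c30 := le_trans ler01 c31.
apply: le_trans (ge0_ler_powR e0 _ _ rc) _; rewrite ?nnegrE ?mulr_ge0 ?pw_ge0 //.
rewrite powRM ?pw_ge0 // pw_pow [s * e]mulrC ler_wpM2r ?pw_ge0 //.
exact: ler1_powR.
Qed.

Lemma push_weight (T : eqType) (c : seq T) (x : T) :
  (2 : R) ^- size (push x c) = 2 ^- size c * (if ohead c == Some x then 2 else 2^-1).
Proof.
case: c => [|j c] /=; first by rewrite expr0 invr1 mul1r expr1.
rewrite eq_sym; case: eqVneq => [->|jx]; first by rewrite eqxx exprS invfM mulrC mulVKf ?pnatr_eq0.
case: eqP => [[xj]|_]; first by rewrite xj eqxx in jx.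
by rewrite [LHS]/= exprS [RHS]mulrC -invfM.
Qed.

Lemma branch_bound (x : R) (c : bool) : 0 <= x ->
  x * (if c then 2 else 2^-1) <= 2^-1 * x + 2 * (if c then x else 0).
Proof. by case: c; lra. Qed.

Lemma branch_sum (x y : R) : x <= 3 / 2 -> y <= 10^-1 -> 2^-1 * x + 2 * y <= 19 / 20.
Proof. by lra. Qed.

Definition stack a := nf (map lab a).

(** The factor 2^-size charges for labels not yet cancelled; kernel words have an empty stack and
    keep their full mass^t. *)
Definition weight a : R := if a is u :: b then mass (nrm u b) `^ t * 2 ^- size (stack a) else 0.

Lemma weight_ge0 a : 0 <= weight a.
Proof. by case: a => //= u a; rewrite mulr_ge0 ?powR_ge0 ?invr_ge0 ?exprn_ge0. Qed.

(** A child halves the weight factor of the stack unless its label cancels the top one, when it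
    doubles it. With [r] the ratio of masses, the sum of r^t is at most 3/2 over all children and
    1/10 over those that cancel. *)
Lemma weight_step u a : word (u :: a) -> red (u :: a) ->
  sum_le [set w | bdry w /\ w != u] (fun w => weight (w :: u :: a)) (19 / 20 * weight (u :: a)).
Proof.
move=> aA ra; have [p [hp up Hp]] := node_point aA ra; have uA := (word_cons aA).1.
have pD := bdry_wall_chamber HW uA hp up; have mu0 := mass_node_gt0 aA.
set mu := mass (nrm u a) in mu0; pose r w := mass (nrm w (u :: a)) / mu.
have W w : bdry w /\ w != u -> word (w :: u :: a) by move=> [wA _]; exact: word_consI.
have r0 w : bdry w /\ w != u -> 0 < r w by move=> /W/mass_node_gt0 h; rewrite divr_gt0.
have rle w : bdry w /\ w != u -> r w <= c3 * pw (cosh_wall w p) s.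
  move=> [wA wu]; rewrite ler_pdivrMr //; apply: le_trans (mass_child aA ra hp up Hp wA wu) _.
  by rewrite ler_wpM2r ?(ltW mu0) // ler_wpM2r ?pw_ge0.
have [th0 th1] := andP th01.
(* Interpolate between exponent 1, where disjointness of the children gives at most 1, and s1 / s,
   where the wall sum is bounded. *)
have S1 : sum_le [set w | bdry w /\ w != u] (fun w => r w `^ t) (3 / 2).
  move=> l ul lA.
  have A1 : \sum_(w <- l) r w <= 1.
    rewrite -mulr_suml ler_pdivrMr // mul1r; exact: mass_children.
  have A2 : \sum_(w <- l) r w `^ (s1 / s) <= c3 * B0.
    apply: (@le_trans _ _ (\sum_(w <- l) c3 * pw (cosh_wall w p) s1)).
      rewrite [leLHS]big_seq [leRHS]big_seq; apply: ler_sum => w /lA wA.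
      have := @ratio_pow p w (r w) (s1 / s) (ltW (r0 _ wA)) (rle _ wA); rewrite divfK ?gt_eqF //; apply.
      by rewrite divr_ge0 ?(ltW s0) //= ler_pdivrMr // mul1r.
    rewrite -mulr_sumr ler_wpM2l ?(le_trans ler01 c31) //; apply: HB0 => // w /lA[].
    by [].
  apply: (@le_trans _ _ (\sum_(w <- l) (r w + (1 - th) * r w `^ (s1 / s)))).
    rewrite [leLHS]big_seq [leRHS]big_seq; apply: ler_sum => w /lA wA; rewrite tE.
    by apply: pow_interpolate; [exact: r0 | exact: th01].
  rewrite big_split /= -mulr_sumr.
  have : (1 - th) * \sum_(w <- l) r w `^ (s1 / s) <= (1 - th) * (c3 * B0) by rewrite ler_wpM2l //; lra.
  by have := small1; lra.
have K1 := ws_gt1 HW.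
(* Children of one label: at most one is nearer than [Lm], and the decay beyond [s1] makes the
   others negligible. *)
have S2 (j : 'cV['I_M.+1]_(N + N)) : sum_le [set w | (bdry w /\ w != u) /\ lab w = j] (fun w => r w `^ t) (10^-1).
  move=> l ul lA; have [t0 t1] := andP t01.
  have rt w : w \in l -> r w `^ t <= c3 * pw (cosh_wall w p) (t * s).
    by move=> /lA[wA _]; apply: ratio_pow; [exact/ltW/r0 | exact: rle | rewrite (ltW t0)].
  have cK w : w \in l -> sep q <= cosh_wall w p.
    move=> /lA[[wA wu] _]; have uw := bdry_sep HW wA uA wu.
    by apply: le_trans (wall_point_cosh uA wA wu hp up); rewrite lerNr.
  rewrite (bigID (fun w => cosh_wall w p < Lm)) /=.
  have -> : 10^-1 = 20^-1 + 20^-1 :> R by field.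
  apply: lerD.
    have sz : (size [seq w <- l | cosh_wall w p < Lm]%R <= 1)%N.
      have H w : w \in [seq w <- l | cosh_wall w p < Lm] -> w \in l /\ cosh_wall w p < Lm.
        by rewrite mem_filter => /andP[].
      have : uniq [seq w <- l | cosh_wall w p < Lm] by exact: filter_uniq.
      case: [seq w <- l | cosh_wall w p < Lm] H => [|w1 [|w2 l']] // H uF.
      have w12 : w1 != w2 by move: uF; rewrite /= inE negb_or => /andP[/andP[]].
      exfalso.
      have [/lA[[w1A _] w1j] c1] := H w1 (mem_head _ _).
      have [|/lA[[w2A _] w2j] c2] := H w2; first by rewrite !inE eqxx orbT.
      have [E|sp] := lab_sep w1A.1.1 w2A.1.1 (etrans w1j (esym w2j)); first by rewrite E eqxx in w12.
      have sgn := bdry_sep HW w1A w2A w12.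
      (* Two walls with this label are at least [sep M.+1] apart, so [p] cannot be near both. *)
      have ff := far_walls_sum (bdry_unit HW w1A) (bdry_unit HW w2A) hp.
      have q1 : 1 + lorentz w1 p ^+ 2 < Lm ^+ 2.
        by rewrite -cosh_wall_sqr ltr_sqr ?nnegrE ?(ltW (cosh_wall_gt0 _ _)) ?(le_trans ler01 Lm1).
      have q3 : 1 + lorentz w2 p ^+ 2 < Lm ^+ 2.
        by rewrite -cosh_wall_sqr ltr_sqr ?nnegrE ?(ltW (cosh_wall_gt0 _ _)) ?(le_trans ler01 Lm1).
      rewrite ler0_norm in sp; last lra.
      by have := LmE; lra.
    rewrite -big_filter; apply: le_trans small2.
    have : forall w, w \in [seq w <- l | cosh_wall w p < Lm] -> w \in l by move=> w; rewrite mem_filter => /andP[].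
    case: [seq w <- l | cosh_wall w p < Lm] sz => [|w1 [|//]] _ H.
      by rewrite big_nil mulr_ge0 ?pw_ge0 // (le_trans ler01 c31).
    have w1l := H w1 (mem_head _ _); rewrite big_seq1; apply: le_trans (rt _ w1l) _.
    rewrite ler_wpM2l ?(le_trans ler01 c31) //; apply: pw_le (cK _ w1l) _; first exact: lt_trans ltr01 K1.
    by rewrite mulr_ge0 ?(ltW s0) ?(ltW t0).
  apply: le_trans small3; rewrite -big_filter.
  apply: (@le_trans _ _ (\sum_(w <- [seq w <- l | ~~ (cosh_wall w p < Lm)]) c3 * (pw Lm (t * s - s1) * pw (cosh_wall w p) s1))).
    rewrite [leLHS]big_seq [leRHS]big_seq; apply: ler_sum => w; rewrite mem_filter -leNgt => /andP[Lw wl].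
    apply: le_trans (rt _ wl) _; rewrite ler_wpM2l ?(le_trans ler01 c31) //.
    have -> : pw (cosh_wall w p) (t * s) = pw (cosh_wall w p) (t * s - s1) * pw (cosh_wall w p) s1.
      by rewrite -pw_add ?cosh_wall_gt0 // subrK.
    rewrite ler_wpM2r ?pw_ge0 //; apply: pw_le => //; first exact: lt_le_trans ltr01 Lm1.
    by rewrite subr_ge0.
  rewrite -mulr_sumr -mulr_sumr ler_wpM2l ?(le_trans ler01 c31) // ler_wpM2l ?pw_ge0 //.
  apply: HB0 => //; first exact: filter_uniq.
  by move=> w; rewrite mem_filter => /andP[_ /lA[[]]].
move=> l ul lA; set st' := stack (u :: a).
have mut : 0 <= mu `^ t * 2 ^- size st' by rewrite mulr_ge0 ?powR_ge0 ?invr_ge0 ?exprn_ge0.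
have wE w : w \in l -> weight (w :: u :: a) =
    (mu `^ t * 2 ^- size st') * (r w `^ t * (if (ohead st') == Some (lab w) then 2 else 2^-1)).
  move=> /lA wA; rewrite /weight; have -> : stack (w :: u :: a) = push (lab w) st' by [].
  have -> : mass (nrm w (u :: a)) = mu * r w by rewrite /r mulrC divfK // gt_eqF.
  rewrite powRM ?(ltW mu0) ?(ltW (r0 _ wA)) // -!mulrA; congr (_ * _); rewrite mulrCA; congr (_ * _).
  exact: push_weight.
have -> : weight (u :: a) = mu `^ t * 2 ^- size st' by [].
apply: (@le_trans _ _ (\sum_(w <- l) (mu `^ t * 2 ^- size st') *
    (2^-1 * r w `^ t + 2 * (if ohead st' == Some (lab w) then r w `^ t else 0)))).
  rewrite [leLHS]big_seq [leRHS]big_seq; apply: ler_sum => w wl; rewrite (wE _ wl) ler_wpM2l //.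
  exact: branch_bound (powR_ge0 _ _).
rewrite -mulr_sumr mulrC [19 / 20 * _]mulrC [X in X <= _]mulrC ler_wpM2l //.
rewrite big_split /= -!mulr_sumr.
have X1 := S1 l ul lA.
have X2 : \sum_(w <- l) (if ohead st' == Some (lab w) then r w `^ t else 0) <= 10^-1.
  case: (st') => [|j c] /=; first by rewrite big1 // invr_ge0.
  rewrite -big_mkcond -big_filter; apply: (S2 j); first exact: filter_uniq.
  by move=> w; rewrite mem_filter => /andP[/eqP [E] /lA].
exact: branch_sum X1 X2.
Qed.

Definition nodes (k : nat) : set (seq 'cV[R]_N) := [set a | [/\ word a, red a & size a = k.+1]].

Lemma nodes_sum I (k : nat) : sum_le (nodes 0) weight I -> sum_le (nodes k) weight ((19 / 20) ^+ k * I).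
Proof.
move=> H0; elim: k => [|k IH]; first by rewrite expr0 mul1r.
apply: (@sum_le_pairs _ _ _ _ _ (nodes k) (fun a => [set w | bdry w /\ Some w != ohead a])
  (fun (a : seq 'cV[R]_N) w => w :: a) _ (fun a w => weight (w :: a)) (fun a => 19 / 20 * weight a)).
- case=> [|w [|u a]] [aA ra] //= [sa]; exists (u :: a), w; have [wA aA'] := word_cons aA.
  split => //; first by split => //; [exact: red_cons ra | rewrite /= sa].
  split => //=; have /andP[wu _] := ra.
  by apply/eqP => -[E]; rewrite E eqxx in wu.
- case=> [|u a] [aA ra sa] //; apply: sum_le_sub (weight_step aA ra) => w [wA wu]; split => //; split => //=.
- by rewrite exprS -mulrA; apply: sum_le_scale.
Qed.

Lemma nodes_base : sum_le (nodes 0) weight (((2 * C) `^ s * orbit_sum s) `^ t * B0).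
Proof.
have P1 := orbit_sum_ge1 HB; have P0 := le_trans ler01 P1; have [t0 t1] := andP t01.
apply: (@sum_le_inj _ _ _ _ bdry (fun u => [:: u]) _
  (fun u => ((2 * C) `^ s * orbit_sum s) `^ t * pw (cosh_wall u o) s1)).
- by move=> u _; rewrite mulr_ge0 ?powR_ge0 ?pw_ge0.
- case=> [|u [|v l]] [aA ra sa] //; exists u; have [uA _] := word_cons aA; split => //.
  have u1 := bdry_unit HW uA; rewrite /weight /= /nrm mul1mx.
  have H := mass_upper C1 (ltW s0) HB coc u1 (ltW (bdry_base uA)).
  have m0 : 0 <= mass u := mass_ge0 HB _.
  apply: (@le_trans _ _ (mass u `^ t)).
    by rewrite ler_piMr ?powR_ge0 // expr1 invf_le1 // ler1n.
  apply: le_trans (ge0_ler_powR (ltW t0) _ _ H) _; rewrite ?nnegrE ?mulr_ge0 ?pw_ge0 ?powR_ge0 //.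
  have X0 : 0 <= (2 * C) `^ s * orbit_sum s by rewrite mulr_ge0 ?powR_ge0.
  rewrite mulrAC (powRM t X0 (pw_ge0 _ _)) pw_pow [s * t]mulrC ler_wpM2l ?powR_ge0 //.
  by apply: pw_exp; [exact: cosh_wall_ge1 | exact: st].
- by apply: sum_le_scale; [exact: powR_ge0 | apply: HB0; exact: base_chamber].
Qed.

Lemma geometric_sum_le (c I : R) : 0 <= c < 1 -> 0 <= I -> sum_le setT (fun j : nat => c ^+ j * I) (I / (1 - c)).
Proof.
move=> /andP[c0 c1] I0 l ul _; have c1' : 0 < 1 - c by lra.
rewrite -mulr_suml mulrC ler_wpM2l // -[_^-1]mul1r ler_pdivlMr //.
pose m := (\max_(j <- l) j).+1.
apply: (@le_trans _ _ ((\sum_(0 <= j < m) c ^+ j) * (1 - c))).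
  rewrite ler_wpM2r ?(ltW c1') //.
  have -> : \sum_(j <- l) c ^+ j = \sum_(j <- [seq j <- iota 0 m | j \in l]) c ^+ j.
    apply: perm_big; apply: uniq_perm => // [|j]; first by rewrite filter_uniq // iota_uniq.
    rewrite mem_filter mem_iota /= add0n ltnS; case jl : (j \in l) => //=.
    by rewrite (leq_bigmax_seq (F := id)).
  rewrite big_filter /index_iota subn0 big_mkcond /=; apply: ler_sum => j _.
  by case: ifP => // _; exact: exprn_ge0.
have -> : (\sum_(0 <= j < m) c ^+ j) * (1 - c) = 1 - c ^+ m.
  elim: m => [|m IH]; first by rewrite big_geq // mul0r expr0 subrr.
  by rewrite big_nat_recr //= mulrDl IH exprS; ring.
by rewrite gerBl exprn_ge0.
Qed.

Lemma all_nodes_sum : exists I, sum_le [set a | [/\ word a, red a & a != [::]]] weight I.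
Proof.
have H0 := nodes_base; set I := (_ * B0) in H0; have I0 : 0 <= I by exact: sum_le_ge0 H0.
exists (I / (1 - 19 / 20)); have h : 0 <= (19 / 20 : R) < 1 by apply/andP; split; lra.
apply: (@sum_le_pairs _ _ _ _ _ setT nodes (fun (_ : nat) a => a) _ (fun (_ : nat) a => weight a)
  (fun k : nat => (19 / 20) ^+ k * I)).
- by case=> [|u a] [aA ra] // _; exists (size a), (u :: a); split.
- by move=> k _; exact: nodes_sum.
- exact: geometric_sum_le.
Qed.

(** For a word with empty stack the weight is mass^t, which dominates cosh_wall^-(t s) up to a
    constant, and the remaining factor is summed over [Sg] from the foot [p], with a bound uniform
    over the chamber. *)
Lemma kernel_sum (Sg : set 'M[R]_N) (B1 : R) :
  (forall g, Sg g -> oplus g /\ forall u, bdry u -> lorentz u (g *m o) < 0) ->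
  (forall p, chamber p -> sum_le Sg (fun g => pw (tau p (g *m o)) (t * s)) B1) ->
  exists B2, sum_le [set g | exists a k, [/\ word a, red a, stack a = [::], Sg k & g = rp a *m k]]
    (orb (t * s)) B2.
Proof.
move=> HS HB1; have [I HI] := all_nodes_sum; have [t0 t1] := andP t01.
have ts0 : 0 <= t * s by rewrite mulr_ge0 // ltW.
have B10 : 0 <= B1 by exact: sum_le_ge0 (HB1 _ (base_chamber _)).
pose E := (2 * (4 * C) `^ s) `^ t.
exists (B1 * (1 + E * I)).
apply: (@sum_le_pairs _ _ _ _ _ [set a | [/\ word a, red a & stack a = [::]]] (fun=> Sg)
  (fun (a : seq 'cV[R]_N) g => rp a *m g) _ (fun a g => orb (t * s) (rp a *m g))
  (fun a => B1 * (if a == [::] then 1 else E * weight a))).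
- by move=> g [a [k [aA ra sa kS gE]]]; exists a, k; rewrite gE; split.
- case=> [|u a] [aA ra sa].
    rewrite eqxx mulr1; apply: sum_le_sub (HB1 _ (base_chamber _)) => g gS; split => //.
    by rewrite mul1mx /orb htE [tau _ o]tauC.
  have [uA aA'] := word_cons aA; have u1 := bdry_unit HW uA.
  have [p [hp up Hp]] := node_point aA ra; have pD := bdry_wall_chamber HW uA hp up.
  have c0 := cosh_wall_gt0 (nrm u a) o.
  apply: (@sum_le_weaken _ _ _ _ (pw (cosh_wall (nrm u a) o) (t * s) * B1)).
    rewrite mulrC ler_wpM2l //= sa /= expr0 invr1 mulr1.
    have H := mass_node_lower aA; have P1 := orbit_sum_ge1 HB.
    have H' : pw (cosh_wall (nrm u a) o) s <= 2 * (4 * C) `^ s * mass (nrm u a).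
      by apply: le_trans H; rewrite ler_peMr ?pw_ge0.
    rewrite [t * s]mulrC -pw_pow /E -powRM ?mulr_ge0 ?powR_ge0 //; last exact: mass_ge0 HB _.
    apply: ge0_ler_powR => //; rewrite ?nnegrE ?(ltW t0) ?pw_ge0 //.
    by rewrite !mulr_ge0 ?powR_ge0 //; exact: mass_ge0 HB _.
  apply: sum_le_sub (sum_le_scale (pw_ge0 _ _) (HB1 p pD)) => g gS; split => //.
  have [go gu] := HS g gS; have hgo := oplus_hyp go hb.
  have ro := refl_unit_oplus u1; have hr := oplus_hyp ro hgo.
  have ur : 0 <= lorentz u (refl u *m (g *m o)).
    by rewrite refl_unitE // !lorentzE u1; have := gu u uA; lra.
  have L := Hp _ hr ur.
  (* The last reflection fixes the foot, so it drops out of the distance to be summed over [Sg]. *)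
  have e : refl u *m p = p by rewrite refl_unitE // up mulr0 scale0r subr0.
  rewrite -{1}e oplus_tau // in L.
  rewrite -pw_mul ?(ltW c0) ?(ltW (tau_gt0 hp hgo)) //; apply: pw_le => //.
    by rewrite mulr_gt0 // tau_gt0.
  by rewrite htE [tau _ o]tauC /= -!mulmxA.
- move=> l ul lA; rewrite -mulr_sumr ler_wpM2l //.
  rewrite (bigID (fun a => a == [::])) /=; apply: lerD.
    rewrite -big_filter; have := @sum_le_cst R _ [:: ([::] : seq 'cV[R]_N)] 1 ler01 [seq a <- l | a == [::]] (filter_uniq _ ul).
    rewrite /= mulr1 => H; apply: le_trans (H _); last by move=> a; rewrite mem_filter inE => /andP[].
    by rewrite [leLHS]big_seq [leRHS]big_seq; apply: ler_sum => a; rewrite mem_filter => /andP[-> _].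
  rewrite -big_filter.
  have -> : \sum_(a <- [seq a <- l | a != [::]]) (if a == [::] then 1 else E * weight a) =
      E * \sum_(a <- [seq a <- l | a != [::]]) weight a.
    rewrite mulr_sumr big_seq [RHS]big_seq; apply: eq_bigr => a; rewrite mem_filter => /andP[/negbTE -> _].
    by [].
  rewrite ler_wpM2l ?powR_ge0 //; apply: HI; first exact: filter_uniq.
  by move=> a; rewrite mem_filter => /andP[a0 /lA[aA ra _]].
Qed.
End Contraction.

(** * Comparison with critical exponents; the thin image *)

Section CriticalExponents.
Context {R : realType} {n : nat}.
Local Notation N := n.+1.
Local Notation o := (base_point : 'cV[R]_n.+1).
Implicit Types (g h : 'M[R]_N) (L : set 'M[R]_N) (s : R).

Let hb : hyp o := base_hyp.

Definition decay s g : R := expR (- s * hdist (g *m o) o).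

Lemma decay_ge0 s g : 0 <= decay s g. Proof. exact: expR_ge0. Qed.

(** Here [e] is exp d = cosh d + sinh d, which lies between cosh d and 2 cosh d; heights may replace
    exponentials of distances. *)
Lemma decayE s g : oplus g -> exists2 e, ht g <= e <= 2 * ht g & decay s g = pw e s.
Proof.
move=> go; have h1 := ht_ge1 go; pose e := ht g + Num.sqrt (ht g ^+ 2 - 1).
have E0 : 0 <= Num.sqrt (ht g ^+ 2 - 1) by exact: sqrtr_ge0.
have E1 : Num.sqrt (ht g ^+ 2 - 1) <= ht g.
  by rewrite -[leRHS]ger0_norm ?(le_trans ler01) // -sqrtr_sqr ler_sqrt ?sqr_ge0 //; lra.
exists e; first by apply/andP; rewrite /e; split; lra.
rewrite /decay /hdist /arcosh -[- lorentz _ _]/(tau (g *m o) o) -htE -/e /pw /powR gt_eqF //.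
by rewrite /e; lra.
Qed.

Lemma decay_le_orb s g : 0 <= s -> oplus g -> decay s g <= orb s g.
Proof.
move=> s0 go; have [e /andP[e1 _] ->] := decayE s go.
by apply: pw_le => //; exact: ht_gt0.
Qed.

Lemma orb_le_decay s g : 0 <= s -> oplus g -> orb s g <= 2 `^ s * decay s g.
Proof.
move=> s0 go; have [e /andP[e1 e2] ->] := decayE s go; have h0 := ht_gt0 go.
by apply: pw_scale => //; exact: lt_le_trans e1.
Qed.

Lemma critical_exponent_le L s B : L `<=` oplus -> 0 <= s -> sum_le L (orb s) B ->
  (critical_exponent L <= s%:E)%E.
Proof.
move=> LO s0 HB; apply: ereal_inf_lbound; exists s => //; split => //.
apply: (@le_lt_trans _ _ B%:E); last exact: ltry.
apply: ge_ereal_sup => _ [F [/finite_seqP[l lE] FL] <-]; have FE : F = [set` undup l].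
  by rewrite lE; apply/seteqP; split => x /=; rewrite mem_undup.
rewrite FE -fsbig_seq ?undup_uniq // sumEFin lee_fin.
have lL g : g \in undup l -> L g by move=> gl; apply: FL; rewrite FE.
apply: le_trans (HB (undup l) (undup_uniq l) lL).
rewrite [leLHS]big_seq [leRHS]big_seq; apply: ler_sum => g /lL gL.
by apply: decay_le_orb => //; exact: LO.
Qed.

Lemma critical_exponent_ge L d : L `<=` oplus ->
  (forall s B, 0 <= s -> sum_le L (orb s) B -> d <= s) -> (d%:E <= critical_exponent L)%E.
Proof.
move=> LO H; apply: le_ereal_inf_tmp => _ [s [s0 fin] <-]; rewrite lee_fin.
set S := esum _ _ in fin.
have S0 : (0 <= S)%E by apply: esum_ge0 => g _; rewrite lee_fin expR_ge0.
have SE : S = (fine S)%:E by rewrite fineK // ge0_fin_numE.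
apply: (H s (2 `^ s * fine S)) => //.
apply: (@sum_le_sub _ _ L L (orb s) (fun g => 2 `^ s * decay s g)).
  by move=> g gL; split => //; apply: orb_le_decay => //; exact: LO.
apply: sum_le_scale; first exact: powR_ge0.
move=> l ul lL; rewrite -lee_fin -SE -sumEFin fsbig_seq //.
apply: ereal_sup_ubound; exists [set` l] => //; split; [exact: finite_seq | by move=> g /lL].
Qed.

(** [Gam] is cocompact, so each element of [arith 1] is one of [Gam] times one of a finite ball; a
    convergent series for [Gam] converges for [arith 1]. *)
Lemma Gam_exponent (q M : nat) (n2 : (2 <= n)%N) (q2 : (2 < q)%N) (qM : (q %| M.+1)%N) :
  ((delta (R := R) (n := n))%:E <= critical_exponent (@Gam R n q M))%E.
Proof.
apply: critical_exponent_ge; first by move=> g; exact: Gam_oplus.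
move=> s B s0 HB; apply: delta_lb => //; have [c Hc] := @Gam_cocompact R n q M n2 q2 qM.
have [l [_ lE]] := @ball_list R n (arith 1) (@subset_refl _ (arith 1)) c.
pose C := Num.max 1 c; have C1 : 1 <= C by rewrite le_max lexx.
have cC : c <= C by rewrite le_max lexx orbT.
exists ((size l)%:R * ((2 * C) `^ s * B)).
apply: (@sum_le_fin _ _ _ _ _ (Gam q M) l (fun y f => y *m f) _ (fun y => (2 * C) `^ s * orb s y)).
- by move=> y _; rewrite mulr_ge0 ?powR_ge0 ?pw_ge0.
- move=> g gA; have go := arith_oplus gA; have hg := oplus_hyp go hb.
  have [k [kG kc]] := Hc _ hg; have ko := Gam_oplus q2 kG; have ki := oplus_isom ko.
  have [_ _ _ GV] : is_subgroup (@Gam R n q M) by apply: Gam_subgroup.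
  have kV := oplusV ko; have hk := oplus_hyp kV hb.
  exists (invmx k), (k *m g); split; [exact: GV | | by rewrite isom_invM | ].
    by apply/lE; split; [apply: arithM => //; exact: (Gam_arith q2 kG) | rewrite -/(ht _) htE -mulmxA].
  apply: pw_scale; rewrite ?ht_gt0 //; first lra.
  rewrite (htE (invmx k)); apply: le_trans (tau_tri hk hg hb) _; rewrite -htE.
  rewrite ler_wpM2r ?(ltW (ht_gt0 go)) // ler_wpM2l // tau_move // invmxK tauC.
  exact: le_trans kc cC.
- by apply: sum_le_scale => //; exact: powR_ge0.
Qed.

Section Image.
Variables (q M : nat).
Hypotheses (n2 : (2 <= n)%N) (q2 : (2 < q)%N).
Let HW := @wall_system_q R n q q2.
Local Notation bdry := (bdry (@wall R n q)).
Local Notation J := ('cV['I_M.+1]_(N + N)).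

(** There are infinitely many boundary walls, hence infinitely many with the same label for an
    auxiliary large modulus [m.+1], unrelated to [M]. These are pairwise far apart, and all but
    finitely many are far from the base point. *)
Lemma spread_walls (L : R) : exists X : J -> 'cV[R]_N, [/\ injective X, forall j, bdry (X j),
  forall i j, i != j -> L <= - lorentz (X i) (X j) & forall j, L <= - lorentz (X j) o].
Proof.
pose m := Num.truncn (Num.max 3 L).
have mL : L <= sep m.+1 /\ 3 <= m.+1%:R :> R.
  have h : Num.max 3 L <= m.+1%:R :> R by exact/ltW/truncnS_gt.
  have h3 : 3 <= m.+1%:R :> R by apply: le_trans h; rewrite le_max lexx.
  split => //; apply: (@le_trans _ _ m.+1%:R); first by apply: le_trans h; rewrite le_max lexx orbT.
  rewrite /sep; move: (m.+1%:R) h3 => x x3.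
  have x2 : 9 <= x ^+ 2 by rewrite expr2; nra.
  have -> : x ^+ 4 = x ^+ 2 * x ^+ 2 by rewrite -exprD.
  by rewrite !expr2 in x2 *; nra.
pose fib (j : 'cV['I_m.+1]_(N + N)) := [set u : 'cV[R]_N | bdry u /\ lab m u = j].
have qq : (q %| q.-1.+1)%N by rewrite prednK // (ltn_trans _ q2).
have [j jI] : exists j, infinite_set (fib j).
  apply: contrapT => H; apply: (bdry_infinite (R := R) n2 q2 qq).
  apply: (@sub_finite_set _ _ (\bigcup_(j in setT) fib j)); first by move=> u uA; exists (lab m u).
  apply: bigcup_finite; first exact: finite_finset.
  by move=> j _; apply: contrapT => jF; apply: H; exists j.
have FI : infinite_set [set u | fib j u /\ ~ `|lorentz u o| <= L].
  move=> F; apply: jI; apply: (@sub_finite_set _ _ ([set u | fib j u /\ ~ `|lorentz u o| <= L] `|`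
     [set u | wall q u /\ `|lorentz u o| <= L])).
    move=> u [uA uj]; have [h|h] := pselect (`|lorentz u o| <= L); last by left.
    by right; split => //; exact: uA.1.1.
  by rewrite finite_setU; split => //; exact: finite_wall.
have /infinite_set_fsetP/(_ #|J|)[l lS ll] := FI.
have lt i : (enum_rank (i : J) < size (finmap.enum_fset l))%N by apply: leq_trans ll; exact: ltn_ord.
pose X (i : J) : 'cV[R]_N := nth 0 (finmap.enum_fset l) (enum_rank i).
have XI : injective X.
  move=> i k E; apply/enum_rank_inj/val_inj/eqP.
  by rewrite -(nth_uniq 0 (lt i) (lt k) (finmap.fset_uniq l)) -/(X i) -/(X k) E.
have XF i : fib j (X i) /\ ~ `|lorentz (X i) o| <= L by apply: lS; exact: mem_nth.
exists X; split => //.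
- by move=> i; case: (XF i) => -[].
- move=> i k ik; have [[iA ij] _] := XF i; have [[kA kj] _] := XF k.
  have XX : X i != X k by rewrite (inj_eq XI).
  have sg := bdry_sep HW iA kA XX; have K1 := ws_gt1 HW.
  have [E|h] := lab_sep iA.1.1 kA.1.1 (etrans ij (esym kj)); first by rewrite E eqxx in XX.
  rewrite ltr0_norm in h; last by lra.
  exact: le_trans mL.1 h.
- move=> i; have [[iA _] /negP] := XF i; rewrite -ltNge ltr0_norm; last exact: bdry_base iA.
  exact: ltW.
Qed.

(** By [child_cosh], each further letter multiplies the cosh of the distance to the wall by at least
    [L]. *)
Lemma far_word (X : J -> 'cV[R]_N) (L : R) j d : injective X -> (forall j, bdry (X j)) -> 1 <= L ->
  (forall i k, i != k -> L <= - lorentz (X i) (X k)) -> (forall k, L <= - lorentz (X k) o) -> red (j :: d) ->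
  L ^+ (size d).+1 <= cosh_wall (nrm (X j) (map X d)) o.
Proof.
move=> XI Xb L1 far1 far2; elim: d j => [|i d IH] j jd.
  rewrite /nrm /= mul1mx expr1; apply: le_trans (far2 j) _.
  by apply: le_trans (abs_le_cosh_wall _ _); rewrite -normrN ler_norm.
have wA : word (@wall R n q) (map X (i :: d)) by move=> u /mapP[k _ ->].
have rA : red (map X (i :: d)) by apply: red_map => //; exact: red_cons jd.
have [p [hp up Hp]] := node_point q2 wA rA.
have ij : j != i by have /andP[] := jd.
have XX : X j != X i by rewrite (inj_eq XI).
have := child_cosh q2 wA rA hp up Hp (Xb j) XX; apply: le_trans.
rewrite exprSr; apply: ler_pM; rewrite ?exprn_ge0 ?(le_trans ler01 L1) //.
  by apply: IH; exact: red_cons jd.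
exact: le_trans (far1 _ _ ij) (wall_point_cosh q2 (Xb i) (Xb j) XX hp up).
Qed.

Lemma far_word_ht (X : J -> 'cV[R]_N) (L : R) c : injective X -> (forall j, bdry (X j)) -> 1 <= L ->
  (forall i k, i != k -> L <= - lorentz (X i) (X k)) -> (forall k, L <= - lorentz (X k) o) -> red c ->
  L ^+ size c <= ht (rp (map X c)).
Proof.
move=> XI Xb L1 far1 far2; case: c => [|j d] jd; first by rewrite expr0 /ht mxE eqxx.
have wA : word (@wall R n q) (map X (j :: d)) by move=> u /mapP[k _ ->].
have rA : red (map X (j :: d)) by exact: red_map.
have [p [hp up Hp]] := node_point q2 wA rA.
have u1 := bdry_unit HW (Xb j); have hr := oplus_hyp (refl_unit_oplus u1) hb.
apply: le_trans (far_word XI Xb L1 far1 far2 jd) _.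
rewrite htE [tau _ o]tauC /= -mulmxA; apply: le_trans (Hp _ hr _).
  by rewrite ler_peMr ?(ltW (cosh_wall_gt0 _ _)) //; exact: tau_ge1.
by rewrite refl_unitE // !lorentzE u1; have := bdry_base (Xb j); lra.
Qed.

Lemma image_exponent (eps : R) : 0 < eps -> exists X : J -> 'cV[R]_N,
  [/\ injective X, forall j, bdry (X j) &
   (critical_exponent (phi q X @` Gam q M) < eps%:E)%E].
Proof.
move=> e0; have e2 : 0 < eps / 2 by lra.
pose k : R := #|J|%:R; have k0 : 0 <= k by exact: ler0n.
have k1 : 0 < (2 * (k + 1))^-1 by rewrite invr_gt0; lra.
have [L L1 HL] := pw_small e2 k1.
have [X [XI Xb far1 far2]] := spread_walls L; exists X; split => //.
apply: (@le_lt_trans _ _ (eps / 2)%:E); last by rewrite lte_fin; lra.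
(* There are k^m words of length [m], each contributing at most L^(-m eps/2). The series is
   geometric of ratio [c], and [L] was chosen to make [c] less than 1. *)
pose c := k * pw L (eps / 2).
have c01 : 0 <= c < 1.
  rewrite /c mulr_ge0 ?pw_ge0 //=.
  apply: (@le_lt_trans _ _ (k * (2 * (k + 1))^-1)); first by rewrite ler_wpM2l // HL.
  by rewrite ltr_pdivrMr; lra.
have PO : phi q X @` Gam q M `<=` oplus.
  move=> g /(phi_image q2 Xb)[d [_ ->]]; apply: rp_oplus; apply: (word_unit HW).
  by move=> u /mapP[i _ ->].
apply: (@critical_exponent_le _ _ (1 / (1 - c)) PO (ltW e2)).
apply: (@sum_le_pairs _ _ _ _ _ setT (fun m : nat => [set d : seq J | red d /\ size d = m])
  (fun (m : nat) (d : seq J) => rp (map X d)) _ (fun (m : nat) (d : seq J) => pw (L ^+ m) (eps / 2))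
  (fun m : nat => c ^+ m * 1)).
- move=> g /(phi_image q2 Xb)[d [rd ->]]; exists (size d), d; split => //.
  apply: pw_le; [by rewrite exprn_gt0 // (lt_le_trans ltr01 L1) | exact: far_word_ht | exact: ltW].
- move=> m _; have L0 := le_trans ler01 L1.
  have -> : c ^+ m * 1 = (size (map val (enum {: m.-tuple J})))%:R * pw (L ^+ m) (eps / 2).
    rewrite size_map -cardE card_tuple natrX mulr1 /c exprMn; congr (_ * _).
    by rewrite /pw -!powR_mulrn ?powR_ge0 // -!powRrM mulrC.
  have := @sum_le_cst R _ [seq val x | x <- enum {: m.-tuple J}] _ (pw_ge0 (L ^+ m) (eps / 2)).
  apply: sum_le_sub => d [_ dm]; split => //=.
  have dm' : size d == m by apply/eqP.
  by apply/mapP; exists (Tuple dm') => //; rewrite mem_enum.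
- exact: geometric_sum_le.
Qed.
End Image.
End CriticalExponents.

(** * Choice of numerical constants *)

Section Constants.
Context {R : realType}.

Lemma natr_le_sep (q : nat) : (2 < q)%N -> q%:R <= sep (R := R) q.
Proof.
move=> q2; have h : 3 <= q%:R :> R by rewrite ler_nat.
rewrite /sep; move: (q%:R) h => x x3.
have x2 : 9 <= x ^+ 2 by rewrite expr2; nra.
have -> : x ^+ 4 = x ^+ 2 * x ^+ 2 by rewrite -exprD.
by rewrite !expr2 in x2 *; nra.
Qed.

Lemma small_product (c b e : R) : 0 < c -> 0 <= b -> 0 <= e -> e <= (20 * c * (b + 1))^-1 ->
  c * (e * b) <= 20^-1.
Proof.
move=> c0 b0 e0 h; have p : 0 < 20 * c * (b + 1) by rewrite !mulr_gt0 //; lra.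
rewrite -[_^-1]mul1r ler_pdivlMr // in h.
have : c * (e * b) <= c * (e * (b + 1)) by rewrite ler_wpM2l ?(ltW c0) // ler_wpM2l //; lra.
have -> : c * (e * (b + 1)) = (e * (20 * c * (b + 1))) / 20 by field.
by lra.
Qed.

(** First take [th] close enough to 1 for the interpolation error, then [s] above [d] by much less
    than (1 - th) (d - s1), so that the average of [s] and [s1] falls below [d]. *)
Lemma interpolation_exponent (d s1 b : R) : 0 <= s1 < d -> 0 <= b -> exists th s : R,
  [/\ 0 < th < 1, (1 - th) * b <= 2^-1, d < s <= d + 1 & th * s + (1 - th) * s1 < d].
Proof.
move=> /andP[s10 s1d] b0; pose k := (2 * (b + 1))^-1.
have k0 : 0 < k by rewrite invr_gt0; lra.
have kE : k * (2 * (b + 1)) = 1 by rewrite mulVf // gt_eqF //; lra.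
have k1 : k < 1 by nra.
pose e := Num.min 1 (k * (d - s1) / 2); have kd : 0 < k * (d - s1) by rewrite mulr_gt0 //; lra.
have e0 : 0 < e by rewrite lt_min ltr01 /=; lra.
have e1 : e <= 1 by rewrite ge_min lexx.
have ek : e <= k * (d - s1) / 2 by rewrite ge_min lexx orbT.
exists (1 - k), (d + e); split.
- by apply/andP; split; lra.
- by rewrite opprB addrC subrK; lra.
- by apply/andP; split; lra.
- have : (1 - k) * e <= e by rewrite ler_piMl ?(ltW e0) //; lra.
  by move: ek kd; nra.
Qed.
End Constants.

(** * A bound for the kernel uniform in the endomorphism *)

Section KernelGap.
Context {R : realType} {n : nat}.
Local Notation N := n.+1.
Local Notation o := (base_point : 'cV[R]_n.+1).
Local Notation delta := (@delta R n).

(** The order of choices matters: [c3] from [delta] alone, then [q], then the gap exponent [s1] with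
    its bound [B0], then [th] and [s], then the threshold [Lm], and finally [M]. Nothing depends on
    [X], so the bound precedes the choice of the image. *)
Lemma kernel_gap (n2 : (2 <= n)%N) : exists q M (s' : R), [/\ (2 < q)%N, (q %| M.+1)%N, 0 <= s' < delta &
  forall X : 'cV['I_M.+1]_(N + N) -> 'cV[R]_N, injective X -> (forall j, bdry (@wall R n q) (X j)) ->
    (critical_exponent (Ker (Gam q M) (phi q X)) <= s'%:E)%E].
Proof.
have d0 : 0 < delta := @delta_gt0 R n 3 2 n2 isT (dvdnn 3).
have [C C1 coc] := @cocompact_constant R n.
have E1 : 1 <= 8 * C ^+ 2 by rewrite expr2; nra.
have [c3 [c31 c3H]] : exists c3 : R, 1 <= c3 /\ forall s, s <= delta + 1 -> 2 * (8 * C ^+ 2) `^ s <= c3.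
  exists (2 * (8 * C ^+ 2) `^ (delta + 1)); split; last first.
    by move=> s hs; rewrite ler_wpM2l //; apply: ler_powR.
  have d1 : 0 <= delta + 1 by lra.
  by have := powR_ge1 E1 d1; lra.
have c30 : 0 < c3 by lra.
have d2 : 0 < delta / 2 by lra.
have q0 : 0 < (20 * c3 * (1 + 1))^-1 by rewrite invr_gt0; apply: mulr_gt0; [apply: mulr_gt0 | lra].
have [L0 _ HL0] := pw_small d2 q0.
pose m0 := Num.truncn (Num.max 3 L0); pose q := m0.+1.
have hq : Num.max 3 L0 <= q%:R by exact/ltW/truncnS_gt.
have q2 : (2 < q)%N.
  by rewrite -(ler_nat R); apply: le_trans hq; rewrite le_max lexx.
have qL : pw (sep q) (delta / 2) <= (20 * c3 * (1 + 1))^-1.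
  apply: HL0; apply: le_trans (natr_le_sep q2); apply: le_trans hq; by rewrite le_max lexx orbT.
have HW := @wall_system_q R n q q2.
have qq : (q %| m0.+1)%N by exact: dvdnn.
have [t0 /andP[t00 t0d] [Bg HBg]] := @stab_gap R n q _ n2 q2 qq.
(* At least [delta / 2], so that [q], chosen for the exponent [delta / 2], serves for t s > s1 as
   well. *)
pose s1 := Num.max t0 (delta / 2).
have s12 : delta / 2 <= s1 by rewrite le_max lexx orbT.
have s10 : 0 <= s1 by lra.
have s1d : s1 < delta by rewrite gt_max t0d /=; lra.
have SA := @stab_arith1 R n q m0.
have HB1 : sum_le (@stabS R n q m0) (orb s1) Bg.
  have ts1 : t0 <= s1 by rewrite le_max lexx.
  exact: (@sum_le_exp R n _ t0 s1 Bg SA ts1 HBg).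
have [B0 HB0] := wall_sum q2 qq s10 HB1.
have B00 : 0 <= B0 by exact: sum_le_ge0 (HB0 _ (base_chamber _)).
have cB0 : 0 <= c3 * B0 by rewrite mulr_ge0 // ltW.
have s1d' : 0 <= s1 < delta by rewrite s10.
have [th [s [th01 thB /andP[ds sd1] thsd]]] := interpolation_exponent s1d' cB0.
have s0 : 0 < s by lra.
have s1s : s1 <= s by lra.
pose t := th + (1 - th) * (s1 / s).
have tsE : t * s = th * s + (1 - th) * s1 by rewrite /t mulrDl -mulrA divfK // gt_eqF.
have [th0 th1] := andP th01.
have s1ts : s1 < t * s.
  rewrite tsE; have : 0 < th * (s - s1) by rewrite mulr_gt0 //; lra.
  by lra.
have e0 : 0 < t * s - s1 by lra.
have eta0 : 0 < (20 * c3 * (B0 + 1))^-1 by rewrite invr_gt0; apply: mulr_gt0; [apply: mulr_gt0 | lra].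
have [Lm Lm1 HLm] := pw_small e0 eta0.
pose m := Num.truncn (2 * Lm ^+ 2).
(* A multiple of [q] that makes equally labelled walls too far apart to be both within [Lm]. *)
pose M := (q * m.+1).-1.
have ME : M.+1 = (q * m.+1)%N by rewrite prednK // muln_gt0 (ltn_trans _ q2).
have qM : (q %| M.+1)%N by rewrite ME dvdn_mulr.
have LmE : 2 * Lm ^+ 2 <= sep M.+1.
  apply: (@le_trans _ _ M.+1%:R); last first.
    by apply: natr_le_sep; rewrite ME; apply: leq_trans q2 _; rewrite leq_pmulr.
  apply: (@le_trans _ _ m.+1%:R); first exact/ltW/truncnS_gt.
  by rewrite ler_nat ME leq_pmull // (ltn_trans _ q2).
have [Bs HBs] := @delta_convergent R n s ds.
have c3E := c3H s sd1.
have sm2 : c3 * pw (sep q) (t * s) <= 20^-1.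
  have K1 := ws_gt1 HW.
  have h : pw (sep q) (t * s) <= (20 * c3 * (1 + 1))^-1.
    by apply: le_trans qL; apply: pw_exp; [exact: ltW | lra].
  by have := small_product c30 ler01 (pw_ge0 _ _) h; rewrite mulr1.
have sm3 : c3 * (pw Lm (t * s - s1) * B0) <= 20^-1.
  by apply: small_product => //; [exact: pw_ge0 | exact: HLm].
have ts0 : 0 <= t * s by lra.
have HBts : sum_le (@stabS R n q m0) (orb (t * s)) Bg.
  exact: (sum_le_exp SA (ltW s1ts) HB1).
have [B1 HB1'] := stab_orbit_sum q2 qq ts0 HBts.
(* The sums over the stabiliser were bounded with modulus [q], before [M] was known; the smaller
   congruence subgroup inherits them. *)
have SS g : @stabS R n q M g -> @stabS R n q m0 g.
  by move=> [[gA gd] gS]; split => //; split => //; exact: arith_dvd qM gA.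
have HS g : @stabS R n q M g -> oplus g /\ forall u, bdry (@wall R n q) u -> lorentz u (g *m o) < 0.
  by move=> gS; split; [exact: stabS_oplus gS | move=> u uA; exact: (stab_bdry_lt0 HW gS.2 uA)].
have HB1'' p : chamber (@wall R n q) p -> sum_le (@stabS R n q M) (fun g => pw (tau p (g *m o)) (t * s)) B1.
  by move=> pD; apply: sum_le_sub (HB1' p pD) => g gS; split => //; exact: SS.
have [B2 HB2] := @kernel_sum R n q M q2 C s Bs C1 s0 HBs coc s1 t th c3 B0 Lm s10 s1s th01 erefl c3E c31 HB0
  thB sm2 sm3 Lm1 LmE (@stabS R n q M) B1 HS HB1''.
exists q, M, (t * s); split => //.
  by rewrite ts0 tsE.
move=> X XI Xb; apply: (@critical_exponent_le R n _ (t * s) B2) => //.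
  by move=> g [gG _]; exact: (Gam_oplus q2 gG).
apply: sum_le_sub HB2 => g gK; split => //.
by have [a [k [aA ra na kS gE]]] := Ker_phi q2 Xb XI gK; exists a, k.
Qed.
End KernelGap.

Theorem mainTheorem5 (R : realType) (n : nat) (hn : (2 <= n)%N) :
  exists (Gam : set 'M[R]_n.+1) (alpha : R),
    [/\ is_lattice Gam,
        (alpha%:E < critical_exponent Gam)%E &
        forall eps : R, 0 < eps ->
          exists phi : 'M[R]_n.+1 -> 'M[R]_n.+1,
            [/\ is_endomorphism Gam phi,
                (critical_exponent (Ker Gam phi) < alpha%:E)%E &
                (critical_exponent (phi @` Gam) < eps%:E)%E]].
Proof.
have [q [M [s' [q2 qM /andP[s'0 s'd] HK]]]] := @kernel_gap R n hn.
(* The midpoint between the kernel bound and [delta] leaves strict inequalities on both sides, and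
   it is fixed before [eps]. *)
exists (Gam q M), ((s' + delta (R := R) (n := n)) / 2); split.
- exact: Gam_lattice.
- by apply: lt_le_trans (Gam_exponent hn q2 qM); rewrite lte_fin; lra.
move=> eps e0; have [X [XI Xb HI]] := @image_exponent R n q M hn q2 eps e0.
exists (phi q X); split => //; first exact: (phi_endo q2 Xb).
by apply: le_lt_trans (HK X XI Xb) _; rewrite lte_fin; lra.
Qed.
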